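(* Let $\psi:M^m\to\bar M^{n+1}=I\times_hP$ be a complete mean curvature flow soliton with respect to $X=h(t)\partial_t$, with constant $c$ and $M$ connected. Assume that $P$ has constant sectional curvature $\kappa$ with $$\kappa\le\inf_M\big(h'^2-h''h\big),$$ $$\inf_M\left(\frac{\kappa-h'^2}{h^2}\right)>-\infty,$$ and $$c\,h'+|II|^2\le0\quad\text{on }M,$$ where $h,h',h''$ are evaluated along the immersion at $\pi\circ\psi$. If $|\mathbf H|\in L^2(M,e^{c\eta}\,dM)$, then the mean curvature vector is parallel (in the normal bundle) and either $\mathbf H\equiv0$ or otherwise $|II|^2\equiv-c\,h'$ on $M$.
   Context: $I\subset\mathbb R$ is an open interval, $h:I\to(0,\infty)$ is smooth, $(P^n,g_0)$ is a Riemannian manifold, and $\bar M^{n+1}=I\times_hP$ is $I\times P$ with metric $dt^2+h(t)^2g_0$; $\pi(t,p)=t$. An isometric immersion $\psi:M^m\to\bar M^{n+1}$ is a mean curvature flow soliton with respect to $X$ if $c\,X^\perp=\mathbf H$ along $\psi$ for some constant $c\in\mathbb R$, where $\perp$ is projection on the normal bundle, $II$ is the second fundamental form and $\mathbf H$ is the non-normalized mean curvature vector (the trace of $II$). It is complete if $M$ with the induced metric is complete. Fix $t_0\in I$; $\eta(x)=\int_{t_0}^{\pi(\psi(x))}h(s)\,ds$ for $x\in M$, and $dM$ is the induced volume element. *)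

(* Defs.v *)
From HB Require Import structures.
From mathcomp Require Import all_boot all_order all_algebra.
From mathcomp Require Import all_classical all_reals all_analysis.

Set Implicit Arguments.
Unset Strict Implicit.
Unset Printing Implicit Defensive.

Import Order.TTheory GRing.Theory Num.Theory.
Import numFieldNormedType.Exports.

Local Open Scope classical_set_scope.
Local Open Scope ring_scope.

HB.instance Definition _ (T U : ptopologicalType) :=
  Nbhs.on (T * U)%type.

(* Riemannian geometry in charts: tangent vectors in a
   chart are row vectors, and the tangent map of F at y is v |-> v *m jac F y. *)

Section Euclidean.
Context {R : realType}.

Definition pd {n} {W : normedModType R} (i : 'I_n) (f : 'rV[R]_n -> W) :
  'rV[R]_n -> W := fun y => 'D_(delta_mx 0 i) f y.

Definition smooth_on {n} {W : normedModType R} (U : set 'rV[R]_n)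
    (f : 'rV[R]_n -> W) :=
  forall (s : seq 'I_n) (y : 'rV[R]_n), U y ->
    {for y, continuous (foldr pd f s)} /\
    forall i : 'I_n, derivable (foldr pd f s) y (delta_mx 0 i).

Definition jac {m n} (F : 'rV[R]_m -> 'rV[R]_n) (y : 'rV[R]_m) : 'M[R]_(m, n) :=
  \matrix_i pd i F y.

Definition gdot {n} (G : 'M[R]_n) (u v : 'rV[R]_n) : R :=
  (u *m G *m v^T) 0 0.

(* Lebesgue integral over R^n as an iterated integral; it is only applied to
   nonnegative Borel functions, where Tonelli's theorem makes the two agree. *)
Fixpoint rV_integral n : ('rV[R]_n -> \bar R) -> \bar R :=
  if n is k.+1 return ('rV[R]_n -> \bar R) -> \bar R then
    fun f => (\int[lebesgue_measure]_(t in [set: R])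
      rV_integral (fun y : 'rV[R]_k => f (row_mx (t%:M : 'rV[R]_1) y)))%E
  else fun f => f 0.

End Euclidean.

Section LocalGeometry.
Context {R : realType} {n : nat}.
Implicit Types (g : 'rV[R]_n -> 'M[R]_n) (u v w y : 'rV[R]_n).

Definition christoffel g y (i j k : 'I_n) : R :=
  2^-1 * \sum_l invmx (g y) k l *
    (pd i g y j l + pd j g y i l - pd l g y i j).

Definition gamma g y u v : 'rV[R]_n :=
  \row_k \sum_i \sum_j u 0 i * v 0 j * christoffel g y i j k.

(* Levi-Civita derivative, in the direction of the i-th coordinate, of a vector
   field V along the map F *)
Definition cov {m} g (F : 'rV[R]_m -> 'rV[R]_n) (i : 'I_m)
    (V : 'rV[R]_m -> 'rV[R]_n) (y : 'rV[R]_m) : 'rV[R]_n :=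
  pd i V y + gamma g (F y) (pd i F y) (V y).

(* R(u, v) w, with the convention
   R(X, Y) Z = D_X D_Y Z - D_Y D_X Z - D_[X, Y] Z *)
Definition riemann_tensor g y u v w : 'rV[R]_n :=
  \sum_i \sum_j \sum_k (u 0 i * v 0 j * w 0 k) *:
    (cov g id i (cov g id j (fun=> delta_mx 0 k)) y
     - cov g id j (cov g id i (fun=> delta_mx 0 k)) y).

Definition sectional_curvature g y u v : R :=
  gdot (g y) (riemann_tensor g y u v v) u /
  (gdot (g y) u u * gdot (g y) v v - gdot (g y) u v ^+ 2).

End LocalGeometry.

(* [param a] is the inverse of [coord a] on [chart_im a] (values of [coord],
   [param] and [metric] elsewhere are junk), and [chart_at x] is a preferred
   chart around x, used only to evaluate chart-independent scalars. *)
Record riemData (R : realType) (n : nat) := RiemData {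
  carrier :> ptopologicalType;
  chart : Type;
  chart_dom : chart -> set carrier;
  coord : chart -> carrier -> 'rV[R]_n;
  param : chart -> 'rV[R]_n -> carrier;
  chart_at : carrier -> chart;
  metric : chart -> 'rV[R]_n -> 'M[R]_n
}.
Arguments chart {R n} r.
Arguments chart_dom {R n r} a : rename.
Arguments coord {R n r} a : rename.
Arguments param {R n r} a : rename.
Arguments chart_at {R n r} x : rename.
Arguments metric {R n r} a y : rename.

Definition chart_im {R : realType} {n} {M : riemData R n} (a : chart M) :
  set 'rV[R]_n := coord a @` chart_dom a.

Definition transition {R : realType} {n} {M : riemData R n} (a b : chart M) :
  'rV[R]_n -> 'rV[R]_n := coord b \o param a.

Record is_smooth_manifold {R : realType} {n} (M : riemData R n) : Prop := {
  mfd_hausdorff : hausdorff_space M;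
  mfd_countable : @second_countable M;
  mfd_cover : forall x : M, chart_dom (chart_at x) x;
  mfd_open_dom : forall a : chart M, open (chart_dom a);
  mfd_open_im : forall a : chart M, open (chart_im a);
  mfd_coordK : forall (a : chart M) (x : M),
    chart_dom a x -> param a (coord a x) = x;
  mfd_coord_cont : forall (a : chart M) (x : M),
    chart_dom a x -> {for x, continuous (coord a)};
  mfd_param_cont : forall (a : chart M) (y : 'rV[R]_n),
    chart_im a y -> {for y, continuous (param a)};
  mfd_transition : forall a b : chart M,
    smooth_on (coord a @` (chart_dom a `&` chart_dom b)) (transition a b)
}.

Record is_riemannian {R : realType} {n} (M : riemData R n) : Prop := {
  riem_manifold : is_smooth_manifold M;
  riem_smooth : forall a : chart M, smooth_on (chart_im a) (metric a);
  riem_sym : forall (a : chart M) y, chart_im a y -> (metric a y)^T = metric a y;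
  riem_pos : forall (a : chart M) y v,
    chart_im a y -> v != 0 -> 0 < gdot (metric a y) v v;
  riem_compat : forall (a b : chart M) (x : M),
    chart_dom a x -> chart_dom b x ->
    let J := jac (transition a b) (coord a x) in
    metric a (coord a x) = J *m metric b (coord b x) *m J^T
}.

Definition constant_sectional_curvature {R : realType} {n} (P : riemData R n)
    (kappa : R) :=
  forall (a : chart P) (y u v : 'rV[R]_n), chart_im a y ->
    row_free (col_mx u v) -> sectional_curvature (metric a) y u v = kappa.

Section Completeness.
Context {R : realType} {n : nat} (M : riemData R n).

Definition speed (a : chart M) (gam : R -> 'rV[R]_n) (t : R) : R :=
  Num.sqrt (gdot (metric a (gam t)) (derive1 gam t) (derive1 gam t)).

(* [curve_length x y l]: a piecewise C^1 curve of length l joins x to y, given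
   as a concatenation of C^1 arcs each contained in a chart; arcs are
   parametrized by [0, 1] and extended to R in coordinates. *)
Inductive curve_length : M -> M -> R -> Prop :=
| curve_nil (x : M) : curve_length x x 0
| curve_cons (a : chart M) (gam : R -> 'rV[R]_n) (y : M) (l : R) :
    (forall t, 0 <= t <= 1 -> chart_im a (gam t)) ->
    (forall t, derivable gam t 1) -> continuous (derive1 gam) ->
    curve_length (param a (gam 1)) y l ->
    curve_length (param a (gam 0)) y
      (\int[lebesgue_measure]_(t in `[0, 1]) speed a gam t + l).

Definition riem_dist (x y : M) : \bar R :=
  ereal_inf [set l%:E | l in curve_length x y].

Definition complete_riemannian :=
  forall u : nat -> M,
    (forall e : R, 0 < e -> exists N, forall p q : nat,
       (N <= p)%N -> (N <= q)%N -> (riem_dist (u p) (u q) < e%:E)%E) ->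
    exists x : M, forall e : R, 0 < e -> exists N, forall p : nat,
       (N <= p)%N -> (riem_dist (u p) x < e%:E)%E.

End Completeness.

Definition borel (T : ptopologicalType) := g_sigma_algebraType (@open T).

(* On a second countable manifold this determines mu uniquely. *)
Definition is_riemannian_volume {R : realType} {n} (M : riemData R n)
    (mu : set (borel M) -> \bar R) :=
  forall (a : chart M) (A : set (borel M)),
    measurable A -> A `<=` chart_dom a ->
    mu A = rV_integral (fun y : 'rV[R]_n =>
      (\1_(coord a @` A) y * Num.sqrt (\det (metric a y)))%:E).

Section Immersion.
Context {R : realType} {m n : nat} {M : riemData R m} {N : riemData R n}.
Variable psi : M -> N.

Definition local_rep (a : chart M) (b : chart N) : 'rV[R]_m -> 'rV[R]_n :=
  coord b \o psi \o param a.

Definition local_dom (a : chart M) (b : chart N) : set 'rV[R]_m :=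
  coord a @` (chart_dom a `&` psi @^-1` chart_dom b).

(* The points of the manifold N are those lying in some chart. *)
Record is_isometric_immersion : Prop := {
  imm_range : forall x : M, exists b : chart N, chart_dom b (psi x);
  imm_cont : continuous psi;
  imm_smooth : forall a b, smooth_on (local_dom a b) (local_rep a b);
  imm_isometric : forall a b y, local_dom a b y ->
    let J := jac (local_rep a b) y in
    J *m metric b (local_rep a b y) *m J^T = metric a y
}.

Section InCharts.
Variables (a : chart M) (b : chart N).
Let F := local_rep a b.
Let g := metric a.
Let gbar := metric b.

(* V minus its tangential part sum_ij g^ij <V, d_j psi> d_i psi, where g is the
   metric of M, i.e. the induced one. *)
Definition normal_proj (y : 'rV[R]_m) (V : 'rV[R]_n) : 'rV[R]_n :=
  V - V *m gbar (F y) *m (jac F y)^T *m invmx (g y) *m jac F y.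

(* the normal part of the ambient derivative of d_j psi along d_i *)
Definition second_ff (i j : 'I_m) (y : 'rV[R]_m) : 'rV[R]_n :=
  normal_proj y (cov gbar F i (pd j F) y).

Definition mean_curv (y : 'rV[R]_m) : 'rV[R]_n :=
  \sum_i \sum_j invmx (g y) i j *: second_ff i j y.

Definition second_ff_sqr (y : 'rV[R]_m) : R :=
  \sum_i \sum_j \sum_k \sum_l invmx (g y) i k * invmx (g y) j l *
    gdot (gbar (F y)) (second_ff i j y) (second_ff k l y).

Definition normal_conn (i : 'I_m) (V : 'rV[R]_m -> 'rV[R]_n)
    (y : 'rV[R]_m) : 'rV[R]_n :=
  normal_proj y (cov gbar F i V y).

End InCharts.

(* |II|^2 *)
Definition II2 (x : M) : R :=
  let a := chart_at x in second_ff_sqr a (chart_at (psi x)) (coord a x).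

Definition norm_mean_curv (x : M) : R :=
  let a := chart_at x in let b := chart_at (psi x) in
  let H := mean_curv a b (coord a x) in
  Num.sqrt (gdot (metric b (coord b (psi x))) H H).

Definition mean_curv_zero :=
  forall a b y, local_dom a b y -> mean_curv a b y = 0.

Definition parallel_mean_curv :=
  forall a b i y, local_dom a b y -> normal_conn a b i (mean_curv a b) y = 0.

(* X b is the expression of the ambient vector field in the chart b. *)
Definition mcf_soliton (X : chart N -> 'rV[R]_n -> 'rV[R]_n) (c : R) :=
  is_isometric_immersion /\
  forall a b y, local_dom a b y ->
    c *: normal_proj a b y (X b (local_rep a b y)) = mean_curv a b y.

End Immersion.

Section WarpedProduct.
Context {R : realType} {n : nat} (I : set R) (h : R -> R) (P : riemData R n).

(* I x_h P: the charts are I x U for U a chart domain of P, so that the points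
   of R * P covered by charts are exactly those of I x P. *)
Definition warped : riemData R (1 + n) := {|
  carrier := (R * P)%type;
  chart := chart P;
  chart_dom := fun b => [set q : R * P | I q.1 /\ chart_dom b q.2];
  coord := fun b (q : R * P) => row_mx (q.1%:M : 'rV[R]_1) (coord b q.2);
  param := fun b (z : 'rV[R]_(1 + n)) =>
    (lsubmx z 0 0, param b (rsubmx z)) : R * P;
  chart_at := fun q : R * P => chart_at q.2;
  metric := fun b (z : 'rV[R]_(1 + n)) =>
    block_mx 1%:M 0 0 (h (lsubmx z 0 0) ^+ 2 *: metric b (rsubmx z))
|}.

Definition conformal_field (b : chart warped) (z : 'rV[R]_(1 + n)) :
  'rV[R]_(1 + n) := row_mx ((h (lsubmx z 0 0))%:M : 'rV[R]_1) 0.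

End WarpedProduct.

Definition open_interval {R : realType} (I : set R) := is_interval I /\ open I.

Definition smooth_fun_on {R : realType} (I : set R) (h : R -> R) :=
  forall (k : nat) (t : R), I t -> derivable (derive1n k h) t 1.

Definition oriented_int {R : realType} (h : R -> R) (t0 t : R) : R :=
  if t0 <= t then \int[lebesgue_measure]_(s in `[t0, t]) h s
  else - \int[lebesgue_measure]_(s in `[t, t0]) h s.

(* Main.v *)
(** Let X = h(t) d_t, let X^perp be its normal part along psi and w = |X^perp|^2,
so that |H|^2 = c^2 w; put s = |grad t|^2 and L = Delta + c h <grad t, grad .>.
Since X is closed conformal, the soliton equation, the Codazzi equation and the
curvature of the warped product give

  L w / 2 = |nabla^perp X^perp|^2 - (c h' w + |<II, X^perp>|^2)
            + (m - 1) s (1 - s) (h'^2 - h'' h - kappa),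

where |<II, X^perp>|^2 <= |II|^2 w. Under the hypotheses every summand is
nonnegative, and |grad w|^2 <= 4 w |nabla^perp X^perp|^2 <= 2 w L w. Now L is
the Laplacian for the weight e^(c eta), so testing with the square of a cutoff
phi such that |grad phi| <= 1/r bounds the integral of phi^2 |grad w|^2 / w by
a multiple of r^-2 times the integral of w e^(c eta), which is finite if c <> 0.
Letting r go to infinity, w is constant, so L w = 0 and every summand vanishes.

The cutoffs do not come from the distance function. Let D(x) be the supremum of
f(x) over the C^1 functions f with |grad f| <= 1 that are <= 0 off a compact
set. If D were finite, Ekeland's principle on the complete manifold would give a
point from which D does not descend at a definite rate, and gluing a paraboloid
into a near-optimal f at this point would exceed D. Hence D is infinite. *)

(* The identity for L w is obtained without differentiating II. Put N = X^perp and let V be the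
   derivative of N along the tangential part of X. Since <D_p N, e_i> = - <N, D_p e_i> is symmetric
   in p and i, the tangential part of V is half the gradient of w. The trace of the derivative of V
   is computed twice: as a divergence, and by commuting second derivatives of N; the commutator is
   where the ambient curvature enters.

   Two obstacles shape the analysis. First, w may vanish, so |grad w|^2 / (2 w), read as 0 there,
   stands in for L w, by which it is bounded. Second, the volume is given on subsets of single
   charts, so integration by parts is done for fields with compact support in one chart, and a
   cutoff is decomposed into pieces of this kind. Each cutoff is differentiated only once, so C^1
   cutoffs do, and maxima can be smoothed by an explicit piecewise quadratic function.

   If c = 0, the integrability hypothesis says nothing about w, but then H = c X^perp = 0. *)
From HB Require Import structures.
From mathcomp Require Import all_boot all_order all_algebra.
From mathcomp Require Import all_classical all_reals all_analysis.
From mathcomp Require Import perm measurable_realfun ring lra.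
Require Import Defs.

Set Implicit Arguments.
Unset Strict Implicit.
Unset Printing Implicit Defensive.
Import Order.TTheory GRing.Theory Num.Theory.
Import numFieldNormedType.Exports.
Local Open Scope classical_set_scope.
Local Open Scope ring_scope.

(** * Calculus on open subsets of R^m *)

Section Line.
Context {R : realType} {V W : normedModType R}.

Lemma line_derive (f : V -> W) (z v : V) (s : R) :
  derivable f (z + s *: v) v ->
  is_derive s 1 (fun r => f (z + r *: v)) ('D_v f (z + s *: v)).
Proof.
move=> df.
have E : (fun h : R => h^-1 *: (((fun r => f (z + r *: v)) \o shift s) (h *: 1)
    - f (z + s *: v))) =
  (fun h : R => h^-1 *: ((f \o shift (z + s *: v)) (h *: v) - f (z + s *: v))).
  apply/funext => h /=.
  by rewrite scalerDl addrCA addrC [h *: 1]mulr1 addrC.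
by split; rewrite /derivable /derive E.
Qed.

End Line.

Section Calculus.
Context {R : realType} {m : nat}.
Implicit Types (U : set 'rV[R]_m) (f g : 'rV[R]_m -> R) (y z : 'rV[R]_m).

Lemma near_open (T : topologicalType) (V : set T) (P : T -> Prop) (x : T) :
  open V -> V x -> (forall t, V t -> P t) -> \near x, P x.
Proof. by move=> oV Vx VP; apply: filterS VP _; exact: open_nbhs_nbhs. Qed.

Lemma open_ball_sub U y : open U -> U y ->
  exists2 d : R, 0 < d & forall z, `|z - y| < d -> U z.
Proof.
move=> oU Uy; have /nbhs_normP[d /= d0 dU] := open_nbhs_nbhs (conj oU Uy).
by exists d => // z zy; apply: dU => /=; rewrite distrC.
Qed.

Lemma contP f y : {for y, continuous f} ->
  forall e, 0 < e -> exists2 d, 0 < d & forall z, `|z - y| < d -> `|f z - f y| < e.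
Proof.
move=> /cvgrPdist_lt cf e e0; have /nbhs_normP[d /= d0 dU] := cf e e0.
by exists d => // z zy; rewrite distrC; apply: dU => /=; rewrite distrC.
Qed.

Lemma norm_delta (i : 'I_m) : `|delta_mx 0 i : 'rV[R]_m| <= 1.
Proof.
rewrite /Num.Def.normr/= mx_normrE; apply: bigmax_le => // -[a b] _ /=.
by rewrite mxE; case: (_ && _); rewrite ?normr1 ?normr0.
Qed.

Lemma rV_norm_le y (r : R) : 0 <= r -> (forall i, `|y 0 i| <= r) -> `|y| <= r.
Proof.
move=> r0 yr; rewrite /Num.Def.normr/= mx_normrE; apply: bigmax_le => // -[a b] _ /=.
by rewrite ord1.
Qed.

Lemma rV_norm_coord y i : `|y 0 i| <= `|y|.
Proof.
rewrite [leRHS]/Num.Def.normr/= mx_normrE.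
exact: (le_bigmax _ (fun ij : 'I_1 * 'I_m => `|y ij.1 ij.2|) (0, i)).
Qed.

Lemma pd_near i f g y : (\near y, f y = g y) -> pd i f y = pd i g y.
Proof. exact: near_eq_derive. Qed.

Lemma pd_derivable i f y : derivable f y (delta_mx 0 i) ->
  is_derive y (delta_mx 0 i) f (pd i f y).
Proof. exact: derivableP. Qed.

Lemma line_MVT f z i (h : R) :
  (forall s, `|s| <= `|h| -> derivable f (z + s *: delta_mx 0 i) (delta_mx 0 i)) ->
  exists2 s, `|s| <= `|h| &
    f (z + h *: delta_mx 0 i) - f z = pd i f (z + s *: delta_mx 0 i) * h.
Proof.
move=> df; set e := delta_mx 0 i : 'rV[R]_m.
pose F s := f (z + s *: e).
have dF (s : R) : `|s| <= `|h| -> is_derive s 1 F (pd i f (z + s *: e)).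
  by move=> sh; apply: line_derive; exact: df.
have F0 : f z = F 0 by rewrite /F scale0r addr0.
have cF a b : (forall s, s \in `[a, b] -> `|s| <= `|h|) ->
    {within `[a, b], continuous F}.
  move=> ab; apply: derivable_within_continuous => s /ab sh.
  exact: (ex_derive (is_derive := dF s sh)).
rewrite F0 -/(F h); have [h0|h0] := leP 0 h.
- have ab s : s \in `[0, h] -> `|s| <= `|h|.
    by rewrite in_itv/= => /andP[s0 sh]; rewrite !ger0_norm.
  have [c ch ->] := MVT_segment h0
    (fun x xi => dF x (ab x (subset_itv_oo_cc xi))) (cF _ _ ab).
  by exists c; [exact: ab|rewrite subr0].
- have ab s : s \in `[h, 0] -> `|s| <= `|h|.
    by rewrite in_itv/= => /andP[s0 sh]; rewrite !ler0_norm ?lerN2 // ltW.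
  have [c ch E] := MVT_segment (ltW h0)
    (fun x xi => dF x (ab x (subset_itv_oo_cc xi))) (cF _ _ ab).
  by exists c; [exact: ab|rewrite -opprB E sub0r mulrN opprK].
Qed.

(** Recursion on partial derivatives, with continuity asked at every level, makes closure under
    products, inverses and composition an induction on k. Everything is asked pointwise on U because
    the functions of interest take junk values outside the image of a chart. Differentiability
    proper is recovered in [C1_differentiable]. *)
Fixpoint Ck (k : nat) U f : Prop :=
  (forall y, U y -> {for y, continuous f}) /\
  if k is k'.+1 then
    forall i, (forall y, U y -> derivable f y (delta_mx 0 i)) /\ Ck k' U (pd i f)
  else True.

Lemma Ck_cont k U f y : Ck k U f -> U y -> {for y, continuous f}.
Proof. by case: k => [|k] [+ _]; exact. Qed.

Lemma Ck_der k U f i y : Ck k.+1 U f -> U y -> derivable f y (delta_mx 0 i).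
Proof. by move=> [_ /(_ i)[+ _]]; exact. Qed.

Lemma Ck_pd k U f i : Ck k.+1 U f -> Ck k U (pd i f).
Proof. by move=> [_ /(_ i)[]]. Qed.

Lemma CkW k U f : Ck k.+1 U f -> Ck k U f.
Proof.
elim: k f => [|k IH] f Cf; first by case: Cf.
split; first by move=> y; exact: Ck_cont Cf.
by move=> i; split => [y|]; [exact: Ck_der Cf|exact/IH/Ck_pd].
Qed.

Lemma Ck_sub k U V f : V `<=` U -> Ck k U f -> Ck k V f.
Proof.
move=> VU; elim: k f => [|k IH] f Cf.
  by split=> // y /VU; exact: Ck_cont Cf.
split; first by move=> y /VU; exact: Ck_cont Cf.
by move=> i; split => [y /VU|]; [exact: Ck_der Cf|exact/IH/Ck_pd].
Qed.

Lemma Ck_local k U f : (forall y, U y -> exists V, [/\ open V, V y & Ck k V f]) ->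
  Ck k U f.
Proof.
elim: k f => [|k IH] f H.
  by split=> // y /H[V [_ Vy /Ck_cont]]; exact.
split; first by move=> y /H[V [_ Vy /Ck_cont]]; exact.
move=> i; split; first by move=> y /H[V [_ Vy /Ck_der]]; exact.
by apply: IH => y /H[V [oV Vy /Ck_pd Cf]]; exists V.
Qed.

Lemma continuous_near (T : topologicalType) (f1 f2 : T -> R) (x : T) :
  (\near x, f1 x = f2 x) -> {for x, continuous f1} -> {for x, continuous f2}.
Proof.
move=> fg cf; rewrite /prop_for /continuous_at -(nbhs_singleton fg).
exact: cvg_trans (near_eq_cvg fg) cf.
Qed.

Lemma Ck_ext k U f g : open U -> (forall y, U y -> f y = g y) ->
  Ck k U f -> Ck k U g.
Proof.
move=> oU; elim: k f g => [|k IH] f g fg Cf.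
  split=> // y Uy; apply: continuous_near (Ck_cont Cf Uy).
  exact: near_open fg.
split.
  move=> y Uy; apply: continuous_near (Ck_cont Cf Uy); exact: near_open fg.
move=> i; split.
  move=> y Uy; refine (near_eq_derivable _ (Ck_der Cf Uy)); exact: near_open fg.
apply: IH (Ck_pd i Cf) => y Uy; apply: pd_near; exact: near_open fg.
Qed.

Lemma pd_cst i (c : R) : pd i (fun=> c : R) = (fun=> 0) :> ('rV[R]_m -> R).
Proof. by apply/funext => y; rewrite /pd; exact: derive_cst. Qed.

Lemma Ck_cst k U (c : R) : Ck k U (fun=> c).
Proof.
elim: k c => [|k IH] c.
  by split=> // y _; exact: cst_continuous.
split; first by move=> y _; exact: cst_continuous.
by move=> i; split => [y _|]; [exact: derivable_cst|rewrite pd_cst; exact: IH].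
Qed.

Section Point.
Variables (i : 'I_m) (f g : 'rV[R]_m -> R) (y : 'rV[R]_m).
Hypothesis df : derivable f y (delta_mx 0 i).
Hypothesis dg : derivable g y (delta_mx 0 i).

Lemma pdD : pd i (fun y => f y + g y) y = pd i f y + pd i g y.
Proof. exact: (deriveD df dg). Qed.

Lemma pdB : pd i (fun y => f y - g y) y = pd i f y - pd i g y.
Proof. exact: (deriveB df dg). Qed.

Lemma pdM : pd i (fun y => f y * g y) y = pd i f y * g y + f y * pd i g y.
Proof. by rewrite [LHS](deriveM df dg) addrC [g y *: _]mulrC. Qed.

Lemma pdV : f y != 0 -> pd i (fun y => (f y)^-1) y = - (pd i f y * (f y)^-1 * (f y)^-1).
Proof.
move=> f0; rewrite [LHS](deriveV f0 df) scaleNr [_ *: _]mulrC.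
by rewrite expr2 invfM mulrA.
Qed.

End Point.

Lemma derivable_bigsum (I : Type) (r : seq I) (P : pred I)
    (f : I -> 'rV[R]_m -> R) y (v : 'rV[R]_m) :
  (forall a, P a -> derivable (f a) y v) ->
  derivable (fun y => \sum_(a <- r | P a) f a y) y v.
Proof.
move=> H; elim: r => [|a r IH].
  by under eq_fun do rewrite big_nil; exact: derivable_cst.
have E (b : bool) : P a = b -> (fun y => \sum_(a <- a :: r | P a) f a y) =
    if b then (fun y => f a y + \sum_(a <- r | P a) f a y) else fun y => \sum_(a <- r | P a) f a y.
  by move=> Pa; apply/funext => z; rewrite big_cons Pa; case: b {Pa}.
case Pa: (P a); rewrite (E _ Pa); last exact IH.
exact (derivableD (H a Pa) IH).
Qed.

Lemma pd_sum (I : Type) (r : seq I) (P : pred I)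
    (f : I -> 'rV[R]_m -> R) i y :
  (forall a, P a -> derivable (f a) y (delta_mx 0 i)) ->
  pd i (fun y => \sum_(a <- r | P a) f a y) y = \sum_(a <- r | P a) pd i (f a) y.
Proof.
move=> H; elim: r => [|a r IH].
  by under eq_fun do rewrite big_nil; rewrite big_nil pd_cst.
under eq_fun do rewrite big_cons; rewrite big_cons; case: ifP => // Pa.
by rewrite pdD ?IH//; [exact: H|exact: derivable_bigsum].
Qed.

Lemma CkD k U f g : open U -> Ck k U f -> Ck k U g -> Ck k U (fun y => f y + g y).
Proof.
move=> oU; elim: k f g => [|k IH] f g Cf Cg.
  by split=> // y Uy; exact: (continuousD (Ck_cont Cf Uy) (Ck_cont Cg Uy)).
split; first by move=> y Uy; exact: (continuousD (Ck_cont Cf Uy) (Ck_cont Cg Uy)).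
move=> i; split.
  by move=> y Uy; exact (derivableD (Ck_der Cf Uy) (Ck_der Cg Uy)).
apply: Ck_ext (IH _ _ (Ck_pd i Cf) (Ck_pd i Cg)) => // y Uy.
by rewrite pdD //; [exact: Ck_der Cf Uy|exact: Ck_der Cg Uy].
Qed.

Lemma CkM k U f g : open U -> Ck k U f -> Ck k U g -> Ck k U (fun y => f y * g y).
Proof.
move=> oU; elim: k f g => [|k IH] f g Cf Cg.
  by split=> // y Uy; exact: (continuousM (Ck_cont Cf Uy) (Ck_cont Cg Uy)).
split; first by move=> y Uy; exact: (continuousM (Ck_cont Cf Uy) (Ck_cont Cg Uy)).
move=> i; split.
  by move=> y Uy; exact (derivableM (Ck_der Cf Uy) (Ck_der Cg Uy)).
apply: Ck_ext (CkD oU (IH _ _ (Ck_pd i Cf) (CkW Cg)) (IH _ _ (CkW Cf) (Ck_pd i Cg))).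
  by [].
by move=> y Uy; rewrite pdM //; [exact: Ck_der Cf Uy|exact: Ck_der Cg Uy].
Qed.

Lemma CkN k U f : open U -> Ck k U f -> Ck k U (fun y => - f y).
Proof.
move=> oU Cf; apply: Ck_ext (CkM oU (Ck_cst k U (-1)) Cf) => // y _.
by rewrite mulN1r.
Qed.

Lemma CkB k U f g : open U -> Ck k U f -> Ck k U g -> Ck k U (fun y => f y - g y).
Proof. by move=> oU Cf Cg; exact: CkD (CkN _ Cg). Qed.

Lemma CkX k U f p : open U -> Ck k U f -> Ck k U (fun y => f y ^+ p).
Proof.
move=> oU Cf; elim: p => [|p IH]; first exact: Ck_cst.
by under eq_fun do rewrite exprS; exact: CkM.
Qed.

Lemma Ck_sum k U (I : Type) (r : seq I) (P : pred I) (f : I -> 'rV[R]_m -> R) :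
  open U -> (forall a, P a -> Ck k U (f a)) ->
  Ck k U (fun y => \sum_(a <- r | P a) f a y).
Proof.
move=> oU H; elim: r => [|a r IH].
  by under eq_fun do rewrite big_nil; exact: Ck_cst.
under eq_fun do rewrite big_cons.
by case Pa: (P a) => //; apply: CkD => //; exact: H.
Qed.

Lemma Ck_prod k U (I : Type) (r : seq I) (P : pred I) (f : I -> 'rV[R]_m -> R) :
  open U -> (forall a, P a -> Ck k U (f a)) ->
  Ck k U (fun y => \prod_(a <- r | P a) f a y).
Proof.
move=> oU H; elim: r => [|a r IH].
  by under eq_fun do rewrite big_nil; exact: Ck_cst.
under eq_fun do rewrite big_cons.
by case Pa: (P a) => //; apply: CkM => //; exact: H.
Qed.

Lemma CkV k U f : open U -> (forall y, U y -> f y != 0) -> Ck k U f ->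
  Ck k U (fun y => (f y)^-1).
Proof.
move=> oU f0; elim: k => [|k IH] Cf.
  by split=> // y Uy; exact: continuousV (f0 _ Uy) (Ck_cont Cf Uy).
split; first by move=> y Uy; exact: continuousV (f0 _ Uy) (Ck_cont Cf Uy).
move=> i; split.
  by move=> y Uy; exact (derivableV (f0 _ Uy) (Ck_der Cf Uy)).
have CV := IH (CkW Cf).
apply: Ck_ext (CkN oU (CkM oU (CkM oU (Ck_pd i Cf) CV) CV)) => // y Uy.
by rewrite pdV ?f0//; exact: Ck_der Cf Uy.
Qed.

Definition smooth U f := forall k, Ck k U f.

Lemma smooth_pd U f i : smooth U f -> smooth U (pd i f).
Proof. by move=> sf k; exact: Ck_pd. Qed.

Lemma smooth_der U f i y : smooth U f -> U y -> derivable f y (delta_mx 0 i).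
Proof. by move=> /(_ 1%N); exact: Ck_der. Qed.

Lemma smooth_cont U f y : smooth U f -> U y -> {for y, continuous f}.
Proof. by move=> /(_ 0%N); exact: Ck_cont. Qed.

(** The increment is taken one coordinate at a time; the mean value theorem turns each step into a
    partial derivative at a point within |h| of y, and continuity of the partial derivatives does
    the rest. *)
Lemma C1_expansion U f y : open U -> U y -> Ck 1 U f ->
  forall e, 0 < e -> exists2 d, 0 < d & forall h, `|h| < d ->
    `|f (y + h) - f y - \sum_i h 0 i * pd i f y| <= e * `|h|.
Proof.
move=> oU Uy Cf e e0.
have [d0 d00 dU] := open_ball_sub oU Uy.
(* The successor keeps the quotient meaningful in dimension 0. *)
pose e' := e / m.+1%:R.
have e'0 : 0 < e' by rewrite divr_gt0.
have /choice[d dP] : forall i, exists d, 0 < d /\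
    forall z, `|z - y| < d -> `|pd i f z - pd i f y| < e'.
  by move=> i; have [d ? ?] := contP (Ck_cont (Ck_pd i Cf) Uy) e'0; exists d.
exists (\big[Num.min/d0]_i d i).
  by apply: (big_ind (fun x => 0 < x)) => //; [move=> *; rewrite lt_min; apply/andP|move=> i _; case: (dP i)].
move=> h hd.
have hd0 : `|h| < d0 by apply: lt_le_trans hd _; exact: bigmin_le_id.
have hdi i : `|h| < d i by apply: lt_le_trans hd _; exact: bigmin_le_cond.
(* A staircase from y to y + h: the first k coordinates have already been moved. In the sup norm it
   stays within |h| of y. *)
pose z k := y + \row_j (if (j < k)%N then h 0 j else 0).
have z0 : z 0%N = y by apply/rowP => j; rewrite !mxE addr0.
have zm : z m = y + h by apply/rowP => j; rewrite !mxE ltn_ord.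
have zS (k : 'I_m) : z k.+1 = z k + h 0 k *: delta_mx 0 k.
  apply/rowP => j; rewrite !mxE/= -addrA; congr (_ + _).
  have [->|jk] := eqVneq j k; first by rewrite leqnn ltnn add0r mulr1.
  by rewrite mulr0 addr0 ltnS leq_eqVlt (negPf jk : (j == k :> nat) = false).
have zc (k : 'I_m) s : `|s| <= `|h 0 k| -> `|z k + s *: delta_mx 0 k - y| <= `|h|.
  move=> sh; apply: rV_norm_le => // j; rewrite !mxE/=.
  have -> (a b c : R) : a + b + c - a = b + c by ring.
  have [->|jk] := eqVneq j k.
    by rewrite ltnn add0r mulr1 (le_trans sh)// rV_norm_coord.
  by rewrite mulr0 addr0; case: ifP; rewrite ?rV_norm_coord// normr0.
have /choice[s sP] : forall k : 'I_m, exists s, `|s| <= `|h 0 k| /\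
    f (z k.+1) - f (z k) = pd k f (z k + s *: delta_mx 0 k) * h 0 k.
  move=> k; rewrite zS; have [s sh|s ? ?] := @line_MVT f (z k) k (h 0 k).
    by apply: Ck_der Cf _; apply: dU; apply: le_lt_trans hd0; exact: zc.
  by exists s.
have -> : f (y + h) - f y = \sum_(k < m) (f (z k.+1) - f (z k)).
  by rewrite -zm -[in RHS](big_mkord xpredT (fun k => f (z k.+1) - f (z k)))
    (telescope_sumr (f \o z)) //= z0.
rewrite -sumrB; apply: le_trans (ler_norm_sum _ _ _) _.
apply: (@le_trans _ _ (\sum_(k < m) e' * `|h|)).
  apply: ler_sum => k _; have [sh ->] := sP k.
  rewrite mulrC -mulrBr normrM mulrC ler_pM ?rV_norm_coord//.
  by apply/ltW/(dP k).2/(le_lt_trans (zc k _ sh)).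
rewrite sumr_const card_ord -mulr_natl mulrA ler_wpM2r//.
by rewrite /e' mulrA ler_pdivrMr// mulrC ler_wpM2l ?ler_nat// ltW.
Qed.

Lemma C1_differentiable U f y : open U -> U y -> Ck 1 U f ->
  differentiable f y /\ forall h, 'd f y h = \sum_i h 0 i * pd i f y.
Proof.
move=> oU Uy Cf.
pose df (h : 'rV[R]_m) : R := \sum_i h 0 i * pd i f y.
have df_lin : linear (df : 'rV[R]_m -> R).
  move=> a u v; rewrite /df scaler_sumr -big_split/=.
  by apply: eq_bigr => i _; rewrite !mxE [a *: _]mulrA mulrDl.
pose dfL : {linear 'rV[R]_m -> R} :=
  HB.pack df (GRing.isLinear.Build _ _ _ _ _ df_lin).
have cdf : continuous dfL.
  move=> z; apply: (@Ck_cont 0 setT) => //.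
  apply: Ck_sum => [|i _]; first exact: openT.
  apply: CkM; [exact: openT| |exact: Ck_cst].
  by split=> // ? _; exact: coord_continuous.
have E (e : R) : 0 < e -> \forall h \near (0 : 'rV[R]_m),
    `|f (h + y) - (f y + dfL h)| <= e * `|h|.
  move=> e0; have [d d0 dP] := C1_expansion oU Uy Cf e0.
  apply/nbhs_normP; exists d => // h /=; rewrite sub0r normrN => hd.
  by have := dP _ hd; rewrite opprD addrA [h + y]addrC.
have D : 'd f y = dfL :> (_ -> R).
  by refine (@diff_unique R 'rV[R]_m R f dfL y cdf _); apply/eqaddoP.
split; last by move=> h; rewrite D.
by apply/diff_locallyP; rewrite D; split => //; apply/eqaddoP.
Qed.

(** [F] is only derivable in the direction v, so the chain rule for differentials cannot be applied
    to it directly; it applies to the restriction of [F] to the line through y. The source is any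
    normed space so that the same lemma serves curves and changes of variables. *)
Lemma chain_line (W : normedModType R) (F : W -> 'rV[R]_m) U f (y v : W) :
  open U -> U (F y) -> Ck 1 U f -> derivable F y v ->
  is_derive y v (f \o F) (\sum_i ('D_v F y) 0 i * pd i f (F y)).
Proof.
move=> oU Uy Cf dF.
have [df E] := C1_differentiable oU Uy Cf.
pose G (h : R) := F (y + h *: v).
have dF' : derivable F (y + 0 *: v) v by rewrite scale0r addr0.
have dG := line_derive dF'; rewrite scale0r addr0 in dG.
have G0 : G 0 = F y by rewrite /G scale0r addr0.
have /derivable1_diffP dG' : derivable G 0 1 := ex_derive (is_derive := dG).
have df0 : differentiable f (G 0) by rewrite G0.
have dfG := differentiable_comp dG' df0.
have EQ : (fun h : R => h^-1 *: ((f \o F \o shift y) (h *: v) - (f \o F) y)) =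
    (fun h : R => h^-1 *: ((f \o G \o shift 0) (h *: 1) - (f \o G) 0)).
  apply/funext => h /=; rewrite G0 /G addr0.
  by rewrite [h *: 1]mulr1 [y + _]addrC.
have D0 : derivable (f \o G) 0 1 by apply/derivable1_diffP.
split; first by rewrite /derivable EQ.
transitivity ('D_1 (f \o G) (0 : R)); first by rewrite /derive EQ.
rewrite (deriveE _ dfG) (diff_comp dG' df0) /=.
have -> : 'd G 0 1 = 'D_v F y.
  by rewrite -(deriveE _ dG'); exact: (derive_val (is_derive := dG)).
by rewrite G0 E.
Qed.

(** The mixed second difference of f with step s is symmetric in the two directions, and two uses of
    the mean value theorem write it as s^2 times either mixed derivative at a point within 2 s of
    y. *)
Lemma pd_comm U f i j y : open U -> U y -> Ck 2 U f ->
  pd i (pd j f) y = pd j (pd i f) y.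
Proof.
move=> oU Uy Cf.
have [d d0 dU] := open_ball_sub oU Uy.
have key a b (s : R) : 0 < s -> s + s < d -> exists2 z, `|z - y| <= s + s &
    f (y + s *: delta_mx 0 a + s *: delta_mx 0 b) - f (y + s *: delta_mx 0 a)
     - f (y + s *: delta_mx 0 b) + f y = pd b (pd a f) z * s * s.
  move=> s0 sd.
  have zU r r' : `|r| <= `|s| -> `|r'| <= `|s| ->
      `|y + r *: delta_mx 0 a + r' *: delta_mx 0 b - y| <= s + s.
    move=> rs r's; rewrite addrAC [y + _]addrC addrK.
    apply: le_trans (ler_normD _ _) _; rewrite -[in leRHS](gtr0_norm s0) !normrZ.
    by apply: lerD; rewrite -[leRHS]mulr1 ler_pM ?norm_delta.
  have zU' r r' : `|r| <= `|s| -> `|r'| <= `|s| ->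
      U (y + r *: delta_mx 0 a + r' *: delta_mx 0 b).
    by move=> rs r's; apply: dU; apply: le_lt_trans sd; exact: zU.
  have zU'' r : `|r| <= `|s| -> U (y + r *: delta_mx 0 a).
    by move=> rs; have := zU' r 0 rs; rewrite normr0 scale0r addr0; exact.
  pose phi z := f (z + s *: delta_mx 0 b) - f z.
  have dsh z : derivable f (z + s *: delta_mx 0 b) (delta_mx 0 a) ->
      is_derive z (delta_mx 0 a) (fun z => f (z + s *: delta_mx 0 b))
       (pd a f (z + s *: delta_mx 0 b)).
    move=> D.
    have EQ : (fun h : R => h^-1 *: (((fun z => f (z + s *: delta_mx 0 b))
        \o shift z) (h *: delta_mx 0 a) - f (z + s *: delta_mx 0 b))) =
       (fun h : R => h^-1 *: ((f \o shift (z + s *: delta_mx 0 b))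
          (h *: delta_mx 0 a) - f (z + s *: delta_mx 0 b))).
      by apply/funext => h /=; rewrite addrA.
    by split; rewrite /derivable /derive EQ.
  have dphi r : `|r| <= `|s| -> is_derive (y + r *: delta_mx 0 a) (delta_mx 0 a)
     phi (pd a f (y + r *: delta_mx 0 a + s *: delta_mx 0 b)
          - pd a f (y + r *: delta_mx 0 a)).
    move=> rs; apply: is_deriveB.
      by apply: dsh; apply: Ck_der Cf _; exact: zU'.
    by apply: pd_derivable; apply: Ck_der Cf _; exact: zU''.
  have [r /dphi|r rs E] := @line_MVT phi y a s; first by case.
  have [r' r's|r' r's E'] := @line_MVT (pd a f) (y + r *: delta_mx 0 a) b s.
    by apply: Ck_der (Ck_pd a Cf) _; exact: zU'.
  exists (y + r *: delta_mx 0 a + r' *: delta_mx 0 b); first exact: zU.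
  have -> : forall p q t u : R, p - q - t + u = (p - q) - (t - u) by move=> *; ring.
  have Ephi : pd a phi (y + r *: delta_mx 0 a) =
    pd a f (y + r *: delta_mx 0 a + s *: delta_mx 0 b)
          - pd a f (y + r *: delta_mx 0 a) by exact: (derive_val (is_derive := dphi _ rs)).
  by rewrite -E' -Ephi -E /phi.
apply/eqP; rewrite -subr_eq0 -normr_le0; apply/ler_addgt0Pl => e e0; rewrite addr0.
have e2 : 0 < e / 2 by rewrite divr_gt0.
have [d1 d10 D1] := contP (Ck_cont (Ck_pd i (Ck_pd j Cf)) Uy) e2.
have [d2 d20 D2] := contP (Ck_cont (Ck_pd j (Ck_pd i Cf)) Uy) e2.
(* A third of the smallest radius, so that points within 2 t of y are still inside all three. *)
pose t := Num.min d (Num.min d1 d2) / 3.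
have t0 : 0 < t by rewrite divr_gt0// !lt_min d0 d10.
have [td td1 td2] : [/\ t + t < d, t + t < d1 & t + t < d2].
  have : t + t < Num.min d (Num.min d1 d2).
    have : t *+ 3 = Num.min d (Num.min d1 d2) by rewrite /t; field.
    by rewrite mulrS mulr2n; lra.
  by rewrite !lt_min => /and3P[].
clearbody t; have [p py Ep] := key j i t t0 td.
have [q qy Eq] := key i j t t0 td.
have {D1} := D1 p (le_lt_trans py td1); have {D2} := D2 q (le_lt_trans qy td2).
have : f (y + t *: delta_mx 0 j + t *: delta_mx 0 i) =
    f (y + t *: delta_mx 0 i + t *: delta_mx 0 j) by rewrite addrAC.
move: Ep Eq {key}; move: (pd i (pd j f) p) (pd j (pd i f) q) (pd i (pd j f) y)
  (pd j (pd i f) y) => A B A' B'.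
move: (f _) (f _) (f _) (f _) (f _) => a1 a2 a3 a4 a5 EA EB E15.
have -> : A = B.
  apply: (mulIf (lt0r_neq0 t0)); apply: (mulIf (lt0r_neq0 t0)).
  by rewrite -EA -EB E15; ring.
by rewrite !ltr_norml => /andP[? ?] /andP[? ?]; rewrite ler_norml; lra.
Qed.

End Calculus.

Section Composition.
Context {R : realType} {m p : nat}.
Implicit Types (U : set 'rV[R]_m) (V : set 'rV[R]_p).

Lemma derivable_coords (W : normedModType R) (F : W -> 'rV[R]_p) y v :
  (forall l, derivable (fun y => F y 0 l) y v) -> derivable F y v.
Proof. by move=> H; apply/derivable_mxP => i j; rewrite ord1. Qed.

Lemma continuous_coords (T : topologicalType) (F : T -> 'rV[R]_p) x :
  (forall l, {for x, continuous (fun x => F x 0 l)}) -> {for x, continuous F}.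
Proof.
move=> cF; apply/cvgrPdist_le => /= e e0; near=> z.
apply: rV_norm_le => [|j]; first exact: ltW.
rewrite !mxE; move: j; near: z; apply: filter_forall => j.
by have /cvgrPdist_le := cF j; exact.
Unshelve. all: by end_near. Qed.

Lemma pd_comp V (f : 'rV[R]_p -> R) (F : 'rV[R]_m -> 'rV[R]_p) i y :
  open V -> V (F y) -> Ck 1 V f ->
  (forall l, derivable (fun y => F y 0 l) y (delta_mx 0 i)) ->
  is_derive y (delta_mx 0 i) (f \o F)
    (\sum_l pd i (fun y => F y 0 l) y * pd l f (F y)).
Proof.
move=> oV Vy Cf dF; have dF' := derivable_coords dF.
have := chain_line oV Vy Cf dF'; rewrite derive_mx //.
by under eq_bigr do rewrite mxE.
Qed.

Lemma Ck_comp k U V (f : 'rV[R]_p -> R) (F : 'rV[R]_m -> 'rV[R]_p) :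
  open U -> open V -> (forall y, U y -> V (F y)) ->
  (forall l, Ck k U (fun y => F y 0 l)) -> Ck k V f -> Ck k U (f \o F).
Proof.
move=> oU oV UV; elim: k f => [|k IH] f CF Cf.
  split=> // y Uy; apply: continuous_comp (Ck_cont Cf (UV _ Uy)).
  by apply: continuous_coords => l; exact: Ck_cont (CF l) Uy.
have D y i : U y -> is_derive y (delta_mx 0 i) (f \o F)
    (\sum_l pd i (fun y => F y 0 l) y * pd l f (F y)).
  move=> Uy; apply: (pd_comp oV (UV _ Uy)).
    by move: Cf; clear; elim: k f => // k IH f /CkW/IH.
  by move=> l; exact: Ck_der (CF l) Uy.
have C0 : Ck k U (f \o F) by apply: IH (CkW Cf) => l; exact: CkW.
split; first by move=> y; exact: Ck_cont C0.
move=> i; split; first by move=> y /(D y i) [].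
apply: (@Ck_ext _ _ _ _ (fun y => \sum_l pd i (fun y => F y 0 l) y * pd l f (F y))).
- by [].
- by move=> y /(D y i) [].
apply: Ck_sum => // l _; apply: CkM => //; first exact: Ck_pd.
by apply: IH => [l'|]; [exact: CkW|exact: Ck_pd].
Qed.

End Composition.

Section Composition1.
Context {R : realType} {m : nat} (I : set R) (U : set 'rV[R]_m).
Hypotheses (oI : open I) (oU : open U).

Lemma pd_comp1 (g : R -> R) (f : 'rV[R]_m -> R) i y :
  derivable g (f y) 1 -> derivable f y (delta_mx 0 i) ->
  is_derive y (delta_mx 0 i) (g \o f) (derive1 g (f y) * pd i f y).
Proof.
move=> dg df.
have df' : derivable f (y + 0 *: delta_mx 0 i) (delta_mx 0 i) by rewrite scale0r addr0.
have := line_derive df'; rewrite scale0r addr0 => dG.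
pose G (r : R) := f (y + r *: delta_mx 0 i).
have G0 : G 0 = f y by rewrite /G scale0r addr0.
have dG1 : derivable G 0 1 := ex_derive (is_derive := dG).
have dg1 : derivable g (G 0) 1 by rewrite G0.
have EQ : (fun h : R => h^-1 *: ((g \o f \o shift y) (h *: delta_mx 0 i) - (g \o f) y)) =
    (fun h : R => h^-1 *: ((g \o G \o shift 0) (h *: 1) - (g \o G) 0)).
  apply/funext => h /=; rewrite G0 /G addr0.
  by rewrite [h *: 1]mulr1 [y + _]addrC.
have /derivable1_diffP dG' := dG1.
have /derivable1_diffP dg' := dg1.
have D0 : derivable (g \o G) 0 1 by apply/derivable1_diffP; exact: differentiable_comp.
split; first by rewrite /derivable EQ.
transitivity ('D_1 (g \o G) (0 : R)); first by rewrite /derive EQ.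
rewrite -derive1E (derive1_comp dG1 dg1) G0; congr (_ * _).
by rewrite derive1E; exact: (derive_val (is_derive := dG)).
Qed.

Lemma Ck_comp1 k (g : R -> R) (f : 'rV[R]_m -> R) :
  (forall j t, (j <= k)%N -> I t -> derivable (derive1n j g) t 1) ->
  (forall y, U y -> I (f y)) -> Ck k U f -> Ck k U (g \o f).
Proof.
elim: k g => [|k IH] g dg UI Cf.
  split=> // y Uy; apply: continuous_comp; first exact: Ck_cont Cf Uy.
  apply: differentiable_continuous; apply/derivable1_diffP.
  by have := dg 0%N (f y) isT (UI _ Uy).
have D y i : U y -> is_derive y (delta_mx 0 i) (g \o f) (derive1 g (f y) * pd i f y).
  move=> Uy; apply: pd_comp1 (Ck_der Cf Uy).
  by have := dg 0%N (f y) isT (UI _ Uy).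
have C0 : Ck k U (g \o f).
  by apply: IH (CkW Cf) => // j t jk; apply: dg; exact: leqW.
split; first by move=> y; exact: Ck_cont C0.
move=> i; split; first by move=> y /(D y i) [].
apply: (@Ck_ext _ _ _ _ (fun y => (derive1 g \o f) y * pd i f y)) => //.
  by move=> y /(D y i) [].
apply: CkM => //; last exact: Ck_pd.
apply: IH (CkW Cf) => // j t jk It.
by have := dg j.+1 t jk It; rewrite derive1Sn.
Qed.

End Composition1.

Section MatrixValued.
Context {R : realType} {m p q : nat}.
Implicit Types (U : set 'rV[R]_m) (F : 'rV[R]_m -> 'M[R]_(p, q)).

Lemma pd_mxE F i y a b :
  (forall a b, derivable (fun y => F y a b) y (delta_mx 0 i)) ->
  (pd i F y) a b = pd i (fun y => F y a b) y.
Proof. by move=> H; rewrite /pd derive_mx ?mxE//; apply/derivable_mxP. Qed.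

Lemma smooth_on_pd U F i : smooth_on U F -> smooth_on U (pd i F).
Proof. by move=> sF s y Uy; have := sF (rcons s i) y Uy; rewrite foldr_rcons. Qed.

(** [smooth_on] speaks of iterated derivatives of a matrix-valued map. From here on the scalar
    calculus of [Ck] is applied entry by entry. *)
Lemma smooth_on_mx U F a b : open U -> smooth_on U F -> smooth U (fun y => F y a b).
Proof.
move=> oU sF k; elim: k F sF => [|k IH] F sF.
  split=> // y Uy; have [cF _] := sF [::] y Uy.
  exact: (continuous_comp cF (@coord_continuous _ _ _ a b _)).
have cF y : U y -> {for y, continuous (fun y => F y a b)}.
  move=> Uy; have [cF _] := sF [::] y Uy.
  exact: (continuous_comp cF (@coord_continuous _ _ _ a b _)).
have dF y i : U y -> forall a b, derivable (fun y => F y a b) y (delta_mx 0 i).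
  by move=> Uy; have [_ /(_ i) /derivable_mxP] := sF [::] y Uy.
split=> // i; split; first by move=> y Uy; exact: dF.
apply: Ck_ext (IH _ (smooth_on_pd i sF)) => // y Uy.
by rewrite pd_mxE//; exact: dF.
Qed.

End MatrixValued.

(** * Determinants, inverse matrices and Jacobi's formula *)

Section Determinant.
Context {R : realType} {m n : nat} (U : set 'rV[R]_m) (g : 'rV[R]_m -> 'M[R]_n).
Hypothesis oU : open U.

Lemma Ck_det k : (forall a b, Ck k U (fun y => g y a b)) ->
  Ck k U (fun y => \det (g y)).
Proof.
move=> Cg; apply: Ck_sum => // s _; apply: CkM => //; first exact: Ck_cst.
by apply: Ck_prod => // i _; exact: Cg.
Qed.

End Determinant.

(** Cramer's rule: the entries are cofactors divided by a determinant that does not vanish. *)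
Lemma Ck_invmx (R : realType) m n (U : set 'rV[R]_m) (g : 'rV[R]_m -> 'M[R]_n) k a b :
  open U -> (forall y, U y -> g y \in unitmx) ->
  (forall a b, Ck k U (fun y => g y a b)) -> Ck k U (fun y => invmx (g y) a b).
Proof.
move=> oU gU Cg.
apply: (@Ck_ext _ _ _ _ (fun y => (\det (g y))^-1 * ((-1) ^+ (b + a) *
    \det (row' b (col' a (g y)))))) => //.
  by move=> y Uy; rewrite /invmx gU // !mxE.
apply: CkM => //.
  apply: CkV => //; last exact: Ck_det.
  by move=> y /gU; rewrite unitmxE unitfE.
apply: CkM => //; first exact: Ck_cst.
by apply: Ck_det => // i j; under eq_fun do rewrite !mxE; exact: Cg.
Qed.

Section Jacobi.
Context {R : realType} {m n : nat} (g : 'rV[R]_m -> 'M[R]_n) (i : 'I_m) (y : 'rV[R]_m).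
Hypothesis dg : forall a b, derivable (fun y => g y a b) y (delta_mx 0 i).

Lemma pd_prod (I : eqType) (r : seq I) (f : I -> 'rV[R]_m -> R) : uniq r ->
  (forall a, derivable (f a) y (delta_mx 0 i)) ->
  is_derive y (delta_mx 0 i) (fun y => \prod_(a <- r) f a y)
    (\sum_(a <- r) pd i (f a) y * \prod_(b <- r | b != a) f b y).
Proof.
move=> ur df; elim: r ur => [_|a r IH /= /andP[ar ur]].
  by under eq_fun do rewrite big_nil; rewrite big_nil; exact: is_derive_cst.
under eq_fun do rewrite big_cons.
have {}IH := IH ur.
have := is_deriveM (derivableP (df a)) IH.
move=> /is_derive_eq; apply; rewrite big_cons [LHS]addrC; congr (_ + _).
  rewrite [LHS]mulrC big_cons eqxx/=; congr (_ * _).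
  rewrite [RHS]big_mkcond; apply: eq_big_seq => j jr /=.
  by case: eqP => // ja; rewrite -ja jr in ar.
rewrite scaler_sumr; apply: eq_big_seq => b br.
rewrite big_cons; have -> : a != b by apply: contraNneq ar => ->.
by rewrite /GRing.scale/= mulrCA.
Qed.

(** In the Leibniz expansion the product rule singles out one row a; the permutations are then
    grouped by the column b = s a, and each group sums to a cofactor. *)
Lemma pd_det : is_derive y (delta_mx 0 i) (fun y => \det (g y))
  (\sum_a \sum_b pd i (fun y => g y a b) y * cofactor (g y) a b).
Proof.
have dP (s : 'S_n) : is_derive y (delta_mx 0 i)
    (fun y => (-1) ^+ s * \prod_a g y a (s a))
    ((-1) ^+ s * \sum_a pd i (fun y => g y a (s a)) y *
      \prod_(b | b != a) g y b (s b)).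
  have H : is_derive y (delta_mx 0 i) (fun y => \prod_a g y a (s a))
      (\sum_a pd i (fun y => g y a (s a)) y * \prod_(b | b != a) g y b (s b)).
    apply: (@pd_prod _ (index_enum 'I_n) (fun a y => g y a (s a))).
      exact: index_enum_uniq.
    by move=> a; exact: dg.
  have := @is_deriveZ _ _ _ (fun y => \prod_a g y a (s a)) ((-1) ^+ s) _ _ _ H.
  exact.
split; first by apply: derivable_bigsum => s _; exact: (ex_derive (is_derive := dP s)).
have := @pd_sum R m _ (index_enum _) xpredT
  (fun (s : 'S_n) y => (-1) ^+ s * \prod_a g y a (s a)) i y.
rewrite /pd => ->; last by move=> s _; exact: (ex_derive (is_derive := dP s)).
rewrite (eq_bigr _ (fun s _ => derive_val (is_derive := dP s))).
under eq_bigr do rewrite mulr_sumr.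
rewrite exchange_big; apply: eq_bigr => a _ /=.
rewrite (partition_big (fun s : 'S_n => s a) xpredT) //=.
apply: eq_bigr => b _; rewrite expand_cofactor mulr_sumr.
apply: eq_bigr => s /eqP <-; rewrite mulrCA; congr (_ * (_ * _)).
by apply: eq_bigl => c; rewrite eq_sym.
Qed.

Lemma pd_det_unit : g y \in unitmx -> is_derive y (delta_mx 0 i) (fun y => \det (g y))
  (\det (g y) * \sum_a \sum_b invmx (g y) b a * pd i (fun y => g y a b) y).
Proof.
move=> gU; apply: is_derive_eq pd_det _; rewrite mulr_sumr.
apply: eq_bigr => a _; rewrite mulr_sumr; apply: eq_bigr => b _.
rewrite mulrC mulrA; congr (_ * _).
rewrite /invmx gU !mxE mulrA divff ?mul1r//.
by move: gU; rewrite unitmxE unitfE.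
Qed.

End Jacobi.

(** * Positive definite forms and orthonormal frames *)

Section Gdot.
Context {R : realType} {n : nat}.
Implicit Types (G : 'M[R]_n) (u v w : 'rV[R]_n).

Lemma gdotE G u v : gdot G u v = \sum_i \sum_j u 0 i * G i j * v 0 j.
Proof.
rewrite /gdot mxE exchange_big; apply: eq_bigr => j _ /=.
by rewrite !mxE mulr_suml; apply: eq_bigr.
Qed.

Lemma gdotDl G u v w : gdot G (u + v) w = gdot G u w + gdot G v w.
Proof. by rewrite /gdot !mulmxDl mxE. Qed.

Lemma gdotZl G a u w : gdot G (a *: u) w = a * gdot G u w.
Proof. by rewrite /gdot -!scalemxAl mxE. Qed.

Lemma gdotNl G u w : gdot G (- u) w = - gdot G u w.
Proof. by rewrite /gdot !mulNmx mxE. Qed.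

Lemma gdotBl G u v w : gdot G (u - v) w = gdot G u w - gdot G v w.
Proof. by rewrite gdotDl gdotNl. Qed.

Lemma gdot0l G w : gdot G 0 w = 0.
Proof. by rewrite /gdot !mul0mx mxE. Qed.

Lemma gdot_suml G (I : Type) (r : seq I) (P : pred I) (u : I -> 'rV[R]_n) w :
  gdot G (\sum_(a <- r | P a) u a) w = \sum_(a <- r | P a) gdot G (u a) w.
Proof.
elim/big_rec2: _ => [|a x y Pa <-]; first exact: gdot0l.
by rewrite gdotDl.
Qed.

Lemma gdotC G u v : G^T = G -> gdot G u v = gdot G v u.
Proof.
move=> GT; rewrite /gdot -[in LHS](trmxK (u *m G *m v^T)) mxE.
by rewrite !trmx_mul trmxK GT mulmxA.
Qed.

Lemma gdotDr G u v w : gdot G w (u + v) = gdot G w u + gdot G w v.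
Proof. by rewrite /gdot linearD mulmxDr mxE. Qed.

Lemma gdotZr G a u w : gdot G w (a *: u) = a * gdot G w u.
Proof. by rewrite /gdot linearZ -scalemxAr mxE. Qed.

Lemma gdotNr G u w : gdot G w (- u) = - gdot G w u.
Proof. by rewrite /gdot linearN mulmxN mxE. Qed.

Lemma gdotBr G u v w : gdot G w (u - v) = gdot G w u - gdot G w v.
Proof. by rewrite gdotDr gdotNr. Qed.

Lemma gdot0r G w : gdot G w 0 = 0.
Proof. by rewrite /gdot trmx0 mulmx0 mxE. Qed.

Lemma gdot_sumr G (I : Type) (r : seq I) (P : pred I) (u : I -> 'rV[R]_n) w :
  gdot G w (\sum_(a <- r | P a) u a) = \sum_(a <- r | P a) gdot G w (u a).
Proof.
elim/big_rec2: _ => [|a x y Pa <-]; first exact: gdot0r.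
by rewrite gdotDr.
Qed.

Definition posdef G := G^T = G /\ forall v, v != 0 -> 0 < gdot G v v.

Lemma posdef_ge0 G v : posdef G -> 0 <= gdot G v v.
Proof.
by move=> [_ GP]; have [->|/GP/ltW//] := eqVneq v 0; rewrite gdot0l.
Qed.

Lemma posdef_unit G : posdef G -> G \in unitmx.
Proof.
move=> [_ GP]; rewrite -row_free_unit; apply/row_freeP.
have : kermx G == 0.
  apply/eqP/row_matrixP => i; rewrite row0; apply/eqP.
  apply/negPn/negP => /GP; rewrite /gdot.
  by rewrite -row_mul mulmx_ker row0 mul0mx mxE ltxx.
by rewrite kermx_eq0 => /row_freeP.
Qed.

Lemma posdef_cauchy G u v : posdef G ->
  gdot G u v ^+ 2 <= gdot G u u * gdot G v v.
Proof.
move=> GP; have [->|v0] := eqVneq v 0; first by rewrite !gdot0r mulr0 expr0n.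
have vv := GP.2 v v0.
have := posdef_ge0 (gdot G v v *: u - gdot G u v *: v) GP.
rewrite gdotBl !gdotBr !gdotZl !gdotZr (gdotC v u GP.1).
set a := gdot G u u; set b := gdot G u v; set d := gdot G v v in vv *.
have -> : d * (d * a) - d * (b * b) - (b * (d * b) - b * (b * d)) =
  d * (a * d - b ^+ 2) by ring.
by rewrite pmulr_rge0 // subr_ge0.
Qed.

End Gdot.

Lemma gdot_mul (R : realType) m n (G : 'M[R]_n) (J : 'M[R]_(m, n)) u v :
  gdot (J *m G *m J^T) u v = gdot G (u *m J) (v *m J).
Proof. by rewrite /gdot trmx_mul !mulmxA. Qed.

(** Block elimination: the congruence by [L] clears the first row and column and leaves the Schur
    complement [S], which is again positive definite, so induction applies to it. *)
Lemma posdef_frame (R : realType) n (G : 'M[R]_n) : posdef G ->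
  exists B : 'M[R]_n, B *m G *m B^T = 1%:M.
Proof.
elim: n G => [|n IH] G GP; first by exists 1%:M; apply/matrixP => -[].
move: G GP; rewrite -[n.+1]/(1 + n)%N => G GP.
have [GT GG] := GP.
rewrite -[G]submxK in GT GG *.
set a := ulsubmx G in GT GG *; set v := ursubmx G in GT GG *.
set v' := dlsubmx G in GT GG *; set G' := drsubmx G in GT GG *.
move: GT; rewrite tr_block_mx => /eq_block_mx[aT v'T vT G'T].
pose e : 'rV[R]_(1 + n) := row_mx 1%:M 0.
have e0 : e != 0.
  by apply/eqP => /(congr1 lsubmx); rewrite row_mxKl linear0 => /matrixP/(_ 0 0);
    rewrite !mxE eqxx => /eqP; rewrite oner_eq0.
have a0 : 0 < a 0 0.
  have := GG e e0; rewrite /gdot /e mul_row_block tr_row_mx mul_row_col.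
  by rewrite !mul1mx !mul0mx trmx1 mulmx1 trmx0 mulmx0 !addr0.
pose L : 'M[R]_(1 + n) := block_mx 1%:M 0 (- ((a 0 0)^-1 *: v')) 1%:M.
pose S := G' - (a 0 0)^-1 *: (v' *m v).
have aE : a = (a 0 0)%:M by rewrite [LHS]mx11_scalar.
have LG : L *m block_mx a v v' G' *m L^T = block_mx a 0 0 S.
  rewrite /L tr_block_mx !mulmx_block !mul1mx !mul0mx !addr0.
  rewrite !trmx1 !trmx0 !mulmx0 !mulmx1 !addr0.
  have E : - ((a 0 0)^-1 *: v') *m a + v' = 0.
    rewrite mulNmx -scalemxAl [in X in v' *m X]aE mul_mx_scalar scalerA.
    by rewrite mulVf ?scale1r ?addNr// gt_eqF.
  rewrite E mul0mx add0r; congr block_mx.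
    rewrite linearN linearZ/= v'T mulmxN -scalemxAr [in X in X *m v]aE mul_scalar_mx.
    by rewrite scalerA mulVf ?scale1r ?addNr// gt_eqF.
  by rewrite mulNmx -scalemxAl addrC.
have SP : posdef S.
  split.
    by rewrite /S linearB/= G'T linearZ/= trmx_mul v'T vT.
  move=> u u0.
  have nz : row_mx 0 u *m L != 0.
    apply/eqP; rewrite /L mul_row_block mul0mx add0r mulmx0 add0r mulmx1.
    by move=> /(congr1 rsubmx); rewrite row_mxKr linear0; apply/eqP.
  have := GG _ nz; rewrite -gdot_mul LG /gdot mul_row_block tr_row_mx mul_row_col.
  by rewrite !mul0mx !mulmx0 !add0r trmx0 mulmx0 add0r.
have [B BS] := IH _ SP.
exists (block_mx ((Num.sqrt (a 0 0))^-1)%:M 0 0 B *m L).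
rewrite trmx_mul !mulmxA.
have -> (A D : 'M[R]_(1 + n)) : A *m L *m D *m L^T = A *m (L *m D *m L^T).
  by rewrite !mulmxA.
rewrite LG tr_block_mx !mulmx_block !mul0mx !mulmx0 !addr0 !add0r !trmx0 !mulmx0.
rewrite !mul0mx BS tr_scalar_mx mul_scalar_mx mul_mx_scalar scalerA.
have s1 : (Num.sqrt (a 0 0))^-1 / Num.sqrt (a 0 0) * a 0 0 = 1.
  by rewrite -invfM -expr2 sqr_sqrtr ?ltW// mulVf ?gt_eqF.
move: (Num.sqrt _) s1 => s s1; rewrite aE scale_scalar_mx s1 !add0r addr0.
by rewrite -scalar_mx_block.
Qed.

(** The rows of B form an orthonormal frame. A trace against the inverse metric thereby becomes a
    sum over the frame, which is how the inequalities for traces are proved below. *)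
Lemma frame_inv (R : realType) n (G B : 'M[R]_n) : B *m G *m B^T = 1%:M ->
  invmx G = B^T *m B.
Proof.
move=> H; have := H; rewrite -mulmxA => /mulmx1C H1.
rewrite -[LHS]mulmx1.
have GU : G \in unitmx.
  have /mulmx1_unit[BG _] := H; move: BG; rewrite unitmx_mul => /andP[_ //].
apply: (can_inj (mulKmx GU)); rewrite mulmx1 mulmxV// mulmxA.
exact/esym.
Qed.

Lemma posdef_inv (R : realType) n (G : 'M[R]_n) : posdef G -> (invmx G)^T = invmx G.
Proof.
by move=> /posdef_frame[B /frame_inv ->]; rewrite trmx_mul trmxK.
Qed.

Lemma posdef_det (R : realType) n (G : 'M[R]_n) : posdef G -> 0 < \det G.
Proof.
move=> /posdef_frame[B /(congr1 determinant)].
rewrite !det_mulmx det_tr det1 mulrAC -expr2 => E.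
have : 0 < \det B ^+ 2 * \det G by rewrite E.
by rewrite pmulr_rgt0 // exprn_even_gt0 //=; apply: contra_eq_neq E => ->;
  rewrite expr0n mul0r eq_sym oner_eq0.
Qed.

(** * Covariant derivatives along maps *)

Section VectorFields.
Context {R : realType} {m d : nat} (U : set 'rV[R]_m).
Hypothesis oU : open U.
Implicit Types (A B : 'rV[R]_m -> 'rV[R]_d) (f : 'rV[R]_m -> R).

Definition vsmooth A := forall l, smooth U (fun y => A y 0 l).

Lemma vsmooth_der A i y : vsmooth A -> U y -> derivable A y (delta_mx 0 i).
Proof. by move=> sA Uy; apply: derivable_coords => l; exact: smooth_der (sA l) Uy. Qed.

Lemma pd_rVE A i y l : vsmooth A -> U y -> (pd i A y) 0 l = pd i (fun y => A y 0 l) y.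
Proof. by move=> sA Uy; rewrite pd_mxE// => a b; rewrite ord1; exact: smooth_der (sA b) Uy. Qed.

Lemma smooth_ext f g : (forall y, U y -> f y = g y) -> smooth U f -> smooth U g.
Proof. by move=> fg sf k; exact: Ck_ext fg (sf k). Qed.

Lemma vsmooth_pd A i : vsmooth A -> vsmooth (pd i A).
Proof.
move=> sA l; apply: smooth_ext (smooth_pd i (sA l)) => y Uy.
by rewrite pd_rVE.
Qed.

Lemma vsmooth_ext A B : (forall y, U y -> A y = B y) -> vsmooth A -> vsmooth B.
Proof. by move=> AB sA l; apply: smooth_ext (sA l) => y Uy; rewrite AB. Qed.

Lemma vsmoothD A B : vsmooth A -> vsmooth B -> vsmooth (fun y => A y + B y).
Proof. by move=> sA sB l k; under eq_fun do rewrite mxE; exact: CkD (sA l k) (sB l k). Qed.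

Lemma vsmoothN A : vsmooth A -> vsmooth (fun y => - A y).
Proof. by move=> sA l k; under eq_fun do rewrite mxE; exact: CkN (sA l k). Qed.

Lemma vsmoothB A B : vsmooth A -> vsmooth B -> vsmooth (fun y => A y - B y).
Proof. by move=> sA sB; apply: vsmoothD => //; exact: vsmoothN. Qed.

Lemma vsmoothZ f A : smooth U f -> vsmooth A -> vsmooth (fun y => f y *: A y).
Proof. by move=> sf sA l k; under eq_fun do rewrite mxE; exact: CkM (sf k) (sA l k). Qed.

Lemma vsmooth_cst (v : 'rV[R]_d) : vsmooth (fun=> v).
Proof. by move=> l k; exact: Ck_cst. Qed.

Lemma smooth_sum (I : Type) (r : seq I) (P : pred I) (f : I -> 'rV[R]_m -> R) :
  (forall a, P a -> smooth U (f a)) -> smooth U (fun y => \sum_(a <- r | P a) f a y).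
Proof. by move=> sf k; apply: Ck_sum => // a Pa; exact: sf. Qed.

Lemma smoothM f g : smooth U f -> smooth U g -> smooth U (fun y => f y * g y).
Proof. by move=> sf sg k; exact: CkM. Qed.

Lemma smoothD f g : smooth U f -> smooth U g -> smooth U (fun y => f y + g y).
Proof. by move=> sf sg k; exact: CkD. Qed.

Lemma smoothB f g : smooth U f -> smooth U g -> smooth U (fun y => f y - g y).
Proof. by move=> sf sg k; exact: CkB. Qed.

Lemma smooth_cst (c : R) : smooth U (fun=> c).
Proof. by move=> k; exact: Ck_cst. Qed.

Lemma vsmooth_sum (I : Type) (r : seq I) (P : pred I) (A : I -> 'rV[R]_m -> 'rV[R]_d) :
  (forall a, P a -> vsmooth (A a)) -> vsmooth (fun y => \sum_(a <- r | P a) A a y).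
Proof.
move=> sA l; apply: (smooth_ext _ (smooth_sum r (P := P) (f := fun a y => A a y 0 l) _)).
  by move=> y _; rewrite summxE.
by move=> a Pa; exact: sA.
Qed.

Section Point.
Variables (i : 'I_m) (y : 'rV[R]_m) (Uy : U y).

Lemma vpd_ext A B : (forall y, U y -> A y = B y) -> pd i A y = pd i B y.
Proof. by move=> AB; apply: near_eq_derive; exact: near_open AB. Qed.

Lemma vpdD A B : vsmooth A -> vsmooth B ->
  pd i (fun y => A y + B y) y = pd i A y + pd i B y.
Proof. by move=> sA sB; exact (deriveD (vsmooth_der sA Uy) (vsmooth_der sB Uy)). Qed.

Lemma vpdZ f A : smooth U f -> vsmooth A ->
  pd i (fun y => f y *: A y) y = pd i f y *: A y + f y *: pd i A y.
Proof.
move=> sf sA; apply/rowP => l; rewrite pd_rVE//; last exact: vsmoothZ.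
under eq_fun do rewrite mxE.
rewrite pdM ?[in RHS]mxE ?[in RHS]mxE ?[in RHS]mxE ?pd_rVE//.
- exact: smooth_der sf Uy.
- exact: smooth_der (sA l) Uy.
Qed.

Lemma vpd_sum (I : Type) (r : seq I) (A : I -> 'rV[R]_m -> 'rV[R]_d) :
  (forall a, vsmooth (A a)) ->
  pd i (fun y => \sum_(a <- r) A a y) y = \sum_(a <- r) pd i (A a) y.
Proof.
move=> sA; apply/rowP => l; rewrite pd_rVE//; last by apply: vsmooth_sum.
under eq_fun do rewrite summxE.
rewrite pd_sum ?summxE; first by apply: eq_bigr => a _; rewrite pd_rVE.
by move=> a _; exact: smooth_der (sA a l) Uy.
Qed.

Opaque pd.

Lemma vpd_comm A j : vsmooth A -> pd i (pd j A) y = pd j (pd i A) y.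
Proof.
move=> sA; apply/rowP => l.
apply: (etrans (pd_rVE i l (vsmooth_pd j sA) Uy)).
apply: (etrans _ (esym (pd_rVE j l (vsmooth_pd i sA) Uy))).
rewrite (@pd_near _ _ _ _ (pd j (fun y => A y 0 l))); last first.
  by apply: near_open oU Uy _ => z Uz; rewrite pd_rVE.
rewrite [RHS](@pd_near _ _ _ _ (pd i (fun y => A y 0 l))); last first.
  by apply: near_open oU Uy _ => z Uz; rewrite pd_rVE.
exact: pd_comm oU Uy (sA l 2%N).
Qed.

End Point.
End VectorFields.

Opaque pd.

Section Metric.
Context {R : realType} {d : nat} (V : set 'rV[R]_d) (G : 'rV[R]_d -> 'M[R]_d).
Hypotheses (oV : open V) (sG : forall a b, smooth V (fun z => G z a b))
  (GP : forall z, V z -> posdef (G z)).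
Implicit Types u v w z : 'rV[R]_d.

Definition dmetric z u v w : R := \sum_l u 0 l * gdot (pd l G z) v w.

Lemma pd_metricE l z a b : V z -> (pd l G z) a b = pd l (fun z => G z a b) z.
Proof. by move=> Vz; rewrite pd_mxE// => ? ?; exact: smooth_der (sG _ _) Vz. Qed.

Lemma pd_metricT l z : V z -> (pd l G z)^T = pd l G z.
Proof.
move=> Vz; apply/matrixP => a b; rewrite mxE !pd_metricE//.
apply: pd_near; apply: near_open oV Vz _ => t Vt.
by rewrite -[in LHS](GP Vt).1 mxE.
Qed.

Lemma dmetricC z u v w : V z -> dmetric z u v w = dmetric z u w v.
Proof. by move=> Vz; apply: eq_bigr => l _; rewrite gdotC// pd_metricT. Qed.

Lemma gdot_inj (H : 'M[R]_d) u v : posdef H ->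
  (forall w, gdot H u w = gdot H v w) -> u = v.
Proof.
move=> HP E; apply/eqP; rewrite -subr_eq0; apply/negPn/negP => /HP.2.
by rewrite gdotBl E subrr ltxx.
Qed.

(** Koszul's formula, the upper index being lowered with the metric. Symmetry, metric compatibility
    and the connection of a warped product are read off from it. *)
Lemma gdot_gamma z u v w : V z ->
  gdot (G z) (gamma G z u v) w =
  2^-1 * (dmetric z u v w + dmetric z v u w - dmetric z w u v).
Proof.
move=> Vz; have gU := posdef_unit (GP Vz).
pose C : 'rV[R]_d := \row_l \sum_i \sum_j u 0 i * v 0 j *
  ((pd i G z) j l + (pd j G z) i l - (pd l G z) i j).
have gE : gamma G z u v = 2^-1 *: (C *m invmx (G z)).
  apply/rowP => k; rewrite !mxE.

  transitivity (\sum_i \sum_j \sum_l 2^-1 * (u 0 i * v 0 j *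
     ((pd i G z) j l + (pd j G z) i l - (pd l G z) i j) * invmx (G z) l k)).
    apply: eq_bigr => i _; apply: eq_bigr => j _.
    rewrite /christoffel mulrCA !mulr_sumr; apply: eq_bigr => l _.
    have -> : invmx (G z) k l = invmx (G z) l k.
      by rewrite -[in LHS](posdef_inv (GP Vz)) mxE.
    by ring.
  rewrite mulr_sumr; under [RHS]eq_bigr => l _.
    rewrite mxE mulr_suml mulr_sumr.
    under eq_bigr => i _ do rewrite mulr_suml mulr_sumr.
    over.
  rewrite [RHS]exchange_big /=; apply: eq_bigr => i _.
  by rewrite [RHS]exchange_big.
have -> : gdot (G z) (gamma G z u v) w = 2^-1 * \sum_l C 0 l * w 0 l.
  rewrite gE gdotZl /gdot -(mulmxA C) mulVmx// mulmx1 mxE.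
  by congr (_ * _); apply: eq_bigr => l _; rewrite [w^T _ _]mxE.
congr (_ * _).
transitivity (\sum_l \sum_i \sum_j u 0 i * v 0 j *
  ((pd i G z) j l + (pd j G z) i l - (pd l G z) i j) * w 0 l).
  apply: eq_bigr => l _; rewrite mxE mulr_suml.
  by apply: eq_bigr => i _; rewrite mulr_suml.
have -> : dmetric z u v w =
    \sum_l \sum_i \sum_j u 0 i * v 0 j * (pd i G z) j l * w 0 l.
  rewrite exchange_big; apply: eq_bigr => i _; rewrite exchange_big gdotE mulr_sumr.
  apply: eq_bigr => j _; rewrite mulr_sumr; apply: eq_bigr => l _; ring.
have -> : dmetric z v u w =
    \sum_l \sum_i \sum_j u 0 i * v 0 j * (pd j G z) i l * w 0 l.
  under eq_bigr do rewrite exchange_big /=.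
  rewrite exchange_big; apply: eq_bigr => j _; rewrite exchange_big gdotE mulr_sumr.
  apply: eq_bigr => i _; rewrite mulr_sumr; apply: eq_bigr => l _; ring.
have -> : dmetric z w u v =
    \sum_l \sum_i \sum_j u 0 i * v 0 j * (pd l G z) i j * w 0 l.
  apply: eq_bigr => l _; rewrite gdotE mulr_sumr; apply: eq_bigr => i _.
  rewrite mulr_sumr; apply: eq_bigr => j _; ring.
rewrite -big_split -sumrB; apply: eq_bigr => l _ /=.
rewrite -big_split -sumrB; apply: eq_bigr => i _ /=.
rewrite -big_split -sumrB; apply: eq_bigr => j _ /=.
by ring.
Qed.

Lemma gammaC z u v : V z -> gamma G z u v = gamma G z v u.
Proof.
move=> Vz; apply: (gdot_inj (GP Vz)) => w; rewrite !gdot_gamma//.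
by rewrite (dmetricC w u v Vz) [dmetric z u v w + _]addrC.
Qed.

Lemma gammaE z u v :
  gamma G z u v = \sum_p \sum_q (u 0 p * v 0 q) *: gamma G z (delta_mx 0 p) (delta_mx 0 q).
Proof.
apply/rowP => k; rewrite summxE mxE; apply: eq_bigr => p _.
rewrite summxE; apply: eq_bigr => q _; rewrite !mxE; congr (_ * _).
rewrite (bigD1 p)//= (bigD1 q)//= !mxE !eqxx !mul1r.
rewrite [X in _ + X]big1 ?addr0 => [|i ip]; last first.
  by rewrite big1// => j _; rewrite !mxE (negPf ip) andbF !mul0r.
rewrite [X in _ + X]big1 ?addr0 => // j jq.
by rewrite !mxE (negPf jq) andbF mulr0 mul0r.
Qed.

Lemma gammaZr z a u v : gamma G z u (a *: v) = a *: gamma G z u v.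
Proof.
rewrite gammaE [in RHS]gammaE scaler_sumr; apply: eq_bigr => p _.
by rewrite scaler_sumr; apply: eq_bigr => q _; rewrite mxE scalerA mulrCA.
Qed.

Lemma gammaZl z a u v : gamma G z (a *: u) v = a *: gamma G z u v.
Proof.
rewrite gammaE [in RHS]gammaE scaler_sumr; apply: eq_bigr => p _.
by rewrite scaler_sumr; apply: eq_bigr => q _; rewrite mxE scalerA mulrA.
Qed.

Lemma gammaDl z u v w : gamma G z (u + v) w = gamma G z u w + gamma G z v w.
Proof.
rewrite gammaE [in RHS]gammaE [gamma _ _ v w]gammaE -big_split; apply: eq_bigr => p _.
rewrite -big_split; apply: eq_bigr => q _ /=.
by rewrite mxE mulrDl scalerDl.
Qed.

Lemma gamma0l z u : gamma G z 0 u = 0.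
Proof. by have := gammaZl z 0 0 u; rewrite !scale0r. Qed.

Lemma gamma0r z u : gamma G z u 0 = 0.
Proof. by have := gammaZr z 0 u 0; rewrite !scale0r. Qed.

Lemma gammaDr z u v w : gamma G z u (v + w) = gamma G z u v + gamma G z u w.
Proof.
rewrite gammaE [in RHS]gammaE [gamma _ _ u w]gammaE -big_split; apply: eq_bigr => p _.
rewrite -big_split; apply: eq_bigr => q _ /=.
by rewrite mxE mulrDr scalerDl.
Qed.

Lemma smooth_gamma p q : vsmooth V (fun z => gamma G z (delta_mx 0 p) (delta_mx 0 q)).
Proof.
move=> k; under eq_fun do rewrite mxE.
apply: (smooth_sum oV) => i _; apply: (smooth_sum oV) => j _.
apply: smoothM => //; first exact: smooth_cst.
apply: smoothM => //; first exact: smooth_cst.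
apply: (smooth_sum oV) => l _; apply: smoothM => //.
  move=> c; apply: Ck_invmx => // [z /GP/posdef_unit//|a b]; exact: sG.
have D i' a b : smooth V (fun z => pd i' G z a b).
  apply: smooth_ext (smooth_pd i' (sG a b)) => // z Vz.
  by rewrite pd_metricE.
by apply: smoothB => //; apply: smoothD.
Qed.

Section AlongMap.
Context {m : nat} (U : set 'rV[R]_m) (F : 'rV[R]_m -> 'rV[R]_d).
Hypotheses (oU : open U) (sF : vsmooth U F) (UV : forall y, U y -> V (F y)).
Implicit Types (A B : 'rV[R]_m -> 'rV[R]_d).

Lemma smooth_compF (f : 'rV[R]_d -> R) : smooth V f -> smooth U (f \o F).
Proof. by move=> sf k; exact: Ck_comp (fun l => sF l k) (sf k). Qed.

Lemma vsmooth_cov A i : vsmooth U A -> vsmooth U (cov G F i A).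
Proof.
move=> sA.
apply: (@vsmooth_ext _ _ _ _ oU (fun y => pd i A y + \sum_p \sum_q
  (pd i F y 0 p * A y 0 q) *: gamma G (F y) (delta_mx 0 p) (delta_mx 0 q))).
  by move=> y Uy; rewrite /cov [in RHS]gammaE.
apply: vsmoothD => //; first exact: vsmooth_pd.
apply: vsmooth_sum => // p _; apply: vsmooth_sum => // q _.
apply: vsmoothZ => //.
  by apply: smoothM => //; exact: vsmooth_pd.
by move=> l; exact (smooth_compF (smooth_gamma p q l)).
Qed.

Section AtPoint.
Variables (y : 'rV[R]_m) (Uy : U y).

Lemma covD A B i : vsmooth U A -> vsmooth U B ->
  cov G F i (fun y => A y + B y) y = cov G F i A y + cov G F i B y.
Proof. by move=> sA sB; rewrite /cov (vpdD i Uy) // gammaDr addrACA. Qed.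

Lemma covZ (f : 'rV[R]_m -> R) A i : smooth U f -> vsmooth U A ->
  cov G F i (fun y => f y *: A y) y = pd i f y *: A y + f y *: cov G F i A y.
Proof. by move=> sf sA; rewrite /cov (vpdZ oU i Uy) // gammaZr scalerDr addrA. Qed.

Lemma cov_sum (J : Type) (r : seq J) (A : J -> 'rV[R]_m -> 'rV[R]_d) i :
  (forall a, vsmooth U (A a)) ->
  cov G F i (fun y => \sum_(a <- r) A a y) y = \sum_(a <- r) cov G F i (A a) y.
Proof.
move=> sA; rewrite /cov (vpd_sum oU i Uy) // big_split/=; congr (_ + _).
elim: r => [|a r IH]; last by rewrite !big_cons gammaDr IH.
by rewrite !big_nil gamma0r.
Qed.

Lemma cov_ext A B i : (forall y, U y -> A y = B y) -> cov G F i A y = cov G F i B y.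
Proof. by move=> AB; rewrite /cov (vpd_ext oU i Uy AB) AB. Qed.

Lemma cov_torsion i j : cov G F i (pd j F) y = cov G F j (pd i F) y.
Proof. exact: (f_equal2 +%R (vpd_comm oU i Uy j sF) (gammaC _ _ (UV Uy))). Qed.

(** The chain rule applied to the coefficients [G (F y)] yields [dmetric] in the direction d_i F. By
    Koszul's formula the two [gamma] terms add up to the same quantity, their other contributions
    cancelling. *)
Lemma metric_compat A B i : vsmooth U A -> vsmooth U B ->
  is_derive y (delta_mx 0 i) (fun y => gdot (G (F y)) (A y) (B y))
    (gdot (G (F y)) (cov G F i A y) (B y) + gdot (G (F y)) (A y) (cov G F i B y)).
Proof.
move=> sA sB; have Vy := UV Uy.
have dG a b : is_derive y (delta_mx 0 i) (fun y => G (F y) a b)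
    (\sum_l pd i F y 0 l * pd l G (F y) a b).
  have := @pd_comp _ _ _ V (fun z => G z a b) F i y oV Vy (sG a b 1%N)
    (fun l => smooth_der (sF l) Uy).
  move=> /is_derive_eq; apply; apply: eq_bigr => l _.
  by rewrite (pd_metricE _ _ _ Vy) (pd_rVE i l sF Uy).
have sGF a b : smooth U (fun y => G (F y) a b) by exact (smooth_compF (sG a b)).
have E : (fun y => gdot (G (F y)) (A y) (B y)) =
    (fun y => \sum_a \sum_b A y 0 a * G (F y) a b * B y 0 b).
  by apply/funext => z; rewrite gdotE.
have sT a b : smooth U (fun y => A y 0 a * G (F y) a b * B y 0 b).
  by apply: smoothM => //; apply: smoothM.
have sS a : smooth U (fun y => \sum_b A y 0 a * G (F y) a b * B y 0 b).
  by apply: (smooth_sum oU).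
rewrite E; apply: is_derive_eq.
  apply: pd_derivable; apply: (smooth_der _ Uy).
  by apply: (smooth_sum oU) => a _; exact: sS.
rewrite pd_sum; last by move=> a _; exact: smooth_der (sS a) Uy.
under eq_bigr => a _.
  rewrite pd_sum; last by move=> b _; exact: smooth_der (sT a b) Uy.
  under eq_bigr => b _.
    have dA := smooth_der (sA a) Uy; have dB := smooth_der (sB b) Uy.
    have dGF := smooth_der (sGF a b) Uy.
    rewrite pdM // ?pdM //; last exact (derivableM (dA i) (dGF i)).
    have -> : pd i (fun y0 => G (F y0) a b) y = \sum_l pd i F y 0 l * pd l G (F y) a b.
      exact: (derive_val (is_derive := dG a b)).
    rewrite -(pd_rVE i a sA Uy) -(pd_rVE i b sB Uy).
    over.
  over.
have -> : \sum_a \sum_b ((pd i A y 0 a * G (F y) a b + A y 0 a *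
     (\sum_l pd i F y 0 l * pd l G (F y) a b)) * B y 0 b +
     A y 0 a * G (F y) a b * pd i B y 0 b) =
   gdot (G (F y)) (pd i A y) (B y) + dmetric (F y) (pd i F y) (A y) (B y) +
     gdot (G (F y)) (A y) (pd i B y).
  have -> : dmetric (F y) (pd i F y) (A y) (B y) = \sum_a \sum_b
      A y 0 a * (\sum_l pd i F y 0 l * pd l G (F y) a b) * B y 0 b.
    rewrite /dmetric; under eq_bigr do rewrite gdotE mulr_sumr.
    rewrite exchange_big; apply: eq_bigr => a _ /=.
    under eq_bigr do rewrite mulr_sumr; rewrite exchange_big.
    apply: eq_bigr => b _ /=; rewrite mulr_sumr mulr_suml.
    by apply: eq_bigr => l _; ring.
  rewrite !gdotE -!big_split; apply: eq_bigr => a _ /=.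
  by rewrite -!big_split; apply: eq_bigr => b _ /=; ring.
rewrite /cov gdotDl gdotDr (gdotC (A y) (gamma _ _ _ _) (GP Vy).1) !gdot_gamma//.
rewrite (dmetricC (pd i F y) (B y) (A y) Vy).
by field.
Qed.

End AtPoint.
End AlongMap.



Lemma vpd_comp (p m' : nat) (U' : set 'rV[R]_p) (U : set 'rV[R]_m')
    (A : 'rV[R]_m' -> 'rV[R]_d) (t : 'rV[R]_p -> 'rV[R]_m') i y :
  open U' -> open U -> vsmooth U A -> vsmooth U' t -> (forall y, U' y -> U (t y)) ->
  U' y -> pd i (fun y => A (t y)) y = \sum_j pd i t y 0 j *: pd j A (t y).
Proof.
move=> oU' oU sA st tU Uy; apply/rowP => l.
have D := pd_comp oU (tU _ Uy) (sA l 1%N) (fun j => smooth_der (i := i) (st j) Uy).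
rewrite summxE; have sAt : vsmooth U' (fun y => A (t y)).
  by move=> l' k; exact: Ck_comp (fun j => st j k) (sA l' k).
have {}D : pd i (fun y => A (t y) 0 l) y = _ := derive_val (is_derive := D).
rewrite (pd_rVE i l sAt Uy) D.
apply: eq_bigr => j _; rewrite mxE (pd_rVE i j st Uy).
by rewrite (pd_rVE j l sA (tU _ Uy)).
Qed.

Section Chain.
Context {m p : nat} (U : set 'rV[R]_m) (U' : set 'rV[R]_p).
Variables (F : 'rV[R]_m -> 'rV[R]_d) (t : 'rV[R]_p -> 'rV[R]_m).
Hypotheses (oU : open U) (oU' : open U') (sF : vsmooth U F) (st : vsmooth U' t).
Hypotheses (tU : forall y, U' y -> U (t y)).

Lemma cov_comp (A : 'rV[R]_m -> 'rV[R]_d) i y : vsmooth U A -> U' y ->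
  cov G (fun y => F (t y)) i (fun y => A (t y)) y =
  \sum_j pd i t y 0 j *: cov G F j A (t y).
Proof.
move=> sA Uy; rewrite /cov (vpd_comp i oU' oU sA st tU Uy).
rewrite (vpd_comp i oU' oU sF st tU Uy).
under [RHS]eq_bigr do rewrite scalerDr; rewrite big_split/=; congr (_ + _).
elim: (index_enum _) => [|a r IH]; first by rewrite !big_nil gamma0l.
by rewrite !big_cons gammaDl gammaZl IH.
Qed.

End Chain.

Section Curvature.
Context {m : nat} (U : set 'rV[R]_m) (F : 'rV[R]_m -> 'rV[R]_d).
Hypotheses (oU : open U) (sF : vsmooth U F) (UV : forall y, U y -> V (F y)).

Lemma vsmooth_id : vsmooth V id.
Proof.
move=> l; elim=> [|k IH]; first by split=> // z _; exact: coord_continuous.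
have D i z : is_derive z (delta_mx 0 i) (fun z : 'rV[R]_d => z 0 l) ((i == l)%:R).
  have df : differentiable (fun z : 'rV[R]_d => z 0 l) z by exact: differentiable_coord.
  split; first exact: diff_derivable.
  have dI : derivable (id : 'rV[R]_d -> 'rV[R]_d) z (delta_mx 0 i) by exact: derivable_id.
  have := derive_mx dI.
  by rewrite derive_id => /matrixP/(_ 0 l); rewrite !mxE eqxx /= eq_sym => <-.
split; first by move=> z _; exact: coord_continuous.
move=> i; split; first by move=> z _; exact: (ex_derive (is_derive := D i z)).
apply: Ck_ext (Ck_cst k V ((i == l)%:R)) => // z _.
by rewrite -(derive_val (is_derive := D i z)).
Qed.

(** Expand A in the coordinate fields of the target. The terms that contain derivatives of A or
    second derivatives of F are symmetric in i and j, so the commutator retains only the derivatives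
    of the connection, which make up [riemann_tensor]. *)
Lemma curvature_along (A : 'rV[R]_m -> 'rV[R]_d) i j y : vsmooth U A -> U y ->
  cov G F i (cov G F j A) y - cov G F j (cov G F i A) y =
  riemann_tensor G (F y) (pd i F y) (pd j F y) (A y).
Proof.
move=> sA Uy; have Vy := UV Uy.
pose E p q z := cov G id p (fun=> delta_mx 0 q) z : 'rV[R]_d.
have idE z k : pd k id z = delta_mx 0 k :> 'rV[R]_d.
  by rewrite [LHS]derive_id.
have EE p q z : E p q z = gamma G z (delta_mx 0 p) (delta_mx 0 q).
  by rewrite /E /cov idE [pd _ _ _]derive_cst add0r.
have sE p q : vsmooth V (E p q).
  by apply: (vsmooth_ext oV _ (smooth_gamma p q)) => z _; rewrite EE.
have sEF p q : vsmooth U (fun y => E p q (F y)).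
  by move=> l; exact (smooth_compF oU sF UV (sE p q l)).
pose K r p q := cov G id r (E p q) (F y).
have covE k p q : cov G F k (fun y => E p q (F y)) y = \sum_r pd k F y 0 r *: K r p q.
  exact: (cov_comp oV oU vsmooth_id sF UV k (sE p q) Uy).
have covA k (z : 'rV[R]_m) : cov G F k A z = pd k A z + \sum_p \sum_q
    (pd k F z 0 p * A z 0 q) *: E p q (F z).
  rewrite /cov gammaE; congr (_ + _); apply: eq_bigr => p _; apply: eq_bigr => q _.
  by rewrite EE.
have sFA k p q : smooth U (fun z : 'rV[R]_m => pd k F z 0 p * A z 0 q).
  by apply: smoothM => //; exact: vsmooth_pd.
have sFE l p q : vsmooth U (fun z : 'rV[R]_m => (pd l F z 0 p * A z 0 q) *: E p q (F z)).
  exact (vsmoothZ oU (sFA l p q) (sEF p q)).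
have sFE1 l p : vsmooth U (fun z : 'rV[R]_m =>
    \sum_q (pd l F z 0 p * A z 0 q) *: E p q (F z)).
  by apply: (vsmooth_sum oU) => q _; exact (sFE l p q).
have sFE2 l : vsmooth U (fun z : 'rV[R]_m =>
    \sum_p \sum_q (pd l F z 0 p * A z 0 q) *: E p q (F z)).
  by apply: (vsmooth_sum oU) => p _; exact (sFE1 l p).
(* The terms of first order in A together with those in the second derivatives of F. They drop out
   of the commutator because partial derivatives commute. *)
pose S k l := \sum_p \sum_q (pd k F y 0 p * pd l A y 0 q +
     pd k (pd l F) y 0 p * A y 0 q + pd l F y 0 p * pd k A y 0 q) *: E p q (F y).
have SC : S i j = S j i.
  rewrite /S (vpd_comm oU i Uy j sF).
  move: (pd j (pd i F) y) (pd i F y) (pd j F y) (pd i A y) (pd j A y) => a b c e f.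
  apply: eq_bigr => p _; apply: eq_bigr => q _; congr (_ *: _).
  by ring.
have key k l : cov G F k (cov G F l A) y = (pd k (pd l A) y + S k l) +
   \sum_p \sum_q \sum_r (pd k F y 0 r * pd l F y 0 p * A y 0 q) *: K r p q.
  rewrite (cov_ext F oU Uy k (fun (z : 'rV[R]_m) _ => covA l z)).
  rewrite (covD F Uy); last 2 first.
  - exact: vsmooth_pd.
  - exact (sFE2 l).
  rewrite /cov -!addrA; congr (_ + _).
  rewrite -/(cov G F k _ y) [gamma _ _ _ _]gammaE.
  rewrite (cov_sum F oU Uy _ _ (sFE1 l)).
  rewrite -!big_split; apply: eq_bigr => p _ /=.
  rewrite (cov_sum F oU Uy _ _ (sFE l p)).
  rewrite -!big_split; apply: eq_bigr => q _ /=.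
  rewrite (covZ F oU Uy _ (sFA l p q) (sEF p q)) covE scaler_sumr -EE addrA -scalerDl; congr (_ *: _ + _).
    rewrite pdM; [|exact: smooth_der (vsmooth_pd _ _ _ _) Uy|exact: smooth_der (sA q) Uy].
    have E1 := pd_rVE k p (vsmooth_pd oU l sF) Uy.
    have E2 := pd_rVE k q sA Uy.
    by rewrite -E1 -E2 addrA.
  by apply: eq_bigr => r _; rewrite scalerA; congr (_ *: _); ring.
rewrite !key (vpd_comm oU i Uy j sA) SC opprD addrACA subrr add0r.
have -> : riemann_tensor G (F y) (pd i F y) (pd j F y) (A y) =
  \sum_r \sum_p \sum_q (pd i F y 0 r * pd j F y 0 p * A y 0 q) *:
    (K r p q - K p r q) by [].
clearbody K; move: (pd i F y) (pd j F y) (A y) => a b c.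
under [RHS]eq_bigr do under eq_bigr do under eq_bigr do rewrite scalerBr.
under [RHS]eq_bigr do under eq_bigr do rewrite sumrB.
under [RHS]eq_bigr do rewrite sumrB.
rewrite sumrB; congr (_ - _).
  under eq_bigr do rewrite exchange_big /=.
  rewrite exchange_big; apply: eq_bigr => r _; apply: eq_bigr => p _.
  by apply: eq_bigr => q _.
apply: eq_bigr => p _; rewrite exchange_big; apply: eq_bigr => r _.
apply: eq_bigr => q _; congr (_ *: _); ring.
Qed.

End Curvature.
End Metric.
Transparent pd.

(** * The Bochner-type identity for the normal part of a closed conformal field *)

(* The Bochner computation uses only a metric connection D along the immersion,
   with dd its action on functions; S and VF stand for the smooth functions and
   fields, and identities hold on U. *)
Section AbstractIdentity.
Context {R : realFieldType} {E : lmodType R} {T : Type} {m : nat}.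
Variables (U : T -> Prop) (S : (T -> R) -> Prop) (VF : (T -> E) -> Prop).
Variables (dd : 'I_m -> (T -> R) -> T -> R) (D : 'I_m -> (T -> E) -> T -> E).
Variable (ip : T -> E -> E -> R).
Hypothesis ipDl : forall y A B C, ip y (A + B) C = ip y A C + ip y B C.
Hypothesis ipZl : forall y a A C, ip y (a *: A) C = a * ip y A C.
Hypothesis ipC : forall y A B, U y -> ip y A B = ip y B A.
Hypothesis S_cst : forall a, S (fun=> a).
Hypothesis S_M : forall f g, S f -> S g -> S (fun y => f y * g y).
Hypothesis S_N : forall f, S f -> S (fun y => - f y).
Hypothesis S_sum : forall (f : 'I_m -> T -> R), (forall i, S (f i)) ->
  S (fun y => \sum_i f i y).
Hypothesis S_dd : forall i f, S f -> S (dd i f).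
Hypothesis S_ip : forall A B, VF A -> VF B -> S (fun y => ip y (A y) (B y)).
Hypothesis VF_B : forall A B, VF A -> VF B -> VF (fun y => A y - B y).
Hypothesis VF_D : forall A B, VF A -> VF B -> VF (fun y => A y + B y).
Hypothesis VF_Z : forall f A, S f -> VF A -> VF (fun y => f y *: A y).
Hypothesis VF_sum : forall (A : 'I_m -> T -> E), (forall i, VF (A i)) ->
  VF (fun y => \sum_i A i y).
Hypothesis VF_cov : forall i A, VF A -> VF (D i A).
Hypothesis dd_ext : forall i f g y, U y -> (forall z, U z -> f z = g z) ->
  dd i f y = dd i g y.
Hypothesis dd_cst : forall i (c : R) y, U y -> dd i (fun=> c) y = 0.
Hypothesis dd_Ml : forall i (c : R) f y, U y -> S f ->
  dd i (fun y => c * f y) y = c * dd i f y.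
Hypothesis dd_sum : forall i (f : 'I_m -> T -> R) y, U y -> (forall j, S (f j)) ->
  dd i (fun y => \sum_j f j y) y = \sum_j dd i (f j) y.
Hypothesis D_add : forall i A B y, U y -> VF A -> VF B ->
  D i (fun y => A y + B y) y = D i A y + D i B y.
Hypothesis D_sub : forall i A B y, U y -> VF A -> VF B ->
  D i (fun y => A y - B y) y = D i A y - D i B y.
Hypothesis D_Z : forall i f A y, U y -> S f -> VF A ->
  D i (fun y => f y *: A y) y = dd i f y *: A y + f y *: D i A y.
Hypothesis D_sum : forall i (A : 'I_m -> T -> E) y, U y -> (forall j, VF (A j)) ->
  D i (fun y => \sum_j A j y) y = \sum_j D i (A j) y.
Hypothesis dd_ip : forall i A B y, U y -> VF A -> VF B ->
  dd i (fun y => ip y (A y) (B y)) y = ip y (D i A y) (B y) + ip y (A y) (D i B y).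
Variables (e : 'I_m -> T -> E) (gi : 'I_m -> 'I_m -> T -> R) (X : T -> E)
  (h1 : T -> R) (c : R).
Hypothesis VF_e : forall i, VF (e i).
Hypothesis S_gi : forall i j, S (gi i j).
Hypothesis giC : forall i j y, U y -> gi i j y = gi j i y.
Hypothesis gi_inv : forall i j y, U y ->
  \sum_k gi i k y * ip y (e k y) (e j y) = (i == j)%:R.
Hypothesis torsion : forall i j y, U y -> D i (e j) y = D j (e i) y.
Hypothesis VF_X : VF X.
Hypothesis D_X : forall i y, U y -> D i X y = h1 y *: e i y.

(** With e_i the tangent frame and [gi] its inverse Gram matrix, [xi] are the components of the
    tangential part X^T, [NN] is N = X^perp, and D_i N = [nperp i] - sum_p [bm i p] e_p splits its
    derivative into the normal derivative and the shape operator of N. [YY] is half the gradient of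
    |N|^2 and [Rt] the trace over i of the curvature R(e_i, X^T) N. *)
Definition xi k y := \sum_q gi k q y * ip y (X y) (e q y).
Definition NN y := X y - \sum_k xi k y *: e k y.
Definition nD i := D i NN.
Definition bm i p y := - \sum_q gi p q y * ip y (nD i y) (e q y).
Definition nperp i y := nD i y + \sum_p bm i p y *: e p y.
Definition ww y := ip y (NN y) (NN y).
Definition YY j y := \sum_q gi j q y * (2^-1 * dd q ww y).
Definition Rt y := \sum_k xi k y * \sum_i \sum_j gi i j y *
  ip y (D i (nD k) y - D k (nD i) y) (e j y).

(** The soliton equation H = c N, tested against normal vectors P; the normal projection inside II
    disappears in such a pairing. *)
Hypothesis mean : forall y P, U y -> (forall j, ip y P (e j y) = 0) ->
  \sum_i \sum_j gi i j y * ip y P (D i (e j) y) = c * ip y P (NN y).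

Lemma ipDr y A B C : U y -> ip y C (A + B) = ip y C A + ip y C B.
Proof. by move=> Uy; rewrite !(ipC C). Qed.
Lemma ipZr y a A C : U y -> ip y C (a *: A) = a * ip y C A.
Proof. by move=> Uy; rewrite !(ipC C). Qed.
Lemma ip0l y C : ip y 0 C = 0.
Proof. by rewrite -(scale0r (0 : E)) ipZl mul0r. Qed.
Lemma ipNl y A C : ip y (- A) C = - ip y A C.
Proof. by rewrite -scaleN1r ipZl mulN1r. Qed.
Lemma ipBl y A B C : ip y (A - B) C = ip y A C - ip y B C.
Proof. by rewrite ipDl ipNl. Qed.
Lemma ipNr y A C : U y -> ip y C (- A) = - ip y C A.
Proof. by move=> Uy; rewrite !(ipC C)// ipNl. Qed.
Lemma ipBr y A B C : U y -> ip y C (A - B) = ip y C A - ip y C B.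
Proof. by move=> Uy; rewrite ipDr// ipNr. Qed.
Lemma ip_suml y (A : 'I_m -> E) C : ip y (\sum_i A i) C = \sum_i ip y (A i) C.
Proof.
elim/big_rec2: _ => [|i a b _ <-]; first exact: ip0l.
by rewrite ipDl.
Qed.
Lemma ip_sumr y (A : 'I_m -> E) C : U y -> ip y C (\sum_i A i) = \sum_i ip y C (A i).
Proof.
by move=> Uy; rewrite ipC// ip_suml; apply: eq_bigr => i _; rewrite ipC.
Qed.

Lemma contract y (a : 'I_m -> R) r : U y ->
  \sum_j gi r j y * \sum_p a p * ip y (e p y) (e j y) = a r.
Proof.
move=> Uy; under eq_bigr do rewrite mulr_sumr.
rewrite exchange_big /= (bigD1 r)//= [X in _ + X]big1 ?addr0 => [|p pr].
  transitivity (a r * \sum_k gi r k y * ip y (e k y) (e r y)).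
    rewrite mulr_sumr; apply: eq_bigr => j _.
    by rewrite mulrCA (ipC (e r y)).
  by rewrite gi_inv// eqxx mulr1.
transitivity (a p * \sum_k gi r k y * ip y (e k y) (e p y)).
  rewrite mulr_sumr; apply: eq_bigr => j _.
  by rewrite mulrCA (ipC (e p y)).
by rewrite gi_inv// eq_sym (negPf pr) mulr0.
Qed.

Lemma contract' y (a : 'I_m -> R) r : U y ->
  \sum_p (\sum_q gi p q y * a q) * ip y (e p y) (e r y) = a r.
Proof.
move=> Uy; under eq_bigr do rewrite mulr_suml.
rewrite exchange_big /= (bigD1 r)//= [X in _ + X]big1 ?addr0 => [|q qr].
  transitivity (a r * \sum_k gi r k y * ip y (e k y) (e r y)).
    rewrite mulr_sumr; apply: eq_bigr => j _.
    by rewrite (giC j r)//; ring.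
  by rewrite gi_inv// eqxx mulr1.
transitivity (a q * \sum_k gi q k y * ip y (e k y) (e r y)).
  rewrite mulr_sumr; apply: eq_bigr => j _.
  by rewrite (giC j q)//; ring.
by rewrite gi_inv// (negPf qr) mulr0.
Qed.

Lemma S_xi k : S (xi k).
Proof. by apply: S_sum => q; apply: S_M => //; exact: S_ip. Qed.

Lemma VF_NN : VF NN.
Proof. by apply: VF_B => //; apply: VF_sum => k; apply: VF_Z => //; exact: S_xi. Qed.

Lemma VF_nD i : VF (nD i). Proof. exact/VF_cov/VF_NN. Qed.

Lemma S_bm i p : S (bm i p).
Proof.
apply: S_N; apply: S_sum => q; apply: S_M => //; apply: S_ip => //; exact: VF_nD.
Qed.

Lemma VF_nperp i : VF (nperp i).
Proof.
apply: VF_D; first exact: VF_nD.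
by apply: VF_sum => p; apply: VF_Z => //; exact: S_bm.
Qed.

Lemma S_ww : S ww. Proof. by apply: S_ip; exact: VF_NN. Qed.

Lemma S_half f : S f -> S (fun y => 2^-1 * f y).
Proof. by move=> Sf; apply: S_M => //; exact: S_cst. Qed.

Lemma S_YY j : S (YY j).
Proof. by apply: S_sum => q; apply: S_M => //; apply/S_half/S_dd/S_ww. Qed.

Lemma NN_normal j y : U y -> ip y (NN y) (e j y) = 0.
Proof.
move=> Uy; rewrite /NN ipBl ip_suml; apply/eqP; rewrite subr_eq0; apply/eqP.
rewrite -[LHS](contract' (fun q => ip y (X y) (e q y)) j Uy).
by apply: eq_bigr => k _; rewrite ipZl.
Qed.

Lemma normal_D (A : T -> E) i j y : U y -> VF A ->
  (forall z, U z -> ip z (A z) (e j z) = 0) ->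
  ip y (D i A y) (e j y) = - ip y (A y) (D i (e j) y).
Proof.
move=> Uy VA A0; apply/eqP; rewrite -addr_eq0 -dd_ip//.
by rewrite (dd_ext i Uy A0) dd_cst.
Qed.

Lemma nD_e i j y : U y -> ip y (nD i y) (e j y) = - ip y (NN y) (D i (e j) y).
Proof.
by move=> Uy; rewrite normal_D// => [|z Uz]; [exact: VF_NN|exact: NN_normal].
Qed.

Lemma nDE i y : U y -> nD i y = h1 y *: e i y -
  \sum_p (dd i (xi p) y *: e p y + xi p y *: D i (e p) y).
Proof.
move=> Uy; rewrite /nD /NN D_sub//; last first.
  by apply: VF_sum => k; apply: VF_Z => //; exact: S_xi.
rewrite D_X// D_sum//; last by move=> k; apply: VF_Z => //; exact: S_xi.
by congr (_ - _); apply: eq_bigr => p _; rewrite D_Z//; exact: S_xi.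
Qed.

Lemma dd_ww i y : U y -> 2^-1 * dd i ww y = ip y (nD i y) (NN y).
Proof.
move=> Uy; rewrite dd_ip//; [|exact: VF_NN|exact: VF_NN].
by rewrite (ipC (NN y))// -/(nD i); field.
Qed.

(** Pairing [nDE] with N leaves - sum_p xi_p <D_i e_p, N>. Because the connection has no torsion,
    this is the pairing of D_p N with e_i: the shape operator is symmetric. *)
Lemma half_ww i y : U y -> 2^-1 * dd i ww y = \sum_p xi p y * ip y (nD p y) (e i y).
Proof.
move=> Uy; rewrite dd_ww// nDE// ipBl ipZl ip_suml.
rewrite (ipC (e i y))// NN_normal// mulr0 sub0r -sumrN; apply: eq_bigr => p _.
rewrite ipDl !ipZl (ipC (e p y))// NN_normal// mulr0 add0r torsion//.
by rewrite nD_e// (ipC (NN y))// mulrN.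
Qed.

(** The derivative of N along X^T. By [half_ww] its tangential part is [YY], half the gradient of
    |N|^2, and [Pf] is what remains. *)
Definition Vf y := \sum_k xi k y *: nD k y.
Definition Pf y := Vf y - \sum_k YY k y *: e k y.

Lemma VF_Vf : VF Vf.
Proof. by apply: VF_sum => k; apply: VF_Z; [exact: S_xi|exact: VF_nD]. Qed.

Lemma VF_Pf : VF Pf.
Proof.
apply: VF_B; first exact: VF_Vf.
by apply: VF_sum => k; apply: VF_Z => //; exact: S_YY.
Qed.

Lemma Pf_normal j y : U y -> ip y (Pf y) (e j y) = 0.
Proof.
move=> Uy; rewrite /Pf ipBl !ip_suml; apply/eqP; rewrite subr_eq0; apply/eqP.
transitivity (2^-1 * dd j ww y).
  by rewrite half_ww//; apply: eq_bigr => p _; rewrite ipZl.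
rewrite -[LHS](contract' (fun q => 2^-1 * dd q ww y) j Uy).
by apply: eq_bigr => k _; rewrite ipZl.
Qed.

(** The Christoffel symbol of the induced metric with upper index i and lower indices k, p. *)
Definition Gm k p i y := \sum_j gi i j y * ip y (D k (e p) y) (e j y).
Definition tr (B : 'I_m -> 'I_m -> R) y := \sum_i \sum_j gi i j y * B i j.

Lemma trD A B y : tr (fun i j => A i j + B i j) y = tr A y + tr B y.
Proof.
rewrite /tr -big_split; apply: eq_bigr => i _; rewrite -big_split.
by apply: eq_bigr => j _; rewrite mulrDr.
Qed.

Lemma trN A y : tr (fun i j => - A i j) y = - tr A y.
Proof.
rewrite /tr -sumrN; apply: eq_bigr => i _; rewrite -sumrN.
by apply: eq_bigr => j _; rewrite mulrN.
Qed.

Lemma trZ A a y : tr (fun i j => a * A i j) y = a * tr A y.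
Proof.
rewrite /tr mulr_sumr; apply: eq_bigr => i _; rewrite mulr_sumr.
by apply: eq_bigr => j _; rewrite mulrCA.
Qed.

Lemma tr_sum (A : 'I_m -> 'I_m -> 'I_m -> R) y :
  tr (fun i j => \sum_k A k i j) y = \sum_k tr (A k) y.
Proof.
rewrite /tr [RHS]exchange_big; apply: eq_bigr => i _ /=.
rewrite [RHS]exchange_big; apply: eq_bigr => j _ /=.
by rewrite mulr_sumr.
Qed.

Lemma eq_tr A B y : (forall i j, A i j = B i j) -> tr A y = tr B y.
Proof. by move=> AB; apply: eq_bigr => i _; apply: eq_bigr => j _; rewrite AB. Qed.

Lemma tr_e (a : 'I_m -> 'I_m -> R) y : U y ->
  tr (fun i j => \sum_p a i p * ip y (e p y) (e j y)) y = \sum_i a i i.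
Proof. by move=> Uy; apply: eq_bigr => i _; exact: contract. Qed.

(** First evaluation of the trace. The tangential part of [Vf] contributes the divergence of [YY].
    For the normal part [Pf] the derivative is moved onto e_j, where the trace is the mean curvature
    and [mean] applies; moreover <Pf, N> = <Vf, N>. *)
Lemma tr_Vf y : U y -> tr (fun i j => ip y (D i Vf y) (e j y)) y =
  \sum_i dd i (YY i) y + \sum_k YY k y * \sum_i Gm i k i y
   - c * \sum_k xi k y * (2^-1 * dd k ww y).
Proof.
move=> Uy.
have VYe k : VF (fun y => YY k y *: e k y) by apply: VF_Z => //; exact: S_YY.
have H i j : ip y (D i Vf y) (e j y) =
    \sum_k dd i (YY k) y * ip y (e k y) (e j y)
    + \sum_k YY k y * ip y (D i (e k) y) (e j y) + - ip y (Pf y) (D i (e j) y).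
  rewrite -(normal_D i Uy VF_Pf (@Pf_normal j)) /Pf.
  rewrite D_sub//; [|exact: VF_Vf|exact: VF_sum].
  rewrite (D_sum _ Uy VYe) ipBl ip_suml -big_split /= addrCA -[LHS]addr0.
  congr (_ + _); apply/esym/eqP; rewrite subr_eq0; apply/eqP.
  by apply: eq_bigr => k _; rewrite D_Z ?ipDl ?ipZl//; exact: S_YY.
rewrite (eq_tr _ H) !trD trN tr_e//; congr (_ + _ - _).
  by rewrite tr_sum; apply: eq_bigr => k _; rewrite trZ.
rewrite /tr mean//; last by move=> j; exact: Pf_normal.
rewrite /Pf ipBl !ip_suml [X in _ - X]big1 ?subr0 => [|k _].
  by congr (_ * _); apply: eq_bigr => k _; rewrite ipZl dd_ww.
by rewrite ipZl (ipC (e k y))// NN_normal// mulr0.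
Qed.

(** Second evaluation: the product rule on xi_k D_k N, followed by an exchange of D_i and D_k at the
    price of the curvature term [Rt]. *)
Lemma tr_Vf' y : U y -> tr (fun i j => ip y (D i Vf y) (e j y)) y =
  - (\sum_k \sum_i dd i (xi k) y * bm k i y)
  + \sum_k xi k y * tr (fun i j => ip y (D k (nD i) y) (e j y)) y + Rt y.
Proof.
move=> Uy.
have H i j : ip y (D i Vf y) (e j y) =
    \sum_k (dd i (xi k) y * ip y (nD k y) (e j y) +
     xi k y * (ip y (D k (nD i) y) (e j y) +
       ip y (D i (nD k) y - D k (nD i) y) (e j y))).
  rewrite /Vf D_sum//; last by move=> k; apply: VF_Z; [exact: S_xi|exact: VF_nD].
  rewrite ip_suml; apply: eq_bigr => k _.
  rewrite D_Z//; [|exact: S_xi|exact: VF_nD].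
  by rewrite ipBl [LHS]ipDl !ipZl; ring.
rewrite (eq_tr _ H) tr_sum.
have H2 k : tr (fun i j => dd i (xi k) y * ip y (nD k y) (e j y) +
     xi k y * (ip y (D k (nD i) y) (e j y) +
       ip y (D i (nD k) y - D k (nD i) y) (e j y))) y =
    - (\sum_i dd i (xi k) y * bm k i y) +
    xi k y * tr (fun i j => ip y (D k (nD i) y) (e j y)) y +
    xi k y * tr (fun i j => ip y (D i (nD k) y - D k (nD i) y) (e j y)) y.
  rewrite trD trZ trD mulrDr addrA; congr (_ + _ + _).
  rewrite /tr -sumrN; apply: eq_bigr => i _.
  rewrite /bm mulrN opprK mulr_sumr; apply: eq_bigr => j _; exact: mulrCA.
by rewrite (eq_bigr _ (fun k _ => H2 k)) !big_split /= sumrN.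
Qed.

Lemma nperp_normal i j y : U y -> ip y (nperp i y) (e j y) = 0.
Proof.
move=> Uy; rewrite /nperp ipDl ip_suml; apply/eqP; rewrite addr_eq0 -sumrN; apply/eqP.
rewrite -[LHS](contract' (fun q => ip y (nD i y) (e q y)) j Uy).
by apply: eq_bigr => k _; rewrite ipZl /bm mulNr opprK.
Qed.

Lemma tr_bm y : U y -> \sum_i bm i i y = c * ww y.
Proof.
move=> Uy; rewrite -mean//; last by move=> j; exact: NN_normal.
rewrite /bm; apply: eq_bigr => i _; rewrite -sumrN; apply: eq_bigr => q _.
by rewrite nD_e// mulrN opprK.
Qed.

(** Substitute D_i N = nperp_i - sum_p bm_ip e_p. The trace of the shape operator is c |N|^2 by
    [tr_bm], which accounts for the first term; as nperp_i is normal, its derivative is moved onto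
    e_j. *)
Lemma tr_DnD k y : U y -> tr (fun i j => ip y (D k (nD i) y) (e j y)) y =
  - (c * dd k ww y) - \sum_i \sum_p bm i p y * Gm k p i y
  - tr (fun i j => ip y (nperp i y) (D k (e j) y)) y.
Proof.
move=> Uy.
have H i j : ip y (D k (nD i) y) (e j y) =
    - (\sum_p dd k (bm i p) y * ip y (e p y) (e j y)) +
    - (\sum_p bm i p y * ip y (D k (e p) y) (e j y)) +
    - ip y (nperp i y) (D k (e j) y).
  rewrite -(normal_D k Uy (VF_nperp i) (@nperp_normal i j)) /nperp.
  have VS : VF (fun y => \sum_p bm i p y *: e p y).
    by apply: VF_sum => p; apply: VF_Z => //; exact: S_bm.
  rewrite D_add//; last exact: VF_nD.
  rewrite D_sum//; last by move=> p; apply: VF_Z => //; exact: S_bm.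
  have -> : \sum_j0 D k (fun y0 => bm i j0 y0 *: e j0 y0) y =
     \sum_p (dd k (bm i p) y *: e p y) + \sum_p (bm i p y *: D k (e p) y).
    by rewrite -big_split; apply: eq_bigr => p _; rewrite D_Z//; exact: S_bm.
  rewrite !ipDl !ip_suml.
  under [X in _ = - X + _ + _]eq_bigr do rewrite -ipZl.
  under [X in _ = _ + - X + _]eq_bigr do rewrite -ipZl.
  by ring.
rewrite (eq_tr _ H) !trD !trN tr_e//; congr (- _ - _ - _).
  rewrite -dd_Ml//; last exact: S_ww.
  rewrite -dd_sum//; last by move=> i; exact: S_bm.
  by apply: dd_ext => // z Uz; exact: tr_bm.
rewrite /tr; apply: eq_bigr => i _; rewrite /Gm.
under eq_bigr do rewrite mulr_sumr.
rewrite exchange_big; apply: eq_bigr => p _ /=; rewrite mulr_sumr.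
by apply: eq_bigr => j _; rewrite mulrCA.
Qed.

(** The tangential part of D_i X = h' e_i: the covariant derivative of X^T is h' times the identity
    plus the shape operator of N. *)
Lemma dd_xi i r y : U y -> dd i (xi r) y =
  (i == r)%:R * h1 y + bm i r y - \sum_p xi p y * Gm i p r y.
Proof.
move=> Uy.
have H : bm i r y = - ((i == r)%:R * h1 y) + dd i (xi r) y + \sum_p xi p y * Gm i p r y.
  have Hq q : gi r q y * ip y (nD i y) (e q y) = h1 y * (gi r q y * ip y (e q y) (e i y)) -
      gi r q y * (\sum_p dd i (xi p) y * ip y (e p y) (e q y)) -
      \sum_p xi p y * (gi r q y * ip y (D i (e p) y) (e q y)).
    rewrite nDE// ipBl ipZl ip_suml (ipC (e i y))//.
    have -> : \sum_p ip y (dd i (xi p) y *: e p y + xi p y *: D i (e p) y) (e q y) =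
        (\sum_p dd i (xi p) y * ip y (e p y) (e q y)) +
        (\sum_p xi p y * ip y (D i (e p) y) (e q y)).
      by rewrite -big_split; apply: eq_bigr => p _; rewrite ipDl !ipZl.
    have -> : \sum_p xi p y * (gi r q y * ip y (D i (e p) y) (e q y)) =
       gi r q y * (\sum_p xi p y * ip y (D i (e p) y) (e q y)).
      by rewrite mulr_sumr; apply: eq_bigr => p _; rewrite mulrCA.
    by ring.
  rewrite /bm (eq_bigr _ (fun q _ => Hq q)) !sumrB -mulr_sumr gi_inv//.
  rewrite contract// [X in _ - X]exchange_big /= (eq_sym r i).
  under [X in _ - _ - X]eq_bigr do rewrite -mulr_sumr.
  by rewrite !opprB addrA; rewrite /Gm; ring.
by rewrite H; ring.
Qed.

(** The normal part of D_j X = h' e_j: the normal derivative of N along e_j is - II(e_j, X^T). This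
    is what produces the square of the normal derivative. *)
Lemma nperp_D y : U y ->
  \sum_k xi k y * tr (fun i j => ip y (nperp i y) (D k (e j) y)) y =
  - tr (fun i j => ip y (nperp i y) (nperp j y)) y.
Proof.
move=> Uy; under eq_bigr do rewrite -trZ.
rewrite -tr_sum -trN; apply: eq_tr => i j.
have -> : nperp j y = h1 y *: e j y - \sum_k dd j (xi k) y *: e k y
    - \sum_k xi k y *: D k (e j) y + \sum_p bm j p y *: e p y.
  rewrite /nperp nDE// big_split /= opprD addrA; congr (_ - _ + _).
  by apply: eq_bigr => p _; rewrite torsion.
rewrite ipDr// ipBr// ipBr// ipZr// !ip_sumr// nperp_normal// mulr0.
rewrite [X in 0 - X]big1 ?subr0 ?sub0r => [|k _]; last first.
  by rewrite ipZr// nperp_normal// mulr0.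
rewrite [X in - _ + X]big1 ?addr0 ?opprK => [|k _]; last first.
  by rewrite ipZr// nperp_normal// mulr0.
by apply: eq_bigr => k _; rewrite ipZr.
Qed.

(** The two evaluations are equated. The Christoffel terms coming from [tr_DnD] and from [dd_xi]
    cancel, and the first-order term in |N|^2 occurs with factor 2 c on one side and c on the other,
    which leaves the single drift term. *)
Theorem abstract_identity y : U y ->
  \sum_i dd i (YY i) y + \sum_k YY k y * \sum_i Gm i k i y =
  tr (fun i j => ip y (nperp i y) (nperp j y)) y - c * h1 y * ww y
  - \sum_i \sum_p bm i p y * bm p i y - c * \sum_k xi k y * (2^-1 * dd k ww y) + Rt y.
Proof.
move=> Uy; have := tr_Vf Uy; rewrite tr_Vf'//.
have -> : \sum_k xi k y * tr (fun i j => ip y (D k (nD i) y) (e j y)) y =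
   - (2 * (c * \sum_k xi k y * (2^-1 * dd k ww y)))
   - \sum_k xi k y * (\sum_i \sum_p bm i p y * Gm k p i y) +
   tr (fun i j => ip y (nperp i y) (nperp j y)) y.
  rewrite -[X in _ = _ + X]opprK -nperp_D// !mulr_sumr -!sumrN -!big_split.
  by apply: eq_bigr => k _ /=; rewrite tr_DnD//; field.
have -> : \sum_k \sum_i dd i (xi k) y * bm k i y = c * h1 y * ww y +
    \sum_i \sum_p bm i p y * bm p i y -
    \sum_k xi k y * (\sum_i \sum_p bm i p y * Gm k p i y).
  under eq_bigr => k _ do under eq_bigr => i _ do rewrite dd_xi// mulrBl mulrDl.
  under eq_bigr => k _ do rewrite sumrB big_split/=.
  rewrite sumrB big_split/=; congr (_ + _ - _).
  - rewrite mulrAC -tr_bm// mulr_suml; apply: eq_bigr => k _.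
    rewrite (bigD1 k)//= eqxx mul1r big1 ?addr0 1?mulrC// => i ik.
    by rewrite (negPf ik) !mul0r.
  - by rewrite exchange_big.
  - under eq_bigr => k _ do under eq_bigr => i _ do rewrite mulr_suml.
    under [RHS]eq_bigr => k _ do rewrite mulr_sumr.
    under eq_bigr => k _ do rewrite exchange_big /=.
    rewrite [LHS]exchange_big /=; apply: eq_bigr => p _.
    apply: eq_bigr => k _; rewrite mulr_sumr; apply: eq_bigr => i _.
    rewrite -mulrA; congr (_ * _); rewrite mulrC /Gm; congr (_ * _).
    by apply: eq_bigr => j _; rewrite torsion.
by move=> H; have {H} := esym H; move/(canRL (subrK _)) => ->; ring.
Qed.

End AbstractIdentity.

(** * Warped products *)

Section Sectional.
Context {R : realType} {d : nat} (G : 'rV[R]_d -> 'M[R]_d) (z : 'rV[R]_d).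
Implicit Types u v w : 'rV[R]_d.
Local Notation rt := (riemann_tensor G z).

(** Hides the coefficients: trilinearity and skew-symmetry in the first two slots follow from this
    form alone. *)
Lemma riemann_tensorE : exists2 K : 'I_d -> 'I_d -> 'I_d -> 'rV[R]_d,
  forall i j k, K i j k = - K j i k &
  forall u v w, rt u v w = \sum_i \sum_j \sum_k (u 0 i * v 0 j * w 0 k) *: K i j k.
Proof.
exists (fun i j k => cov G id i (cov G id j (fun=> delta_mx 0 k)) z
  - cov G id j (cov G id i (fun=> delta_mx 0 k)) z) => // i j k.
by rewrite opprB.
Qed.

Lemma riemann_suml (m : nat) (c : 'I_m -> R) (u : 'I_m -> 'rV[R]_d) v w :
  rt (\sum_a c a *: u a) v w = \sum_a c a *: rt (u a) v w.
Proof.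
have [K _ E] := riemann_tensorE.
under [RHS]eq_bigr do rewrite E scaler_sumr.
rewrite E [RHS]exchange_big; apply: eq_bigr => i _ /=.
under [RHS]eq_bigr do rewrite scaler_sumr.
rewrite [RHS]exchange_big; apply: eq_bigr => j _ /=.
under [RHS]eq_bigr do rewrite scaler_sumr.
rewrite [RHS]exchange_big; apply: eq_bigr => k _ /=.
rewrite summxE !mulr_suml scaler_suml; apply: eq_bigr => a _.
by rewrite scalerA mxE !mulrA.
Qed.

Lemma riemannN u v w : rt u v w = - rt v u w.
Proof.
have [K KN E] := riemann_tensorE.
rewrite !E [in RHS]exchange_big -sumrN; apply: eq_bigr => i _ /=.
rewrite -sumrN; apply: eq_bigr => j _; rewrite -sumrN; apply: eq_bigr => k _.
by rewrite -scalerN -KN [u _ _ * _]mulrC.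
Qed.

Lemma riemann_sumr (m : nat) (c : 'I_m -> R) (u : 'I_m -> 'rV[R]_d) v w :
  rt v (\sum_a c a *: u a) w = \sum_a c a *: rt v (u a) w.
Proof.
rewrite riemannN riemann_suml -sumrN; apply: eq_bigr => a _.
by rewrite -scalerN -riemannN.
Qed.

Lemma riemannZl a u v w : rt (a *: u) v w = a *: rt u v w.
Proof.
have := riemann_suml (fun=> a : R) (fun=> u : 'rV[R]_d) v w (m := 1).
by rewrite !big_ord1.
Qed.

Lemma riemannZr a u v w : rt u v (a *: w) = a *: rt u v w.
Proof.
have [K _ E] := riemann_tensorE.
rewrite !E scaler_sumr; apply: eq_bigr => i _.
rewrite scaler_sumr; apply: eq_bigr => j _.
rewrite scaler_sumr; apply: eq_bigr => k _.
by rewrite scalerA mxE mulrCA.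
Qed.

Lemma riemann0r u v : rt u v 0 = 0.
Proof. by have := riemannZr 0 u v 0; rewrite !scale0r. Qed.

Lemma riemann_diag v w : rt v v w = 0.
Proof.
have /eqP := riemannN v v w; rewrite -addr_eq0 -mulr2n -scaler_nat scaler_eq0.
by rewrite pnatr_eq0 => /eqP.
Qed.

(** The curvature hypothesis concerns independent pairs. If the Gram determinant [De] vanishes and v
    is nonzero, then w has squared norm <v, v> De = 0, so u is a multiple of v and both sides
    vanish. Otherwise u and v are independent, by Cramer's rule for the Gram matrix. *)
Lemma sectional_form kappa : posdef (G z) ->
  (forall u v, row_free (col_mx u v) -> sectional_curvature G z u v = kappa) ->
  forall u v, gdot (G z) (rt u v v) u =
    kappa * (gdot (G z) u u * gdot (G z) v v - gdot (G z) u v ^+ 2).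
Proof.
move=> GP H u v.
set De := _ - _; have [D0|D0] := eqVneq De 0.
  have [->|v0] := eqVneq v 0.
    by rewrite riemann0r gdot0l D0 mulr0.
  pose w := gdot (G z) v v *: u - gdot (G z) u v *: v.
  have w0 : w = 0.
    apply/eqP; apply: contraTT isT => /(GP.2); rewrite /w gdotBl !gdotBr !gdotZl !gdotZr.
    rewrite (gdotC v u GP.1).
    have -> (a b c : R) : c * (c * a) - c * (b * b) - (b * (c * b) - b * (b * c)) =
       c * (a * c - b ^+ 2) by ring.
    by rewrite -/De D0 mulr0 ltxx.
  have vv := GP.2 v v0.
  have -> : u = (gdot (G z) u v / gdot (G z) v v) *: v.
    apply: (scalerI (lt0r_neq0 vv)).
    by rewrite scalerA mulrCA divff ?gt_eqF// mulr1; apply/eqP; rewrite -subr_eq0 -/w w0.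
  by rewrite riemannZl riemann_diag scaler0 gdot0l D0 mulr0.
have rf : row_free (col_mx u v).
  rewrite -kermx_eq0; apply/eqP/row_matrixP => i; rewrite row0.
  set c := row i _.
  have : c *m col_mx u v = 0 by rewrite /c -row_mul mulmx_ker row0.
  rewrite -[c]hsubmxK mul_row_col [lsubmx c]mx11_scalar [rsubmx c]mx11_scalar !mul_scalar_mx.
  set a := lsubmx c 0 0; set b := rsubmx c 0 0 => E.
  have Eu : a * gdot (G z) u u + b * gdot (G z) u v = 0.
    by rewrite (gdotC u v GP.1) -!gdotZl -gdotDl E gdot0l.
  have Ev : a * gdot (G z) u v + b * gdot (G z) v v = 0.
    by rewrite -!gdotZl -gdotDl E gdot0l.
  have a0 : a = 0.
    apply: (mulIf D0); rewrite mul0r /De.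
    transitivity (gdot (G z) v v * (a * gdot (G z) u u + b * gdot (G z) u v) -
      gdot (G z) u v * (a * gdot (G z) u v + b * gdot (G z) v v)); first by ring.
    by rewrite Eu Ev !mulr0 subrr.
  have b0 : b = 0.
    apply: (mulIf D0); rewrite mul0r /De.
    transitivity (gdot (G z) u u * (a * gdot (G z) u v + b * gdot (G z) v v) -
      gdot (G z) u v * (a * gdot (G z) u u + b * gdot (G z) u v)); first by ring.
    by rewrite Eu Ev !mulr0 subrr.
  by rewrite a0 b0 -scalemx1 scale0r row_mx0.
by rewrite -(H u v rf) /sectional_curvature divfK.
Qed.

(** A trace against B^T B is a sum of values of a quadratic form at the combinations sum_i B a i
    f_i, so the diagonal information of [sectional_form] suffices. *)
Lemma sectional_trace kappa m (B : 'M[R]_m) (f : 'I_m -> 'rV[R]_d) v : posdef (G z) ->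
  (forall u v, row_free (col_mx u v) -> sectional_curvature G z u v = kappa) ->
  \sum_i \sum_j (B^T *m B) i j * gdot (G z) (rt (f i) v v) (f j) =
  kappa * \sum_i \sum_j (B^T *m B) i j * (gdot (G z) (f i) (f j) * gdot (G z) v v -
     gdot (G z) (f i) v * gdot (G z) (f j) v).
Proof.
move=> GP H; have Q := sectional_form GP H.
have expand (q : 'rV[R]_d -> 'rV[R]_d -> R) :
    (forall c w, q (\sum_a c a *: f a) w = \sum_a c a * q (f a) w) ->
    (forall c w, q w (\sum_a c a *: f a) = \sum_a c a * q w (f a)) ->
    \sum_i \sum_j (B^T *m B) i j * q (f i) (f j) =
    \sum_a q (\sum_i B a i *: f i) (\sum_i B a i *: f i).
  move=> ql qr; under eq_bigr => i _ do under eq_bigr => j _ do rewrite mxE mulr_suml.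
  under eq_bigr => i _ do rewrite exchange_big /=.
  rewrite exchange_big; apply: eq_bigr => a _ /=; rewrite ql; apply: eq_bigr => i _.
  rewrite qr mulr_sumr; apply: eq_bigr => j _.
  by rewrite mxE mulrA.
rewrite (expand (fun u w => gdot (G z) (rt u v v) w)); first last.
- by move=> c w; rewrite gdot_sumr; apply: eq_bigr => a _; rewrite gdotZr.
- by move=> c w; rewrite riemann_suml gdot_suml; apply: eq_bigr => a _; rewrite gdotZl.
rewrite (expand (fun u w => gdot (G z) u w * gdot (G z) v v - gdot (G z) u v * gdot (G z) w v)).
- by rewrite mulr_sumr; apply: eq_bigr => a _; rewrite Q expr2.
- move=> c w; rewrite !gdot_suml !mulr_suml -sumrB; apply: eq_bigr => a _.
  by rewrite !gdotZl; ring.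
- move=> c w; rewrite gdot_sumr gdot_suml mulr_suml mulr_sumr -sumrB.
  by apply: eq_bigr => a _; rewrite gdotZl gdotZr; ring.
Qed.

End Sectional.

Lemma smooth_coordinate (R : realType) d (V : set 'rV[R]_d) l :
  smooth V (fun z => z 0 l).
Proof.
move=> k; apply: (@Ck_sub _ _ _ setT) => //.
exact (vsmooth_id openT l k).
Qed.

Lemma pd_coordinate (R : realType) d (z : 'rV[R]_d) l k :
  pd l (fun z => z 0 k) z = (l == k)%:R.
Proof.
have := @pd_rVE R d d setT id l z k (vsmooth_id openT) I.
rewrite [pd l id z]derive_id => <-.
by rewrite mxE eqxx eq_sym.
Qed.

Lemma smooth_funS (R : realType) (I : set R) (h : R -> R) :
  smooth_fun_on I h -> smooth_fun_on I (derive1 h).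
Proof. by move=> sh k t It; rewrite -derive1Sn; exact: sh. Qed.

Lemma smooth_comp1 (R : realType) m (I : set R) (U : set 'rV[R]_m) (h : R -> R) f :
  open U -> smooth_fun_on I h -> (forall y, U y -> I (f y)) ->
  smooth U f -> smooth U (fun y => h (f y)).
Proof. by move=> oU sh fI sf k; exact: (Ck_comp1 oU (fun j t _ => sh j t) fI (sf k)). Qed.

Lemma pd_gdot (R : realType) (p q : nat) (V : set 'rV[R]_p) (G : 'rV[R]_p -> 'M[R]_q)
    l x (a b : 'rV[R]_q) :
  open V -> (forall i j, smooth V (fun z => G z i j)) -> V x ->
  is_derive x (delta_mx 0 l) (fun z => gdot (G z) a b) (gdot (pd l G x) a b).
Proof.
move=> oV sG Vx.
have sT i j : smooth V (fun z => a 0 i * G z i j * b 0 j).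
  apply: smoothM => //; last exact: smooth_cst.
  by apply: smoothM => //; exact: smooth_cst.
have sS i : smooth V (fun z => \sum_j a 0 i * G z i j * b 0 j).
  exact: smooth_sum.
under eq_fun do rewrite gdotE.
apply: is_derive_eq.
  apply: pd_derivable; apply: (smooth_der _ Vx); apply: smooth_sum => // i _; exact: sS.
rewrite pd_sum; last by move=> i _; exact: smooth_der (sS i) Vx.
rewrite gdotE; apply: eq_bigr => i _.
rewrite pd_sum; last by move=> j _; exact: smooth_der (sT i j) Vx.
apply: eq_bigr => j _.
have dG : derivable (fun z => G z i j) x (delta_mx 0 l) := smooth_der (sG i j) Vx.
have dG' : derivable (fun z => a 0 i * G z i j) x (delta_mx 0 l).
  exact (derivableM (derivable_cst _ _ _) dG).
rewrite (pdM (g := fun=> b 0 j) dG' (derivable_cst _ _ _)).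
rewrite (pdM (f := fun=> a 0 i) (derivable_cst _ _ _) dG).
rewrite !pd_cst mul0r add0r mulr0 addr0; congr (_ * _ * _).
by apply/esym; apply: pd_mxE => c e; exact: smooth_der (sG c e) Vx.
Qed.

Section Warped.
Context {R : realType} {n : nat} (I : set R) (h : R -> R).
Variables (V0 : set 'rV[R]_n) (g0 : 'rV[R]_n -> 'M[R]_n).
Hypotheses (oI : open I) (sh : smooth_fun_on I h) (h_pos : forall t, I t -> 0 < h t).
Hypotheses (oV0 : open V0) (sg0 : forall a b, smooth V0 (fun z => g0 z a b))
  (g0P : forall z, V0 z -> posdef (g0 z)).
Implicit Types u v w z : 'rV[R]_(1 + n).

Definition wm z : 'M[R]_(1 + n) :=
  block_mx 1%:M 0 0 (h (lsubmx z 0 0) ^+ 2 *: g0 (rsubmx z)).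
Definition Vw : set 'rV[R]_(1 + n) := [set z | I (lsubmx z 0 0) /\ V0 (rsubmx z)].

Lemma lsub00 z : lsubmx z 0 0 = z 0 (lshift n 0). Proof. by rewrite mxE. Qed.
Lemma rsub0 z k : rsubmx z 0 k = z 0 (rshift 1 k). Proof. by rewrite mxE. Qed.

Lemma open_Vw : open Vw.
Proof.
have -> : Vw = [set z : 'rV[R]_(1 + n) | I (z 0 (lshift n 0))] `&`
    [set z : 'rV[R]_(1 + n) | V0 (rsubmx z)].
  by apply/seteqP; split => z; rewrite /Vw /= lsub00.
apply: openI.
  by apply: open_comp => // z _; exact: coord_continuous.
apply: open_comp => // z _; apply: continuous_coords => l.
have -> : (fun x : 'rV[R]_(1 + n) => rsubmx x 0 l) = (fun x => x 0 (rshift 1 l)).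
  by apply/funext => x; rewrite mxE.
exact: coord_continuous.
Qed.

Lemma gdot_wm z u v : gdot (wm z) u v = lsubmx u 0 0 * lsubmx v 0 0 +
  h (lsubmx z 0 0) ^+ 2 * gdot (g0 (rsubmx z)) (rsubmx u) (rsubmx v).
Proof.
rewrite /gdot -[u in LHS]hsubmxK -[v in LHS]hsubmxK /wm mul_row_block tr_row_mx.
rewrite mul_row_col !mulmx0 mulmx1 addr0 add0r mxE; congr (_ + _).
  by rewrite [lsubmx u]mx11_scalar mul_scalar_mx !mxE eqxx mulr1n.
by rewrite -scalemxAr -scalemxAl mxE.
Qed.

Lemma wm_posdef z : Vw z -> posdef (wm z).
Proof.
move=> [Iz Vz]; have [gT gP] := g0P Vz; split.
  by rewrite /wm tr_block_mx !trmx0 trmx1 linearZ/= gT.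
move=> v v0; rewrite gdot_wm -expr2.
have h2 : 0 < h (lsubmx z 0 0) ^+ 2 by rewrite exprn_gt0 ?h_pos.
have [l0|l0] := eqVneq (lsubmx v 0 0) 0.
  have r0 : rsubmx v != 0.
    apply: contra_neq v0 => r0; rewrite -[v]hsubmxK r0 [lsubmx v]mx11_scalar l0.
    by rewrite -scalemx1 scale0r row_mx0.
  by rewrite l0 expr0n add0r mulr_gt0// gP.
apply: ltr_pwDl; first by rewrite exprn_even_gt0.
by apply: mulr_ge0; [exact: ltW|exact: posdef_ge0 (g0P Vz)].
Qed.

Lemma smooth_h (k : R -> R) : smooth_fun_on I k ->
  smooth Vw (fun z => k (lsubmx z 0 0)).
Proof.
move=> sk; under eq_fun do rewrite lsub00.
apply: (smooth_comp1 open_Vw sk); last exact: smooth_coordinate.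
by move=> y []; rewrite lsub00.
Qed.

Lemma smooth_g0r a b : smooth Vw (fun z => g0 (rsubmx z) a b).
Proof.
move=> k; apply: (Ck_comp open_Vw oV0 _ _ (sg0 a b k)) => [y []//|l].
by under eq_fun do rewrite rsub0; exact: smooth_coordinate.
Qed.

Lemma smooth_wm a b : smooth Vw (fun z => wm z a b).
Proof.
have oV := open_Vw.
rewrite -(fintype.splitK a) -(fintype.splitK b); case: (fintype.split a) => a';
  case: (fintype.split b) => b' /=.
- by under eq_fun do rewrite /wm block_mxEul; exact: smooth_cst.
- by under eq_fun do rewrite /wm block_mxEur; exact: smooth_cst.
- by under eq_fun do rewrite /wm block_mxEdl; exact: smooth_cst.
under eq_fun do rewrite /wm block_mxEdr mxE expr2.
apply: smoothM => //; last exact: smooth_g0r.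
by apply: smoothM => //; exact: smooth_h.
Qed.

Lemma dmetric_wm z u v w : Vw z -> dmetric wm z u v w =
  2 * h (lsubmx z 0 0) * derive1 h (lsubmx z 0 0) * lsubmx u 0 0 *
    gdot (g0 (rsubmx z)) (rsubmx v) (rsubmx w) +
  h (lsubmx z 0 0) ^+ 2 * dmetric g0 (rsubmx z) (rsubmx u) (rsubmx v) (rsubmx w).
Proof.
move=> Vz; have [Iz V0z] := Vz; have oV := open_Vw.
set t := lsubmx z 0 0.
pose q0 x : R := gdot (g0 x) (rsubmx v) (rsubmx w).
have D l : gdot (pd l wm z) v w =
   2 * h t * derive1 h t * (l == lshift n 0)%:R * q0 (rsubmx z) +
   h t ^+ 2 * \sum_q (l == rshift 1 q)%:R * gdot (pd q g0 (rsubmx z)) (rsubmx v) (rsubmx w).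
  rewrite -(derive_val (is_derive := pd_gdot l v w oV smooth_wm Vz)).
  under eq_fun do rewrite gdot_wm.
  have sq0 : smooth V0 q0.
    rewrite /q0; under eq_fun do rewrite gdotE.
    apply: smooth_sum => // i _; apply: smooth_sum => // j _.
    apply: smoothM => //; last exact: smooth_cst.
    by apply: smoothM => //; exact: smooth_cst.
  have Dq : is_derive z (delta_mx 0 l) (fun z => q0 (rsubmx z))
     (\sum_q (l == rshift 1 q)%:R * gdot (pd q g0 (rsubmx z)) (rsubmx v) (rsubmx w)).
    have dr k : derivable (fun z : 'rV[R]_(1 + n) => rsubmx z 0 k) z (delta_mx 0 l).
      by under eq_fun do rewrite rsub0; exact: (smooth_der (@smooth_coordinate _ _ setT _)).
    have := pd_comp oV0 V0z (sq0 1%N) dr; move=> /is_derive_eq; apply.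
    apply: eq_bigr => k _; congr (_ * _).
      by under eq_fun do rewrite rsub0; exact: pd_coordinate.
    exact: (derive_val (is_derive := pd_gdot k _ _ oV0 sg0 V0z)).
  have Dh : is_derive z (delta_mx 0 l) (fun z => h (lsubmx z 0 0))
      (derive1 h t * (l == lshift n 0)%:R).
    have dl : derivable (fun z : 'rV[R]_(1 + n) => lsubmx z 0 0) z (delta_mx 0 l).
      by under eq_fun do rewrite lsub00; exact: (smooth_der (@smooth_coordinate _ _ setT _)).
    have := pd_comp1 (@sh 0%N _ Iz) dl; move=> /is_derive_eq; apply; congr (_ * _).
    by under eq_fun do rewrite lsub00; exact: pd_coordinate.
  have := is_deriveD (is_derive_cst (lsubmx v 0 0 * lsubmx w 0 0) z (delta_mx 0 l))
    (is_deriveM (is_deriveM Dh Dh) Dq).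
  move=> H; rewrite [LHS](derive_val (is_derive := H)) add0r.
  have -> : ((fun z => h (lsubmx z 0 0)) * (fun z => h (lsubmx z 0 0)) :
    'rV[R]_(1 + n) -> R) z = h t * h t by [].
  rewrite /GRing.scale /= -[h (lsubmx z 0 0)]/(h t) -[q0 (rsubmx z)]/(q0 _).
  move: (h t) (derive1 h t) (q0 _) (\sum_q _) => a b e f.
  by ring.
rewrite /dmetric; under eq_bigr do rewrite D.
rewrite big_split_ord /= big_ord1 eqxx; congr (_ + _).
  rewrite [X in _ + _ * X]big1 => [|q _]; last by rewrite eq_lrshift mul0r.
  have -> : u 0 (lshift n ord0) = lsubmx u 0 0 by rewrite mxE.
  rewrite -/(q0 (rsubmx z)); move: (h t) (derive1 h t) (q0 _) (lsubmx u 0 0) => a b e f.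
  by rewrite /= mulr1n; ring.
rewrite mulr_sumr; apply: eq_bigr => k _.
rewrite mulr0 mul0r add0r mulrCA; congr (_ * (_ * _)); first by rewrite mxE.
rewrite (bigD1 k)//= eqxx mul1r big1 ?addr0// => q qk.
by rewrite eq_rshift eq_sym (negPf qk) mul0r.
Qed.

(** O'Neill's formulas, verified by pairing with an arbitrary w: [gdot_gamma] describes the
    connections of the warped metric and of the fibre in lowered form. *)
Lemma gamma_wm z u v : Vw z -> gamma wm z u v =
  row_mx ((- (h (lsubmx z 0 0) * derive1 h (lsubmx z 0 0) *
       gdot (g0 (rsubmx z)) (rsubmx u) (rsubmx v)))%:M : 'rV_1)
   (gamma g0 (rsubmx z) (rsubmx u) (rsubmx v) +
    (derive1 h (lsubmx z 0 0) / h (lsubmx z 0 0)) *: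
      (lsubmx u 0 0 *: rsubmx v + lsubmx v 0 0 *: rsubmx u)).
Proof.
move=> Vz; have [Iz V0z] := Vz.
have h0 := lt0r_neq0 (h_pos Iz).
apply: (gdot_inj (wm_posdef Vz)) => w.
rewrite (gdot_gamma wm_posdef)// !dmetric_wm// gdot_wm.
rewrite row_mxKl row_mxKr gdotDl (gdot_gamma g0P)// gdotZl gdotDl !gdotZl.
rewrite !mxE eqxx mulr1n (gdotC (rsubmx v) (rsubmx w) (g0P V0z).1) 
  (gdotC (rsubmx u) (rsubmx w) (g0P V0z).1) (gdotC (rsubmx u) (rsubmx v) (g0P V0z).1).
rewrite !(gdotC (rsubmx w) _ (g0P V0z).1).
rewrite lsub00 in h0; move: (h _) (derive1 h _) h0 => a b a0.
by field.
Qed.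

Section Along.
Context {m : nat} (U : set 'rV[R]_m) (F : 'rV[R]_m -> 'rV[R]_(1 + n)).
Hypotheses (oU : open U) (sF : vsmooth U F) (UV : forall y, U y -> Vw (F y)).
Implicit Types (A : 'rV[R]_m -> 'rV[R]_(1 + n)) (y : 'rV[R]_m).

Definition tpart A y : R := lsubmx (A y) 0 0.
Definition fpart A y : 'rV[R]_n := rsubmx (A y).

Let t := tpart F.
Let f := fpart F.

(* the fibre component of A, normalized so that the warped metric becomes the
   product metric *)
Definition spart A y : 'rV[R]_n := h (t y) *: fpart A y.

Lemma smooth_tpart A : vsmooth U A -> smooth U (tpart A).
Proof. by move=> sA k; rewrite /tpart; under eq_fun do rewrite lsub00; exact: sA. Qed.

Lemma vsmooth_fpart A : vsmooth U A -> vsmooth U (fpart A).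
Proof. by move=> sA l k; rewrite /fpart; under eq_fun do rewrite rsub0; exact: sA. Qed.

Lemma It y : U y -> I (t y). Proof. by move=> /UV[]. Qed.
Lemma V0f y : U y -> V0 (f y). Proof. by move=> /UV[]. Qed.
Let sf : vsmooth U f. Proof. exact: vsmooth_fpart. Qed.
Let st : smooth U t. Proof. exact: smooth_tpart. Qed.

Lemma smooth_ht (k : R -> R) : smooth_fun_on I k -> smooth U (fun y => k (t y)).
Proof. by move=> sk; apply: (smooth_comp1 oU sk It st). Qed.

Lemma vsmooth_spart A : vsmooth U A -> vsmooth U (spart A).
Proof. by move=> sA; apply: vsmoothZ => //; [exact: smooth_ht|exact: vsmooth_fpart]. Qed.

Lemma pd_ht (k : R -> R) i y : smooth_fun_on I k -> U y ->
  pd i (fun y => k (t y)) y = derive1 k (t y) * pd i t y.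
Proof.
move=> sk Uy; have dt := smooth_der (i := i) st Uy.
exact: (derive_val (is_derive := pd_comp1 (@sk 0%N _ (It Uy)) dt)).
Qed.

Lemma tpart_pd A i y : vsmooth U A -> U y -> tpart (pd i A) y = pd i (tpart A) y.
Proof.
move=> sA Uy; rewrite /tpart lsub00 (pd_rVE i _ sA Uy).
by under [in RHS]eq_fun do rewrite lsub00.
Qed.

Lemma fpart_pd A i y : vsmooth U A -> U y -> fpart (pd i A) y = pd i (fpart A) y.
Proof.
move=> sA Uy; apply/rowP => l; rewrite (pd_rVE i l (vsmooth_fpart sA) Uy).
rewrite /fpart rsub0 (pd_rVE i _ sA Uy).
by under [in RHS]eq_fun do rewrite rsub0.
Qed.

Lemma gdot_parts A B y : gdot (wm (F y)) (A y) (B y) =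
  tpart A y * tpart B y + gdot (g0 (f y)) (spart A y) (spart B y).
Proof. by rewrite gdot_wm gdotZl gdotZr mulrA expr2. Qed.

Lemma tpart_cov A i y : vsmooth U A -> U y -> tpart (cov wm F i A) y =
  pd i (tpart A) y - derive1 h (t y) * gdot (g0 (f y)) (pd i f y) (spart A y).
Proof.
move=> sA Uy; rewrite -tpart_pd// /tpart /cov (gamma_wm _ _ (UV Uy)) linearD/= mxE.
rewrite row_mxKl; congr (_ + _); rewrite mxE eqxx mulr1n gdotZr.
have -> : rsubmx (pd i F y) = pd i f y := fpart_pd i sF Uy.
by rewrite -[h _]/(h (t y)) -[derive1 h _]/(derive1 h (t y)); ring.
Qed.

(** The factor h in [spart] is chosen for this formula: the derivative of h absorbs the term (h'/h)
    dt of the warped connection, and no quotient by h survives. *)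
Lemma spart_cov A i y : vsmooth U A -> U y -> spart (cov wm F i A) y =
  cov g0 f i (spart A) y + (derive1 h (t y) * tpart A y) *: pd i f y.
Proof.
move=> sA Uy; have sh' : smooth U (fun y => h (t y)) by exact: smooth_ht.
rewrite (covZ g0 f oU Uy i sh' (vsmooth_fpart sA)) pd_ht//.
rewrite /spart {1}/fpart /cov (gamma_wm _ _ (UV Uy)) linearD/= row_mxKr.
have -> : rsubmx (pd i A y) = pd i (fpart A) y := fpart_pd i sA Uy.
have -> : rsubmx (pd i F y) = pd i f y := fpart_pd i sF Uy.
have -> : lsubmx (pd i F y) 0 0 = pd i t y := tpart_pd i sF Uy.
rewrite -[rsubmx (F y)]/(f y) -[rsubmx (A y)]/(fpart A y) -[lsubmx (F y) 0 0]/(t y).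
rewrite -[lsubmx (A y) 0 0]/(tpart A y).
have h0 := lt0r_neq0 (h_pos (It Uy)).
move: (h (t y)) (derive1 h (t y)) h0 (gamma g0 _ _ _) => x x' x0 e.
move: (pd i (fpart A) y) (pd i f y) (pd i t y) (fpart A y) (tpart A y) => a b c p q.
rewrite !scalerDr !scalerA mulrCA divff// mulr1 -!addrA.
by rewrite [RHS]addrCA; congr (_ + _); rewrite addrCA; congr (_ + (_ + _)).
Qed.

Let h1 y := derive1 h (t y).
Let h2 y := derive1 (derive1 h) (t y).

(** The component formulas [tpart_cov] and [spart_cov] are iterated. What is symmetric in i and k
    cancels in the commutator, and there remain the curvature of the fibre, the terms with h'' and
    the terms with h'^2. *)
Lemma curvature_parts A i k y : vsmooth U A -> U y ->
  let C := cov wm F i (cov wm F k A) y - cov wm F k (cov wm F i A) y in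
  lsubmx C 0 0 = - (h2 y * (pd i t y * gdot (g0 (f y)) (pd k f y) (spart A y)
     - pd k t y * gdot (g0 (f y)) (pd i f y) (spart A y))) /\
  h (t y) *: rsubmx C = riemann_tensor g0 (f y) (pd i f y) (pd k f y) (spart A y)
    + (h2 y * tpart A y) *: (pd i t y *: pd k f y - pd k t y *: pd i f y)
    - (h1 y ^+ 2) *: (gdot (g0 (f y)) (pd k f y) (spart A y) *: pd i f y
         - gdot (g0 (f y)) (pd i f y) (spart A y) *: pd k f y).
Proof.
move=> sA Uy C.
have oV := open_Vw.
have UV0 := V0f.
have sh1 : smooth U h1 by apply: smooth_ht; exact: smooth_funS.
have sS := vsmooth_spart sA.
have sD j : vsmooth U (cov wm F j A).
  by apply: (vsmooth_cov oV smooth_wm wm_posdef) => //.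
have pdh1 j : pd j h1 y = h2 y * pd j t y by exact (pd_ht j (smooth_funS sh) Uy).
pose q j (z : 'rV[R]_m) := gdot (g0 (f z)) (pd j f z) (spart A z).
have sa := smooth_tpart sA.
have sfj j : vsmooth U (pd j f) by exact: vsmooth_pd.
have dq j l : is_derive y (delta_mx 0 l) (q j)
   (gdot (g0 (f y)) (cov g0 f l (pd j f) y) (spart A y) +
    gdot (g0 (f y)) (pd j f y) (cov g0 f l (spart A) y)).
  exact: (metric_compat oV0 sg0 g0P oU sf UV0 Uy).
have sq j : smooth U (q j).
  have H a b : smooth U (fun y => g0 (f y) a b).
    exact (smooth_compF oV0 oU sf UV0 (sg0 a b)).
  rewrite /q; under eq_fun do rewrite gdotE.
  apply: (smooth_sum oU) => a _; apply: (smooth_sum oU) => b _.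
  by apply: (smoothM oU); [apply: (smoothM oU); [exact: (sfj j a)|exact: H]|exact: sS].
have T k1 k2 : tpart (cov wm F k1 (cov wm F k2 A)) y =
   pd k1 (pd k2 (tpart A)) y - (h2 y * pd k1 t y * q k2 y +
     h1 y * (gdot (g0 (f y)) (cov g0 f k1 (pd k2 f) y) (spart A y) +
    gdot (g0 (f y)) (pd k2 f y) (cov g0 f k1 (spart A) y))) -
   h1 y * (gdot (g0 (f y)) (pd k1 f y) (cov g0 f k2 (spart A) y) +
     (h1 y * tpart A y) * gdot (g0 (f y)) (pd k1 f y) (pd k2 f y)).
  apply: (etrans (tpart_cov k1 (sD k2) Uy)).
  apply: (f_equal2 (fun a b => a - b)); last first.
    by rewrite (spart_cov k2 sA Uy) gdotDr gdotZr.
  rewrite (@pd_near _ _ _ _ (fun z : 'rV[R]_m => pd k2 (tpart A) z - h1 z * q k2 z)); last first.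
    by apply: near_open oU Uy _ => x Ux; exact: tpart_cov.
  have d1 : derivable h1 y (delta_mx 0 k1) := smooth_der sh1 Uy.
  have d2 : derivable (q k2) y (delta_mx 0 k1) := smooth_der (sq k2) Uy.
  have d3 : derivable (pd k2 (tpart A)) y (delta_mx 0 k1).
    exact: smooth_der (smooth_pd k2 sa) Uy.
  have d12 : derivable (fun x : 'rV[R]_m => h1 x * q k2 x) y (delta_mx 0 k1).
    exact (derivableM d1 d2).
  apply: (etrans (pdB d3 d12)); apply: (f_equal2 (fun a b => a - b)) => [//|].
  apply: (etrans (pdM d1 d2)); rewrite pdh1; apply: (f_equal2 (fun a b => a + b)) => [//|].
  apply: (f_equal2 (fun a b => a * b)) => [//|].
  exact: (derive_val (is_derive := dq k2 k1)).
have S k1 k2 : spart (cov wm F k1 (cov wm F k2 A)) y =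
   cov g0 f k1 (cov g0 f k2 (spart A)) y +
   ((h2 y * pd k1 t y * tpart A y + h1 y * pd k1 (tpart A) y) *: pd k2 f y +
    (h1 y * tpart A y) *: cov g0 f k1 (pd k2 f) y) +
   (h1 y * (pd k2 (tpart A) y - h1 y * q k2 y)) *: pd k1 f y.
  rewrite (spart_cov k1 (sD k2) Uy) (tpart_cov k2 sA Uy); congr (_ + _).
  rewrite (cov_ext g0 f oU Uy k1 (fun (x : 'rV[R]_m) Ux => spart_cov k2 sA Ux)).
  have sC : vsmooth U (cov g0 f k2 (spart A)).
    exact: (vsmooth_cov oV0 sg0 g0P).
  have sha : smooth U (fun y => h1 y * tpart A y) by exact: (smoothM oU).
  have shf : vsmooth U (fun y => (h1 y * tpart A y) *: pd k2 f y).
    exact: (vsmoothZ oU).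
  rewrite (covD g0 f Uy k1 sC shf) (covZ g0 f oU Uy k1 sha (sfj k2)).
  rewrite pdM ?pdh1//; first exact: smooth_der sh1 Uy.
  exact: smooth_der sa Uy.
split.
  have -> : lsubmx C 0 0 = tpart (cov wm F i (cov wm F k A)) y -
     tpart (cov wm F k (cov wm F i A)) y by rewrite /C linearB mxE [X in _ + X]mxE.
  (* The three equations assumed here are the sources of the cancellation: commuting partial
     derivatives, absence of torsion in the fibre, and symmetry of the fibre metric. *)
  have alg (a1 a2 b ti tk qi qk c x1 x2 u1 u2 a f1 f2 : R) :
      a1 = a2 -> x1 = x2 -> f1 = f2 ->
      (a1 - (b * ti * qk + c * (x1 + u1)) - c * (u2 + (c * a) * f1)) -
      (a2 - (b * tk * qi + c * (x2 + u2)) - c * (u1 + (c * a) * f2)) =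
      - (b * (ti * qk - tk * qi)) by move=> -> -> ->; ring.
  apply: (etrans (f_equal2 (fun a b => a - b) (T i k) (T k i))); apply: alg.
  - exact (pd_comm i k oU Uy (sa 2%N)).
  - have -> // : cov g0 f i (pd k f) y = cov g0 f k (pd i f) y.
    exact: (cov_torsion oV0 sg0 g0P oU sf UV0 Uy).
  - exact: (gdotC _ _ (g0P (UV0 _ Uy)).1).
have -> : h (t y) *: rsubmx C = spart (cov wm F i (cov wm F k A)) y -
     spart (cov wm F k (cov wm F i A)) y by rewrite /C linearB scalerBr.
have alg (X Y Rm fi fk c1 c2 : 'rV[R]_n) (b ti tk c a ai ak qi qk : R) :
    c1 = c2 -> X - Y = Rm ->
    (X + ((b * ti * a + c * ai) *: fk + (c * a) *: c1) + (c * (ak - c * qk)) *: fi) -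
    (Y + ((b * tk * a + c * ak) *: fi + (c * a) *: c2) + (c * (ai - c * qi)) *: fk) =
    Rm + (b * a) *: (ti *: fk - tk *: fi) - c ^+ 2 *: (qk *: fi - qi *: fk).
  by move=> -> <-; apply/rowP => l; rewrite !mxE; ring.
apply: (etrans (f_equal2 (fun a b => a - b) (S i k) (S k i))); apply: alg.
  exact: (cov_torsion oV0 sg0 g0P oU sf UV0 Uy).
exact (curvature_along oV0 sg0 g0P oU sf UV0 i k sS Uy).
Qed.

End Along.

End Warped.

(** * Isometric immersions in coordinates *)

Section LocalImmersion.
Context {R : realType} {m d : nat}.
Variables (U : set 'rV[R]_m) (V : set 'rV[R]_d) (G : 'rV[R]_d -> 'M[R]_d).
Variables (F : 'rV[R]_m -> 'rV[R]_d) (g : 'rV[R]_m -> 'M[R]_m).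
Hypotheses (oU : open U) (oV : open V).
Hypotheses (sG : forall a b, smooth V (fun z => G z a b))
  (GP : forall z, V z -> posdef (G z)).
Hypotheses (sF : vsmooth U F) (UV : forall y, U y -> V (F y)).
Hypotheses (sg : forall a b, smooth U (fun y => g y a b))
  (gP : forall y, U y -> posdef (g y)).
Hypothesis gram : forall y i j, U y -> gdot (G (F y)) (pd i F y) (pd j F y) = g y i j.
Implicit Types (A B : 'rV[R]_m -> 'rV[R]_d) (y : 'rV[R]_m).

(** [lip], [le], [lgi], [lD] and [ldd] are the concrete [ip], [e], [gi], [D] and [dd] to which the
    abstract identity is applied. *)
Definition lip y (u v : 'rV[R]_d) : R := gdot (G (F y)) u v.
Definition le (i : 'I_m) := pd i F.
Definition lgi (i j : 'I_m) y : R := invmx (g y) i j.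
Definition lD (i : 'I_m) A := cov G F i A.
Definition ldd (i : 'I_m) (f : 'rV[R]_m -> R) := pd i f.

Lemma lipDl y u v w : lip y (u + v) w = lip y u w + lip y v w. Proof. exact: gdotDl. Qed.
Lemma lipZl y a u w : lip y (a *: u) w = a * lip y u w. Proof. exact: gdotZl. Qed.
Lemma lipC y u v : U y -> lip y u v = lip y v u.
Proof. by move=> Uy; apply: gdotC; case: (GP (UV Uy)). Qed.
Lemma smoothN_ f : smooth U f -> smooth U (fun y => - f y).
Proof. by move=> sf k; exact: CkN. Qed.

Lemma smooth_lip A B : vsmooth U A -> vsmooth U B -> smooth U (fun y => lip y (A y) (B y)).
Proof.
move=> sA sB; have H a b : smooth U (fun y => G (F y) a b).
  exact (smooth_compF oV oU sF UV (sG a b)).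
rewrite /lip; under eq_fun do rewrite gdotE.
apply: (smooth_sum oU) => a _; apply: (smooth_sum oU) => b _.
by apply: (smoothM oU); [apply: (smoothM oU); [exact: sA|exact: H]|exact: sB].
Qed.

Lemma vsmooth_lD i A : vsmooth U A -> vsmooth U (lD i A).
Proof. exact: (vsmooth_cov oV sG GP oU sF UV). Qed.

Lemma ldd_ext i f f' y : U y -> (forall z, U z -> f z = f' z) -> ldd i f y = ldd i f' y.
Proof. by move=> Uy H; apply: pd_near; exact: near_open H. Qed.

Lemma ldd_cst i (c : R) y : U y -> ldd i (fun=> c) y = 0.
Proof. by move=> _; rewrite /ldd pd_cst. Qed.

Lemma ldd_Ml i (c : R) f y : U y -> smooth U f ->
  ldd i (fun y => c * f y) y = c * ldd i f y.
Proof.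
move=> Uy sf; rewrite /ldd (pdM (f := fun=> c)) ?pd_cst ?mul0r ?add0r//.
exact: smooth_der sf Uy.
Qed.

Lemma ldd_sum i (f : 'I_m -> 'rV[R]_m -> R) y : U y -> (forall j, smooth U (f j)) ->
  ldd i (fun y => \sum_j f j y) y = \sum_j ldd i (f j) y.
Proof. by move=> Uy sf; apply: pd_sum => j _; exact: smooth_der (sf j) Uy. Qed.

Lemma lD_sub i A B y : U y -> vsmooth U A -> vsmooth U B ->
  lD i (fun y => A y - B y) y = lD i A y - lD i B y.
Proof.
move=> Uy sA sB; rewrite /lD.
have sN : vsmooth U (fun y => -1 *: B y) by apply: (vsmoothZ oU _ sB); exact: smooth_cst.
rewrite (cov_ext G F oU Uy (B := fun y => A y + -1 *: B y)); last first.
  by move=> z _; rewrite scaleN1r.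
rewrite (covD G F Uy i sA sN) (covZ G F oU Uy i _ sB); last exact: smooth_cst.
by rewrite pd_cst scale0r add0r scaleN1r.
Qed.

Lemma ldd_ip i A B y : U y -> vsmooth U A -> vsmooth U B ->
  ldd i (fun y => lip y (A y) (B y)) y = lip y (lD i A y) (B y) + lip y (A y) (lD i B y).
Proof.
move=> Uy sA sB; exact: (derive_val (is_derive := metric_compat oV sG GP oU sF UV Uy i sA sB)).
Qed.

Lemma vsmooth_le i : vsmooth U (le i). Proof. exact: vsmooth_pd. Qed.

Lemma smooth_lgi i j : smooth U (lgi i j).
Proof. by move=> k; apply: Ck_invmx => // [y /gP/posdef_unit|a b]; [|exact: sg]. Qed.

Lemma lgiC i j y : U y -> lgi i j y = lgi j i y.
Proof. by move=> Uy; rewrite /lgi -[in LHS](posdef_inv (gP Uy)) mxE. Qed.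

Lemma lgi_inv i j y : U y -> \sum_k lgi i k y * lip y (le k y) (le j y) = (i == j)%:R.
Proof.
move=> Uy; transitivity ((invmx (g y) *m g y) i j).
  by rewrite mxE; apply: eq_bigr => k _; rewrite /lip gram.
by rewrite mulVmx ?posdef_unit//; [rewrite mxE|exact: gP].
Qed.

Lemma ltorsion i j y : U y -> lD i (le j) y = lD j (le i) y.
Proof. by move=> Uy; exact: (cov_torsion oV sG GP oU sF UV Uy). Qed.

Lemma lD_add i A B y : U y -> vsmooth U A -> vsmooth U B ->
  lD i (fun y => A y + B y) y = lD i A y + lD i B y.
Proof. by move=> Uy; exact: covD. Qed.

Lemma lD_Z i f A y : U y -> smooth U f -> vsmooth U A ->
  lD i (fun y => f y *: A y) y = ldd i f y *: A y + f y *: lD i A y.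
Proof. by move=> Uy; exact: covZ. Qed.

Lemma lD_sum i (A : 'I_m -> 'rV[R]_m -> 'rV[R]_d) y : U y -> (forall j, vsmooth U (A j)) ->
  lD i (fun y => \sum_j A j y) y = \sum_j lD i (A j) y.
Proof. by move=> Uy; exact: cov_sum. Qed.

(** The body of [normal_proj] with both metrics as parameters, hence convertible to it on the charts
    of an immersion. *)
Definition nproj y (A : 'rV[R]_d) : 'rV[R]_d :=
  A - A *m G (F y) *m (jac F y)^T *m invmx (g y) *m jac F y.

Lemma nprojE y (A : 'rV[R]_d) : U y ->
  nproj y A = A - \sum_k (\sum_q lgi k q y * lip y A (le q y)) *: le k y.
Proof.
move=> Uy; rewrite /nproj; congr (_ - _); set u := A *m _ *m _ *m _.
rewrite (mulmx_sum_row u); apply: eq_bigr => k _; rewrite rowK; congr (_ *: _).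
rewrite /u mxE; apply: eq_bigr => q _; rewrite mulrC; congr (_ * _).
  by rewrite -/(lgi q k y) lgiC.
rewrite /lip /gdot !mxE; apply: eq_bigr => l _; congr (_ * _).
by rewrite !mxE.
Qed.

Lemma lip_nproj y (P A : 'rV[R]_d) : U y -> (forall j, lip y P (le j y) = 0) ->
  lip y P (nproj y A) = lip y P A.
Proof.
move=> Uy P0; rewrite nprojE// /lip gdotBr gdot_sumr big1 ?subr0// => k _.
by rewrite gdotZr -/(lip y P _) P0 mulr0.
Qed.

Lemma nprojD y (A B : 'rV[R]_d) : nproj y (A + B) = nproj y A + nproj y B.
Proof. by rewrite /nproj !mulmxDl opprD addrACA. Qed.

Lemma nprojZ y a (A : 'rV[R]_d) : nproj y (a *: A) = a *: nproj y A.
Proof. by rewrite /nproj -!scalemxAl scalerBr. Qed.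

Lemma nproj_le y j : U y -> nproj y (le j y) = 0.
Proof.
move=> Uy; rewrite nprojE//; apply/eqP; rewrite subr_eq0; apply/eqP.
rewrite (bigD1 j)//= [X in _ + X]big1 ?addr0 => [|k kj].
  under eq_bigr do rewrite lipC//.
  by rewrite lgi_inv// eqxx scale1r.
under eq_bigr do rewrite lipC//.
by rewrite lgi_inv// (negPf kj) scale0r.
Qed.

Lemma trace_frame (B : 'M[R]_m) y (q : 'I_m -> 'I_m -> R) : invmx (g y) = B^T *m B ->
  tr lgi q y = \sum_a \sum_i \sum_j B a i * B a j * q i j.
Proof.
move=> gB; rewrite /tr; under eq_bigr => i _ do under eq_bigr => j _ do
  rewrite /lgi gB mxE mulr_suml.
under eq_bigr do rewrite exchange_big /=.
rewrite exchange_big; apply: eq_bigr => a _; apply: eq_bigr => i _.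
by apply: eq_bigr => j _; rewrite mxE.
Qed.

Lemma tr_lip (N N' : 'I_m -> 'rV[R]_d) (B : 'M[R]_m) y : invmx (g y) = B^T *m B ->
  tr lgi (fun i j => lip y (N i) (N' j)) y =
  \sum_a lip y (\sum_i B a i *: N i) (\sum_i B a i *: N' i).
Proof.
move=> gB; rewrite (trace_frame _ gB); apply: eq_bigr => a _.
rewrite /lip gdot_suml; apply: eq_bigr => i _; rewrite gdotZl gdot_sumr mulr_sumr.
by apply: eq_bigr => j _; rewrite gdotZr mulrA.
Qed.

Lemma tr_lip_ge0 (N : 'I_m -> 'rV[R]_d) y : U y ->
  0 <= tr lgi (fun i j => lip y (N i) (N j)) y.
Proof.
move=> Uy; have [B /frame_inv gB] := posdef_frame (gP Uy).
by rewrite (tr_lip _ _ gB); apply: sumr_ge0 => a _; apply: posdef_ge0; exact/GP/UV.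
Qed.

Lemma tr_lip_eq0 (N : 'I_m -> 'rV[R]_d) y i : U y ->
  tr lgi (fun i j => lip y (N i) (N j)) y = 0 -> N i = 0.
Proof.
move=> Uy; have [B BG] := posdef_frame (gP Uy); have gB := frame_inv BG.
have GPy := GP (UV Uy).
rewrite (tr_lip _ _ gB) => /eqP; rewrite psumr_eq0 => [|a _]; last exact: posdef_ge0.
move=> /allP H.
have H0 a : \sum_i B a i *: N i = 0.
  have /eqP := H a (mem_index_enum _); apply: contraPP => /eqP/(GPy.2).
  by move=> /lt0r_neq0/eqP.
have Bu : B \in unitmx by move: BG; rewrite -mulmxA => /mulmx1_unit[].
have <- : \sum_a invmx B i a *: (\sum_j B a j *: N j) = N i.
  under eq_bigr do rewrite scaler_sumr.
  rewrite exchange_big (bigD1 i)//= [X in _ + X]big1 ?addr0 => [|j ji].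
    under eq_bigr do rewrite scalerA.
    rewrite -scaler_suml (_ : \sum_k _ = (invmx B *m B) i i); last by rewrite mxE.
    by rewrite mulVmx// mxE eqxx scale1r.
  under eq_bigr do rewrite scalerA.
  rewrite -scaler_suml (_ : \sum_k _ = (invmx B *m B) i j); last by rewrite mxE.
  by rewrite mulVmx// mxE eq_sym (negPf ji) scale0r.
by rewrite big1// => a _; rewrite H0 scaler0.
Qed.

(* Cauchy-Schwarz in an orthonormal frame *)
Lemma grad_le (N : 'I_m -> 'rV[R]_d) P y : U y ->
  tr lgi (fun i j => lip y (N i) P * lip y (N j) P) y <=
  tr lgi (fun i j => lip y (N i) (N j)) y * lip y P P.
Proof.
move=> Uy; have [B /frame_inv gB] := posdef_frame (gP Uy).
rewrite (tr_lip _ _ gB) (trace_frame _ gB) mulr_suml; apply: ler_sum => a _.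
apply: le_trans (posdef_cauchy _ _ (GP (UV Uy))).
rewrite le_eqVlt; apply/orP; left; apply/eqP.
rewrite /lip gdot_suml expr2 mulr_suml; apply: eq_bigr => i _.
by rewrite mulr_sumr; apply: eq_bigr => j _; rewrite !gdotZl; ring.
Qed.

Lemma II_frame (N : 'I_m -> 'I_m -> 'rV[R]_d) (B : 'M[R]_m) y : invmx (g y) = B^T *m B ->
  \sum_i \sum_j \sum_k \sum_l lgi i k y * lgi j l y * lip y (N i j) (N k l) =
  \sum_b \sum_a lip y (\sum_i B a i *: \sum_j B b j *: N i j)
                      (\sum_i B a i *: \sum_j B b j *: N i j).
Proof.
move=> gB; transitivity (tr lgi (fun i k => tr lgi (fun j l => lip y (N i j) (N k l)) y) y).
  apply: eq_bigr => i _; rewrite exchange_big /=; apply: eq_bigr => k _.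
  rewrite /tr mulr_sumr; apply: eq_bigr => j _; rewrite mulr_sumr.
  by apply: eq_bigr => l _; rewrite mulrA.
transitivity (\sum_b tr lgi (fun i k => lip y (\sum_j B b j *: N i j) (\sum_j B b j *: N k j)) y).
  by rewrite -tr_sum; apply: eq_tr => i k; exact: tr_lip.
by apply: eq_bigr => b _; rewrite (tr_lip _ _ gB).
Qed.

(** In an orthonormal frame the left side is the trace of X X. It falls short of the sum of the X a
    b ^ 2 by half the sum of the (X a b - X b a)^2, since N is not assumed symmetric; each entry is
    then bounded by Cauchy-Schwarz against P. *)
Lemma shape_le (N : 'I_m -> 'I_m -> 'rV[R]_d) (P : 'rV[R]_d) y : U y ->
  \sum_i \sum_p (\sum_q lgi p q y * lip y (N i q) P) * (\sum_q lgi i q y * lip y (N p q) P) <=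
  (\sum_i \sum_j \sum_k \sum_l lgi i k y * lgi j l y * lip y (N i j) (N k l)) * lip y P P.
Proof.
move=> Uy; have [B /frame_inv gB] := posdef_frame (gP Uy).
rewrite (II_frame _ gB) mulr_suml.
pose S : 'M[R]_m := \matrix_(i, j) lip y (N i j) P.
pose X := B *m S *m B^T.
have XE a b : X a b = lip y (\sum_i B a i *: \sum_j B b j *: N i j) P.
  rewrite /X -mulmxA mxE /lip gdot_suml; apply: eq_bigr => i _; rewrite gdotZl; congr (_ * _).
  by rewrite mxE gdot_suml; apply: eq_bigr => j _; rewrite !mxE gdotZl mulrC.
have SE i p : \sum_q lgi p q y * lip y (N i q) P = (S *m invmx (g y)) i p.
  rewrite mxE; apply: eq_bigr => q _; rewrite mxE mulrC; congr (_ * _).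
  by rewrite -/(lgi q p y) lgiC.
under eq_bigr => i _ do under eq_bigr => p _ do rewrite !SE.
have -> : \sum_i \sum_p (S *m invmx (g y)) i p * (S *m invmx (g y)) p i = \tr (X *m X).
  transitivity (\tr ((S *m invmx (g y)) *m (S *m invmx (g y)))).
    by apply: eq_bigr => i _; rewrite [RHS]mxE.
  by rewrite gB !mulmxA mxtrace_mulC /X !mulmxA.
apply: (@le_trans _ _ (\sum_b \sum_a X a b ^+ 2)).
  rewrite -subr_ge0.
  have -> : \tr (X *m X) = \sum_b \sum_a X a b * X b a.
    by apply: eq_bigr => b _; rewrite mxE; apply: eq_bigr => a _; rewrite mulrC.
  have E : \sum_b \sum_a X a b ^+ 2 = 2^-1 * \sum_b \sum_a (X a b ^+ 2 + X b a ^+ 2).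
    have -> : \sum_b \sum_a (X a b ^+ 2 + X b a ^+ 2) =
        \sum_b \sum_a X a b ^+ 2 + \sum_b \sum_a X b a ^+ 2.
      by rewrite -big_split; apply: eq_bigr => b _; rewrite -big_split.
    rewrite [X in _ * (_ + X)]exchange_big /=.
    by move: (\sum_b _) => r; field.
  rewrite E mulr_sumr -sumrB; apply: sumr_ge0 => b _; rewrite mulr_sumr -sumrB.
  apply: sumr_ge0 => a _.
  have -> : 2^-1 * (X a b ^+ 2 + X b a ^+ 2) - X a b * X b a = 2^-1 * (X a b - X b a) ^+ 2 by field.
  by rewrite mulr_ge0 ?sqr_ge0.
apply: ler_sum => b _; rewrite mulr_suml; apply: ler_sum => a _.
by rewrite XE; exact: posdef_cauchy (GP (UV Uy)).
Qed.

Lemma lip_suml y (A : 'I_m -> 'rV[R]_d) C : lip y (\sum_i A i) C = \sum_i lip y (A i) C.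
Proof. exact: gdot_suml. Qed.
Lemma lip_sumr y (A : 'I_m -> 'rV[R]_d) C : lip y C (\sum_i A i) = \sum_i lip y C (A i).
Proof. exact: gdot_sumr. Qed.
Lemma lipZr y a u w : lip y u (a *: w) = a * lip y u w. Proof. exact: gdotZr. Qed.
Lemma lipBl y u v w : lip y (u - v) w = lip y u w - lip y v w. Proof. exact: gdotBl. Qed.
Lemma lip_gram y i j : U y -> lip y (le i y) (le j y) = g y i j. Proof. exact: gram. Qed.

Opaque lip lD le.

Lemma pd_gram k i j y : U y -> pd k (fun y => g y i j) y =
  lip y (lD k (le i) y) (le j y) + lip y (lD k (le j) y) (le i y).
Proof.
move=> Uy; rewrite [in X in _ + X]lipC//.
rewrite -(ldd_ip k Uy (vsmooth_le i) (vsmooth_le j)) /ldd.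
by apply: pd_near; apply: (near_open oU Uy) => z Uz; rewrite lip_gram.
Qed.

Let koszul_alg (p q r a b e a' b' e' : R) : p = a + b -> q = a' + e -> r = b' + e' ->
  a' = a -> b' = b -> e' = e -> a = 2^-1 * (p + q - r).
Proof. by move=> -> -> -> -> -> ->; field. Qed.

Lemma koszul i q k y : U y -> lip y (lD i (le q) y) (le k y) =
  2^-1 * (pd i (fun y => g y q k) y + pd q (fun y => g y i k) y - pd k (fun y => g y i q) y).
Proof.
move=> Uy; exact (koszul_alg (pd_gram i q k Uy) (pd_gram q i k Uy) (pd_gram k i q Uy)
  (congr1 (fun v => lip y v (le k y)) (ltorsion q i Uy))
  (congr1 (fun v => lip y v (le q y)) (ltorsion k i Uy))
  (congr1 (fun v => lip y v (le i y)) (ltorsion k q Uy))).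
Qed.

Let trace_sym (a p : 'I_m -> 'I_m -> R) y : U y -> (forall i j, p i j = a i j + a j i) ->
  \sum_i \sum_j lgi i j y * a i j = 2^-1 * \sum_i \sum_j lgi i j y * p i j.
Proof.
move=> Uy pE; have -> : \sum_i \sum_j lgi i j y * p i j =
    \sum_i \sum_j lgi i j y * a i j + \sum_i \sum_j lgi i j y * a j i.
  rewrite -big_split; apply: eq_bigr => i _; rewrite -big_split; apply: eq_bigr => j _.
  by rewrite pE mulrDr.
have -> : \sum_i \sum_j lgi i j y * a j i = \sum_i \sum_j lgi i j y * a i j.
  rewrite exchange_big; apply: eq_bigr => i _; apply: eq_bigr => j _.
  by rewrite (lgiC j i Uy).
by move: (\sum_i _) => r; field.
Qed.

(** The contracted Christoffel symbol is the derivative of log sqrt (det g). This turns the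
    covariant divergence of the abstract identity into one that integrates against the volume. *)
Lemma Gm_trace k y : U y -> \sum_i Gm lD lip le lgi i k i y =
  2^-1 * \sum_i \sum_j lgi i j y * pd k (fun y => g y i j) y.
Proof.
move=> Uy; rewrite -(trace_sym Uy (fun i j => pd_gram k i j Uy)).
by apply: eq_bigr => i _; apply: eq_bigr => j _; rewrite (ltorsion i k Uy).
Qed.

Section Soliton.
Variables (X : 'rV[R]_m -> 'rV[R]_d) (h1 : 'rV[R]_m -> R) (c : R).
Hypotheses (sX : vsmooth U X) (DX : forall i y, U y -> cov G F i X y = h1 y *: pd i F y).
Hypothesis soliton : forall y, U y ->
  c *: nproj y (X y) = \sum_i \sum_j lgi i j y *: nproj y (cov G F i (pd j F) y).

Definition lN := NN lip le lgi X.
Definition lnperp i := nperp lD lip le lgi X i.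
Definition lw := ww lip le lgi X.
Definition lxi := xi lip le lgi X.
Definition lbm := bm lD lip le lgi X.
Definition lY := YY ldd lip le lgi X.

Lemma lNE y : U y -> lN y = nproj y (X y).
Proof. by move=> Uy; rewrite nprojE. Qed.

Lemma lnperpE i y : U y -> lnperp i y = nproj y (lD i lN y).
Proof.
move=> Uy; rewrite nprojE// /lnperp /nperp; congr (_ + _); rewrite -sumrN.
by apply: eq_bigr => p _; rewrite /bm scaleNr.
Qed.

Let S_cst (a : R) : smooth U (fun=> a). Proof. exact: smooth_cst. Qed.
Let S_M f f' : smooth U f -> smooth U f' -> smooth U (fun y => f y * f' y).
Proof. exact: smoothM. Qed.
Let S_sum (f : 'I_m -> 'rV[R]_m -> R) : (forall i, smooth U (f i)) ->
  smooth U (fun y => \sum_i f i y).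
Proof. by move=> sf; exact: smooth_sum. Qed.
Let S_dd i f : smooth U f -> smooth U (ldd i f). Proof. exact: smooth_pd. Qed.
Let VF_B A B : vsmooth U A -> vsmooth U B -> vsmooth U (fun y => A y - B y).
Proof. exact: vsmoothB. Qed.
Let VF_D A B : vsmooth U A -> vsmooth U B -> vsmooth U (fun y => A y + B y).
Proof. exact: vsmoothD. Qed.
Let VF_Z f A : smooth U f -> vsmooth U A -> vsmooth U (fun y => f y *: A y).
Proof. exact: vsmoothZ. Qed.
Let VF_sum (A : 'I_m -> 'rV[R]_m -> 'rV[R]_d) : (forall i, vsmooth U (A i)) ->
  vsmooth U (fun y => \sum_i A i y).
Proof. by move=> sA; exact: vsmooth_sum. Qed.
Let ipC y (A B : 'rV[R]_d) : U y -> lip y A B = lip y B A. Proof. exact: lipC. Qed.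
Let dd_ip i A B y : U y -> vsmooth U A -> vsmooth U B ->
  ldd i (fun y => lip y (A y) (B y)) y = lip y (lD i A y) (B y) + lip y (A y) (lD i B y).
Proof. exact: ldd_ip. Qed.

Lemma vsmooth_lN : vsmooth U lN.
Proof. exact: (VF_NN S_M S_sum smooth_lip VF_B VF_Z VF_sum vsmooth_le smooth_lgi sX). Qed.

Lemma smooth_lw : smooth U lw.
Proof. exact: smooth_lip vsmooth_lN vsmooth_lN. Qed.

Lemma lN_normal j y : U y -> lip y (lN y) (le j y) = 0.
Proof. exact: (NN_normal lipDl lipZl X lgiC lgi_inv). Qed.

Lemma lmean y P : U y -> (forall j, lip y P (le j y) = 0) ->
  \sum_i \sum_j lgi i j y * lip y P (lD i (le j) y) = c * lip y P (lN y).
Proof.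
move=> Uy P0; transitivity (lip y P (c *: lN y)); last by rewrite lipZr.
rewrite lNE// soliton// lip_sumr; apply: eq_bigr => i _.
rewrite lip_sumr; apply: eq_bigr => j _; rewrite lipZr; congr (_ * _).
by rewrite lip_nproj.
Qed.

Lemma soliton_identity y : U y ->
  \sum_i pd i (lY i) y +
    \sum_k lY k y * (2^-1 * \sum_i \sum_j lgi i j y * pd k (fun y => g y i j) y) +
    c * \sum_k lxi k y * (2^-1 * pd k lw y) =
  tr lgi (fun i j => lip y (lnperp i y) (lnperp j y)) y - c * h1 y * lw y
  - \sum_i \sum_p lbm i p y * lbm p i y + Rt lD lip le lgi X y.
Proof.
move=> Uy; under eq_bigr do rewrite -[pd _ _ _]/(ldd _ _ _).
under [X in _ + X + _]eq_bigr do rewrite -Gm_trace//.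
rewrite (abstract_identity lipDl lipZl ipC S_cst S_M smoothN_ S_sum S_dd smooth_lip VF_B
  VF_D VF_Z VF_sum vsmooth_lD ldd_ext ldd_cst ldd_Ml ldd_sum lD_add lD_sub lD_Z lD_sum dd_ip
  vsmooth_le smooth_lgi lgiC lgi_inv ltorsion sX DX lmean Uy).
rewrite -/lw -/lxi -/lbm; set u := c * \sum_k _.
by rewrite -[tr _ _ _ - c * _ * _]/(tr _ _ _ - c * _ * _); ring.
Qed.

Lemma lbmE i p y : U y -> lbm i p y = \sum_q lgi p q y * lip y (lN y) (lD i (le q) y).
Proof.
move=> Uy; rewrite /lbm /bm -sumrN; apply: eq_bigr => q _.
by rewrite (nD_e lipDl lipZl S_M S_sum smooth_lip VF_B VF_Z VF_sum ldd_ext ldd_cst dd_ip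
  vsmooth_le smooth_lgi lgiC lgi_inv sX)// mulrN opprK.
Qed.

Lemma grad_lw i y : U y -> 2^-1 * pd i lw y = lip y (lnperp i y) (lN y).
Proof.
move=> Uy; rewrite /lnperp /nperp lipDl.
rewrite -[pd _ _ _]/(ldd _ _ _) (dd_ww ipC S_M S_sum smooth_lip VF_B VF_Z VF_sum dd_ip
  vsmooth_le smooth_lgi sX i Uy).
rewrite [X in _ + X](_ : _ = 0) ?addr0// lip_suml big1// => p _.
by rewrite lipZl lipC// lN_normal// mulr0.
Qed.

Let grad_alg (a b p q : R) : 2^-1 * a = p -> 2^-1 * b = q -> a * b = 4 * (p * q).
Proof. by move=> <- <-; field. Qed.

Lemma grad_lw_le y : U y -> tr lgi (fun i j => pd i lw y * pd j lw y) y <=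
  4 * lw y * tr lgi (fun i j => lip y (lnperp i y) (lnperp j y)) y.
Proof.
move=> Uy; have := grad_le (fun i => lnperp i y) (lN y) Uy.
rewrite -(ler_pM2l (_ : 0 < 4))// => H; apply: le_trans (le_trans H _); last first.
  by rewrite le_eqVlt; apply/orP; left; apply/eqP; rewrite /lw /ww -/lN; ring.
rewrite -trZ le_eqVlt; apply/orP; left; apply/eqP; apply: eq_tr => i j.
exact (grad_alg (grad_lw i Uy) (grad_lw j Uy)).
Qed.

(* the right-hand side involves only the metric of M and <X, d_q psi> *)
Lemma shape_intrinsic i q y : U y -> lip y (lN y) (lD i (le q) y) =
  pd i (fun y => lip y (X y) (le q y)) y - h1 y * g y i q -
  \sum_k lxi k y * (2^-1 * (pd i (fun y => g y q k) y + pd q (fun y => g y i k) y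
                            - pd k (fun y => g y i q) y)).
Proof.
move=> Uy; rewrite -[pd i (fun y => lip _ _ _) y]/(ldd _ _ _) dd_ip//; last exact: vsmooth_le.
rewrite [lD i X y]DX// lipZl lip_gram// [X in X - _]addrAC subrr add0r.
under eq_bigr do rewrite -koszul//.
rewrite /lN /NN lipBl lip_suml; congr (_ - _); apply: eq_bigr => k _.
by rewrite lipZl (lipC (le k y)).
Qed.

Lemma shape_sqr_le y : U y -> \sum_i \sum_p lbm i p y * lbm p i y <=
  (\sum_i \sum_j \sum_k \sum_l lgi i k y * lgi j l y *
     lip y (nproj y (lD i (le j) y)) (nproj y (lD k (le l) y))) * lw y.
Proof.
move=> Uy; have := shape_le (fun i j => nproj y (lD i (le j) y)) (lN y) Uy.
congr (_ <= _); apply: eq_bigr => i _; apply: eq_bigr => p _.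
by rewrite !lbmE//; congr (_ * _); apply: eq_bigr => q _; congr (_ * _);
  rewrite lipC// lip_nproj// => j; exact: lN_normal.
Qed.

End Soliton.
End LocalImmersion.
Transparent lip lD le.

Section GradientOperators.
Context {R : realType} {m : nat}.
Variables (g : 'rV[R]_m -> 'M[R]_m).
Implicit Types (f : 'rV[R]_m -> R) (y : 'rV[R]_m).

Definition gradv f (k : 'I_m) y : R := \sum_q lgi g k q y * pd q f y.
Definition gradip f f' y : R := \sum_k gradv f k y * pd k f' y.
(* [divg] is the divergence for the volume density sqrt (det g) *)
Definition divg (Y : 'I_m -> 'rV[R]_m -> R) y : R := \sum_i pd i (Y i) y +
  \sum_k Y k y * (2^-1 * \sum_i \sum_j lgi g i j y * pd k (fun y => g y i j) y).
(* |X^perp|^2 for X = h(t) d_t: the tangential part of d_t is the gradient of t *)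
Definition wfun (h : R -> R) (t : 'rV[R]_m -> R) y := h (t y) ^+ 2 * (1 - gradip t t y).
(* the Laplacian for the weight exp (c eta), where d eta = h(t) dt *)
Definition lop (h : R -> R) (c : R) t f y :=
  divg (gradv f) y + c * h (t y) * gradip t f y.

End GradientOperators.

Section WarpedSoliton.
Context {R : realType} {n m : nat} (I : set R) (h : R -> R).
Variables (V0 : set 'rV[R]_n) (g0 : 'rV[R]_n -> 'M[R]_n).
Hypotheses (oI : open I) (sh : smooth_fun_on I h) (h_pos : forall t, I t -> 0 < h t).
Hypotheses (oV0 : open V0) (sg0 : forall a b, smooth V0 (fun z => g0 z a b))
  (g0P : forall z, V0 z -> posdef (g0 z)).
Variables (U : set 'rV[R]_m) (F : 'rV[R]_m -> 'rV[R]_(1 + n)) (g : 'rV[R]_m -> 'M[R]_m).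
Hypotheses (oU : open U) (sF : vsmooth U F) (UV : forall y, U y -> Vw I V0 (F y)).
Hypotheses (sg : forall a b, smooth U (fun y => g y a b))
  (gP : forall y, U y -> posdef (g y)).
Let G := wm h g0.
Hypothesis gram : forall y i j, U y -> gdot (G (F y)) (pd i F y) (pd j F y) = g y i j.
Let t := tpart F.
Let f := fpart F.

Definition conf y : 'rV[R]_(1 + n) := row_mx ((h (t y))%:M : 'rV[R]_1) 0.

Let oV : open (Vw I V0). Proof. exact: open_Vw. Qed.
Let sG a b : smooth (Vw I V0) (fun z => G z a b). Proof. exact: smooth_wm. Qed.
Let GP z : Vw I V0 z -> posdef (G z). Proof. exact: wm_posdef. Qed.
Let h1 y : R := derive1 h (t y).
Let h2 y : R := derive1 (derive1 h) (t y).
Let hy y := h (t y).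

Lemma tpart_conf y : tpart conf y = hy y.
Proof. by rewrite /tpart /conf row_mxKl mxE eqxx mulr1n. Qed.

Lemma spart_conf y : spart h F conf y = 0.
Proof. by rewrite /spart /fpart /conf row_mxKr scaler0. Qed.

Lemma vsmooth_conf : vsmooth U conf.
Proof.
move=> l; have [j -> | j ->] := split_ordP l.
  apply: (smooth_ext oU _ (smooth_ht oU sF UV sh)) => y _.
  by rewrite row_mxEl mxE ord1 eqxx mulr1n.
apply: (smooth_ext oU _ (smooth_cst U 0)) => y _.
by rewrite row_mxEr mxE.
Qed.

Lemma parts_inj a (u v : 'rV[R]_(1 + n)) : a != 0 -> lsubmx u 0 0 = lsubmx v 0 0 ->
  a *: rsubmx u = a *: rsubmx v -> u = v.
Proof.
move=> a0 E1 /(scalerI a0) E2; rewrite -[u]hsubmxK -[v]hsubmxK E2; congr row_mx.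
by rewrite [LHS]mx11_scalar [RHS]mx11_scalar E1.
Qed.

Lemma cov0 i y : cov g0 f i (fun=> 0) y = 0.
Proof.
rewrite /cov gamma0r addr0; apply/rowP => l.
rewrite (pd_rVE i l (vsmooth_cst setT 0) Logic.I) [RHS]mxE.
by rewrite (_ : (fun=> _) = fun=> 0) ?pd_cst//; apply/funext => z; rewrite mxE.
Qed.

Lemma hy_gt0 y : U y -> 0 < hy y.
Proof. by move=> Uy; apply: h_pos; exact: (It UV Uy). Qed.

(** In the rescaled components X is (h(t), 0), so [tpart_cov] and [spart_cov] leave h' dt and h'
    times the derivative of the fibre part. *)
Lemma cov_conf i y : U y -> cov G F i conf y = h1 y *: pd i F y.
Proof.
move=> Uy; have h0 := lt0r_neq0 (hy_gt0 Uy); apply: (parts_inj h0).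
  have := tpart_cov oI sh h_pos oV0 sg0 g0P sF UV i vsmooth_conf Uy.
  rewrite spart_conf gdot0r mulr0 subr0 {1}/tpart => ->.
  have -> : pd i (tpart conf) y = pd i (fun y => h (t y)) y.
    by apply: pd_near; apply: filterE => z; exact: tpart_conf.
  rewrite (pd_ht sF UV i sh Uy).
  rewrite linearZ/= mxE; congr (_ * _).
  by rewrite -(tpart_pd i sF Uy).
have := spart_cov oI sh h_pos oV0 sg0 g0P oU sF UV i vsmooth_conf Uy.
rewrite (cov_ext g0 f oU Uy i (B := fun=> 0)) => [|z _]; last exact: spart_conf.
rewrite cov0 add0r tpart_conf {1}/spart => ->.
by rewrite linearZ/= scalerA mulrC -(fpart_pd i sF Uy).
Qed.

Lemma lip_parts y A B : lip G F y (A y) (B y) =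
  tpart A y * tpart B y + gdot (g0 (f y)) (spart h F A y) (spart h F B y).
Proof. exact: gdot_parts. Qed.

Lemma lip_conf A y : lip G F y (conf y) (A y) = hy y * tpart A y.
Proof. by rewrite lip_parts tpart_conf spart_conf gdot0l addr0. Qed.

Lemma tpart_le i y : U y -> tpart (le F i) y = pd i t y.
Proof. by move=> Uy; exact: tpart_pd. Qed.

Lemma spart_le i y : U y -> spart h F (le F i) y = hy y *: pd i f y.
Proof. by move=> Uy; rewrite /spart (fpart_pd i sF Uy). Qed.

Let N := lN G F g conf.
Let v y := spart h F N y.
Let s y := gradip g t t y.
Let tau k y := gradv g t k y.

Lemma lxi_conf k y : U y -> lxi G F g conf k y = hy y * tau k y.
Proof.
move=> Uy; rewrite /lxi /xi /tau /gradv mulr_sumr; apply: eq_bigr => q _.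
by rewrite lip_conf tpart_le// mulrCA.
Qed.

Lemma NE y : N y = conf y - \sum_k lxi G F g conf k y *: le F k y. Proof. by []. Qed.

Lemma tpart_N y : U y -> tpart N y = hy y * (1 - s y).
Proof.
move=> Uy; rewrite /tpart NE linearB/= mxE -/(tpart conf y) tpart_conf.
rewrite mulrBr mulr1; congr (_ + _); rewrite mxE; congr (- _).
rewrite linear_sum summxE /s /gradip mulr_sumr; apply: eq_bigr => k _.
by rewrite linearZ/= mxE lxi_conf// -/(tpart (le F k) y) tpart_le// mulrA.
Qed.

Lemma spart_N y : U y -> v y = - \sum_k (hy y ^+ 2 * tau k y) *: pd k f y.
Proof.
move=> Uy; rewrite /v /spart /fpart NE linearB/= row_mxKr sub0r scalerN; congr (- _).
rewrite linear_sum scaler_sumr; apply: eq_bigr => k _.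
rewrite linearZ/= lxi_conf// -(fpart_pd k sF Uy) scalerA; congr (_ *: _).
by rewrite -/(hy y); ring.
Qed.

Let N0 j y : U y -> lip G F y (N y) (le F j y) = 0.
Proof. by move=> Uy; exact: (lN_normal gP gram conf j Uy). Qed.

Lemma f_v k y : U y -> gdot (g0 (f y)) (v y) (pd k f y) = - ((1 - s y) * pd k t y).
Proof.
move=> Uy; have := N0 k Uy; rewrite lip_parts tpart_N// tpart_le// spart_le// gdotZr.
rewrite -/(v y) -mulrA -mulrDr => /eqP; rewrite mulf_eq0 (gt_eqF (hy_gt0 Uy))/=.
by rewrite addrC addr_eq0 => /eqP.
Qed.

Lemma lwE y : U y -> lw G F g conf y = wfun g h t y.
Proof.
move=> Uy; transitivity (lip G F y (conf y) (N y)).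
  rewrite /lw /ww -/(lN G F g conf) -/N [in X in lip _ _ _ X _]NE lipBl lip_suml.
  rewrite big1 ?subr0// => k _.
  by rewrite lipZl (lipC GP UV _ _ Uy) N0// mulr0.
by rewrite lip_conf tpart_N// mulrA -expr2.
Qed.

Lemma v_v y : U y -> gdot (g0 (f y)) (v y) (v y) = hy y ^+ 2 * (s y * (1 - s y)).
Proof.
move=> Uy; have := lwE Uy; rewrite /lw /ww -/(lN G F g conf) -/N lip_parts tpart_N//.
rewrite -/(v y) /wfun -/(s y) -/(hy y) => /(canRL (addKr _)) ->.
by rewrite expr2; ring.
Qed.

Lemma f_f i j y : U y -> hy y ^+ 2 * gdot (g0 (f y)) (pd i f y) (pd j f y) =
  g y i j - pd i t y * pd j t y.
Proof.
move=> Uy; rewrite -(gram i j Uy) -[gdot (G _) _ _]/(lip G F y (le F i y) (le F j y)).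
have A := f_equal2 *%R (tpart_le i Uy) (tpart_le j Uy).
have B := f_equal2 (gdot (g0 (f y))) (spart_le i Uy) (spart_le j Uy).
rewrite (etrans (lip_parts y (le F i) (le F j)) (f_equal2 +%R A B)).
by rewrite gdotZl gdotZr mulrA -expr2 [RHS]addrAC subrr add0r.
Qed.

Lemma wfun_ge0 y : U y -> 0 <= wfun g h t y.
Proof. by move=> Uy; rewrite -lwE//; apply: posdef_ge0; exact/GP/UV. Qed.

Lemma s_le1 y : U y -> s y <= 1.
Proof.
move=> Uy; have := wfun_ge0 Uy; rewrite pmulr_rge0 ?subr_ge0//.
by rewrite exprn_gt0// hy_gt0.
Qed.

Lemma trace_dt y : tr (lgi g) (fun i j => pd i t y * pd j t y) y = s y.
Proof.
apply: eq_bigr => k _; rewrite /gradv mulr_suml; apply: eq_bigr => q _.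
by move: (lgi g k q y) (pd k t y) (pd q t y) => a b d; rewrite mulrA mulrAC.
Qed.

Lemma trace_g y : U y -> tr (lgi g) (fun i j => g y i j) y = m%:R.
Proof.
move=> Uy; transitivity (\sum_(i < m) (1 : R)); last by rewrite sumr_const card_ord.
apply: eq_bigr => i _; rewrite -[RHS](_ : (i == i)%:R = 1); last by rewrite eqxx.
rewrite -(lgi_inv gP gram i i Uy); apply: eq_bigr => j _; congr (_ * _).
by rewrite (lip_gram gram)// -[in LHS](gP Uy).1 mxE.
Qed.

Lemma s_ge0 y : U y -> 0 <= s y.
Proof.
move=> Uy; have [B /frame_inv gB] := posdef_frame (gP Uy).
rewrite -trace_dt (trace_frame _ gB); apply: sumr_ge0 => a _.
rewrite [leRHS](_ : _ = (\sum_i B a i * pd i t y) ^+ 2) ?sqr_ge0//.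
rewrite expr2 mulr_suml; apply: eq_bigr => i _; rewrite mulr_sumr; apply: eq_bigr => j _.
by move: (B a i) (B a j) (pd i t y) (pd j t y) => b1 b2 d1 d2; ring.
Qed.

Variable kappa : R.
Hypothesis curv : forall z, V0 z -> forall u v, row_free (col_mx u v) ->
  sectional_curvature g0 z u v = kappa.

Let C i k y := lD G F i (lD G F k N) y - lD G F k (lD G F i N) y.
Let sN : vsmooth U N.
Proof. exact: (vsmooth_lN oU oV sG sF UV sg gP vsmooth_conf). Qed.

Let Calg (x a2 a b qk qi r : R) : x = - (a2 * (a * qk - b * qi)) ->
  qk = - (r * b) -> qi = - (r * a) -> x = 0.
Proof. by move=> -> -> ->; ring. Qed.

Let Cvec (a2 a0 a1 r a b tN qk qi : R) (x z p q : 'rV[R]_n) :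
  x = z + (a2 * tN) *: (a *: q - b *: p) - a1 ^+ 2 *: (qk *: p - qi *: q) ->
  qk = - (r * b) -> qi = - (r * a) -> tN = a0 * r ->
  x = z + (r * (a2 * a0 - a1 ^+ 2)) *: (a *: q - b *: p).
Proof.
move=> -> -> -> ->; rewrite -addrA; congr (_ + _).
by apply/rowP => l; rewrite !mxE; ring.
Qed.

Let gdot_lin (H : 'M[R]_n) (x p q w : 'rV[R]_n) (r a b : R) :
  gdot H (x + r *: (a *: p - b *: q)) w = gdot H x w + r * (a * gdot H p w - b * gdot H q w).
Proof. by rewrite gdotDl gdotZl gdotBl !gdotZl. Qed.

Let Salg (a0 ta A r ti B tk E : R) : a0 * ta * (a0 * (A + r * (ti * B - tk * E))) =
  a0 ^+ 2 * ta * A + (r * (ti * (a0 ^+ 2 * ta * B)) - r * (ta * tk * (a0 ^+ 2 * E))).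
Proof. by ring. Qed.

Let Talg (x vv q q' a0 r e a b : R) : a0 ^+ 2 * x = e - a * b ->
  vv = a0 ^+ 2 * (r * (1 - r)) -> q = - ((1 - r) * a) -> q' = - ((1 - r) * b) ->
  x * vv - q * q' = (1 - r) * (r * e - a * b).
Proof.
move=> E -> -> ->; transitivity (a0 ^+ 2 * x * (r * (1 - r)) - (1 - r) ^+ 2 * (a * b)).
  by ring.
by rewrite E; ring.
Qed.

Let sum_alg (x p q r : 'I_m -> R) : (forall k, x k = p k + (q k - r k)) ->
  \sum_k x k = \sum_k p k + (\sum_k q k - \sum_k r k).
Proof. by move=> E; rewrite -sumrB -big_split; apply: eq_bigr => k _. Qed.

(** By [f_v], normality of N makes the pairing of its fibre part with d_k f a multiple of d_k t.
    Substituted in [curvature_parts], this cancels the height component altogether and combines the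
    h'' and h'^2 terms into one factor. *)
Lemma C_e i k j y : U y -> lip G F y (C i k y) (le F j y) =
  hy y * (gdot (g0 (f y)) (riemann_tensor g0 (f y) (pd i f y) (pd k f y) (v y)) (pd j f y) +
   (1 - s y) * (h2 y * hy y - h1 y ^+ 2) *
   (pd i t y * gdot (g0 (f y)) (pd k f y) (pd j f y) -
    pd k t y * gdot (g0 (f y)) (pd i f y) (pd j f y))).
Proof.
move=> Uy; have g0S : (g0 (f y))^T = g0 (f y) by case: (g0P (V0f UV Uy)).
have := curvature_parts oI sh h_pos oV0 sg0 g0P oU sF UV i k sN Uy; cbv zeta.
rewrite -[cov _ _ _ _ _ - _]/(C i k y) => -[C1 C2].
have vf l : gdot (g0 (fpart F y)) (pd l (fpart F) y) (spart h F N y) =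
    - ((1 - s y) * pd l t y).
  by apply: etrans (f_v l Uy); apply: gdotC.
have {}C1 : tpart (C i k) y = 0.
  exact (Calg C1 (vf k) (vf i)).
have {}C2 : spart h F (C i k) y = riemann_tensor g0 (f y) (pd i f y) (pd k f y) (v y) +
    ((1 - s y) * (h2 y * hy y - h1 y ^+ 2)) *: (pd i t y *: pd k f y - pd k t y *: pd i f y).
  exact (Cvec C2 (vf k) (vf i) (tpart_N Uy)).
rewrite lip_parts C1 mul0r add0r C2 spart_le// gdotZr; congr (_ * _).
exact: gdot_lin.
Qed.

(** By [spart_N], the combination of the d_k f with the weights of X^T is -v, so the fibre curvature
    enters only through <R(d_i f, v) v, d_j f>, which the constant kappa determines. The traces of
    dt (x) dt and of g are s and m; hence the factor (m - 1) s (1 - s). *)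
Lemma Rt_warped y : U y -> Rt (lD G F) (lip G F) (le F) (lgi g) conf y =
  (m%:R - 1) * (s y * (1 - s y)) * (h1 y ^+ 2 - h2 y * hy y - kappa).
Proof.
move=> Uy; have g0S : (g0 (f y))^T = g0 (f y) by case: (g0P (V0f UV Uy)).
pose K : R := h2 y * hy y - h1 y ^+ 2.
have E i j : \sum_k lxi G F g conf k y * lip G F y (C i k y) (le F j y) =
    - gdot (g0 (f y)) (riemann_tensor g0 (f y) (pd i f y) (v y) (v y)) (pd j f y) +
    (1 - s y) * K * (pd i t y * pd j t y - s y * g y i j).
  transitivity (gdot (g0 (f y)) (riemann_tensor g0 (f y) (pd i f y)
       (\sum_k (hy y ^+ 2 * tau k y) *: pd k f y) (v y)) (pd j f y) +
     (1 - s y) * K * (pd i t y * gdot (g0 (f y)) (\sum_k (hy y ^+ 2 * tau k y) *: pd k f y) (pd j f y) -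
        s y * (hy y ^+ 2 * gdot (g0 (f y)) (pd i f y) (pd j f y)))).
    rewrite riemann_sumr !gdot_suml mulrBr !mulr_sumr.
    rewrite [X in _ - X](_ : _ = \sum_k (1 - s y) * K *
       (tau k y * pd k t y * (hy y ^+ 2 * gdot (g0 (f y)) (pd i f y) (pd j f y)))); last first.
      by rewrite -mulr_sumr -mulr_suml.
    apply: sum_alg => k.
    rewrite lxi_conf// C_e// !gdotZl -/K -/(s y).
    exact: Salg.
  have -> : \sum_k (hy y ^+ 2 * tau k y) *: pd k f y = - v y by rewrite spart_N// opprK.
  rewrite -[- v y]scaleN1r riemannN riemannZl gdotNl gdotZl mulN1r opprK.
  rewrite gdotZl (f_v j Uy) (f_f i j Uy) riemannN gdotNl; congr (_ + _).
  by move: (pd _ _ _) (pd _ _ _) => a b; ring.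
transitivity (tr (lgi g) (fun i j => \sum_k lxi G F g conf k y *
    lip G F y (C i k y) (le F j y)) y).
  by rewrite tr_sum; apply: eq_bigr => k _; rewrite trZ.
rewrite (eq_tr _ _ E) trD trN trZ trD trN trZ trace_dt trace_g//.
have [B /frame_inv gB] := posdef_frame (gP Uy).
have -> : tr (lgi g) (fun i j => gdot (g0 (f y))
    (riemann_tensor g0 (f y) (pd i f y) (v y) (v y)) (pd j f y)) y =
    kappa * ((1 - s y) * (s y * m%:R - s y)).
  rewrite /tr /lgi gB (sectional_trace B (fun i => pd i f y) (v y) (g0P (V0f UV Uy))
    (curv (V0f UV Uy))) -gB; congr (_ * _).
  transitivity (tr (lgi g) (fun i j => (1 - s y) * (s y * g y i j - pd i t y * pd j t y)) y).
    have vf l : gdot (g0 (f y)) (pd l f y) (v y) = - ((1 - s y) * pd l t y).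
      by apply: etrans (f_v l Uy); apply: gdotC.
    apply: eq_tr => i j; exact (Talg (f_f i j Uy) (v_v Uy) (vf i) (vf j)).
  by rewrite trZ trD trZ trN trace_dt trace_g.
by rewrite /K; ring.
Qed.

End WarpedSoliton.

Section ShapeOperator.
Context {R : realType} {m : nat} (g : 'rV[R]_m -> 'M[R]_m) (h : R -> R) (t : 'rV[R]_m -> R).

(* <N, D_i d_q psi> for N the normal part of h(t) d_t: since d_q psi has height
   component d_q t, it depends on the immersion through t and g only *)
Definition shape (i q : 'I_m) (y : 'rV[R]_m) : R :=
  pd i (fun y => h (t y) * pd q t y) y - derive1 h (t y) * g y i q -
  \sum_k (h (t y) * gradv g t k y) * (2^-1 * (pd i (fun y => g y q k) y +
    pd q (fun y => g y i k) y - pd k (fun y => g y i q) y)).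

Definition shape_sqr (y : 'rV[R]_m) : R := \sum_i \sum_p
  (\sum_q lgi g p q y * shape i q y) * (\sum_q lgi g i q y * shape p q y).

End ShapeOperator.

Section WarpedIdentity.
Context {R : realType} {n m : nat} (I : set R) (h : R -> R).
Variables (V0 : set 'rV[R]_n) (g0 : 'rV[R]_n -> 'M[R]_n).
Hypotheses (oI : open I) (sh : smooth_fun_on I h) (h_pos : forall t, I t -> 0 < h t).
Hypotheses (oV0 : open V0) (sg0 : forall a b, smooth V0 (fun z => g0 z a b))
  (g0P : forall z, V0 z -> posdef (g0 z)).
Variables (U : set 'rV[R]_m) (F : 'rV[R]_m -> 'rV[R]_(1 + n)) (g : 'rV[R]_m -> 'M[R]_m).
Hypotheses (oU : open U) (sF : vsmooth U F) (UV : forall y, U y -> Vw I V0 (F y)).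
Hypotheses (sg : forall a b, smooth U (fun y => g y a b))
  (gP : forall y, U y -> posdef (g y)).
Let G := wm h g0.
Hypothesis gram : forall y i j, U y -> gdot (G (F y)) (pd i F y) (pd j F y) = g y i j.
Let t := tpart F.
Let w := wfun g h t.
Let X := conf h F.

Let oV : open (Vw I V0). Proof. exact: open_Vw. Qed.
Let sG a b : smooth (Vw I V0) (fun z => G z a b). Proof. exact: smooth_wm. Qed.
Let GP z : Vw I V0 z -> posdef (G z). Proof. exact: wm_posdef. Qed.
Let sX : vsmooth U X. Proof. exact: (vsmooth_conf sh oU sF UV). Qed.
Let DX i y : U y -> cov G F i X y = derive1 h (t y) *: pd i F y.
Proof. exact: (cov_conf oI sh h_pos oV0 sg0 g0P oU sF UV). Qed.

Lemma wfun_lw y : U y -> lw G F g X y = w y.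
Proof. exact: (lwE h_pos g0P sF UV gP gram). Qed.

Lemma smooth_wfun : smooth U w.
Proof.
by apply: smooth_ext (smooth_lw oU oV sG sF UV sg gP sX) => // y Uy; exact: wfun_lw.
Qed.

Let pd_w i y : U y -> pd i (lw G F g X) y = pd i w y.
Proof.
by move=> Uy; apply: pd_near; apply: (near_open oU Uy) => z Uz; exact: wfun_lw.
Qed.

Let lYE j y : U y -> lY G F g X j y = 2^-1 * gradv g w j y.
Proof.
move=> Uy; rewrite /lY /YY /gradv mulr_sumr; apply: eq_bigr => q _.
rewrite mulrCA; congr (_ * (_ * _)); exact: pd_w.
Qed.

Let pd_lY i j y : U y -> pd i (lY G F g X j) y = 2^-1 * pd i (gradv g w j) y.
Proof.
move=> Uy; have sY : smooth U (gradv g w j).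
  by apply: (smooth_sum oU) => q _; apply: (smoothM oU);
    [exact: (smooth_lgi oU sg gP)|apply: smooth_pd => //; exact: smooth_wfun].
transitivity (pd i (fun z => 2^-1 * gradv g w j z) y).
  by apply: pd_near; apply: (near_open oU Uy) => z Uz; exact: lYE.
exact: (ldd_Ml i _ Uy sY).
Qed.

Let lxiE k y : U y -> lxi G F g X k y = h (t y) * gradv g t k y.
Proof. exact: (lxi_conf h g0 g sF). Qed.

Lemma grad_wfun_le y : U y -> gradip g w w y <=
  4 * w y * tr (lgi g) (fun i j => lip G F y (lnperp G F g X i y) (lnperp G F g X j y)) y.
Proof.
move=> Uy; have := grad_lw_le oU oV sG GP sF UV sg gP gram sX Uy.
rewrite (wfun_lw Uy); congr (_ <= _).
apply: eq_bigr => i _; rewrite /gradv mulr_suml; apply: eq_bigr => j _.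
rewrite (pd_w i Uy) (pd_w j Uy); move: (lgi g i j y) (pd i w y) (pd j w y) => a b d.
by rewrite -mulrA [b * d]mulrC.
Qed.

(** Expresses the shape term through t and g, so that it is attached to a chart of M alone and makes
    sense without a chart of P. *)
Lemma lbm_shape y : U y ->
  \sum_i \sum_p lbm G F g X i p y * lbm G F g X p i y = shape_sqr g h t y.
Proof.
move=> Uy; have E i p : lbm G F g X i p y = \sum_q lgi g p q y * shape g h t i q y.
  rewrite (lbmE oU oV sG GP sF UV sg gP gram sX i p Uy); apply: eq_bigr => q _.
  congr (_ * _); apply: etrans (shape_intrinsic oU oV sG GP sF UV gram sX DX i q Uy) _.
  congr (_ - _ - _).
    apply: pd_near; apply: (near_open oU Uy) => z Uz.
    by rewrite (lip_conf h g0) (tpart_le sF).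
  by apply: eq_bigr => k _; rewrite lxiE.
by apply: eq_bigr => i _; apply: eq_bigr => p _; rewrite !E.
Qed.

Lemma shape_sqr_wfun y : U y -> shape_sqr g h t y <=
  (\sum_i \sum_j \sum_k \sum_l lgi g i k y * lgi g j l y *
     lip G F y (nproj G F g y (lD G F i (le F j) y)) (nproj G F g y (lD G F k (le F l) y))) * w y.
Proof.
move=> Uy; rewrite -lbm_shape// -wfun_lw//.
exact: (shape_sqr_le oU oV sG GP sF UV sg gP gram sX Uy).
Qed.

Variable kappa : R.
Hypothesis curv : forall z, V0 z -> forall u v, row_free (col_mx u v) ->
  sectional_curvature g0 z u v = kappa.
Variable c : R.
Hypothesis soliton : forall y, U y ->
  c *: nproj G F g y (X y) =
  \sum_i \sum_j lgi g i j y *: nproj G F g y (cov G F i (pd j F) y).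

Lemma wfun_identity y : U y -> 2^-1 * lop g h c t w y =
  tr (lgi g) (fun i j => lip G F y (lnperp G F g X i y) (lnperp G F g X j y)) y
  - c * derive1 h (t y) * w y - shape_sqr g h t y +
  (m%:R - 1) * (gradip g t t y * (1 - gradip g t t y)) *
  (derive1 h (t y) ^+ 2 - derive1 (derive1 h) (t y) * h (t y) - kappa).
Proof.
move=> Uy; rewrite -(Rt_warped oI sh h_pos oV0 sg0 g0P oU sF UV sg gP gram curv Uy).
rewrite -lbm_shape// -wfun_lw//.
rewrite -(soliton_identity oU oV sG GP sF UV sg gP gram sX DX soliton Uy).
rewrite /lop /divg !mulrDr !mulr_sumr; congr (_ + _ + _).
- by apply: eq_bigr => i _; rewrite pd_lY.
- by apply: eq_bigr => k _; rewrite lYE// mulrA.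
apply: eq_bigr => k _ /=; rewrite (lxiE k Uy) (pd_w k Uy); move: (pd k w y) (gradv g t k y) (h (t y)) => a b e; ring.
Qed.

Lemma normal_conn_mean i y : U y ->
  nproj G F g y (cov G F i (fun z => \sum_i \sum_j lgi g i j z *:
    nproj G F g z (cov G F i (pd j F) z)) y) = c *: lnperp G F g X i y.
Proof.
move=> Uy; rewrite (lnperpE G F gP X i Uy) -nprojZ; congr (nproj _ _ _ _ _).
have sN : vsmooth U (lN G F g X) by exact: (vsmooth_lN oU oV sG sF UV sg gP sX).
have := covZ G F oU Uy i (smooth_cst U c) sN; rewrite pd_cst scale0r add0r => <-.
by apply: (cov_ext G F oU Uy) => z Uz; rewrite -soliton// (lNE G F gP).
Qed.

End WarpedIdentity.

(** * From coordinates to manifolds *)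

Section GradientProduct.
Context {R : realType} {m : nat}.
Implicit Types (f : 'rV[R]_m -> R) (y : 'rV[R]_m).

Definition drow f y : 'rV[R]_m := \row_i pd i f y.

Lemma gradipE (g : 'rV[R]_m -> 'M[R]_m) f f' y :
  gradip g f f' y = gdot (invmx (g y)) (drow f' y) (drow f y).
Proof.
rewrite gdotE; apply: eq_bigr => k _; rewrite /gradv mulr_suml; apply: eq_bigr => q _.
by rewrite !mxE /lgi mulrC mulrA.
Qed.

Lemma posdef_invmx (G : 'M[R]_m) : posdef G -> posdef (invmx G).
Proof.
move=> GP; split; first exact: posdef_inv.
move=> v v0; have Gu := posdef_unit GP; have vG : v *m invmx G != 0.
  by apply: contraNneq v0 => E; rewrite -(mulmxKV Gu v) E mul0mx.
have := GP.2 _ vG; rewrite /gdot (mulmxKV Gu).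
rewrite trmx_mul posdef_inv// => H.
have -> : v *m invmx G *m v^T = (v *m (invmx G *m v^T))^T.
  by rewrite !trmx_mul trmxK posdef_inv// mulmxA.
by rewrite mxE.
Qed.

End GradientProduct.

Section Manifold.
Context {R : realType} {m : nat} {M : riemData R m} (MR : is_riemannian M).
Let MM := riem_manifold MR.
Implicit Types (a b : chart M) (x : M) (y : 'rV[R]_m) (f : M -> R).

Definition locf f a : 'rV[R]_m -> R := f \o param a.

Lemma paramP a y : chart_im a y -> chart_dom a (param a y) /\ coord a (param a y) = y.
Proof. by move=> [x ax <-]; rewrite (mfd_coordK MM). Qed.

Lemma open_pre a (Q : set M) : open Q -> open [set y | chart_im a y /\ Q (param a y)].
Proof.
move=> oQ; rewrite openE => y [/= ay Qy].
have H1 : \near y, chart_im a y by apply: open_nbhs_nbhs; split => //; exact: (mfd_open_im MM).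
have H2 : \near y, Q (param a y).
  by apply: (mfd_param_cont MM ay); apply: open_nbhs_nbhs.
by rewrite /interior; near=> z; split; near: z.
Unshelve. all: by end_near. Qed.

Definition ovl a b := [set y | chart_im a y /\ chart_dom b (param a y)].

Lemma open_ovl a b : open (ovl a b).
Proof. by apply: open_pre; exact: (mfd_open_dom MM). Qed.

Lemma ovlE a b : coord a @` (chart_dom a `&` chart_dom b) = ovl a b.
Proof.
apply/seteqP; split => [_ [x [ax bx] <-]|y [/paramP[ay E] by_]].
  by split; [exists x|rewrite (mfd_coordK MM)].
by exists (param a y).
Qed.

Lemma ovl_transition a b y : ovl a b y -> chart_im b (transition a b y).
Proof. by move=> [_ H]; exists (param a y). Qed.

Lemma param_transition a b y : ovl a b y -> param b (transition a b y) = param a y.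
Proof. by move=> [_ H]; rewrite /transition/= (mfd_coordK MM). Qed.

Lemma vsmooth_transition a b : vsmooth (ovl a b) (transition a b).
Proof.
move=> l; apply: smooth_on_mx; first exact: open_ovl.
by rewrite -ovlE; exact: (mfd_transition MM).
Qed.

Lemma smooth_metric a i j : smooth (chart_im a) (fun y => metric a y i j).
Proof. by apply: smooth_on_mx; [exact: (mfd_open_im MM)|exact: (riem_smooth MR)]. Qed.

Lemma posdef_metric a y : chart_im a y -> posdef (metric a y).
Proof. by move=> ay; split => [|v]; [exact: (riem_sym MR)|exact: (riem_pos MR)]. Qed.

Lemma metric_transition a b y : ovl a b y -> let J := jac (transition a b) y in
  metric a y = J *m metric b (transition a b y) *m J^T.
Proof.
move=> [/paramP[ay E] H]; have := riem_compat MR ay H; rewrite E /=.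
by rewrite /transition/=.
Qed.

Lemma jac_unit a b y : ovl a b y -> jac (transition a b) y \in unitmx.
Proof.
move=> H; have := posdef_unit (posdef_metric H.1); rewrite (metric_transition H)/=.
by rewrite unitmx_mul => /andP[]; rewrite unitmx_mul => /andP[].
Qed.

Lemma inv_metric a b y : ovl a b y -> let J := jac (transition a b) y in
  invmx (metric b (transition a b y)) = J^T *m invmx (metric a y) *m J.
Proof.
move=> H J; have Ju := jac_unit H; have gu := posdef_unit (posdef_metric (ovl_transition H)).
have JTu : J^T \in unitmx by rewrite unitmx_tr.
have ga := posdef_unit (posdef_metric H.1).
set g' := metric b _ in gu *.
have E : J^T *m invmx (metric a y) *m J *m g' *m J^T = J^T.
  by rewrite -!mulmxA [J *m _]mulmxA -(metric_transition H) mulVmx ?mulmx1.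
have {}E : J^T *m invmx (metric a y) *m J *m g' = 1%:M.
  by rewrite -[LHS](mulmxK JTu) E mulmxV.
by rewrite -[LHS]mul1mx -E mulmxK.
Qed.

Lemma Ck_transition k a b (O : set M) f : open O -> O `<=` chart_dom b ->
  Ck k [set y | chart_im b y /\ O (param b y)] (locf f b) ->
  Ck k [set y | chart_im a y /\ O (param a y)] (locf f a).
Proof.
move=> oO Ob Cf; set Ua := [set y | _]; have oU : open Ua by exact: open_pre.
have Uo y : Ua y -> ovl a b y by move=> [? /Ob].
apply: (@Ck_ext _ _ _ _ (locf f b \o transition a b)) => //.
  by move=> y /Uo H; rewrite /locf/= param_transition.
apply: (Ck_comp oU (open_pre oO) _ _ Cf).
  by move=> y Uy; split; [exact/ovl_transition/Uo|rewrite param_transition; [case: Uy|exact: Uo]].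
by move=> l; exact: Ck_sub Uo (vsmooth_transition a b l k).
Qed.

Lemma pd_transition a b (O : set 'rV[R]_m) f y i : ovl a b y -> open O ->
  O (transition a b y) -> Ck 1 O (locf f b) ->
  pd i (locf f a) y = \sum_l pd i (transition a b) y 0 l * pd l (locf f b) (transition a b y).
Proof.
move=> H oO Oy Cf.
have dT l : derivable (fun y => transition a b y 0 l) y (delta_mx 0 i).
  exact: smooth_der (vsmooth_transition a b l) H.
have := derive_val (is_derive := pd_comp oO Oy Cf dT).
rewrite -/(pd i (locf f b \o transition a b) y) => E.
transitivity (pd i (locf f b \o transition a b) y).
  by apply: pd_near; apply: (near_open (@open_ovl a b) H) => z Hz;
    rewrite /locf/= param_transition.
rewrite E; apply: eq_bigr => l _; congr (_ * _).
exact (esym (pd_rVE i l (@vsmooth_transition a b) H)).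
Qed.

Lemma drow_transition a b (O : set 'rV[R]_m) f y : ovl a b y -> open O ->
  O (transition a b y) -> Ck 1 O (locf f b) ->
  drow (locf f a) y = drow (locf f b) (transition a b y) *m (jac (transition a b) y)^T.
Proof.
move=> H oO Oy Cf; apply/rowP => i; rewrite mxE (pd_transition i H oO Oy Cf) mxE.
by apply: eq_bigr => l _; rewrite !mxE mulrC.
Qed.

Lemma gradip_transition a b (O : set 'rV[R]_m) f f' y : ovl a b y -> open O ->
  O (transition a b y) -> Ck 1 O (locf f b) -> Ck 1 O (locf f' b) ->
  gradip (metric a) (locf f a) (locf f' a) y =
  gradip (metric b) (locf f b) (locf f' b) (transition a b y).
Proof.
move=> H oO Oy Cf Cf'; rewrite !gradipE (drow_transition H oO Oy Cf).
rewrite (drow_transition H oO Oy Cf') (inv_metric H)/= /gdot.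
by rewrite trmx_mul trmxK !mulmxA.
Qed.

End Manifold.

Lemma frame_reparam {R : realType} {m d : nat} (N N' : 'I_m -> 'I_m -> 'rV[R]_d)
    (B J : 'M[R]_m) a b :
  (forall i j, N i j = \sum_k J i k *: \sum_l J j l *: N' k l) ->
  \sum_i B a i *: \sum_j B b j *: N i j =
  \sum_k (B *m J) a k *: \sum_l (B *m J) b l *: N' k l.
Proof.
move=> E; have H (v : 'I_m -> 'rV[R]_d) (a' : 'I_m) :
    \sum_k (B *m J) a' k *: v k = \sum_i B a' i *: \sum_k J i k *: v k.
  under [RHS]eq_bigr do rewrite scaler_sumr.
  rewrite [RHS]exchange_big; apply: eq_bigr => k _; rewrite mxE scaler_suml.
  by apply: eq_bigr => i _; rewrite scalerA.
rewrite [RHS]H; apply: eq_bigr => i _; congr (_ *: _).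
under eq_bigr do rewrite E scaler_sumr.
rewrite exchange_big; apply: eq_bigr => k _; rewrite H scaler_sumr.
by apply: eq_bigr => j _; rewrite scalerA mulrC -scalerA.
Qed.

(** * The second fundamental form under a change of chart of M *)

Section Reparametrization.
Context {R : realType} {m d : nat}.
Variables (U U' : set 'rV[R]_m) (V : set 'rV[R]_d) (G : 'rV[R]_d -> 'M[R]_d).
Variables (F F' : 'rV[R]_m -> 'rV[R]_d) (g g' : 'rV[R]_m -> 'M[R]_m)
  (tr : 'rV[R]_m -> 'rV[R]_m).
Hypotheses (oU : open U) (oU' : open U') (oV : open V).
Hypotheses (sG : forall a b, smooth V (fun z => G z a b))
  (GP : forall z, V z -> posdef (G z)).
Hypotheses (sF' : vsmooth U' F') (UV' : forall y, U' y -> V (F' y)).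
Hypotheses (str : vsmooth U tr) (trU : forall y, U y -> U' (tr y)).
Hypothesis FE : forall y, U y -> F y = F' (tr y).
Hypotheses (gP : forall y, U y -> posdef (g y)) (g'P : forall y, U' y -> posdef (g' y)).
Hypothesis gram' : forall y i j, U' y ->
  gdot (G (F' y)) (pd i F' y) (pd j F' y) = g' y i j.
Hypothesis ginv : forall y, U y ->
  invmx (g' (tr y)) = (jac tr y)^T *m invmx (g y) *m jac tr y.
Let J y i l : R := pd i tr y 0 l.

Let pdF i y : U y -> pd i F y = \sum_l J y i l *: pd l F' (tr y).
Proof.
move=> Uy; rewrite (vpd_ext oU i Uy FE).
exact (vpd_comp i oU oU' sF' str trU Uy).
Qed.

Let jacF y : U y -> jac F y = jac tr y *m jac F' (tr y).
Proof.
move=> Uy; apply/row_matrixP => i; rewrite rowK row_mul rowK pdF// mulmx_sum_row.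
by apply: eq_bigr => l _; rewrite rowK.
Qed.

Lemma nproj_reparam y (A : 'rV[R]_d) : U y -> nproj G F g y A = nproj G F' g' (tr y) A.
Proof.
move=> Uy; rewrite /nproj jacF// ginv// FE// trmx_mul; congr (_ - _).
by rewrite !mulmxA.
Qed.

(** Tensoriality of II: the second derivatives of the transition map multiply tangent vectors d_l
    F', which the normal projection annihilates. *)
Lemma second_reparam i j y : U y -> nproj G F g y (cov G F i (pd j F) y) =
  \sum_k J y i k *: \sum_l J y j l *: nproj G F' g' (tr y) (cov G F' k (pd l F') (tr y)).
Proof.
move=> Uy; have sJ a b : smooth U (fun y => J y a b) by apply: vsmooth_pd => //; exact: str.
have sF l : vsmooth U (fun y => pd l F' (tr y)).
  move=> q; exact: (smooth_compF oU' oU str trU (vsmooth_pd oU' l sF' q)).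
have -> : cov G F i (pd j F) y =
    cov G (fun y => F' (tr y)) i (fun y => \sum_l J y j l *: pd l F' (tr y)) y.
  rewrite /cov (vpd_ext oU i Uy (fun z => @pdF j z)) (vpd_ext oU i Uy FE) FE//.
  by rewrite (pdF j Uy).
rewrite (cov_sum _ _ oU Uy) => [|l]; last exact: (vsmoothZ oU (sJ j l) (sF l)).
under eq_bigr => l _ do rewrite (covZ _ _ oU Uy i (sJ j l) (sF l))
  (cov_comp G oU' oU sF' str trU i (vsmooth_pd oU' l sF') Uy).
rewrite nproj_reparam//.
have np_sum (x : 'I_m -> 'rV[R]_d) : nproj G F' g' (tr y) (\sum_l x l) =
    \sum_l nproj G F' g' (tr y) (x l).
  by elim/big_rec2: _ => [|l u v _ <-]; [rewrite /nproj !mul0mx subr0|rewrite nprojD].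
rewrite np_sum; under eq_bigr => l _.
  rewrite nprojD nprojZ [nproj _ _ _ _ (pd l F' _)](nproj_le GP UV' g'P gram' l (trU Uy)).
  rewrite scaler0 add0r nprojZ np_sum scaler_sumr.
  under eq_bigr => k _ do rewrite nprojZ scalerA mulrC -scalerA.
over.
rewrite exchange_big; apply: eq_bigr => k _; rewrite scaler_sumr.
by apply: eq_bigr.
Qed.

Let II (g : 'rV[R]_m -> 'M[R]_m) F y := \sum_i \sum_j \sum_k \sum_l
  invmx (g y) i k * invmx (g y) j l * gdot (G (F y))
    (nproj G F g y (cov G F i (pd j F) y)) (nproj G F g y (cov G F k (pd l F) y)).

(** An orthonormal frame B in one chart becomes B J in the other, and the two sums of squares over
    these frames have the same summands by [frame_reparam]. *)
Lemma II_reparam y : U y -> II g F y = II g' F' (tr y).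
Proof.
move=> Uy; have [B /frame_inv gB] := posdef_frame (gP Uy).
have g'B : invmx (g' (tr y)) = (B *m jac tr y)^T *m (B *m jac tr y).
  by rewrite ginv// gB trmx_mul !mulmxA.
pose N i j := nproj G F g y (cov G F i (pd j F) y).
pose N' i j := nproj G F' g' (tr y) (cov G F' i (pd j F') (tr y)).
apply: etrans (II_frame G F N gB) _; apply: etrans (esym (II_frame G F' N' g'B)).
apply: eq_bigr => b _; apply: eq_bigr => a _.
have lipE u : lip G F y u u = lip G F' (tr y) u u.
  by change (gdot (G (F y)) u u = gdot (G (F' (tr y))) u u); rewrite FE.
rewrite lipE; apply: (congr1 (fun u => lip G F' (tr y) u u)).
apply: frame_reparam => i j; apply: etrans (second_reparam i j Uy) _.
by apply: eq_bigr => k _; rewrite mxE; congr (_ *: _); apply: eq_bigr => l _; rewrite mxE.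
Qed.

End Reparametrization.

(** * The soliton identity on the charts of M and its consequences *)

Section SolitonOnManifold.
Context {R : realType} {m n : nat} (I : set R) (oI : open I).
Context (h : R -> R) (sh : smooth_fun_on I h) (h_pos : forall t, I t -> 0 < h t).
Context (P : riemData R n) (PR : is_riemannian P) (M : riemData R m) (MR : is_riemannian M).
Context (psi : M -> warped I h P) (c kappa : R)
  (psi_soliton : mcf_soliton psi (conformal_field (I:=I) (h:=h) (P:=P)) c)
  (P_curv : constant_sectional_curvature P kappa).
Implicit Types (a : chart M) (b : chart P) (x : M) (y : 'rV[R]_m).

Definition height x : R := (psi x).1.
Let hc x : R := c * derive1 h (height x).
Hypothesis kappa_le : forall x, kappa <=
  derive1 h (height x) ^+ 2 - derive1 (derive1 h) (height x) * h (height x).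
Hypothesis II_le : forall x, hc x + II2 psi x <= 0.

Let imm : is_isometric_immersion psi := psi_soliton.1.
Let MM := riem_manifold MR.
Let PM := riem_manifold PR.

(** A chart of the warped product is a chart of P, but with other domains and coordinates; [sol_dom]
    and [sol_rep] fix this reading of b. *)
Definition sol_dom a b : set 'rV[R]_m := @local_dom _ _ _ M (warped I h P) psi a b.
Definition sol_rep a b : 'rV[R]_m -> 'rV[R]_(1 + n) :=
  @local_rep _ _ _ M (warped I h P) psi a b.

Lemma sol_domE a b : sol_dom a b = [set y | chart_im a y /\
  (psi @^-1` @chart_dom _ _ (warped I h P) b) (param a y)].
Proof.
apply/seteqP; split => [_ [x [ax bx] <-]|y [/(paramP MR)[ay E] bx]].
  by split; [exists x|rewrite (mfd_coordK MM)].
by exists (param a y).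
Qed.

Lemma open_warped_dom b : open (@chart_dom _ _ (warped I h P) b).
Proof.
have -> : @chart_dom _ _ (warped I h P) b =
    (fst @^-1` I) `&` (snd @^-1` chart_dom b) :> set (R * P) by [].
apply: openI; apply: open_comp => //.
- by move=> z _; exact: cvg_fst.
- by move=> z _; exact: cvg_snd.
- exact: (mfd_open_dom PM).
Qed.

Lemma open_sol_dom a b : open (sol_dom a b).
Proof.
rewrite sol_domE; apply: (open_pre MR).
apply: open_comp; last exact: open_warped_dom.
by move=> x _; exact: (imm_cont imm).
Qed.

Lemma sol_dom_im a b y : sol_dom a b y -> chart_im a y.
Proof. by rewrite sol_domE => -[]. Qed.

Lemma vsmooth_sol_rep a b : vsmooth (sol_dom a b) (sol_rep a b).
Proof. by move=> l; apply: smooth_on_mx; [exact: open_sol_dom|exact: (imm_smooth imm)]. Qed.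

Lemma tpart_sol a b : tpart (sol_rep a b) = locf height a.
Proof.
by apply/funext => y; rewrite /tpart/= row_mxKl mxE eqxx mulr1n.
Qed.

Lemma sol_Vw a b y : sol_dom a b y -> Vw I (chart_im b) (sol_rep a b y).
Proof.
rewrite sol_domE => -[_ /= [It bx]]; split.
  by rewrite /sol_rep/= row_mxKl mxE eqxx mulr1n.
by rewrite /sol_rep/= row_mxKr; exists (psi (param a y)).2.
Qed.

Lemma sol_gram a b y i j : sol_dom a b y ->
  gdot (wm h (metric b) (sol_rep a b y)) (pd i (sol_rep a b) y) (pd j (sol_rep a b) y) =
  metric a y i j.
Proof.
move=> Uy; have /= <- := imm_isometric imm Uy.
rewrite /gdot -!(rowK (fun i => pd i (sol_rep a b) y)) -/(jac (sol_rep a b) y).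
rewrite [RHS]mxE [LHS]mxE; apply: eq_bigr => k _; congr (_ * _); last by rewrite !mxE.
by rewrite -row_mul mxE.
Qed.

Definition psi_chart x : chart P := chart_at (psi x).2.

Lemma psi_chartP x : I (height x) /\ chart_dom (psi_chart x) (psi x).2.
Proof.
have [b [It bx]] := imm_range imm x; split => //.
exact: (mfd_cover PM).
Qed.

Lemma sol_domP a y : chart_im a y -> sol_dom a (psi_chart (param a y)) y.
Proof. by rewrite sol_domE => ay; split => //; exact: psi_chartP. Qed.

Lemma smooth_height a : smooth (chart_im a) (locf height a).
Proof.
move=> k; apply: Ck_local => y ay; exists (sol_dom a (psi_chart (param a y))); split.
- exact: open_sol_dom.
- exact: sol_domP.
by rewrite -(tpart_sol a (psi_chart (param a y))); exact: (smooth_tpart (@vsmooth_sol_rep _ _)).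
Qed.

Let sg0 b i j : smooth (chart_im b) (fun z => metric b z i j).
Proof. exact: (smooth_metric PR). Qed.
Let g0P b (z : 'rV[R]_n) : chart_im b z -> posdef (metric b z).
Proof. exact: (posdef_metric PR). Qed.
Let sg a b i j : smooth (sol_dom a b) (fun y => metric a y i j).
Proof. by move=> k; apply: Ck_sub (smooth_metric MR a i j k) => y; exact: sol_dom_im. Qed.
Let gP a b y : sol_dom a b y -> posdef (metric a y).
Proof. by move=> /sol_dom_im; exact: (posdef_metric MR). Qed.
Let oP b : open (chart_im b). Proof. exact: (mfd_open_im PM). Qed.
Let curv b z : chart_im b z -> forall u v, row_free (col_mx u v) ->
  sectional_curvature (metric b) z u v = kappa.
Proof. by move=> bz u v; exact: (P_curv bz). Qed.
Let sol a b y : sol_dom a b y ->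
  c *: nproj (wm h (metric b)) (sol_rep a b) (metric a) y (conf h (sol_rep a b) y) =
  \sum_i \sum_j lgi (metric a) i j y *: nproj (wm h (metric b)) (sol_rep a b) (metric a) y
    (cov (wm h (metric b)) (sol_rep a b) i (pd j (sol_rep a b)) y).
Proof. exact: psi_soliton.2. Qed.

(** As [wfun] involves only the height and the metric of M, this is defined on the whole image of a
    chart of M, not just on the pieces [sol_dom a b]. Every statement about it can still be proved
    on such a piece around a given point. *)
Definition wloc a : 'rV[R]_m -> R := wfun (metric a) h (locf height a).
Definition wsol x : R := wloc (chart_at x) (coord (chart_at x) x).

Let oM a : open (chart_im a). Proof. exact: (mfd_open_im MM). Qed.

Lemma wsolE a y : chart_im a y -> wsol (param a y) = wloc a y.
Proof.
move=> ay; set x := param a y; set a' := chart_at x.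
have H : ovl a a' y by split => //; exact: (mfd_cover MM).
rewrite /wsol -/a' -[coord a' x]/(transition a a' y) /wloc /wfun.
rewrite (gradip_transition MR H (@oM a') (ovl_transition H) (@smooth_height a' 1%N) (@smooth_height a' 1%N)).
by rewrite {1}/locf/= (param_transition MR H).
Qed.

Lemma smooth_wloc a : smooth (chart_im a) (wloc a).
Proof.
move=> k; apply: Ck_local => y ay; exists (sol_dom a (psi_chart (param a y))); split.
- exact: open_sol_dom.
- exact: sol_domP.
rewrite /wloc -(tpart_sol a (psi_chart (param a y))).
exact: (smooth_wfun oI sh h_pos (@oP _) (@sg0 _) (@g0P _) (@open_sol_dom _ _)
  (@vsmooth_sol_rep _ _) (@sol_Vw _ _) (@sg _ _) (@gP _ _) (@sol_gram _ _)).
Qed.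

Lemma wloc_ge0 a y : chart_im a y -> 0 <= wloc a y.
Proof.
move=> /sol_domP Uy; rewrite /wloc -(tpart_sol a (psi_chart (param a y))).
exact: (wfun_ge0 h_pos (@g0P _) (@vsmooth_sol_rep _ _) (@sol_Vw _ _) (@gP _ _) (@sol_gram _ _)).
Qed.

Let T a b y := tr (lgi (metric a)) (fun i j => lip (wm h (metric b)) (sol_rep a b) y
  (lnperp (wm h (metric b)) (sol_rep a b) (metric a) (conf h (sol_rep a b)) i y)
  (lnperp (wm h (metric b)) (sol_rep a b) (metric a) (conf h (sol_rep a b)) j y)) y.
Let sn a y := gradip (metric a) (locf height a) (locf height a) y.
Definition Lsol a y := lop (metric a) h c (locf height a) (wloc a) y.

Lemma Lsol_identity a b y : sol_dom a b y -> 2^-1 * Lsol a y =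
  T a b y - c * derive1 h (locf height a y) * wloc a y
  - shape_sqr (metric a) h (locf height a) y +
  (m%:R - 1) * (sn a y * (1 - sn a y)) *
  (derive1 h (locf height a y) ^+ 2
    - derive1 (derive1 h) (locf height a y) * h (locf height a y) - kappa).
Proof.
move=> Uy; rewrite /Lsol /sn /wloc -(tpart_sol a b).
exact: (wfun_identity oI sh h_pos (@oP _) (@sg0 _) (@g0P _) (@open_sol_dom _ _)
  (@vsmooth_sol_rep _ _) (@sol_Vw _ _) (@sg _ _) (@gP _ _) (@sol_gram _ _) (@curv _) (@sol _ _) Uy).
Qed.

Lemma T_ge0 a b y : sol_dom a b y -> 0 <= T a b y.
Proof.
move=> Uy; apply: (tr_lip_ge0 (V := Vw I (chart_im b)) _ (@sol_Vw a b) (@gP a b)) => //.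
exact: (wm_posdef h_pos (@g0P b)).
Qed.

Lemma grad_wloc_le a b y : sol_dom a b y ->
  gradip (metric a) (wloc a) (wloc a) y <= 4 * wloc a y * T a b y.
Proof.
move=> Uy; rewrite /wloc -(tpart_sol a b).
exact: (grad_wfun_le oI sh h_pos (@oP _) (@sg0 _) (@g0P _) (@open_sol_dom _ _)
  (@vsmooth_sol_rep _ _) (@sol_Vw _ _) (@sg _ _) (@gP _ _) (@sol_gram _ _) Uy).
Qed.

Lemma second_ff_sqr_chart a a' b y : ovl a a' y -> sol_dom a b y ->
  @second_ff_sqr _ _ _ M (warped I h P) psi a b y =
  @second_ff_sqr _ _ _ M (warped I h P) psi a' b (transition a a' y).
Proof.
move=> H Uy; pose W := sol_dom a b `&` ovl a a'.
have oW : open W by apply: openI; [exact: open_sol_dom|exact: (open_ovl MR)].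
have trU z : W z -> sol_dom a' b (transition a a' z).
  move=> [Uz Hz]; rewrite sol_domE; split; first exact: (ovl_transition Hz).
  by move: Uz; rewrite sol_domE (param_transition MR Hz) => -[].
have FE z : W z -> sol_rep a b z = sol_rep a' b (transition a a' z).
  by move=> [_ [_ Hz]]; rewrite /sol_rep/= (mfd_coordK MM Hz).
have str : vsmooth W (transition a a').
  by move=> l k; apply: Ck_sub (vsmooth_transition MR a a' l k) => z [].
exact: (II_reparam oW (@open_sol_dom a' b) (wm_posdef h_pos (@g0P b)) (@vsmooth_sol_rep a' b)
  (@sol_Vw a' b) str trU FE (fun z Wz => gP Wz.1) (@gP a' b) (@sol_gram a' b)
  (fun z Wz => inv_metric MR Wz.2) (conj Uy H)).
Qed.

(** [II2] is evaluated in preferred charts, whereas the identity for L w is stated in an arbitrary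
    chart of M; this connects them. *)
Lemma II2_chart a y : chart_im a y -> II2 psi (param a y) =
  @second_ff_sqr _ _ _ M (warped I h P) psi a (psi_chart (param a y)) y.
Proof.
move=> ay; have H : ovl a (chart_at (param a y)) y by split => //; exact: (mfd_cover MM).
by rewrite (second_ff_sqr_chart H (sol_domP ay)).
Qed.

Lemma shape_sqr_wloc a y : chart_im a y ->
  shape_sqr (metric a) h (locf height a) y <= II2 psi (param a y) * wloc a y.
Proof.
move=> ay; rewrite (II2_chart ay) /wloc -(tpart_sol a (psi_chart (param a y))).
exact: (shape_sqr_wfun oI sh h_pos (@oP _) (@sg0 _) (@g0P _) (@open_sol_dom _ _)
  (@vsmooth_sol_rep _ _) (@sol_Vw _ _) (@sg _ _) (@gP _ _) (@sol_gram _ _) (sol_domP ay)).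
Qed.

Lemma sn_bounds a y : chart_im a y -> 0 <= sn a y <= 1.
Proof.
move=> /sol_domP Uy; rewrite /sn -(tpart_sol a (psi_chart (param a y))); apply/andP; split.
  exact: (s_ge0 (sol_rep a (psi_chart (param a y))) (@gP _ _) Uy).
exact: (s_le1 h_pos (@g0P _) (@vsmooth_sol_rep _ _) (@sol_Vw _ _) (@gP _ _) (@sol_gram _ _) Uy).
Qed.

Let Rterm a y := (m%:R - 1) * (sn a y * (1 - sn a y)) *
  (derive1 h (locf height a y) ^+ 2
    - derive1 (derive1 h) (locf height a y) * h (locf height a y) - kappa).

Let Rterm_ge0 a y : chart_im a y -> 0 <= Rterm a y.
Proof.
move=> ay; have /andP[s0 s1] := sn_bounds ay.
rewrite /Rterm; apply: mulr_ge0; last by rewrite subr_ge0; exact: kappa_le.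
(* In dimension 0 the factor m - 1 is negative, but there |grad t|^2 is an empty sum. *)
have [m0|m0] := posnP m.
  rewrite (_ : sn a y = 0) ?mul0r ?mulr0// /sn /gradip big1// => k _.
  by have := ltn_ord k; rewrite {2}m0.
by rewrite mulr_ge0 ?mulr_ge0 ?subr_ge0// ler1n.
Qed.

(** The chain is shape_sqr <= |II|^2 w <= - c h' w, the second inequality being the pointwise
    hypothesis times w >= 0. *)
Let slack a y : chart_im a y ->
  0 <= - c * derive1 h (locf height a y) * wloc a y - shape_sqr (metric a) h (locf height a) y.
Proof.
move=> ay; rewrite subr_ge0; apply: le_trans (shape_sqr_wloc ay) _.
rewrite ler_wpM2r ?wloc_ge0//.
by have := II_le (param a y); rewrite /hc addrC -lerBrDr sub0r mulNr.
Qed.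

Lemma T_le_Lsol a b y : sol_dom a b y -> T a b y <= 2^-1 * Lsol a y.
Proof.
move=> Uy; have ay := sol_dom_im Uy; rewrite (Lsol_identity Uy) -/(Rterm a y).
have := slack ay; have := Rterm_ge0 ay; rewrite !mulNr.
move: (T _ _ _) (Rterm _ _) (shape_sqr _ _ _ _) (c * _ * _) => u v w z; lra.
Qed.

Lemma Lsol_ge a y : chart_im a y -> 0 <= Lsol a y /\
  gradip (metric a) (wloc a) (wloc a) y <= 2 * wloc a y * Lsol a y.
Proof.
move=> ay; have Uy := sol_domP ay; have H := T_le_Lsol Uy; have T0 := T_ge0 Uy.
have w0 := wloc_ge0 ay.
split; first by move: H T0; move: (T _ _ _) (Lsol _ _) => u v; lra.
apply: le_trans (grad_wloc_le Uy) _.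
have -> : 2 * wloc a y * Lsol a y = 4 * wloc a y * (2^-1 * Lsol a y).
  by move: (wloc _ _) (Lsol _ _) => u v; field.
by rewrite ler_wpM2l// mulr_ge0.
Qed.

Lemma Lsol0_parallel a b i y : sol_dom a b y -> Lsol a y = 0 ->
  @normal_conn _ _ _ M (warped I h P) psi a b i (@mean_curv _ _ _ M (warped I h P) psi a b) y = 0.
Proof.
move=> Uy L0; have := T_le_Lsol Uy; rewrite L0 mulr0 => Tle.
have T0 : T a b y = 0 by apply: le_anti; rewrite Tle T_ge0.
apply: etrans (normal_conn_mean oI sh (@oP _) (@sg0 _) (@open_sol_dom _ _)
  (@vsmooth_sol_rep _ _) (@sol_Vw _ _) (@sg _ _) (@gP _ _) (@sol _ _) i Uy) _.
have E := tr_lip_eq0 (V := Vw I (chart_im b)) (wm_posdef h_pos (@g0P b)) (@sol_Vw a b)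
  (@gP a b) i Uy T0.
by rewrite E scaler0.
Qed.

Lemma c0_parallel a b i y : c = 0 -> sol_dom a b y ->
  @normal_conn _ _ _ M (warped I h P) psi a b i (@mean_curv _ _ _ M (warped I h P) psi a b) y = 0.
Proof.
move=> c0 Uy.
apply: etrans (normal_conn_mean oI sh (@oP _) (@sg0 _) (@open_sol_dom _ _)
  (@vsmooth_sol_rep _ _) (@sol_Vw _ _) (@sg _ _) (@gP _ _) (@sol _ _) i Uy) _.
by rewrite c0 scale0r.
Qed.

(** A vanishing L w forces equality throughout shape_sqr <= |II|^2 w <= - c h' w, and the positive
    factor w can be cancelled. *)
Lemma Lsol0_II a y : chart_im a y -> Lsol a y = 0 -> 0 < wloc a y ->
  II2 psi (param a y) = - hc (param a y).
Proof.
move=> ay L0 w0; have Uy := sol_domP ay.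
have := Lsol_identity Uy; rewrite L0 mulr0 -/(Rterm a y) => E.
have := T_ge0 Uy; have := Rterm_ge0 ay; have := shape_sqr_wloc ay.
have := II_le (param a y) => H1 H2 H3 H4.
have E1 : c * derive1 h (locf height a y) * wloc a y = hc (param a y) * wloc a y by [].
rewrite E1 in E; apply/eqP; rewrite -addr_eq0; apply/eqP; apply: le_anti.
rewrite addrC H1/= -(pmulr_lge0 _ w0) mulrDl.
move: E H2 H3 H4; move: (hc _ * _) (II2 _ _ * _) (T _ _ _) (Rterm _ _) (shape_sqr _ _ _ _).
by move=> u v w z s; lra.
Qed.

Lemma wsol_norm a b y : sol_dom a b y -> gdot (wm h (metric b) (sol_rep a b y))
  (nproj (wm h (metric b)) (sol_rep a b) (metric a) y (conf h (sol_rep a b) y))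
  (nproj (wm h (metric b)) (sol_rep a b) (metric a) y (conf h (sol_rep a b) y)) = wloc a y.
Proof.
move=> Uy; rewrite /wloc -(tpart_sol a b).
apply: etrans (lwE h_pos (@g0P b) (@vsmooth_sol_rep a b) (@sol_Vw a b) (@gP a b) (@sol_gram a b) Uy).
by rewrite /lw /ww -(lNE _ _ (@gP a b) _ Uy).
Qed.

Lemma norm_mean_curvE x : norm_mean_curv psi x ^+ 2 = c ^+ 2 * wsol x.
Proof.
set a := chart_at x; have ax := mfd_cover MM x.
have ay : chart_im a (coord a x) by exists x.
have Uy : sol_dom a (psi_chart x) (coord a x).
  by rewrite -{1}(mfd_coordK MM ax); exact: sol_domP.
have -> : wsol x = wloc a (coord a x) by [].
rewrite -(wsol_norm Uy).
have E : norm_mean_curv psi x = Num.sqrt (c ^+ 2 * gdot (wm h (metric (psi_chart x))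
   (sol_rep a (psi_chart x) (coord a x)))
  (nproj (wm h (metric (psi_chart x))) (sol_rep a (psi_chart x)) (metric a) (coord a x)
     (conf h (sol_rep a (psi_chart x)) (coord a x)))
  (nproj (wm h (metric (psi_chart x))) (sol_rep a (psi_chart x)) (metric a) (coord a x)
     (conf h (sol_rep a (psi_chart x)) (coord a x)))).
  rewrite /norm_mean_curv -/a; congr (Num.sqrt _).
  have -> : @mean_curv _ _ _ M (warped I h P) psi a (chart_at (psi x)) (coord a x) =
    c *: nproj (wm h (metric (psi_chart x))) (sol_rep a (psi_chart x)) (metric a) (coord a x)
     (conf h (sol_rep a (psi_chart x)) (coord a x)) by rewrite (sol Uy).
  rewrite gdotZl gdotZr mulrA -expr2 (_ : sol_rep _ _ (coord a x) =
    @coord _ _ (warped I h P) (psi_chart x) (psi x)); first by [].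
  by rewrite /sol_rep /local_rep/= (mfd_coordK MM ax).
rewrite E sqr_sqrtr// mulr_ge0 ?sqr_ge0//; apply: posdef_ge0.
exact: (wm_posdef h_pos (@g0P _) (sol_Vw Uy)).
Qed.

Lemma wsol0_mean a b y : sol_dom a b y -> wloc a y = 0 ->
  @mean_curv _ _ _ M (warped I h P) psi a b y = 0.
Proof.
move=> Uy w0; apply: etrans (esym (sol Uy)) _.
have := wsol_norm Uy; rewrite w0; set v := nproj _ _ _ _ _ => E.
have [->|/(wm_posdef h_pos (@g0P b) (sol_Vw Uy)).2] := eqVneq v 0; first by rewrite scaler0.
by rewrite E ltxx.
Qed.

End SolitonOnManifold.

(** * The divergence theorem in a chart *)

Section UniformOnCompacts.
Context {R : realType} {m : nat}.
Implicit Types (K : set 'rV[R]_m) (y z : 'rV[R]_m).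

Lemma near_dist y (d : R) : 0 < d -> \forall z \near y, `|z - y| < d.
Proof. by move=> d0; apply/nbhs_normP; exists d => // z; rewrite /= distrC. Qed.

(** A Lebesgue number argument for a relation. Near y the local hypothesis lets both arguments move,
    so half its radius works for every centre y' close to y. *)
Lemma compact_uniform K (Q : 'rV[R]_m -> 'rV[R]_m -> Prop) : compact K ->
  (forall y, K y -> exists2 r : R, 0 < r &
     forall y' z, `|y' - y| < r -> `|z - y| < r -> Q y' z) ->
  exists2 r : R, 0 < r & forall y z, K y -> `|z - y| < r -> Q y z.
Proof.
move=> /compact_near_coveringP cK H.
have {}H : \forall r \near (0 : R)^'+, K `<=` (fun y => forall z, `|z - y| < r -> Q y z).
  apply: cK => y /H[r r0 yQ].
  near=> y' s => z zy'.
  have yy' : `|y' - y| < r / 2.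
    by near: y'; apply: near_dist; lra.
  have sr : s < r / 2 by near: s; apply: nbhs_right_lt; lra.
  apply: yQ; first by apply: lt_le_trans yy' _; lra.
  rewrite -(subrK y' z) -addrA; apply: le_lt_trans (ler_normD _ _) _.
  by rewrite [ltRHS](splitr r); apply: ltrD => //; exact: lt_trans zy' sr.
near (0 : R)^'+ => r; exists r; first by near: r; exact: nbhs_right_gt.
by move=> y z Ky; have : K `<=` (fun y => forall z, `|z - y| < r -> Q y z); [near: r|exact].
Unshelve. all: by end_near. Qed.

Lemma compact_ucont K (f : 'rV[R]_m -> R) e : compact K ->
  (forall y, K y -> {for y, continuous f}) -> 0 < e ->
  exists2 r : R, 0 < r & forall y z, K y -> `|z - y| < r -> `|f z - f y| < e.
Proof.
move=> cK cf e0; apply: (compact_uniform (Q := fun y z => `|f z - f y| < e)) => // y Ky.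
have e20 : 0 < e / 2 by lra.
have [d d0 dP] := contP (cf y Ky) e20; exists d => // y' z yy' zy.
rewrite -(subrK (f y) (f z)) -addrA; apply: le_lt_trans (ler_normD _ _) _.
by rewrite [ltRHS](splitr e); apply: ltrD; [exact: dP|rewrite distrC; exact: dP].
Qed.

Lemma compact_fbounded K (f : 'rV[R]_m -> R) : compact K ->
  (forall y, K y -> {for y, continuous f}) ->
  exists2 B : R, 0 < B & forall y, K y -> `|f y| <= B.
Proof.
move=> /compact_near_coveringP cK cf.
have H : \forall B \near +oo%R, K `<=` (fun y => `|f y| <= B).
  apply: cK => y /cf/contP/(_ _ ltr01)[d d0 dP]; near=> y' B.
  have yy' : `|y' - y| < d.
    by near: y'; exact: near_dist.
  have BE : `|f y| + 1 <= B by near: B; apply: nbhs_pinfty_ge; rewrite num_real.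
  have := dP _ yy' => H; apply: le_trans BE; rewrite -(subrK (f y) (f y')) addrC.
  by apply: le_trans (ler_normD _ _) _; rewrite lerD2l ltW.
near (+oo%R : set_system R) => B; exists B; first by near: B; exact: nbhs_pinfty_gt.
by near: B.
Unshelve. all: by end_near. Qed.

Lemma open_uniform K (V : set 'rV[R]_m) : compact K -> open V -> K `<=` V ->
  exists2 r : R, 0 < r & forall y z, K y -> `|z - y| < r -> V z.
Proof.
move=> cK oV KV; apply: (compact_uniform (Q := fun _ => V)) => // y /KV Vy.
by have [d d0 dP] := open_ball_sub oV Vy; exists d => // y' z _; exact: dP.
Qed.

Lemma cball_compact (L : R) : compact [set y : 'rV[R]_m | `|y| <= L].
Proof.
apply: bounded_closed_compact.
  exists L; split; first by rewrite num_real.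
  by move=> B LB y /= yL; apply: le_trans yL _; exact: ltW.
have -> : [set y : 'rV[R]_m | `|y| <= L] = (fun y : 'rV[R]_m => `|y|) @^-1` [set x | x <= L] by [].
apply: closed_comp; last exact: closed_le.
by move=> y _; exact: norm_continuous.
Qed.

End UniformOnCompacts.

(** * Iterated integrals and cubes *)

Section IteratedIntegral.
Context {R : realType}.

(** The integral of a nonnegative function is a supremum over the simple functions below it, so
    monotonicity holds without measurability. This is the form that an induction through the inner
    integrals of [rV_integral] calls for. *)
Lemma ge0_integral_mono (f1 f2 : R -> \bar R) :
  (forall t, (0 <= f1 t)%E) -> (forall t, (f1 t <= f2 t)%E) ->
  (\int[lebesgue_measure]_(t in [set: R]) f1 t <=
   \int[lebesgue_measure]_(t in [set: R]) f2 t)%E.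
Proof.
move=> f0 f12; rewrite !ge0_integralTE => [|t|t]; rewrite ?f0//.
  apply: le_ereal_sup => _ [h hf <-]; exists h => // t; apply: le_trans (hf t) _; exact: f12.
exact: le_trans (f12 t).
Qed.

Lemma rV_integral_ge0 m (f : 'rV[R]_m -> \bar R) : (forall y, (0 <= f y)%E) ->
  (0 <= rV_integral f)%E.
Proof.
elim: m f => [|m IH] f f0 /=; first exact: f0.
by apply: integral_ge0 => t _; apply: IH.
Qed.

Lemma rV_integral_mono m (f1 f2 : 'rV[R]_m -> \bar R) :
  (forall y, (0 <= f1 y)%E) -> (forall y, (f1 y <= f2 y)%E) ->
  (rV_integral f1 <= rV_integral f2)%E.
Proof.
elim: m f1 f2 => [|m IH] f1 f2 f0 f12 /=; first exact: f12.
apply: ge0_integral_mono => t; first exact: rV_integral_ge0.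
exact: IH.
Qed.

(** Half-open, so that the cubes of a grid are disjoint and leave no gaps. *)
Definition cube m (p : 'rV[R]_m) (e : R) : set 'rV[R]_m :=
  [set y | forall i, p 0 i <= y 0 i < p 0 i + e].

Lemma cube_row m (p : 'rV[R]_(1 + m)) (e t : R) (y : 'rV[R]_m) :
  cube p e (row_mx (t%:M : 'rV[R]_1) y) <->
  `[p 0 ord0, p 0 ord0 + e[%classic t /\ cube (rsubmx p) e y.
Proof.
have E : ord0 = lshift m (0 : 'I_1) by apply/val_inj.
split => [H|[]]; last rewrite /= in_itv/= => tJ H i.
  split; last by move=> i; have := H (rshift 1 i); rewrite row_mxEr mxE.
  by rewrite /= in_itv/= E; have := H (lshift m 0); rewrite row_mxEl mxE eqxx mulr1n.
have [j ->|j ->] := split_ordP i.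
  by rewrite row_mxEl mxE ord1 eqxx mulr1n -E.
by rewrite row_mxEr; have := H j; rewrite mxE.
Qed.

Lemma rV_integral_cube m (p : 'rV[R]_m) (e c : R) : 0 < e -> 0 <= c ->
  rV_integral (fun y => (c * \1_(cube p e) y)%:E) = (c * e ^+ m)%:E.
Proof.
move=> e0; elim: m p c => [|m IH] p c c0.
  by rewrite /= indicE mem_set ?mulr1// => -[].
rewrite /=; pose J : set R := `[p 0 ord0, p 0 ord0 + e[%classic.
pose p' : 'rV[R]_m := rsubmx (p : 'rV[R]_(1 + m)).
have E t (y : 'rV[R]_m) :
    \1_(cube p e) (row_mx (t%:M : 'rV[R]_1) y) = \1_J t * \1_(cube p' e) y :> R.
  rewrite !indicE; have H := cube_row p e t y.
  have [tJ|tJ] := pselect (J t); last first.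
    by rewrite [in RHS](memNset tJ) mul0r memNset// => /H[].
  rewrite [in RHS](mem_set tJ) mul1r; congr (_%:R); congr (nat_of_bool _).
  by apply/idP/idP; rewrite !inE => ?; [have /H[] : cube p e (row_mx (t%:M : 'rV[R]_1) y)|apply/H].
under eq_integral => t _.
  rewrite (_ : (fun y => _) = fun y : 'rV[R]_m => (c * \1_J t * \1_(cube p' e) y)%:E).
    rewrite IH; last by rewrite mulr_ge0.
    rewrite mulrAC; over.
  by apply/funext => y; rewrite E mulrA.
transitivity ((c * e ^+ m)%:E * \int[lebesgue_measure]_(t in [set: R]) (\1_J t)%:E)%E.
  apply: (@integralZl_indic _ _ _ lebesgue_measure setT measurableT (fun=> J)).
    by rewrite ltNge mulr_ge0// exprn_ge0// ltW.
  exact: measurable_itv.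
have LJ : lebesgue_measure J = e%:E.
  rewrite /J lebesgue_measure_itv/= lte_fin ltrDl e0 -EFinB; congr EFin.
  by rewrite addrC addKr.
transitivity ((c * e ^+ m)%:E * lebesgue_measure J)%E; last first.
  by rewrite LJ -EFinM exprSr mulrA.
by rewrite integral_indic ?setIT//; exact: measurable_itv.
Qed.

End IteratedIntegral.

Section GridSums.
Context {R : realType} {m : nat} (L : R) (L0 : 0 < L).
Implicit Types (W : 'rV[R]_m -> R) (y : 'rV[R]_m).

Definition mesh (N : nat) : R := 2 * L / N.+1%:R.
(** The lower corner of the z-th of the N.+1 cells per axis into which [-L, L) is cut. *)
Definition gridpt N (z : {ffun 'I_m -> 'I_N.+1}) : 'rV[R]_m :=
  \row_i (- L + mesh N * (z i)%:R).

Lemma mesh_gt0 N : 0 < mesh N.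
Proof. by rewrite divr_gt0// ?mulr_gt0// ltr0n. Qed.

Lemma mesh_lt (r : R) : 0 < r -> exists N, mesh N < r.
Proof.
move=> r0; exists (Num.bound (2 * L / r)); rewrite /mesh ltr_pdivrMr ?ltr0n//.
rewrite [ltRHS]mulrC -ltr_pdivrMr//; apply: lt_trans (archi_boundP _) _.
  by rewrite divr_ge0 ?mulr_ge0 ?ltW.
by rewrite ltr_nat.
Qed.

Lemma mesh_card N : \sum_(z : {ffun 'I_m -> 'I_N.+1}) mesh N ^+ m = (2 * L) ^+ m.
Proof.
rewrite sumr_const card_ffun !card_ord -[LHS]mulr_natr [X in _ * X]natrX -exprMn.
by rewrite divfK ?pnatr_eq0.
Qed.

Lemma gridpt_norm N z : `|gridpt (N := N) z| <= L.
Proof.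
apply: rV_norm_le => [|i]; first exact: ltW.
rewrite mxE ler_norml; have h0 := mesh_gt0 N.
have zN : mesh N * (z i)%:R <= 2 * L.
  rewrite -[leRHS](divfK (_ : N.+1%:R != 0)) ?pnatr_eq0// -/(mesh N).
  by rewrite ler_pM2l// ler_nat ltnW.
have : 0 <= mesh N * (z i)%:R by rewrite mulr_ge0// ltW.
by move: zN; lra.
Qed.

(** A cyclic shift by one cell permutes the grid. It differs from the translation only where the
    index wraps around, and there the points compared have i-th coordinate L and -L, so W vanishes
    at both. *)
Lemma sum_shift W N i : (forall y, L <= `|y| -> W y = 0) ->
  \sum_z W (gridpt (N := N) z + mesh N *: delta_mx 0 i) = \sum_z W (gridpt (N := N) z).
Proof.
move=> W0.
pose sh (z : {ffun 'I_m -> 'I_N.+1}) := [ffun j => if j == i then ordS (z j) else z j].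
pose sh' (z : {ffun 'I_m -> 'I_N.+1}) := [ffun j => if j == i then ord_pred (z j) else z j].
have shK : cancel sh sh'.
  by move=> z; apply/ffunP => j; rewrite !ffunE; case: eqP => // _; rewrite ordSK.
have shK' : cancel sh' sh.
  by move=> z; apply/ffunP => j; rewrite !ffunE; case: eqP => // _; rewrite ord_predK.
rewrite [RHS](reindex sh)/=; last by exists sh' => z _.
apply: eq_bigr => z _; have [zN|zN] := ltnP (z i).+1 N.+1.
  congr W; apply/rowP => j; rewrite !mxE ffunE eqxx/=; case: eqP => [->|_].
    by rewrite /= modn_small// -[X in _ = _ + _ * X]natr1 mulrDr addrA.
  by rewrite mulr0 addr0.
have zE : (z i).+1 = N.+1 by apply/eqP; rewrite eqn_leq zN ltn_ord.
rewrite !W0//.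
  apply: le_trans (rV_norm_coord _ i); rewrite mxE ffunE eqxx /= zE modnn mulr0 addr0.
  by rewrite normrN gtr0_norm.
apply: le_trans (rV_norm_coord _ i); rewrite !mxE !eqxx /= mulr1 -addrA.
have -> : mesh N * (z i)%:R + mesh N = 2 * L.
  rewrite -[X in _ + X]mulr1 -mulrDr natr1 zE divfK// pnatr_eq0//.
by apply: le_trans (ler_norm _); lra.
Qed.

(* discrete divergence theorem: the difference quotients sum to zero *)
Lemma grid_divergence W i d : Ck 1 setT W -> (forall y, L <= `|y| -> W y = 0) -> 0 < d ->
  exists2 r : R, 0 < r & forall N, mesh N < r ->
    `|\sum_z mesh N ^+ m * pd i W (gridpt (N := N) z)| <= (2 * L) ^+ m * d.
Proof.
move=> CW W0 d0.
have cpd y : {for y, continuous (pd i W)} by exact: (Ck_cont (Ck_pd i CW)).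
have [r r0 rP] := compact_ucont (@cball_compact R m L) (fun y _ => cpd y) d0.
exists r => // N hr; have h0 := mesh_gt0 N.
have key z : `|mesh N * pd i W (gridpt (N := N) z) -
    (W (gridpt z + mesh N *: delta_mx 0 i) - W (gridpt z))| <= mesh N * d.
  have dW s : `|s| <= `|mesh N| -> derivable W (gridpt z + s *: delta_mx 0 i) (delta_mx 0 i).
    by move=> _; exact: (Ck_der CW).
  have [s sh ->] := line_MVT dW.
  rewrite [X in _ - X]mulrC -mulrBr normrM gtr0_norm// ler_pM2l//.
  rewrite distrC ltW// rP//; first exact: gridpt_norm.
  rewrite addrC addKr normrZ; apply: le_lt_trans hr.
  have sN : `|s| <= mesh N by rewrite -[leRHS](gtr0_norm h0).
  by apply: le_trans _ sN; rewrite ler_piMr// norm_delta.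
have S0 : \sum_z (W (gridpt (N := N) z + mesh N *: delta_mx 0 i) - W (gridpt z)) = 0.
  by rewrite sumrB sum_shift// subrr.
rewrite -(mesh_card N) mulr_suml.
have -> : \sum_z mesh N ^+ m * pd i W (gridpt (N := N) z) =
    \sum_z mesh N ^+ m / mesh N * (mesh N * pd i W (gridpt (N := N) z) -
      (W (gridpt (N := N) z + mesh N *: delta_mx 0 i) - W (gridpt (N := N) z))).
  under [RHS]eq_bigr do rewrite mulrBr.
  rewrite sumrB -[X in _ - X]mulr_sumr S0 mulr0 subr0; apply: eq_bigr => z _.
  by rewrite mulrA divfK// gt_eqF.
apply: le_trans (ler_norm_sum _ _ _) _; apply: ler_sum => z _.
rewrite normrM ger0_norm; last by rewrite mulr_ge0 ?exprn_ge0 ?invr_ge0 ?ltW.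
apply: le_trans (ler_wpM2l _ (key z)) _; first by rewrite mulr_ge0 ?exprn_ge0 ?invr_ge0 ?ltW.
by rewrite mulrA divfK// gt_eqF.
Qed.

Lemma grid_cover N y : `|y| < L -> exists z, cube (gridpt (N := N) z) (mesh N) y.
Proof.
move=> yL; have h0 := mesh_gt0 N.
have yi i : - L < y 0 i < L.
  by rewrite -ltr_norml; exact: le_lt_trans (rV_norm_coord y i) yL.
have q0 i : 0 <= (y 0 i + L) / mesh N.
  by rewrite divr_ge0 ?(ltW h0)//; have := yi i; lra.
pose q i := Num.truncn ((y 0 i + L) / mesh N).
have qP i : (q i)%:R <= (y 0 i + L) / mesh N < (q i).+1%:R.
  by have := truncn_itv (q0 i).
have qN i : (q i < N.+1)%N.
  rewrite -(ltr_nat R); have /andP[H _] := qP i; apply: le_lt_trans H _.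
  rewrite ltr_pdivrMr// /mesh mulrC divfK ?pnatr_eq0//.
  by have := yi i; lra.
exists [ffun i => Ordinal (qN i)] => i; rewrite mxE ffunE /=.
have /andP[H1 H2] := qP i; move: H1 H2; rewrite ler_pdivlMr// ltr_pdivrMr// -natr1.
by move=> H1 H2; apply/andP; split; move: H1 H2; rewrite ?mulrDl ?mul1r ![_ * mesh N]mulrC; lra.
Qed.

Lemma cube_disjoint N z z' y : cube (gridpt (N := N) z) (mesh N) y ->
  cube (gridpt (N := N) z') (mesh N) y -> z = z'.
Proof.
have h0 := mesh_gt0 N.
have le z1 z2 i : cube (gridpt (N := N) z1) (mesh N) y ->
    cube (gridpt (N := N) z2) (mesh N) y -> (z1 i <= z2 i)%N.
  move=> /(_ i)/andP[H1 _] /(_ i)/andP[_ H2].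
  have := le_lt_trans H1 H2; rewrite !mxE -addrA ltrD2l -[X in _ + X]mulr1 -mulrDr.
  by rewrite ltr_pM2l// natr1 ltr_nat.
by move=> H H'; apply/ffunP => i; apply/val_inj/eqP; rewrite eqn_leq !le.
Qed.

Lemma cube_dist N z y : cube (gridpt (N := N) z) (mesh N) y ->
  forall y', cube (gridpt (N := N) z) (mesh N) y' -> `|y' - y| <= mesh N.
Proof.
move=> H y' H'; apply: rV_norm_le => [|i]; first exact/ltW/mesh_gt0.
by rewrite !mxE ler_norml; have := H i; have := H' i; lra.
Qed.

Lemma cube_gridpt N z : cube (gridpt (N := N) z) (mesh N) (gridpt z).
Proof. by move=> i; rewrite lexx ltrDl mesh_gt0. Qed.

End GridSums.

Section BorelMeasurability.
Context {R : realType} {T : ptopologicalType}.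

Lemma open_borel (A : set T) : open A -> measurable (A : set (borel T)).
Proof. by move=> oA; apply: sub_sigma_algebra. Qed.

Lemma continuous_borel (f : T -> R) : continuous f ->
  measurable_fun [set: borel T] (f : borel T -> R).
Proof.
move=> /continuousP cf; apply: (measurability _ (RGenOpens.measurableE R)).
move=> _ [_ [a [b ->] <-]]; rewrite setTI.
by apply: open_borel; apply: cf; exact: interval_open.
Qed.

End BorelMeasurability.

Section VolumeOfCubes.
Context {R : realType} {m : nat} {M : riemData R m} (MR : is_riemannian M).
Variables (dM : {measure set (borel M) -> \bar R}) (dM_vol : is_riemannian_volume dM).
Implicit Types (a : chart M) (x : M) (y : 'rV[R]_m).
Let MM := riem_manifold MR.

Definition coord_pre a (V : set 'rV[R]_m) : set M :=
  [set x | chart_dom a x /\ V (coord a x)].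

Lemma open_coord_pre a V : open V -> open (coord_pre a V).
Proof.
move=> oV; rewrite openE => x [ax Vx].
have H1 : \near x, chart_dom a x by apply: open_nbhs_nbhs; split => //; exact: (mfd_open_dom MM).
have H2 : \near x, V (coord a x).
  by apply: (mfd_coord_cont MM ax); apply: open_nbhs_nbhs.
by rewrite /interior; near=> z; split; near: z.
Unshelve. all: by end_near. Qed.

Lemma coord_pre_im a V : V `<=` chart_im a -> coord a @` coord_pre a V = V.
Proof.
move=> Va; apply/seteqP; split => [_ [x [_ Vx] <-]//|y Vy].
have [ay E] := paramP MR (Va y Vy); exists (param a y) => //.
by split; rewrite ?E.
Qed.

(** Each pair of bounds defines a difference of two open half-spaces, whose preimages in the chart
    domain are open. *)
Lemma measurable_coord_cube a (p : 'rV[R]_m) (e : R) :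
  measurable (coord_pre a (cube p e) : set (borel M)).
Proof.
have -> : coord_pre a (cube p e) = chart_dom a `&` \bigcap_(i in [set: 'I_m])
    (coord_pre a [set y | y 0 i < p 0 i + e] `\` coord_pre a [set y | y 0 i < p 0 i]).
  apply/seteqP; split => [x [ax Q]|x [ax Q]]; split => //.
    move=> i _; have /andP[H1 H2] := Q i; split; first by split.
    by move=> [_ /=]; rewrite ltNge H1.
  move=> i; have [[_ H1] H2] := Q i Logic.I; rewrite [X in _ && X]H1 andbT leNgt.
  by apply/negP => H; apply: H2.
have oi i (r : R) : open [set y : 'rV[R]_m | y 0 i < r].
  have -> : [set y : 'rV[R]_m | y 0 i < r] = (fun y : 'rV[R]_m => y 0 i) @^-1` [set t | t < r] by [].
  apply: open_comp; last exact: open_lt.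
  by move=> y _; exact: coord_continuous.
apply: measurableI; first by apply: open_borel; exact: (mfd_open_dom MM).
apply: fin_bigcap_measurable => [|i _]; first exact: finite_finset.
by apply: measurableD; apply: open_borel; exact (open_coord_pre a (oi _ _)).
Qed.

(** The density is squeezed between the constants s - d and s + d, for which the iterated integral
    of the cube is explicit. This is where the description of [dM] by iterated integrals is put to
    use; afterwards only volumes of cubes are needed. *)
Lemma volume_cube a (p : 'rV[R]_m) (e s d : R) : 0 < e -> 0 <= s -> 0 <= d ->
  cube p e `<=` chart_im a ->
  (forall y, cube p e y -> `|Num.sqrt (\det (metric a y)) - s| <= d) ->
  exists2 v : R, dM (coord_pre a (cube p e)) = v%:E & `|v - s * e ^+ m| <= d * e ^+ m.
Proof.
(* Clipped at 0 because [rV_integral_mono] and [rV_integral_cube] are about nonnegative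
   functions. *)
move=> e0 s0 d0 pa H; pose lo := Num.max 0 (s - d).
have lo0 : 0 <= lo by rewrite le_max lexx.
have em : 0 <= e ^+ m by rewrite exprn_ge0 ?ltW.
have E : dM (coord_pre a (cube p e)) = rV_integral (fun y : 'rV[R]_m =>
    (\1_(cube p e) y * Num.sqrt (\det (metric a y)))%:E).
  by rewrite (dM_vol (a := a)) ?coord_pre_im//; [exact: measurable_coord_cube|move=> x []].
have H1 : ((lo * e ^+ m)%:E <= dM (coord_pre a (cube p e)))%E.
  rewrite E -(rV_integral_cube p e0 lo0); apply: rV_integral_mono => y.
    by rewrite lee_fin mulr_ge0.
  rewrite lee_fin indicE; have [yp|yp] := boolP (y \in _); last by rewrite mulr0 mul0r.
  rewrite mulr1 mul1r ge_max sqrtr_ge0/=.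
  by have := H y (set_mem yp); rewrite ler_norml; lra.
have H2 : (dM (coord_pre a (cube p e)) <= ((s + d) * e ^+ m)%:E)%E.
  rewrite E -(rV_integral_cube p e0 (addr_ge0 s0 d0)); apply: rV_integral_mono => y.
    by rewrite lee_fin mulr_ge0// sqrtr_ge0.
  rewrite lee_fin indicE; have [yp|yp] := boolP (y \in _); last by rewrite mulr0 mul0r.
  by rewrite mulr1 mul1r; have := H y (set_mem yp); rewrite ler_norml; lra.
move: H1 H2; case: (dM _) => [v| |]//=; rewrite !lee_fin => H1 H2.
exists v => //; rewrite ler_norml; apply/andP; split; last by move: H2; rewrite mulrDl; lra.
have : (s - d) * e ^+ m <= v.
  by apply: le_trans H1; rewrite ler_wpM2r// le_max lexx orbT.
by rewrite mulrBl; lra.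
Qed.

End VolumeOfCubes.

Section ChartDivergence.
Context {R : realType} {m : nat} {M : riemData R m} (MR : is_riemannian M).
Variables (dM : {measure set (borel M) -> \bar R}) (dM_vol : is_riemannian_volume dM).
Variables (a : chart M) (K : set 'rV[R]_m) (W : 'I_m -> 'rV[R]_m -> R).
Hypotheses (cK : compact K) (KV : K `<=` chart_im a).
Hypotheses (CW : forall i, Ck 1 setT (W i)) (WK : forall i y, ~ K y -> W i y = 0).
Implicit Types (x : M) (y : 'rV[R]_m).
Let MM := riem_manifold MR.

Definition vol a y : R := Num.sqrt (\det (@metric _ _ M a y)).
(** The [W i] are the components of a vector field already multiplied by its volume density, so
    their Euclidean divergence divided by [vol] is the divergence with respect to [dM]. *)
Definition cdiv y : R := (\sum_i pd i (W i) y) / vol a y.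
Definition mdiv x : R := \1_(chart_dom a) x * cdiv (coord a x).

Lemma vol_gt0 b y : chart_im b y -> 0 < vol b y.
Proof. by move=> by_; rewrite sqrtr_gt0; apply: posdef_det; exact: (posdef_metric MR). Qed.

Let oV : open (chart_im a). Proof. exact: (mfd_open_im MM). Qed.

Lemma vol_cont b y : chart_im b y -> {for y, continuous (vol b)}.
Proof.
move=> by_; have sd : smooth (chart_im b) (fun y => \det (metric b y)).
  move=> k; apply: Ck_det => [|i j]; first exact: (mfd_open_im MM).
  exact: (smooth_metric MR).
by apply: continuous_comp; [exact: smooth_cont sd by_|exact: sqrt_continuous].
Qed.

Let cdivW_cont y : {for y, continuous (fun y => \sum_i pd i (W i) y)}.
Proof.
have : Ck 0 setT (fun y => \sum_i pd i (W i) y).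
  by apply: Ck_sum => [|i _]; [exact: openT|exact: Ck_pd (CW i)].
by move=> /Ck_cont; apply.
Qed.

Let cdivW0 y : ~ K y -> \sum_i pd i (W i) y = 0.
Proof.
move=> Ky; rewrite big1// => i _.
have oK : open (~` K) by rewrite openC; apply: compact_closed cK; exact: norm_hausdorff.
transitivity (pd i (fun=> 0 : R) y); last by rewrite pd_cst.
by apply: pd_near; apply: (near_open oK Ky) => z; exact: WK.
Qed.

Lemma cdiv0 y : ~ K y -> cdiv y = 0.
Proof. by move=> Ky; rewrite /cdiv cdivW0// mul0r. Qed.

Lemma cdiv_cont y : chart_im a y -> {for y, continuous cdiv}.
Proof.
move=> ay; apply: continuousM; first exact: cdivW_cont.
by apply: continuousV; [rewrite gt_eqF// vol_gt0|exact: vol_cont].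
Qed.

Lemma mdiv_dom x : chart_dom a x -> mdiv x = cdiv (coord a x).
Proof. by move=> ax; rewrite /mdiv indicE mem_set// mul1r. Qed.

Lemma param_compact : compact (param a @` K).
Proof.
apply: continuous_compact cK; apply: continuous_in_subspaceT => y yK.
by apply: (mfd_param_cont MM); apply: KV; exact: set_mem yK.
Qed.

Lemma mdiv0 x : ~ (param a @` K) x -> mdiv x = 0.
Proof.
move=> H; rewrite /mdiv indicE; have [ax|ax] := boolP (x \in _); last by rewrite mul0r.
rewrite cdiv0 ?mulr0// => Kx; apply: H; exists (coord a x) => //.
by rewrite (mfd_coordK MM)//; exact: set_mem ax.
Qed.

Lemma mdiv_cont : continuous mdiv.
Proof.
move=> x; have [ax|ax] := pselect (chart_dom a x).
  apply: (@continuous_near _ _ (cdiv \o coord a)).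
    by apply: (near_open (mfd_open_dom MM a) ax) => z az; rewrite mdiv_dom.
  apply: continuous_comp; first exact: (mfd_coord_cont MM).
  by apply: cdiv_cont; exists x.
have H : ~ (param a @` K) x.
  by move=> [y /KV/(paramP MR)[ay _] E]; apply: ax; rewrite -E.
have oK : open (~` (param a @` K)).
  by rewrite openC; apply: compact_closed param_compact; exact: (mfd_hausdorff MM).
apply: (@continuous_near _ _ (fun=> 0 : R)); last exact: cst_continuous.
by apply: (near_open oK H) => z Hz; rewrite mdiv0.
Qed.

Section AtScale.
Variables (L B S d r : R) (N : nat).
Hypotheses (L0 : 0 < L) (d0 : 0 < d) (d1 : d <= 1) (B0 : 0 <= B) (S0 : 0 <= S).
Hypotheses (KL : forall y, K y -> `|y| < L) (Nr : mesh L N < r).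
Hypotheses (rV : forall y z, K y -> `|z - y| < r -> chart_im a z)
  (rf : forall y z, K y -> `|z - y| < r -> `|cdiv z - cdiv y| < d)
  (rv : forall y z, K y -> `|z - y| < r -> `|vol a z - vol a y| < d)
  (rD : forall y z, K y -> `|z - y| < r ->
     `|\sum_i pd i (W i) z - \sum_i pd i (W i) y| < d)
  (fB : forall y, K y -> `|cdiv y| <= B) (vS : forall y, K y -> `|vol a y| <= S).
Let e := mesh L N.
Let Q (z : {ffun 'I_m -> 'I_N.+1}) := cube (gridpt L z) e.
Let A z : set (borel M) := coord_pre a (Q z).
Let e0 : 0 < e. Proof. exact: mesh_gt0. Qed.

Let mA z : measurable (A z). Proof. exact: (measurable_coord_cube MR). Qed.

Let near_r z y y' : Q z y -> Q z y' -> `|y' - y| < r.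
Proof. by move=> zy zy'; exact: le_lt_trans (cube_dist L0 zy zy') Nr. Qed.

Let mk : measurable_fun [set: borel M] (mdiv : borel M -> R).
Proof. exact: continuous_borel mdiv_cont. Qed.

Let vol_A z y : K y -> Q z y ->
  exists2 v : R, dM (A z) = v%:E & `|v - vol a y * e ^+ m| <= d * e ^+ m.
Proof.
move=> Ky zy; apply: (volume_cube MR dM_vol e0 (sqrtr_ge0 _) (ltW d0)).
- by move=> y' zy'; apply: rV Ky _; exact: near_r zy zy'.
- by move=> y' zy'; apply/ltW/rv => //; exact: near_r zy zy'.
Qed.

Let k_A z y x : K y -> Q z y -> A z x -> `|mdiv x - cdiv y| < d.
Proof. by move=> Ky zy [ax zx]; rewrite mdiv_dom//; apply: rf => //; exact: near_r zy zx. Qed.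

Let int_A z y : K y -> Q z y -> dM.-integrable (A z) (EFin \o mdiv).
Proof.
move=> Ky zy; apply: measurable_bounded_integrable => //.
- by have [v -> _] := vol_A Ky zy; exact: ltry.
- exact: measurable_funTS.
exists (B + d); split; first by rewrite num_real.
move=> b Bb x Ax; apply/ltW; apply: le_lt_trans Bb.
rewrite -(subrK (cdiv y) (mdiv x)); apply: le_trans (ler_normD _ _) _.
by rewrite addrC lerD ?fB// ltW// (k_A Ky zy).
Qed.

Let I_A z := \int[dM]_(x in A z) mdiv x.

(** A cube that misses K contributes 0 on both sides. Otherwise take y in K and in the cube and let
    v be the volume. The oscillation of [mdiv] costs d v <= d (S + 1) e^m, replacing v by vol(y) e^m
    costs B d e^m, and passing from y to the corner of the cube costs d e^m; the sum is d (S + B +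
    2) e^m. *)
Let I_approx z : `|I_A z - e ^+ m * \sum_i pd i (W i) (gridpt L z)| <=
  e ^+ m * (d * (S + B + 2)).
Proof.
have em : 0 <= e ^+ m by rewrite exprn_ge0 ?ltW.
have [[y [Ky zy]]|H] := pselect (exists y, K y /\ Q z y); last first.
  rewrite cdivW0 ?mulr0 ?subr0; last first.
    by move=> Kp; apply: H; exists (gridpt L z); split => //; exact: cube_gridpt.
  rewrite /I_A (_ : Rintegral _ _ _ = 0); first by rewrite normr0 mulr_ge0// mulr_ge0 ?(ltW d0)// !addr_ge0.
  rewrite /Rintegral integral0_eq// => x [ax zx]; rewrite mdiv_dom// cdiv0// => Kx.
  by apply: H; exists (coord a x).
have [v vE vP] := vol_A Ky zy; have intk := int_A Ky zy.
have v0 : 0 <= v by rewrite -lee_fin -vE measure_ge0.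
have intc (c : R) : dM.-integrable (A z) (EFin \o cst c).
  apply: measurable_bounded_integrable => //; first by rewrite [dM _]vE ltry.
  by exists `|c|; split; [rewrite num_real|move=> b cb x _; exact: ltW].
have H1 : (cdiv y - d) * v <= I_A z.
  have := Rintegral_cst dM (mA z) (cdiv y - d); rewrite [X in fine X]vE /= => <-.
  apply: le_Rintegral => // [|x Ax]; first exact: intc.
  by have := k_A Ky zy Ax; rewrite ltr_norml; lra.
have H2 : I_A z <= (cdiv y + d) * v.
  have := Rintegral_cst dM (mA z) (cdiv y + d); rewrite [X in fine X]vE /= => <-.
  apply: le_Rintegral => // [|x Ax]; first exact: intc.
  by have := k_A Ky zy Ax; rewrite ltr_norml; lra.
have H3 : `|I_A z - cdiv y * v| <= d * v.
  by rewrite ler_norml; move: H1 H2; rewrite !mulrDl mulNr; lra.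
have H4 : `|cdiv y * v - e ^+ m * \sum_i pd i (W i) y| <= B * (d * e ^+ m).
  have -> : cdiv y * v - e ^+ m * \sum_i pd i (W i) y = cdiv y * (v - vol a y * e ^+ m).
    rewrite mulrBr mulrA /cdiv divfK; first by rewrite [e ^+ m * _]mulrC.
    by rewrite gt_eqF// vol_gt0//; exact: KV.
  by rewrite normrM; apply: ler_pM => //; exact: fB.
have H5 : `|e ^+ m * \sum_i pd i (W i) y - e ^+ m * \sum_i pd i (W i) (gridpt L z)| <=
    e ^+ m * d.
  rewrite -mulrBr normrM ger0_norm// ler_wpM2l// distrC ltW// rD//.
  by apply: near_r zy _; exact: cube_gridpt.
have H6 : v <= (S + 1) * e ^+ m.
  have := vS Ky; rewrite ger0_norm ?sqrtr_ge0// => Sv.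
  have : vol a y * e ^+ m <= S * e ^+ m by rewrite ler_wpM2r.
  have : d * e ^+ m <= 1 * e ^+ m by rewrite ler_wpM2r.
  by move: vP; rewrite ler_norml mulrDl; lra.
have H7 : d * v <= d * ((S + 1) * e ^+ m) by rewrite ler_pM2l.
have := ler_normD (I_A z - cdiv y * v) (cdiv y * v - e ^+ m * \sum_i pd i (W i) (gridpt L z)).
have := ler_normD (cdiv y * v - e ^+ m * \sum_i pd i (W i) y)
  (e ^+ m * \sum_i pd i (W i) y - e ^+ m * \sum_i pd i (W i) (gridpt L z)).
rewrite !subrKA => T1 T2.
have -> : e ^+ m * (d * (S + B + 2)) = d * ((S + 1) * e ^+ m) + (B * (d * e ^+ m) + e ^+ m * d).
  by ring.
by apply: le_trans T2 _; apply: lerD; [exact: le_trans H7|apply: le_trans T1 _; exact: lerD].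
Qed.

Let s := [seq z <- enum {ffun 'I_m -> 'I_N.+1} | `[< exists y, K y /\ Q z y >]].
Let D : set (borel M) := \big[setU/set0]_(z <- s) A z.

Let sP z : z \in s -> exists y, K y /\ Q z y.
Proof. by rewrite mem_filter => /andP[/asboolP]. Qed.

Let mD : measurable D. Proof. by apply: bigsetU_measurable. Qed.

Let finD : (dM D < +oo)%E.
Proof.
rewrite /D; move: sP; elim: s => [|z s' IH] sP'.
  by rewrite big_nil measure0.
have mU : measurable (\big[setU/set0]_(z <- s') A z) by apply: bigsetU_measurable.
rewrite big_cons; apply: (le_lt_trans (measureU2 dM (mA z) mU)).
apply: lte_add_pinfty; last by apply: IH => z' z's; apply: sP'; rewrite inE z's orbT.
have [|y [Ky zy]] := sP' z; first by rewrite inE eqxx.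
by have [v vE _] := vol_A Ky zy; rewrite [X in (X < _)%E]vE; exact: ltry.
Qed.

Let cover_K x : mdiv x != 0 -> D x.
Proof.
move=> kx; have ax : chart_dom a x.
  apply: contrapT => ax; move: kx; rewrite /mdiv indicE memNset ?mul0r ?eqxx//.
have Kx : K (coord a x).
  by apply: contrapT => Kx; move: kx; rewrite mdiv_dom// cdiv0// eqxx.
have [z zx] := grid_cover L0 N (KL Kx).
rewrite /D -bigcup_seq; exists z => /=; last by split.
by rewrite mem_filter mem_enum andbT; apply/asboolP; exists (coord a x).
Qed.

Let mdivD : (EFin \o mdiv) \_ D = EFin \o mdiv.
Proof.
apply/funext => x; rewrite patchE; case: ifPn => // xD.
have [/= ->//|/cover_K Dx] := eqVneq (mdiv x) 0.
by move: xD; rewrite notin_setE.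
Qed.

Lemma integrable_mdiv_scale : dM.-integrable [set: borel M] (EFin \o mdiv).
Proof.
rewrite -mdivD; apply/(integrable_mkcond _ mD).
apply: measurable_bounded_integrable; [exact: mD|exact: finD|exact: measurable_funTS mk|].
exists (B + d); split; first by rewrite num_real.
move=> b Bb x _; apply/ltW; apply: le_lt_trans Bb.
have [->|kx] := eqVneq (mdiv x) 0; first by rewrite normr0 addr_ge0// ltW.
have := cover_K kx; rewrite /D -bigcup_seq => -[z /sP[y [Ky zy]] Ax].
rewrite -(subrK (cdiv y) (mdiv x)); apply: le_trans (ler_normD _ _) _.
by rewrite addrC lerD ?fB// ltW// (k_A Ky zy).
Qed.

Lemma Rintegral_mdiv_scale :
  `|\int[dM]_x mdiv x - \sum_z e ^+ m * \sum_i pd i (W i) (gridpt (N := N) L z)| <=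
  (2 * L) ^+ m * (d * (S + B + 2)).
Proof.
have -> : \int[dM]_x mdiv x = \sum_(z <- s) I_A z.
  rewrite /Rintegral -[X in integral _ _ X]mdivD -integral_mkcond.
  rewrite integral_bigsetU_EFin//.
  - rewrite (_ : (\sum_(z <- s) _)%E = (\sum_(z <- s) I_A z)%:E)// -sumEFin.
    apply: eq_big_seq => z zs; have [y [Ky zy]] := sP zs.
    by rewrite /I_A /Rintegral fineK//; apply: integrable_fin_num => //; exact: int_A Ky zy.
  - by rewrite filter_uniq// enum_uniq.
  - move=> z z' _ _ [x [[_ H] [_ H']]]; exact: cube_disjoint H H'.
  - exact/measurable_EFinP/measurable_funTS.
have E : \sum_z e ^+ m * \sum_i pd i (W i) (gridpt (N := N) L z) =
    \sum_(z <- s) e ^+ m * \sum_i pd i (W i) (gridpt L z).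
  rewrite big_filter -big_enum /= [RHS]big_mkcond; apply: eq_bigr => z _.
  case: asboolP => // H; rewrite cdivW0 ?mulr0// => Kp; apply: H.
  by exists (gridpt L z); split => //; exact: cube_gridpt.
rewrite E -sumrB; apply: le_trans (ler_norm_sum _ _ _) _.
apply: (@le_trans _ _ (\sum_(z <- s) e ^+ m * (d * (S + B + 2)))).
  by apply: ler_sum => z _; exact: I_approx.
rewrite -(@mesh_card R m L N) mulr_suml big_filter -[leRHS]big_enum /= big_mkcond.
apply: ler_sum => z _; case: asboolP => // _.
by rewrite mulr_ge0 ?exprn_ge0 ?(ltW e0)// mulr_ge0 ?(ltW d0)// !addr_ge0.
Qed.

End AtScale.

(* dM is given on chart cubes, so the integral is compared with Riemann sums over
   grids, for which the divergence theorem is summation by parts. *)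
Lemma integral_mdiv : dM.-integrable [set: borel M] (EFin \o mdiv) /\
  \int[dM]_x mdiv x = 0.
Proof.
have [L' L'0 L'P] := compact_fbounded cK (fun y _ => @norm_continuous _ _ y).
pose L := L' + 1; have L0 : 0 < L by rewrite /L; lra.
have KL y : K y -> `|y| < L by move=> /L'P; rewrite normr_id /L; lra.
have [B B0 BP] := compact_fbounded cK (fun y Ky => cdiv_cont (KV Ky)).
have [S S0 SP] := compact_fbounded cK (fun y Ky => vol_cont (KV Ky)).
have W0 i y : L <= `|y| -> W i y = 0.
  by move=> Ly; apply: WK => /KL; rewrite ltNge Ly.
have main d : 0 < d -> d <= 1 -> dM.-integrable [set: borel M] (EFin \o mdiv) /\
    `|\int[dM]_x mdiv x| <= d * ((2 * L) ^+ m * (S + B + 2 + m%:R)).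
  move=> d0 d1.
  have [r1 r10 r1P] := open_uniform cK oV KV.
  have [r2 r20 r2P] := compact_ucont cK (fun y Ky => cdiv_cont (KV Ky)) d0.
  have [r3 r30 r3P] := compact_ucont cK (fun y Ky => vol_cont (KV Ky)) d0.
  have [r4 r40 r4P] := compact_ucont cK (fun y _ => @cdivW_cont y) d0.
  have [r5 r50 r5P] : exists2 r : R, 0 < r & forall N, mesh L N < r -> forall i,
      `|\sum_z mesh L N ^+ m * pd i (W i) (gridpt (N := N) L z)| <= (2 * L) ^+ m * d.
    have H : \forall r \near (0 : R)^'+, forall i N, mesh L N < r ->
        `|\sum_z mesh L N ^+ m * pd i (W i) (gridpt (N := N) L z)| <= (2 * L) ^+ m * d.
      apply: filter_forall => i; have [r r0 rP] := grid_divergence L0 i (CW i) (W0 i) d0.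
      near=> r' => N Nr'; apply: rP; apply: lt_le_trans Nr' _.
      by near: r'; exact: nbhs_right_le.
    near (0 : R)^'+ => r; exists r; first by near: r; exact: nbhs_right_gt.
    by move=> N Nr i; have := near H r; apply.
  pose r := Num.min (Num.min r1 r2) (Num.min r3 (Num.min r4 r5)).
  have r0 : 0 < r by rewrite !lt_min r10 r20 r30 r40 r50.
  have [N Nr] := mesh_lt L0 r0.
  have le_r r' z : r <= r' -> z < r -> z < r' by move=> h1 h2; exact: lt_le_trans h2 h1.
  have [l1 l2 l3 l4 l5] : [/\ r <= r1, r <= r2, r <= r3, r <= r4 & r <= r5].
    by rewrite /r !ge_min !lexx !orbT.
  have rV y z : K y -> `|z - y| < r -> chart_im a z.
    by move=> Ky /(le_r _ _ l1); exact: r1P.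
  have rf y z : K y -> `|z - y| < r -> `|cdiv z - cdiv y| < d.
    by move=> Ky /(le_r _ _ l2); exact: r2P.
  have rv y z : K y -> `|z - y| < r -> `|vol a z - vol a y| < d.
    by move=> Ky /(le_r _ _ l3); exact: r3P.
  have rD y z : K y -> `|z - y| < r ->
     `|\sum_i pd i (W i) z - \sum_i pd i (W i) y| < d.
    by move=> Ky /(le_r _ _ l4); exact: r4P.
  split.
    exact: (integrable_mdiv_scale L0 d0 (ltW B0) KL Nr rV rf rv BP).
  have H := Rintegral_mdiv_scale L0 d0 d1 (ltW B0) (ltW S0) KL Nr rV rf rv rD BP SP.
  have {}r5P := r5P _ (le_r _ _ l5 Nr).
  have H2 : `|\sum_z mesh L N ^+ m * \sum_i pd i (W i) (gridpt (N := N) L z)| <=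
      (2 * L) ^+ m * d * m%:R.
    under eq_bigr do rewrite mulr_sumr.
    rewrite exchange_big /=; apply: le_trans (ler_norm_sum _ _ _) _.
    rewrite -[X in _ * X%:R](card_ord m) mulr_natr -sumr_const.
    by apply: ler_sum => i _; exact: r5P.
  rewrite -(subrK (\sum_z mesh L N ^+ m * \sum_i pd i (W i) (gridpt (N := N) L z))
    (\int[dM]_x mdiv x)).
  apply: le_trans (ler_normD _ _) _.
  have -> : d * ((2 * L) ^+ m * (S + B + 2 + m%:R)) =
    (2 * L) ^+ m * (d * (S + B + 2)) + (2 * L) ^+ m * d * m%:R by ring.
  exact: lerD.
split; first by have [] := main 1 ltr01 (lexx _).
apply/eqP; rewrite -normr_le0; apply/ler_addgt0Pr => e e0; rewrite add0r.
pose C := (2 * L) ^+ m * (S + B + 2 + m%:R).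
have C0 : 0 <= C.
  rewrite mulr_ge0 ?exprn_ge0 ?mulr_ge0 ?ltW//.
  by have := ler0n R m; move: S0 B0; lra.
pose d := Num.min 1 (e / (C + 1)).
have C1 : 0 < C + 1 by lra.
have d0 : 0 < d by rewrite lt_min ltr01 divr_gt0.
have [|_ H] := main d d0; first by rewrite ge_min lexx.
apply: le_trans H _; rewrite -/C.
apply: (@le_trans _ _ (e / (C + 1) * (C + 1))); last by rewrite divfK// gt_eqF.
by apply: ler_pM => //; [exact: ltW|rewrite ge_min lexx orbT|lra].
Unshelve. all: by end_near. Qed.

End ChartDivergence.

(** * Cutoff functions on complete manifolds *)

Section SmoothRamp.
Context {R : realType}.
Implicit Types t l : R.

(** A quadratic remainder valid for all increments can be checked for piecewise quadratic functions
    by case distinction and real arithmetic, with no gluing of one-sided derivatives. *)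
Lemma is_derive_quad {V : normedModType R} (f : V -> R) (t v : V) l (C : R) :
  (forall e : R, `|f (t + e *: v) - f t - l * e| <= C * e ^+ 2) -> is_derive t v f l.
Proof.
move=> H; have C0 : 0 <= C.
  by have := le_trans (normr_ge0 _) (H 1); rewrite expr1n mulr1.
have L : (fun e : R => e^-1 *: ((f \o shift t) (e *: v) - f t)) @ 0^' --> l.
  apply/cvgrPdist_le => /= r r0; near=> e.
  have e0 : e != 0 by near: e; exact: nbhs_dnbhs_neq.
  have Ce : C * `|e| <= r.
    apply: (@le_trans _ _ (C * (r / (C + 1)))).
      rewrite ler_wpM2l//; near: e; apply: dnbhs0_le; rewrite divr_gt0//; lra.
    rewrite mulrA ler_pdivrMr; last lra.
    by have := ltW r0; nra.
  rewrite distrC.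
  have -> : e^-1 *: (f (e *: v + t) - f t) - l = e^-1 * (f (t + e *: v) - f t - l * e).
    by rewrite [e *: v + t]addrC mulrBr [l * e]mulrC mulKf.
  rewrite normrM; apply: le_trans (ler_wpM2l (normr_ge0 _) (H e)) _.
  by rewrite normfV -(real_normK (num_real e)) expr2 mulrCA mulKf ?normr_eq0.
split; first by apply/cvg_ex; exists l.
by rewrite /derive; exact: cvg_lim L.
Unshelve. all: by end_near. Qed.

(** A C^1 version of max(t, 0): it is 0 for t <= -1, t for t >= 1, and (t + 1)^2 / 4 in between. The
    derivative [dramp] is piecewise linear with values in [0, 1]. *)
Definition ramp t : R := (Num.max (t + 1) 0 ^+ 2 - Num.max (t - 1) 0 ^+ 2) / 4.
Definition dramp t : R := (Num.max (t + 1) 0 - Num.max (t - 1) 0) / 2.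

Let maxP t : (Num.max t 0 = t /\ 0 <= t) \/ (Num.max t 0 = 0 /\ t <= 0).
Proof. by have [t0|t0] := leP t 0; [right|left; split => //; exact: ltW]. Qed.

Lemma is_derive_ramp t : is_derive t 1 ramp (dramp t).
Proof.
apply: (is_derive_quad (C := 1)) => e; rewrite -[_ *: 1]/(e * 1) mulr1 ler_norml /ramp /dramp.
have [[-> ?]|[-> ?]] := maxP (t + e + 1); have [[-> ?]|[-> ?]] := maxP (t + e - 1);
have [[-> ?]|[-> ?]] := maxP (t + 1); have [[-> ?]|[-> ?]] := maxP (t - 1);
by apply/andP; split; nra.
Qed.

Lemma dramp_ge0 t : 0 <= dramp t.
Proof.
by rewrite /dramp; have [[-> ?]|[-> ?]] := maxP (t + 1);
  have [[-> ?]|[-> ?]] := maxP (t - 1); lra.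
Qed.

Lemma dramp_le1 t : dramp t <= 1.
Proof.
by rewrite /dramp; have [[-> ?]|[-> ?]] := maxP (t + 1);
  have [[-> ?]|[-> ?]] := maxP (t - 1); lra.
Qed.

Lemma ramp_ge t : t <= ramp t.
Proof.
by rewrite /ramp; have [[-> ?]|[-> ?]] := maxP (t + 1);
  have [[-> ?]|[-> ?]] := maxP (t - 1); nra.
Qed.

Lemma ramp_ge0 t : 0 <= ramp t.
Proof.
by rewrite /ramp; have [[-> ?]|[-> ?]] := maxP (t + 1);
  have [[-> ?]|[-> ?]] := maxP (t - 1); nra.
Qed.

Lemma ramp_le0 t : t <= -1 -> ramp t = 0.
Proof.
by move=> t1; rewrite /ramp; have [[-> ?]|[-> ?]] := maxP (t + 1);
  have [[-> ?]|[-> ?]] := maxP (t - 1); nra.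
Qed.

(** The excess of [ramp] over max(t, 0) is largest at t = 0, where it is 1/4. *)
Lemma ramp_le t (c : R) : t <= c -> 0 <= c -> ramp t <= c + 4^-1.
Proof.
by move=> tc c0; rewrite /ramp; have [[-> ?]|[-> ?]] := maxP (t + 1);
  have [[-> ?]|[-> ?]] := maxP (t - 1); nra.
Qed.

Lemma dramp_continuous : continuous dramp.
Proof.
move=> t; apply/cvgrPdist_le => /= e e0; near=> r.
have /ltW : `|t - r| < e by near: r; apply/nbhs_normP; exists e.
rewrite !ler_norml /dramp => /andP[H1 H2].
have L a b : - e <= a - b -> a - b <= e -> - e <= Num.max a 0 - Num.max b 0 <= e.
  have := ltW e0; have [[-> ?]|[-> ?]] := maxP a; have [[-> ?]|[-> ?]] := maxP b => *;
  by apply/andP; split; lra.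
have /andP[L1 L2] : - e <= Num.max (t + 1) 0 - Num.max (r + 1) 0 <= e by apply: L; lra.
have /andP[L3 L4] : - e <= Num.max (t - 1) 0 - Num.max (r - 1) 0 <= e by apply: L; lra.
by apply/andP; split; lra.
Unshelve. all: by end_near. Qed.

End SmoothRamp.

Section C1Composition.
Context {R : realType} {m : nat}.

Lemma pd_scomp (U : set 'rV[R]_m) (u : R -> R) (f : 'rV[R]_m -> R) (i : 'I_m) y (l : R) :
  Ck 1 U f -> U y -> is_derive (f y) 1 u l -> pd i (u \o f) y = l * pd i f y.
Proof.
move=> Cf Uy [du <-].
have H := derive_val (is_derive := pd_comp1 du (Ck_der Cf Uy)).
by rewrite [LHS]H derive1E.
Qed.

Lemma C1_scomp (U : set 'rV[R]_m) (u u' : R -> R) (f : 'rV[R]_m -> R) : open U -> Ck 1 U f ->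
  (forall y, U y -> is_derive (f y) 1 u (u' (f y))) ->
  (forall y, U y -> {for f y, continuous u'}) -> Ck 1 U (u \o f).
Proof.
move=> oU Cf du cu'.
have cu y : U y -> {for f y, continuous u}.
  by move=> Uy; apply: differentiable_continuous; apply/derivable1_diffP; case: (du y Uy).
split; first by move=> y Uy; apply: continuous_comp; [exact: Ck_cont Cf Uy|exact: cu].
move=> i; split => [y Uy|].
  by have [d _] := du y Uy; exact: (ex_derive (is_derive := pd_comp1 d (Ck_der Cf Uy))).
apply: (@Ck_ext _ _ _ _ (fun y => (u' \o f) y * pd i f y)) => //.
  by move=> y Uy; rewrite (pd_scomp i Cf Uy (du y Uy)).
apply: CkM => //; last exact: Ck_pd.
by split => // y Uy; apply: continuous_comp; [exact: Ck_cont Cf Uy|exact: cu'].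
Qed.

Lemma posdef_convex (H : 'M[R]_m) (u v : 'rV[R]_m) (l : R) : posdef H -> 0 <= l <= 1 ->
  gdot H ((1 - l) *: u + l *: v) ((1 - l) *: u + l *: v) <=
  (1 - l) * gdot H u u + l * gdot H v v.
Proof.
move=> HP /andP[l0 l1]; rewrite -subr_ge0.
have -> : (1 - l) * gdot H u u + l * gdot H v v -
    gdot H ((1 - l) *: u + l *: v) ((1 - l) *: u + l *: v) =
    l * (1 - l) * gdot H (u - v) (u - v).
  rewrite !gdotDl !gdotDr !gdotNl !gdotNr !gdotZl !gdotZr (gdotC v u HP.1); ring.
by rewrite mulr_ge0 ?posdef_ge0// mulr_ge0// subr_ge0.
Qed.

Lemma gradip_convex (g : 'rV[R]_m -> 'M[R]_m) (F f k : 'rV[R]_m -> R) y (l : R) :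
  posdef (g y) -> 0 <= l <= 1 ->
  (forall i, pd i F y = (1 - l) * pd i f y + l * pd i k y) ->
  gradip g F F y <= (1 - l) * gradip g f f y + l * gradip g k k y.
Proof.
move=> gP l01 E; rewrite !gradipE.
have -> : drow F y = (1 - l) *: drow f y + l *: drow k y.
  by apply/rowP => i; rewrite !mxE E.
exact: posdef_convex (posdef_invmx gP) l01.
Qed.

Lemma cauchy_dual (H : 'M[R]_m) (u v : 'rV[R]_m) : posdef H ->
  (\sum_i v 0 i * u 0 i) ^+ 2 <= gdot (invmx H) u u * gdot H v v.
Proof.
move=> HP; have Hu := posdef_unit HP.
have := posdef_cauchy (u *m invmx H) v HP.
have -> : gdot H (u *m invmx H) v = \sum_i v 0 i * u 0 i.
  by rewrite /gdot mulmxKV// mxE; apply: eq_bigr => i _; rewrite mxE mulrC.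
have -> : gdot H (u *m invmx H) (u *m invmx H) = gdot (invmx H) u u; last by [].
by rewrite /gdot mulmxKV// trmx_mul posdef_inv// !mulmxA -/(gdot _ u u).
Qed.

End C1Composition.

Section SlopeOneFunctions.
Context {R : realType} {m : nat} {M : riemData R m} (MR : is_riemannian M).
Implicit Types (a b : chart M) (x : M) (y : 'rV[R]_m) (f : M -> R).
Let MM := riem_manifold MR.

Definition C1fun f := forall a, Ck 1 (chart_im a) (locf f a).
Definition slope1 f := forall a y, chart_im a y ->
  gradip (metric a) (locf f a) (locf f a) y <= 1.

(* smooth stand-ins for r - dist(x0, x), which is neither C^1 nor, a priori,
   positive on a relatively compact set only *)
Record cutfun f : Prop := {
  cut_C1 : C1fun f;
  cut_slope : slope1 f;
  cut_supp : exists2 K : set M, compact K & forall x, ~ K x -> f x <= 0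
}.

Definition chart_pre a (O : set M) : set 'rV[R]_m := [set y | chart_im a y /\ O (param a y)].

Lemma open_chart_pre a O : open O -> open (chart_pre a O).
Proof. exact: (open_pre MR). Qed.

Lemma C1fun_local f : (forall x, exists a (O : set M), [/\ open O, O x, O `<=` chart_dom a &
    Ck 1 (chart_pre a O) (locf f a)]) -> C1fun f.
Proof.
move=> H b; apply: Ck_local => y by_.
have [a [Q [oQ Qx Qa Cf]]] := H (param b y).
exists (chart_pre b Q); split; [exact: open_chart_pre|by []|].
exact: (Ck_transition MR _ oQ Qa Cf).
Qed.

Lemma cutfun_local f : (forall x, exists a (O : set M), [/\ open O, O x, O `<=` chart_dom a &
    Ck 1 (chart_pre a O) (locf f a) /\ forall y, chart_pre a O y ->
      gradip (metric a) (locf f a) (locf f a) y <= 1]) -> C1fun f /\ slope1 f.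
Proof.
move=> H; split.
  by apply: C1fun_local => x; have [a [Q [oQ Qx Qa [Cf _]]]] := H x; exists a, Q.
move=> b y by_; have [a [Q [oQ Qx Qa [Cf Hs]]]] := H (param b y).
have Hy : ovl b a y by split => //; exact: Qa.
have Qy : chart_pre a Q (transition b a y).
  by split; [exact: (ovl_transition Hy)|rewrite (param_transition MR Hy)].
rewrite (gradip_transition MR Hy (@open_chart_pre a _ oQ) Qy Cf Cf).
exact: Hs.
Qed.

Lemma C1fun_continuous f : C1fun f -> continuous f.
Proof.
move=> Cf x; set a := chart_at x; have ax := mfd_cover MM x.
apply: (@continuous_near _ _ (locf f a \o coord a)).
  apply: (near_open (mfd_open_dom MM a) ax) => z az.
  by rewrite /= /locf/= (mfd_coordK MM az).
apply: continuous_comp; first exact: (mfd_coord_cont MM ax).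
by apply: Ck_cont (Cf a) _; exists x.
Qed.

Lemma cutfun0 : cutfun (fun=> 0).
Proof.
split.
- by move=> a; exact: Ck_cst.
- move=> a y ay; rewrite /gradip big1// => k _.
  by rewrite [pd _ _ _](_ : _ = 0) ?mulr0// /locf -[RHS](congr1 (@^~ y) (pd_cst k (0 : R))).
- by exists set0; [exact: compact0|].
Qed.

(** A C^1 maximum: it is u when v <= u - tau and v when v >= u + tau. Its gradient is a convex
    combination of the gradients of u and v, with weight [dramp], which preserves a slope of at most
    1. *)
Definition smax (tau u v : R) : R := u + tau * ramp ((v - u) / tau).

Lemma smax_ge tau u v : 0 < tau -> u <= smax tau u v /\ v <= smax tau u v.
Proof.
move=> t0; rewrite /smax; split; first by rewrite lerDl mulr_ge0 ?ramp_ge0 ?ltW.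
have := ler_wpM2l (ltW t0) (ramp_ge ((v - u) / tau)).
by rewrite mulrC divfK ?gt_eqF//; lra.
Qed.

Lemma smax_left tau u v : 0 < tau -> v <= u - tau -> smax tau u v = u.
Proof.
by move=> t0 vu; rewrite /smax ramp_le0 ?mulr0 ?addr0// ler_pdivrMr//; lra.
Qed.

Lemma smax_le0 tau u v : 0 < tau -> u <= 0 -> v <= 0 -> smax tau u v <= tau / 4.
Proof.
move=> t0 u0 v0; rewrite /smax.
have [uv|uv] := leP v u.
  have : tau * ramp ((v - u) / tau) <= tau * (0 + 4^-1).
    by rewrite ler_pM2l// ramp_le// pmulr_lle0 ?invr_gt0//; lra.
  by lra.
have : tau * ramp ((v - u) / tau) <= tau * ((v - u) / tau + 4^-1).
  by rewrite ler_pM2l// ramp_le// divr_ge0 ?(ltW t0)//; lra.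
by rewrite mulrDr [tau * (_ / tau)]mulrC divfK ?gt_eqF//; lra.
Qed.

Section SmaxChart.
Variables (U : set 'rV[R]_m) (g : 'rV[R]_m -> 'M[R]_m) (tau : R) (u v : 'rV[R]_m -> R).
Hypotheses (oU : open U) (t0 : 0 < tau) (Cu : Ck 1 U u) (Cv : Ck 1 U v).

Let q y := (v y - u y) / tau.
Let Cq : Ck 1 U q.
Proof. by apply: (CkM oU (CkB oU Cv Cu)); exact: Ck_cst. Qed.
Let Cr : Ck 1 U (ramp \o q).
Proof.
apply: (C1_scomp (u' := @dramp R) oU Cq) => y _; first exact: is_derive_ramp.
exact: dramp_continuous.
Qed.

Lemma C1_smax : Ck 1 U (fun y => smax tau (u y) (v y)).
Proof. exact (CkD oU Cu (CkM oU (Ck_cst 1 U tau) Cr)). Qed.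

Let pd_smax y i : U y -> pd i (fun y => smax tau (u y) (v y)) y =
  (1 - dramp (q y)) * pd i u y + dramp (q y) * pd i v y.
Proof.
move=> Uy; have du := Ck_der (i := i) Cu Uy; have dv := Ck_der (i := i) Cv Uy.
have dr := Ck_der (i := i) Cr Uy.
have dc (c : R) : derivable (fun=> c) y (delta_mx 0 i : 'rV[R]_m) by exact: derivable_cst.
have dM : derivable (fun y => tau * (ramp \o q) y) y (delta_mx 0 i).
  exact (derivableM (dc tau) dr).
rewrite (pdD du dM) (pdM (dc tau) dr) pd_cst mul0r add0r.
rewrite (pd_scomp i Cq Uy (is_derive_ramp _)).
have dN : derivable (fun y => v y - u y) y (delta_mx 0 i) by exact (derivableB dv du).
rewrite (pdM dN (dc _)) pd_cst mulr0 addr0 (pdB dv du).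
move: (pd i u y) (pd i v y) (dramp _) => a b e; field.
exact: lt0r_neq0.
Qed.

Lemma slope_smax y : U y -> posdef (g y) -> gradip g u u y <= 1 -> gradip g v v y <= 1 ->
  gradip g (fun y => smax tau (u y) (v y)) (fun y => smax tau (u y) (v y)) y <= 1.
Proof.
move=> Uy gP su sv; have l01 : 0 <= dramp (q y) <= 1 by rewrite dramp_ge0 dramp_le1.
apply: le_trans (gradip_convex gP l01 (fun i => pd_smax i Uy)) _.
by move: l01 => /andP[]; nra.
Qed.

End SmaxChart.

(** With c = 0 this also transfers the slope between functions that agree near y. *)
Lemma gradip_shift (g : 'rV[R]_m -> 'M[R]_m) (f f' : 'rV[R]_m -> R) (c : R) y :
  (forall i, derivable f y (delta_mx 0 i)) -> (\near y, f' y = f y - c) ->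
  gradip g f' f' y = gradip g f f y.
Proof.
move=> df E; have P i : pd i f' y = pd i f y.
  rewrite (pd_near i E) (pdB (df i)); first by rewrite pd_cst subr0.
  exact: derivable_cst.
by rewrite !gradipE (_ : drow f' y = drow f y)//; apply/rowP => i; rewrite !mxE P.
Qed.

(** The smoothed maximum of two nonpositive numbers is at most tau / 4; subtracting this restores
    the sign outside the union of the two compact sets. *)
Lemma cutfun_smax tau f f' : 0 < tau -> cutfun f -> cutfun f' ->
  cutfun (fun x => smax tau (f x) (f' x) - tau / 4).
Proof.
move=> t0 [C1 s1 [K1 cK1 K1P]] [C2 s2 [K2 cK2 K2P]].
have CS a := C1_smax tau (@mfd_open_im _ _ _ MM a) (C1 a) (C2 a).
split.
- by move=> a; exact (CkB (@mfd_open_im _ _ _ MM a) (CS a) (Ck_cst 1 _ (tau / 4))).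
- move=> a y ay; rewrite (@gradip_shift _ (fun y => smax tau (locf f a y) (locf f' a y)) _ (tau / 4)).
  + exact (slope_smax (@mfd_open_im _ _ _ MM a) t0 (C1 a) (C2 a) ay (posdef_metric MR ay) (s1 a y ay) (s2 a y ay)).
  + by move=> i; exact: Ck_der (CS a) ay.
  + by apply: filterE.
exists (K1 `|` K2); first exact: compactU.
move=> x /not_orP[/K1P h1 /K2P h2]; rewrite subr_le0; exact: smax_le0.
Qed.

End SlopeOneFunctions.

Lemma continuous_bigsum {R : realType} (T : topologicalType) (I : Type) (r : seq I)
    (F : I -> T -> R) (t : T) : (forall i, {for t, continuous (F i)}) ->
  {for t, continuous (fun t => \sum_(i <- r) F i t)}.
Proof.
move=> cF; elim: r => [|i r IH].
  rewrite (_ : (fun t => _) = fun=> 0); first exact: cst_continuous.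
  by apply/funext => z; rewrite big_nil.
rewrite (_ : (fun t => _) = F i \+ (fun t => \sum_(i <- r) F i t)); first exact (continuousD (cF i) IH).
by apply/funext => z; rewrite big_cons.
Qed.

(** * Functions of slope at most one along curves *)

Section CurvesAndSlopes.
Context {R : realType} {m : nat} {M : riemData R m} (MR : is_riemannian M).
Implicit Types (a b : chart M) (x : M) (y : 'rV[R]_m) (f : M -> R).
Let MM := riem_manifold MR.
Let mu := (@lebesgue_measure R).

Section Arc.
Variables (a : chart M) (gam : R -> 'rV[R]_m).
Hypotheses (ga : forall t, 0 <= t <= 1 -> chart_im a (gam t))
  (dg : forall t, derivable gam t 1) (cg : continuous (derive1 gam)).

Let gam_cont : continuous gam.
Proof. by move=> t; apply: differentiable_continuous; apply/derivable1_diffP. Qed.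

Let dgam_cont i : continuous (fun t => derive1 gam t 0 i).
Proof.
move=> t; apply: (continuous_comp (f := derive1 gam) (g := fun v : 'rV[R]_m => v 0 i)).
  exact: cg.
exact: coord_continuous.
Qed.

Lemma speed_cont t : 0 <= t <= 1 -> {for t, continuous (speed a gam)}.
Proof.
move=> t01; have H : {for t, continuous (fun t => gdot (metric a (gam t)) (derive1 gam t) (derive1 gam t))}.
  rewrite (_ : (fun t => _) = fun t => \sum_i \sum_j
     derive1 gam t 0 i * metric a (gam t) i j * derive1 gam t 0 j); last first.
    by apply/funext => z; rewrite gdotE.
  apply: continuous_bigsum => i; apply: continuous_bigsum => j.
  apply: cvgM; last exact: dgam_cont.
  apply: cvgM; first exact: dgam_cont.
  apply: (continuous_comp (f := gam) (g := fun y => metric a y i j)); first exact: gam_cont.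
  exact: (smooth_cont (smooth_metric MR a i j) (ga t01)).
by apply: continuous_comp H _; exact: sqrt_continuous.
Qed.

Lemma speed_within : {within `[0, 1], continuous (speed a gam)}.
Proof.
apply: continuous_in_subspaceT => t /set_mem; rewrite /= in_itv/= => t01.
exact: speed_cont.
Qed.

Lemma speed_integrable : mu.-integrable `[0, 1] (EFin \o speed a gam).
Proof. by apply: continuous_compact_integrable; [exact: segment_compact|exact: speed_within]. Qed.

(** The derivative of f along the arc is at most the speed, by Cauchy-Schwarz for covectors and the
    slope bound; integrate over [0, 1]. *)
Lemma arc_slope f : C1fun f -> slope1 f ->
  f (param a (gam 1)) <= f (param a (gam 0)) + \int[lebesgue_measure]_(t in `[0, 1]) speed a gam t.
Proof.
move=> Cf sf; pose u := locf f a \o gam.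
pose du t := \sum_i derive1 gam t 0 i * pd i (locf f a) (gam t).
have Du (t : R) : 0 <= t <= 1 -> is_derive t 1 u (du t).
  move=> t01; have := chain_line (@mfd_open_im _ _ _ MM a) (ga t01) (Cf a) (@dg t).
  by rewrite -derive1E.
have u_cont (t : R) : 0 <= t <= 1 -> {for t, continuous u}.
  move=> /Du[d _]; apply: differentiable_continuous; exact/derivable1_diffP.
have du_within : {within `[0, 1], continuous du}.
  apply: continuous_in_subspaceT => t /set_mem; rewrite /= in_itv/= => t01.
  apply: continuous_bigsum => i.
  apply: cvgM; first exact: dgam_cont.
  apply: (continuous_comp (f := gam) (g := pd i (locf f a))); first exact: gam_cont.
  exact: (Ck_cont (Ck_pd i (Cf a)) (ga t01)).
have FTC : (\int[mu]_(t in `[0%R, 1%R]) (du t)%:E = (u 1)%:E - (u 0)%:E)%E.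
  apply: continuous_FTC2 => //; last first.
    move=> t; rewrite in_itv/= => /andP[/ltW t0 /ltW t1].
    by rewrite derive1E (derive_val (is_derive := Du t _)) ?t0.
  split.
  - by move=> t; rewrite in_itv/= => /andP[/ltW t0 /ltW t1]; case: (Du t); rewrite ?t0.
  - by apply: cvg_at_right_filter; apply: u_cont; rewrite lexx ler01.
  - by apply: cvg_at_left_filter; apply: u_cont; rewrite lexx ler01.
have le_sp (t : R) : 0 <= t <= 1 -> du t <= speed a gam t.
  move=> t01; have gP := posdef_metric MR (ga t01); apply: le_trans (ler_norm _) _.
  rewrite -sqrtr_sqr ler_sqrt; last exact: posdef_ge0.
  have := cauchy_dual (drow (locf f a) (gam t)) (derive1 gam t) gP.
  rewrite -gradipE => H; have := sf a _ (ga t01) => H'.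
  have -> : du t = \sum_i derive1 gam t 0 i * drow (locf f a) (gam t) 0 i.
    by apply: eq_bigr => i _; rewrite mxE.
  apply: le_trans H _; rewrite -[leRHS]mul1r ler_wpM2r//; exact: posdef_ge0.
rewrite addrC -lerBlDr -[leLHS]/(fine ((u 1)%:E - (u 0)%:E)%E) -FTC.
apply: le_Rintegral => //.
- by apply: continuous_compact_integrable; [exact: segment_compact|exact: du_within].
- exact: speed_integrable.
Qed.

Lemma arc_bound (c : R) : (forall t, 0 <= t <= 1 -> speed a gam t <= c) ->
  0 <= \int[lebesgue_measure]_(t in `[0, 1]) speed a gam t <= c.
Proof.
move=> H; apply/andP; split.
  by apply: Rintegral_ge0 => t _; exact: sqrtr_ge0.
have -> : c = \int[mu]_(t in `[0, 1]) cst c t.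
  by rewrite Rintegral_cst//= lebesgue_measure_itv/= lte_fin ltr01 oppr0 adde0 mulr1.
apply: le_Rintegral => //; first exact: speed_integrable.
apply: continuous_compact_integrable; first exact: segment_compact.
by apply: continuous_subspaceT; exact: cst_continuous.
Qed.

Let gamr t := gam (1 - t).
Let dgr (t : R) : is_derive t (1 : R) gamr (- derive1 gam (1 - t)).
Proof.
have d1 : is_derive t (1 : R) (fun t : R => 1 - t) (-1).
  apply: (is_derive_quad (C := 0)) => e; rewrite -[_ *: 1]/(e * 1) mulr1 mul0r normr_le0; apply/eqP; ring.
have df1 : differentiable (fun t : R => 1 - t) t by apply/derivable1_diffP; case: d1.
have dfg : differentiable gam (1 - t) by apply/derivable1_diffP.
have D : differentiable (gam \o (fun t : R => 1 - t)) t by exact: differentiable_comp.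
split; first exact: diff_derivable.
rewrite deriveE// diff_comp//= -(deriveE _ df1) (derive_val (is_derive := d1)).
have -> : gam^`()%classic (1 - t) = 'd gam (1 - t) 1 by rewrite derive1E deriveE.
exact: raddfN.
Qed.

(** [curve_length] adds arcs at the starting point, so its symmetry rests on reversing one arc by t
    |-> 1 - t, which changes the sign of the velocity only. *)
Lemma arc_reverse :
  curve_length (param a (gam 1)) (param a (gam 0)) (\int[lebesgue_measure]_(t in `[0, 1]) speed a gam t).
Proof.
have E : derive1 gamr = fun t => - derive1 gam (1 - t).
  by apply/funext => t; rewrite derive1E (derive_val (is_derive := dgr t)).
have onem_cont : continuous (fun t : R => 1 - t).
  by move=> t; apply: cvgB; [exact: cvg_cst|exact: cvg_id].
have H := @curve_cons R m M a gamr (param a (gam 0)) 0 _ _ _ _.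
have -> : \int[lebesgue_measure]_(t in `[0, 1]) speed a gam t =
    \int[lebesgue_measure]_(t in `[0, 1]) speed a gamr t + 0.
  have r01 : 0 <= (1 : R) <= 1 by rewrite ler01 lexx.
  rewrite addr0; apply: (congr1 fine).
  apply: etrans (integration_by_substitution_onem r01 speed_within) _.
  have -> : unstable.onem (1 : R) = 0 by rewrite /unstable.onem subrr.
  apply: eq_integral => t _; apply: congr1.
  by rewrite /unstable.onem /speed E gdotNl gdotNr opprK.
rewrite -[X in curve_length (param a (gam X))](subr0 1); apply: H.
- by move=> t t01; apply: ga; move: t01; lra.
- by move=> t; case: (dgr t).
- rewrite E => t; apply: cvgN.
  exact (@continuous_comp _ _ _ (fun t : R => 1 - t) (derive1 gam) t (@onem_cont t) (@cg (1 - t))).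
- by rewrite /gamr subrr; exact: curve_nil.
Qed.

End Arc.

Lemma curve_slope f x z l : C1fun f -> slope1 f -> curve_length x z l -> f z <= f x + l.
Proof.
move=> Cf sf; elim=> [w|a gam w l' ga dg cg _ IH]; first by rewrite addr0.
by apply: le_trans IH _; rewrite addrA lerD2r; exact: arc_slope.
Qed.

Lemma curve_ge0 x z l : curve_length (M := M) x z l -> 0 <= l.
Proof.
elim=> [w|a gam w l' ga dg cg _ IH] //; rewrite addr_ge0//.
by apply: Rintegral_ge0 => t _; exact: sqrtr_ge0.
Qed.

Lemma curve_trans x z w l l' : curve_length (M := M) x z l -> curve_length z w l' ->
  curve_length x w (l + l').
Proof.
elim=> [v|a gam v k ga dg cg _ IH]; first by rewrite add0r.
by move=> /IH H; rewrite -addrA; exact: curve_cons.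
Qed.

Lemma curve_sym x z l : curve_length (M := M) x z l -> curve_length z x l.
Proof.
elim=> [w|a gam w l' ga dg cg _ IH]; first exact: curve_nil.
by rewrite addrC; apply: curve_trans IH _; exact: arc_reverse.
Qed.

Lemma segment_curve a (y0 v : 'rV[R]_m) (c : R) :
  (forall t, 0 <= t <= 1 -> chart_im a (y0 + t *: v)) ->
  (forall t, 0 <= t <= 1 -> gdot (metric a (y0 + t *: v)) v v <= c ^+ 2) -> 0 <= c ->
  exists2 l, curve_length (param a y0) (param a (y0 + v)) l & l <= c.
Proof.
move=> ga gc c0; pose gam t := y0 + t *: v.
have dg t : is_derive t (1 : R) gam v.
  have L : (fun e : R => e^-1 *: ((gam \o shift t) (e *: 1) - gam t)) @ 0^' --> v.
    apply: cvg_near_cst; near=> e; have e0 : e != 0 by near: e; exact: nbhs_dnbhs_neq.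
    rewrite /gam /= -[_ *: 1]/(e * 1) mulr1 opprD addrACA subrr add0r -scalerBl addrK.
    by rewrite scalerA mulVf ?scale1r.
  split; first by apply/cvg_ex; exists v.
  by rewrite /derive; exact: cvg_lim L.
have E : derive1 gam = cst v.
  by apply/funext => t; rewrite derive1E (derive_val (is_derive := dg t)).
have dg' t : derivable gam t 1 by case: (dg t).
have cg : continuous (derive1 gam) by rewrite E; exact: cst_continuous.
exists (\int[lebesgue_measure]_(t in `[0, 1]) speed a gam t + 0).
  have -> : param a y0 = param a (gam 0) by rewrite /gam scale0r addr0.
  apply: curve_cons => //.
  by rewrite /gam scale1r; exact: curve_nil.
rewrite addr0; suff H : forall t, 0 <= t <= 1 -> speed a gam t <= c.
  by have /andP[] := arc_bound ga dg' cg H.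
move=> t t01; rewrite /speed E /= -[leRHS]ger0_norm// -sqrtr_sqr ler_sqrt ?sqr_ge0//.
exact: gc.
Unshelve. all: by end_near. Qed.

End CurvesAndSlopes.

(** If Q failed for K, the sets B with Q (K \ B) would form a proper filter containing K. A cluster
    point in K has a neighbourhood N with Q N, whose complement belongs to the filter: a
    contradiction. *)
Lemma compact_union_closed (T : topologicalType) (K : set T) (Q : set T -> Prop) :
  compact K -> (forall A B, A `<=` B -> Q B -> Q A) -> (forall A B, Q A -> Q B -> Q (A `|` B)) ->
  Q set0 -> (forall x, K x -> exists2 N, nbhs x N & Q N) -> Q K.
Proof.
move=> cK Qsub QU Q0 Qloc; apply: contrapT => nQK.
pose F : set_system T := [set B | Q (K `\` B)].
have FF : ProperFilter F.
  split; first by rewrite /F/= setD0.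
  split; first by rewrite /F/= setDT.
    by move=> A B QA QB; rewrite /F/= setDIr; exact: QU.
  by move=> A B AB; apply: Qsub => x [Kx nB]; split=> // Ax; apply: nB; exact: AB.
have FK : F K by rewrite /F/= setDv.
have [x [Kx cx]] := cK F FF FK.
have [N Nx QN] := Qloc x Kx.
have FN : F (~` N) by apply: Qsub QN => z [_ /contrapT].
by have [z [nNz Nz]] := cx _ _ FN Nx.
Qed.

(** * Coordinate balls for the metric frozen at a point *)

Section ChartBall.
Context {R : realType} {m : nat} {M : riemData R m} (MR : is_riemannian M).
Let MM := riem_manifold MR.

Lemma posdef_norm (H : 'M[R]_m) : posdef H ->
  exists2 L : R, 1 <= L & forall v, `|v| ^+ 2 <= L * gdot H v v.
Proof.
move=> HP; have HI := posdef_invmx HP; pose D i := gdot (invmx H) (delta_mx 0 i) (delta_mx 0 i).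
have D0 i : 0 <= D i by exact: posdef_ge0.
have S0 : 0 <= \sum_i D i by apply: sumr_ge0.
(* [D i] is the squared dual norm of the i-th coordinate, so v_i^2 <= D i <v, v>; the summand 1
   makes the constant at least 1, as [chart_ball] requires. *)
exists (1 + \sum_i D i) => [|v]; first lra.
set L := 1 + _; have L0 : 0 <= L by rewrite /L; lra.
have q0 : 0 <= L * gdot H v v by rewrite mulr_ge0// posdef_ge0.
rewrite -[leRHS](sqr_sqrtr q0) ler_sqr ?nnegrE ?sqrtr_ge0//.
apply: rV_norm_le => [|i]; first exact: sqrtr_ge0.
rewrite -sqrtr_sqr ler_sqrt//.
have := cauchy_dual (delta_mx 0 i) v HP.
rewrite (_ : \sum_k _ = v 0 i); last first.
  by rewrite (bigD1 i)//= mxE !eqxx mulr1 big1 ?addr0// => k ki; rewrite mxE (negPf ki) andbF mulr0.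
move=> E; apply: le_trans E _; rewrite ler_wpM2r ?posdef_ge0//.
rewrite -/(D i) /L (bigD1 i)//= -/(D i).
have : 0 <= \sum_(j | j != i) D j by apply: sumr_ge0.
by lra.
Qed.

Variables (a : chart M) (p0 : 'rV[R]_m).
Hypothesis ap0 : chart_im a p0.
Let H := metric a p0.
Let HP : posdef H. Proof. exact: posdef_metric. Qed.

(** The squared distance to p0 for the metric frozen at p0: a quadratic polynomial with an explicit
    gradient, comparable to the true distance on a small ball. *)
Definition qball (p : 'rV[R]_m) : R := gdot H (p - p0) (p - p0).

Lemma qball0 : qball p0 = 0. Proof. by rewrite /qball subrr gdot0l. Qed.

Lemma qball_segment v (t : R) : qball (p0 + t *: v) = t ^+ 2 * gdot H v v.
Proof. by rewrite /qball addrAC subrr add0r gdotZl gdotZr mulrA expr2. Qed.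

Lemma qball_C1 : Ck 1 setT qball.
Proof.
have oT : open [set: 'rV[R]_m] by exact: openT.
have Cc i : Ck 1 setT (fun p : 'rV[R]_m => (p - p0) 0 i).
  rewrite (_ : (fun p => _) = fun p : 'rV[R]_m => p 0 i - p0 0 i); last first.
    by apply/funext => p; rewrite !mxE.
  apply: (CkB oT); last exact: Ck_cst.
  by apply: smooth_coordinate.
rewrite (_ : qball = fun p => \sum_i \sum_j (p - p0) 0 i * H i j * (p - p0) 0 j); last first.
  by apply/funext => p; rewrite /qball gdotE.
apply: Ck_sum => // i _; apply: Ck_sum => // j _.
apply: (CkM oT) => //; apply: (CkM oT) => //; exact: Ck_cst.
Qed.

Lemma drow_qball p : drow qball p = 2 *: ((p - p0) *m H).
Proof.
apply/rowP => i; rewrite !mxE.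
have D : is_derive p (delta_mx 0 i) qball (2 * gdot H (p - p0) (delta_mx 0 i)).
  apply: (is_derive_quad (C := gdot H (delta_mx 0 i) (delta_mx 0 i))) => e.
  have -> : qball (p + e *: delta_mx 0 i) - qball p - 2 * gdot H (p - p0) (delta_mx 0 i) * e =
     gdot H (delta_mx 0 i) (delta_mx 0 i) * e ^+ 2.
    have EE : p + e *: delta_mx 0 i - p0 = (p - p0) + e *: delta_mx 0 i by exact: addrAC.
    rewrite /qball EE.
    move: (p - p0) => x; rewrite gdotDl !gdotDr !gdotZl !gdotZr (gdotC (delta_mx 0 i) x HP.1); ring.
  by rewrite ger0_norm// mulr_ge0 ?sqr_ge0 ?posdef_ge0.
rewrite [LHS](derive_val (is_derive := D)) gdotE; congr (_ * _).
rewrite exchange_big/= (bigD1 i)//= [X in _ + X]big1 ?addr0; last first.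
  by move=> j ji; rewrite big1// => k _; rewrite [delta_mx _ _ _ _]mxE (negPf ji) andbF mulr0.
by apply: eq_bigr => k _; rewrite [delta_mx _ _ _ _]mxE !eqxx mulr1.
Qed.

Lemma form_dist (G : 'M[R]_m) v : `|gdot G v v - gdot H v v| <= (\sum_i \sum_j `|G i j - H i j|) * `|v| ^+ 2.
Proof.
rewrite !gdotE -sumrB mulr_suml; apply: le_trans (ler_norm_sum _ _ _) _; apply: ler_sum => i _.
rewrite -sumrB mulr_suml; apply: le_trans (ler_norm_sum _ _ _) _; apply: ler_sum => j _.
rewrite -mulrBl -mulrBr !normrM [`|v 0 i| * _]mulrC -mulrA expr2 ler_wpM2l//.
by apply: ler_pM => //; exact: rV_norm_coord.
Qed.

Lemma chart_ball : exists2 r : R, 0 < r & compact [set p | qball p <= r ^+ 2] /\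
  forall p, qball p <= r ^+ 2 -> chart_im a p /\
    forall v, gdot (metric a p) v v <= 4 * gdot H v v /\ gdot H v v <= 4 * gdot (metric a p) v v.
Proof.
have [L L1 HL] := posdef_norm HP.
have L0 : 0 < L by apply: lt_le_trans L1.
have [d1 d10 Hd1] := open_ball_sub (mfd_open_im MM (a := a)) ap0.
pose F p := \sum_i \sum_j `|metric a p i j - H i j|.
have cF : {for p0, continuous F}.
  apply: continuous_bigsum => i; apply: continuous_bigsum => j.
  have cB : {for p0, continuous (fun p => metric a p i j - H i j)}.
    by apply: (@cvgB _ _ _ (nbhs p0)); [exact (smooth_cont (smooth_metric MR a i j) ap0)|exact: cvg_cst].
  exact: (continuous_comp cB (@norm_continuous _ _ _)).
have [d2 d20 Hd2] : exists2 d, 0 < d & forall z, `|z - p0| < d -> `|F z - F p0| < (2 * L)^-1.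
  by apply: contP cF _ _; rewrite invr_gt0 mulr_gt0.
have F0 : F p0 = 0 by rewrite /F big1// => i _; rewrite big1// => j _; rewrite subrr normr0.
pose d := Num.min d1 d2; have d0 : 0 < d by rewrite lt_min d10.
pose r := d / (2 * L).
have r0 : 0 < r by rewrite divr_gt0// mulr_gt0.
(* From q(p) <= r^2 and r = d / (2 L) one gets |p - p0|^2 <= L r^2 = d^2 / (4 L), less than d^2
   because L >= 1. *)
have near_p p : qball p <= r ^+ 2 -> `|p - p0| < d.
  move=> qr; rewrite -ltr_sqr ?nnegrE//; last exact: ltW.
  apply: le_lt_trans (HL _) _; rewrite -/(qball p).
  apply: le_lt_trans (ler_wpM2l (ltW L0) qr) _.
  rewrite /r expr_div_n exprMn mulrCA gtr_pMr; last by rewrite exprn_gt0.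
  rewrite ltr_pdivrMr ?mul1r; last by rewrite mulr_gt0// exprn_gt0.
  by rewrite !expr2; nra.
exists r => //; split.
  apply: (@subclosed_compact _ _ [set y | `|y| <= `|p0| + d]).
  - apply: (@closed_comp _ _ qball [set x : R | x <= r ^+ 2]); last exact: closed_le.
    by move=> p _; exact: Ck_cont qball_C1 _.
  - exact: cball_compact.
  - move=> p /= /near_p H1; have := ler_normD p0 (p - p0); rewrite addrC subrK.
    by move/le_trans; apply; rewrite lerD2l ltW.
move=> p /near_p pd; have pd1 : `|p - p0| < d1 by apply: lt_le_trans pd _; rewrite ge_min lexx.
have pd2 : `|p - p0| < d2 by apply: lt_le_trans pd _; rewrite ge_min lexx orbT.
split => [|v]; first exact: Hd1.
have := Hd2 _ pd2; rewrite F0 subr0 => /(le_lt_trans (ler_norm _)) Fp.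
have Q0 := posdef_ge0 v HP.
have B : `|gdot (metric a p) v v - gdot H v v| <= 2^-1 * gdot H v v.
  apply: le_trans (form_dist _ _) _; rewrite -/(F p).
  apply: le_trans (ler_pM _ _ (ltW Fp) (HL v)) _; rewrite ?sqr_ge0//.
    by apply: sumr_ge0 => i _; apply: sumr_ge0.
  by rewrite invfM -mulrA mulKf// gt_eqF.
by move: B; rewrite ler_norml => /andP[]; lra.
Qed.

End ChartBall.

Lemma connected_all (T : topologicalType) (Q : T -> Prop) (x0 : T) : connected [set: T] ->
  Q x0 -> (forall x, Q x -> \near x, Q x) -> (forall x, ~ Q x -> \near x, ~ Q x) ->
  forall x, Q x.
Proof.
move=> cT Q0 oQ cQ x; suff -> : Q = setT by [].
apply: cT; first by exists x0.
  by exists Q; rewrite ?setTI// openE => z /oQ.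
exists Q; rewrite ?setTI// -(setCK Q); apply: open_closedC; rewrite openE => z.
exact: cQ.
Qed.

(** An inequality between forms reverses for their inverses. With A the left side, Cauchy-Schwarz
    for H applied to w and u G^-1, whose squared norm for G is A, gives A^2 <= 4 A H(w, w). *)
Lemma dual_compare (R : realType) m (G H : 'M[R]_m) (w : 'rV[R]_m) : posdef G -> posdef H ->
  (forall v, gdot H v v <= 4 * gdot G v v) -> gdot (invmx G) (w *m H) (w *m H) <= 4 * gdot H w w.
Proof.
move=> GP HP HG; have Gu := posdef_unit GP; set u := w *m H; set A := gdot _ u u.
have A1 : gdot G (u *m invmx G) (u *m invmx G) = A.
  by rewrite /gdot mulmxKV// trmx_mul posdef_inv// !mulmxA -/(gdot _ u u).
have A2 : gdot H w (u *m invmx G) = A.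
  by rewrite /gdot -/u trmx_mul posdef_inv// !mulmxA -/(gdot _ u u).
have := posdef_cauchy w (u *m invmx G) HP; rewrite A2.
have := HG (u *m invmx G); rewrite A1.
have A0 : 0 <= A by apply: posdef_ge0; exact: posdef_invmx.
have q0 := posdef_ge0 w HP; move: (gdot H (u *m _) _) (gdot H w w) q0 => b q q0 bA Ab.
have AA : A * A <= (4 * q) * A by rewrite -expr2; apply: le_trans Ab _; nra.
have [A00|An0] := eqVneq A 0; first by rewrite A00; lra.
by rewrite -(ler_pM2r (x := A))// lt_neqAle eq_sym An0.
Qed.

Section Ekeland.
Context {R : realType} {m : nat} {M : riemData R m} (MR : is_riemannian M).
Hypotheses (M_connected : connected [set: M]) (M_complete : complete_riemannian M).
Let MM := riem_manifold MR.

Lemma ball_curve (a : chart M) (p0 p : 'rV[R]_m) (r : R) :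
  (forall p, qball a p0 p <= r ^+ 2 -> chart_im a p /\
    forall v, gdot (metric a p) v v <= 4 * gdot (metric a p0) v v) -> qball a p0 p <= r ^+ 2 ->
  exists2 l, curve_length (param a p0) (param a p) l & l <= 2 * Num.sqrt (qball a p0 p).
Proof.
move=> rP pr; have S t : 0 <= t <= 1 -> qball a p0 (p0 + t *: (p - p0)) <= r ^+ 2.
  move=> /andP[t0 t1]; rewrite qball_segment -/(qball a p0 p).
  have [q0|q0] := leP (qball a p0 p) 0; last by apply: le_trans pr; rewrite ler_piMl ?(ltW q0)// expr_le1.
  by apply: le_trans (sqr_ge0 r); rewrite mulr_ge0_le0 ?sqr_ge0.
have [| | |l H1 H2] := @segment_curve _ _ _ MR a p0 (p - p0) (2 * Num.sqrt (qball a p0 p)).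
- by move=> t /S /rP[].
- move=> t /S /rP[_ H]; apply: le_trans (H _) _; rewrite -/(qball a p0 p) exprMn.
  have [q0|q0] := leP 0 (qball a p0 p); first by rewrite sqr_sqrtr//; lra.
  by have := sqr_ge0 (Num.sqrt (qball a p0 p)); lra.
- by rewrite mulr_ge0// sqrtr_ge0.
by exists l => //; rewrite addrC subrK in H1.
Qed.

Lemma coord_im (x : M) : chart_im (chart_at x) (coord (chart_at x) x).
Proof. by exists x => //; exact: (mfd_cover MM). Qed.

Lemma qball_coord_near (a : chart M) p0 x (r : R) : chart_im a p0 -> chart_dom a x ->
  qball a p0 (coord a x) < r -> \near x, chart_dom a x /\ qball a p0 (coord a x) < r.
Proof.
move=> ap0 ax qx; have c : {for x, continuous (qball a p0 \o coord a)}.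
  apply: continuous_comp; first exact: (mfd_coord_cont MM ax).
  by apply: (Ck_cont (U := setT) (qball_C1 a p0)).
near=> z; split.
  by near: z; exact: (near_open (mfd_open_dom MM a) ax).
by near: z; apply: (cvgr_lt _ c).
Unshelve. all: by end_near. Qed.

(** Relates the topology to lengths of curves; through it, continuity and connectedness arguments
    reduce to [curve_slope]. *)
Lemma near_curve (x : M) (e : R) : 0 < e ->
  \forall z \near x, exists2 l, curve_length x z l & l <= e.
Proof.
move=> e0; set a := chart_at x; have ap0 := coord_im x.
have [r r0 [_ rP]] := chart_ball MR ap0.
pose s := Num.min (r ^+ 2) ((e / 2) ^+ 2).
have s0 : 0 < s by rewrite lt_min !exprn_gt0// divr_gt0.
have q0 : qball a (coord a x) (coord a x) < s by rewrite qball0.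
have := qball_coord_near ap0 (mfd_cover MM x) q0.
apply: filterS => z [az]; rewrite lt_min => /andP[/ltW qr /ltW qe].
have [|l] := @ball_curve a (coord a x) (coord a z) r _ qr.
  by move=> p /rP[H1 H2]; split => // v; have [] := H2 v.
rewrite !(mfd_coordK MM)//; last exact: (mfd_cover MM).
move=> H lq; exists l => //; apply: le_trans lq _.
have : Num.sqrt (qball a (coord a x) (coord a z)) <= e / 2.
  by rewrite -[leRHS]ger0_norm ?divr_ge0 ?(ltW e0)// -sqrtr_sqr ler_sqrt ?sqr_ge0.
lra.
Qed.

Section Bounded.
Variables (x0 : M) (r0 : R).
Hypothesis bound0 : forall f, cutfun f -> f x0 <= r0.

(** A bound changes by at most the length of a curve, so the points at which the cutoff functions
    are bounded form an open and closed set. *)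
Lemma cutfun_bounded (x : M) : exists r, forall f, cutfun f -> f x <= r.
Proof.
move: x; apply: (connected_all M_connected (x0 := x0)); first by exists r0.
- move=> x [r Hr]; apply: filterS (near_curve x ltr01) => z [l xz l1]; exists (r + 1) => f cf.
  by apply: le_trans (curve_slope MR (cut_C1 cf) (cut_slope cf) xz) _; rewrite lerD// Hr.
- move=> x nB; apply: filterS (near_curve x ltr01) => z [l xz l1] [r Hr]; apply: nB.
  exists (r + 1) => f cf.
  apply: le_trans (curve_slope MR (cut_C1 cf) (cut_slope cf) (curve_sym MR xz)) _.
  by rewrite lerD// Hr.
Qed.

Definition height_sup (x : M) : R := sup [set f x | f in @cutfun R m M].
Let D := height_sup.

Let supD x : has_sup [set f x | f in @cutfun R m M].
Proof.
split; first by exists 0, (fun=> 0) => //; exact: cutfun0.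
by have [r Hr] := cutfun_bounded x; exists r => _ [f cf <-]; exact: Hr.
Qed.

Let D_ge f x : cutfun f -> f x <= D x.
Proof. by move=> cf; apply: (sup_upper_bound (supD x)); exists f. Qed.

Let D_ge0 x : 0 <= D x.
Proof. exact: (D_ge x cutfun0). Qed.

Let D_curve x z l : curve_length x z l -> D z <= D x + l.
Proof.
move=> xz; apply: ge_sup; first by case: (supD z).
move=> _ [f cf <-]; apply: le_trans (curve_slope MR (cut_C1 cf) (cut_slope cf) xz) _.
by rewrite lerD2r; exact: D_ge.
Qed.

Let near_D x (e : R) : 0 < e -> \forall z \near x, D z <= D x + e.
Proof.
move=> e0; apply: filterS (near_curve x e0) => z [l xz le].
by apply: le_trans (D_curve xz) _; rewrite lerD2l.
Qed.

(** By the Lipschitz property of D, a function that nearly attains D at one point does so nearby,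
    and [compact_union_closed] merges finitely many of them with [smax]. The slack s < e leaves room
    for the loss at each merge: with tau = e - s only a quarter of the remaining gap is used up. *)
Let uniform_cutfun (K : set M) (e : R) : compact K -> 0 < e ->
  exists2 f, cutfun f & forall x, K x -> D x - e <= f x.
Proof.
move=> cK e0; pose Q (A : set M) := exists2 s, s < e & exists2 f, cutfun f & forall x, A x -> D x - s <= f x.
suff [s se [f cf fs]] : Q K.
  by exists f => // x Kx; apply: le_trans (fs x Kx); lra.
apply: (compact_union_closed cK).
- by move=> A B AB [s se [f cf fs]]; exists s => //; exists f => // x /AB; exact: fs.
- move=> A B [s1 s1e [f1 cf1 fs1]] [s2 s2e [f2 cf2 fs2]].
  pose s := Num.max s1 s2; have se : s < e by rewrite gt_max s1e.
  have t0 : 0 < e - s by rewrite subr_gt0.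
  exists (s + (e - s) / 4); first lra.
  exists (fun x => smax (e - s) (f1 x) (f2 x) - (e - s) / 4); first exact (cutfun_smax MR t0 cf1 cf2).
  have s1s : s1 <= s by rewrite le_max lexx.
  have s2s : s2 <= s by rewrite le_max lexx orbT.
  move=> x ABx; have [H1 H2] := smax_ge (f1 x) (f2 x) t0.
  by case: ABx => [/fs1|/fs2]; lra.
- by exists 0 => //; exists (fun=> 0) => //; exact: cutfun0.
- move=> x Kx; have e4 : 0 < e / 4 by rewrite divr_gt0.
  have [_ [f cf <-] Hf] := sup_adherent e4 (supD x).
  exists [set z | D z - 3 * (e / 4) <= f z].
    near=> z.
    have H1 : D z <= D x + e / 4 by near: z; exact: near_D.
    have H2 : f x - e / 4 < f z.
      by near: z; apply: (cvgr_gt _ (C1fun_continuous MR (cut_C1 cf) (x := x))); lra.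
    have Hf' : D x - e / 4 < f x := Hf.
    by rewrite /=; lra.
  by exists (3 * (e / 4)); [lra|exists f].
Unshelve. all: by end_near. Qed.

(* If no point z descends from y, D lies above a cone at y; the paraboloid [pl]
   exceeds D at y but not near the edge of the ball, so that gluing it into a
   near-optimal f contradicts the definition of D. *)
Section Glue.
Variables (y : M) (r : R).
Let a := chart_at y.
Let p0 := coord a y.
Let q := qball a p0.
Hypotheses (rr0 : 0 < r) (cB : compact [set p | q p <= r ^+ 2])
  (rP : forall p, q p <= r ^+ 2 -> chart_im a p /\
    forall v, gdot (metric a p) v v <= 4 * gdot (metric a p0) v v /\
      gdot (metric a p0) v v <= 4 * gdot (metric a p) v v)
  (far : forall z l, curve_length y z l -> D z < D y -> D y - l / 32 < D z).
Variable f : M -> R.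
Hypotheses (cf : cutfun f) (fD : forall x, (param a @` [set p | q p <= r ^+ 2]) x -> D x - r / 32 <= f x).

Let ap0 : chart_im a p0. Proof. exact: coord_im. Qed.

(** A point of the ball is reached by a curve of length at most 2 r, so by [far] the value of D
    drops by at most 2 r / 32 = r / 16; the approximation of D by f costs another r / 32. *)
Let f_low p : q p <= r ^+ 2 -> D y - r / 16 - r / 32 <= f (param a p).
Proof.
move=> pr; have H : D (param a p) - r / 32 <= f (param a p) by apply: fD; exists p.
suff : D y - r / 16 <= D (param a p) by lra.
have [yD|Dlt] := leP (D y) (D (param a p)); first by have := rr0; lra.
have [|l] := @ball_curve a p0 p r _ pr.
  by move=> p' /rP[H1 H2]; split => // v; have [] := H2 v.
rewrite /p0 (mfd_coordK MM (mfd_cover MM y)) => yz lq; have := far yz Dlt.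
have : Num.sqrt (q p) <= r.
  by rewrite -[leRHS]ger0_norm ?(ltW rr0)// -sqrtr_sqr ler_sqrt ?sqr_ge0.
move: lq; rewrite -/(q p); lra.
Qed.

(** The coefficient (4 r)^-1 is dictated by the slope: on the ball the gradient of q has norm at
    most 2 * 2 r. Where q > (3/4) r^2 the paraboloid has dropped by 3 r / 16, to below D y - r / 8,
    which is the lower bound of [f_low] minus the smoothing width r / 32; so there [smax] returns f
    and the gluing is seamless. *)
Let pl p := (D y + r / 16) - (4 * r)^-1 * q p.
Let A : set M := [set z | chart_dom a z /\ q (coord a z) < r ^+ 2].
Let F z := if `[< A z >] then smax (r / 32) (f z) (pl (coord a z)) else f z.
Let C := param a @` [set p | q p <= 3 / 4 * r ^+ 2].

Let q_cont p : {for p, continuous q}.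
Proof. by apply: (Ck_cont (U := setT) (qball_C1 a p0)). Qed.

Let t0 : 0 < r / 32. Proof. by rewrite divr_gt0. Qed.

Let oA : open A.
Proof.
rewrite openE => z [az qz]; rewrite /interior.
exact: (qball_coord_near ap0 az qz).
Qed.

Let sqr_r : 0 < r ^+ 2. Proof. exact: exprn_gt0. Qed.

Let param_cpt (K : set 'rV[R]_m) : compact K -> (forall p, K p -> q p <= r ^+ 2) -> compact (param a @` K).
Proof.
move=> cK Kr; apply: continuous_compact cK; apply: continuous_in_subspaceT => p /set_mem Kp.
by apply: (mfd_param_cont MM); case: (rP (Kr p Kp)).
Qed.

Let closedC : closed C.
Proof.
apply: (compact_closed (mfd_hausdorff MM)); apply: param_cpt => [|p /= H]; last by have := sqr_r; lra.
apply: (@subclosed_compact _ _ [set p | q p <= r ^+ 2]) => //.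
  apply: (@closed_comp _ _ q [set x : R | x <= 3 / 4 * r ^+ 2]); last exact: closed_le.
  by move=> p _; exact: q_cont.
by move=> p /= H; have := sqr_r; lra.
Qed.

Let F_off z : ~ C z -> F z = f z.
Proof.
move=> nC; rewrite /F; case: asboolP => // -[az qz].
have qz' : 3 / 4 * r ^+ 2 < q (coord a z).
  by rewrite ltNge; apply/negP => H; apply: nC; exists (coord a z) => //; exact: (mfd_coordK MM).
apply: smax_left => //; have := f_low (ltW qz); rewrite (mfd_coordK MM az) /pl.
suff : 3 * r / 16 <= (4 * r)^-1 * q (coord a z) by lra.
rewrite [leRHS]mulrC ler_pdivlMr; last by rewrite mulr_gt0.
by apply: le_trans (ltW qz'); rewrite expr2; lra.
Qed.

Let pl_C1 : Ck 1 setT pl.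
Proof.
apply: CkB; first exact: openT.
  exact: Ck_cst.
by apply: CkM; [exact: openT|exact: Ck_cst|exact: (qball_C1 a p0)].
Qed.

Let pl_slope p : q p <= r ^+ 2 -> gradip (metric a) pl pl p <= 1.
Proof.
move=> pr; have [ap Hp] := rP pr.
have E : drow pl p = - (2 * r)^-1 *: ((p - p0) *m metric a p0).
  have dq i : derivable q p (delta_mx 0 i).
    by apply: (Ck_der (qball_C1 a p0)).
  have dc (k : R) i : derivable (fun=> k) p (delta_mx 0 i : 'rV[R]_m) by exact: derivable_cst.
  have P i : pd i pl p = - ((4 * r)^-1 * pd i q p).
    have dM : derivable (fun p => (4 * r)^-1 * q p) p (delta_mx 0 i) by exact (derivableM (dc _ i) (dq i)).
    by rewrite (pdB (dc _ i) dM) pd_cst sub0r (pdM (dc _ i) (dq i)) pd_cst mul0r add0r.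
  apply/rowP => i; rewrite [LHS]mxE P [RHS]mxE.
  have := congr1 (fun v : 'rV[R]_m => v 0 i) (drow_qball MR ap0 p); rewrite [LHS]mxE => ->.
  move: ((p - p0) *m _) => u; rewrite mxE; move: (u 0 i) => k; field; exact: lt0r_neq0.
rewrite gradipE E gdotZl gdotZr mulrA mulrNN.
have GP := posdef_metric MR ap; have HP := posdef_metric MR ap0.
have := dual_compare (p - p0) GP HP (fun v => (Hp v).2); rewrite -/(qball a p0 p) -/(q p).
move: (gdot _ _ _) => k kq.
have r2 : 0 < (2 * r)^-1 * (2 * r)^-1 by rewrite mulr_gt0// invr_gt0 mulr_gt0.
apply: le_trans (ler_wpM2l (ltW r2) (le_trans kq (ler_wpM2l _ pr))) _ => //.
rewrite le_eqVlt; apply/orP; left; apply/eqP; field; exact: lt0r_neq0.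
Qed.

Let F_reg : C1fun F /\ slope1 F.
Proof.
apply: (cutfun_local MR) => x; have [Ax|nAx] := pselect (A x).
  exists a, A; split => //; first by move=> z [].
  have oP := open_chart_pre MR (a := a) oA.
  have Cf : Ck 1 (chart_pre a A) (locf f a).
    by apply: Ck_sub (cut_C1 cf a) => p [].
  have Cp : Ck 1 (chart_pre a A) pl by apply: Ck_sub pl_C1.
  pose G p := smax (r / 32) (locf f a p) (pl p).
  have EG p : chart_pre a A p -> locf F a p = G p.
    move=> [ap Ap]; rewrite /locf /F /=; case: asboolP => // _.
    by rewrite (paramP MR ap).2.
  have CG : Ck 1 (chart_pre a A) G by exact: C1_smax.
  split; first by apply: Ck_ext CG => // p /EG.
  move=> p Pp; have ap : chart_im a p by case: Pp.
  rewrite (@gradip_shift _ _ _ G (locf F a) 0); last first.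
  - by apply: (near_open oP Pp) => p' /EG ->; rewrite subr0.
  - by move=> i; exact: Ck_der CG Pp.
  have GP := posdef_metric MR ap.
  apply: (slope_smax oP t0 Cf Cp Pp GP); first exact: (cut_slope cf).
  by apply: pl_slope; case: Pp => _ [_]; rewrite (paramP MR ap).2 => /ltW.
have nCx : ~ C x.
  move=> [p qp px]; apply: nAx; have [|ap _] := rP (p := p); first by have := sqr_r; move: qp => /=; lra.
  have [ax pK] := paramP MR ap; rewrite px in ax pK; split => //; rewrite pK.
  by have := sqr_r; move: qp => /=; lra.
exists (chart_at x), (~` C `&` chart_dom (chart_at x)).
have oO : open (~` C `&` chart_dom (chart_at x)).
  by apply: openI; [exact: closed_openC|exact: (mfd_open_dom MM)].
split; [exact: oO|by split => //; exact: (mfd_cover MM)|by move=> z []|].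
have oP := open_chart_pre MR (a := chart_at x) oO.
have Cf : Ck 1 (chart_pre (chart_at x) (~` C `&` chart_dom (chart_at x))) (locf f (chart_at x)).
  by apply: Ck_sub (cut_C1 cf _) => p [].
have EG p : chart_pre (chart_at x) (~` C `&` chart_dom (chart_at x)) p ->
    locf F (chart_at x) p = locf f (chart_at x) p.
  by move=> [ap [nC _]]; exact: F_off.
split; first by apply: Ck_ext Cf => // p /EG.
move=> p Pp; have ap : chart_im (chart_at x) p by case: Pp.
rewrite (@gradip_shift _ _ _ (locf f (chart_at x)) (locf F (chart_at x)) 0).
- exact: (cut_slope cf).
- by move=> i; exact: Ck_der Cf Pp.
- by apply: (near_open oP Pp) => p' /EG ->; rewrite subr0.
Qed.

Lemma glue_absurd : False.
Proof.
have cF : cutfun F.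
  split; [exact: F_reg.1|exact: F_reg.2|].
  have [K cK Kf] := cut_supp cf; exists (K `|` param a @` [set p | q p <= r ^+ 2]).
    by apply: compactU => //; exact: param_cpt.
  move=> x /not_orP[/Kf fx nx]; rewrite F_off// => -[p qp px]; apply: nx; exists p => //.
  by have := sqr_r; move: qp => /=; lra.
have := D_ge y cF; have Ay : A y.
  by split; [exact: (mfd_cover MM)|rewrite /q (qball0 a)].
rewrite /F; case: asboolP => // _; have [_] := smax_ge (f y) (pl (coord a y)) t0.
have -> : pl (coord a y) = D y + r / 16 by rewrite /pl /q (qball0 a) mulr0 subr0.
have := rr0; lra.
Qed.

End Glue.

Lemma descend (y : M) : exists z l, [/\ curve_length y z l, D z <= D y - l / 32 & D z < D y].
Proof.
apply: contrapT => nex.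
have far z l : curve_length y z l -> D z < D y -> D y - l / 32 < D z.
  by move=> yz Dz; rewrite ltNge; apply/negP => H; apply: nex; exists z, l.
have [r rr0 [cB rP]] := chart_ball MR (coord_im y).
have cK : compact (param (chart_at y) @` [set p | qball (chart_at y) (coord (chart_at y) y) p <= r ^+ 2]).
  apply: continuous_compact cB; apply: continuous_in_subspaceT => p /set_mem Kp.
  by apply: (mfd_param_cont MM); case: (rP p Kp).
have r32 : 0 < r / 32 by rewrite divr_gt0.
have [f cf fD] := uniform_cutfun cK r32.
exact: (glue_absurd rr0 cB rP far cf fD).
Qed.

(** Half the rate of [descend]: a descent from the limit point remains admissible when it is started
    at a nearby point of the sequence. *)
Let S x z := exists2 l, curve_length x z l & D z <= D x - l / 64.

(** The choice of z realizes at least half of the possible decrease of D along S from x; the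
    inequality says that D z is at most the mean of D x and D z'. *)
Let next x : exists z, S x z /\ forall z', S x z' -> 2 * D z - D x <= D z'.
Proof.
have Sx : S x x by exists 0; [exact: curve_nil|lra].
have hi : has_inf [set D z | z in S x].
  by split; [exists (D x), x|exists 0 => _ [z _ <-]].
have lb z : S x z -> inf [set D z | z in S x] <= D z.
  by move=> Sz; apply: ge_inf; [exact: hi.2|exists z].
have [H|H] := leP (D x) (inf [set D z | z in S x]).
  by exists x; split => // z' /lb; lra.
have e0 : 0 < (D x - inf [set D z | z in S x]) / 2 by rewrite divr_gt0// subr_gt0.
have [_ [z Sz <-] Hz] := inf_adherent e0 hi.
by exists z; split => // z' /lb; lra.
Qed.

(* Ekeland's variational principle: a maximal chain for the order S converges by
   completeness, and [descend] applies at the limit. *)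
Lemma cutfun_unbounded : False.
Proof.
have [nxt Hn] := choice next; pose u k := iter k nxt x0.
have Su p k : S (u p) (u (p + k)%N).
  elim: k => [|k [l IH Dl]]; first by exists 0; rewrite addn0; [exact: curve_nil|lra].
  have [[l' H' D'] _] := Hn (u (p + k)%N); exists (l + l').
    by apply: curve_trans IH _; rewrite addnS.
  by move: D'; rewrite -[nxt _]/(u (p + k).+1) addnS; lra.
pose E := [set D (u k) | k in setT]; pose L := inf E.
have hi : has_inf E by split; [exists (D (u 0%N)), 0%N|exists 0 => _ [k _ <-]].
have L_le k : L <= D (u k) by apply: ge_inf; [exact: hi.2|exists k].
have L_near e : 0 < e -> exists N, forall p, (N <= p)%N -> D (u p) < L + e.
  move=> e0; have [_ [N _ <-] HN] := inf_adherent e0 hi; exists N => p Np.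
  have [l /(curve_ge0) l0] := Su N (p - N)%N; rewrite subnKC// => H.
  by apply: le_lt_trans HN; lra.
have dist_lt (x z : M) (l e : R) : curve_length x z l -> l < e -> (riem_dist x z < e%:E)%E.
  move=> xz le; apply: (@le_lt_trans _ _ l%:E); last by rewrite lte_fin.
  by apply: ereal_inf_lbound; exists l.
have lt_dist (x z : M) (e : R) : (riem_dist x z < e%:E)%E -> exists2 l, curve_length x z l & l < e.
  by move=> /ereal_inf_lt[_ [l xz <-]]; rewrite lte_fin => le; exists l.
have [|x Hx] := M_complete (u := u).
  move=> e e0; have e64 : 0 < e / 64 by rewrite divr_gt0.
  have [N HN] := L_near _ e64; exists N.
  have H p q : (N <= p)%N -> (p <= q)%N -> exists2 l, curve_length (u p) (u q) l & l < e.
    move=> Np pq; have [l] := Su p (q - p)%N; rewrite subnKC// => ul Dl; exists l => //.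
    by have := HN _ Np; have := L_le q; lra.
  move=> p q Np Nq; have [pq|/ltnW qp] := leqP p q.
    by have [l ul le] := H p q Np pq; exact: dist_lt ul le.
  by have [l ul le] := H q p Nq qp; exact: dist_lt (curve_sym MR ul) le.
have [z [l0 [xz Dz Dlt]]] := descend x.
have l0D : D x - D z <= l0 by have := D_curve (curve_sym MR xz); lra.
(* Call this e. Far along the sequence l < e, while l0 >= 100 e, so the length l + l0 from u p to z
   costs little: D z <= D (u p) + l - l0 / 32 <= D (u p) - (l + l0) / 64. Thus z is admissible from
   u p, although D z lies far below the limit L of the D (u k). *)
have e0 : 0 < (D x - D z) / 100 by rewrite divr_gt0// subr_gt0.
have [N1 H1] := Hx _ e0; have [N2 H2] := L_near _ e0.
pose p := maxn N1 N2; have [l upx le] := lt_dist (u p) x _ (H1 p (leq_maxl _ _)).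
have H2p := H2 p (leq_maxr _ _); have Lp := L_le p; have Lp1 := L_le p.+1.
have Dx := D_curve upx; have l00 := curve_ge0 upx.
have Sz : S (u p) z by exists (l + l0); [exact: curve_trans upx xz|lra].
by have [_ /(_ z Sz)] := Hn (u p); rewrite -[nxt _]/(u p.+1); lra.
Qed.

End Bounded.

Lemma cutoff_exists (x0 : M) (r : R) : exists2 f, cutfun f & r <= f x0.
Proof.
apply: contrapT => nex; apply: (@cutfun_unbounded x0 r) => f cf.
by rewrite leNgt; apply/negP => /ltW H; apply: nex; exists f.
Qed.

End Ekeland.

(** * A parabolicity theorem for weighted Laplacians *)

Section WeightedDivergence.
Context {R : realType} {m : nat} {M : riemData R m} (MR : is_riemannian M).
Variables (dM : {measure set (borel M) -> \bar R}) (dM_vol : is_riemannian_volume dM).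
Variables (u w : M -> R).
Hypotheses (Cu : C1fun u) (Cw : forall a, Ck 2 (chart_im a) (locf w a)).
Implicit Types (a b : chart M) (x : M) (y : 'rV[R]_m) (f : M -> R).
Let MM := riem_manifold MR.
Let oM a : open (chart_im a). Proof. exact: (mfd_open_im MM). Qed.

Lemma gradipC a f f' y : chart_im a y ->
  gradip (metric a) (locf f a) (locf f' a) y = gradip (metric a) (locf f' a) (locf f a) y.
Proof. by move=> /(posdef_metric MR)/posdef_inv H; rewrite !gradipE gdotC. Qed.

(** The logarithmic derivative of the volume density, by Jacobi's formula. *)
Definition half_trace a k y : R :=
  2^-1 * \sum_i \sum_j lgi (metric a) i j y * pd k (fun y => metric a y i j) y.

Let is_derive_sqrt (t : R) : 0 < t -> is_derive t 1 Num.sqrt (2 * Num.sqrt t)^-1.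
Proof. by move=> t0; exact: is_derive1_sqrt. Qed.

Let C1_det a : Ck 1 (chart_im a) (fun y => \det (metric a y)).
Proof. by apply: (Ck_det (@oM a)) => i j; exact: (smooth_metric MR a i j). Qed.

Lemma vol_C1 a : Ck 1 (chart_im a) (vol a).
Proof.
apply: (C1_scomp (u' := fun t => (2 * Num.sqrt t)^-1) (@oM a) (@C1_det a)) => y ay;
  have d0 := posdef_det (posdef_metric MR ay); first exact: is_derive_sqrt.
have c2 : {for \det (metric a y), continuous (fun t : R => 2 * Num.sqrt t)}.
  by apply: cvgM; [exact: cvg_cst|exact: sqrt_continuous].
by apply: cvgV => //; rewrite gt_eqF// mulr_gt0 ?sqrtr_gt0.
Qed.

Lemma pd_vol a k y : chart_im a y -> pd k (vol a) y = vol a y * half_trace a k y.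
Proof.
move=> ay; have GP := posdef_metric MR ay; have d0 := posdef_det GP.
have dg i j : derivable (fun y => metric a y i j) y (delta_mx 0 k).
  by apply: (smooth_der (smooth_metric MR a i j) ay).
apply: etrans (pd_scomp k (@C1_det a) ay (is_derive_sqrt d0)) _.
have E := derive_val (is_derive := pd_det_unit dg (posdef_unit GP)).
rewrite [pd k _ y]E /half_trace /lgi /vol.
have -> : \sum_i \sum_j invmx (metric a y) j i * pd k (fun y => metric a y i j) y =
    \sum_i \sum_j invmx (metric a y) i j * pd k (fun y => metric a y i j) y.
  apply: eq_bigr => i _; apply: eq_bigr => j _.
  by rewrite -[in LHS](posdef_inv GP) mxE.
move: (\sum_i _) => s; rewrite -[X in _ * (X * s)](sqr_sqrtr (ltW d0)) expr2.
have : Num.sqrt (\det (metric a y)) != 0 by rewrite gt_eqF ?sqrtr_gt0.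
move: (Num.sqrt _) => v v0; field; exact: v0.
Qed.

Let gw a i := gradv (metric a) (locf w a) i.

Lemma gradv_C1 a i : Ck 1 (chart_im a) (gw a i).
Proof.
rewrite /gw /gradv; apply: Ck_sum => [|q _]; [exact: oM|]; apply: (CkM (@oM a)); last exact: Ck_pd (Cw a).
apply: Ck_invmx => [|y ay|i' j']; first exact: oM.
  exact: posdef_unit (posdef_metric MR ay).
exact: (smooth_metric MR a).
Qed.

(** The Laplacian of w for the measure e^u dM, with u a general log-weight; [wlap_Lsol] identifies
    it with L. *)
Definition wlap a y := divg (metric a) (gw a) y + gradip (metric a) (locf u a) (locf w a) y.

Let ewf a y := expR (locf u a y).

Let ewf_C1 a : Ck 1 (chart_im a) (ewf a).
Proof.
exact: (C1_scomp (u := expR) (u' := expR) (@oM a) (Cu a) (fun y _ => is_derive_expR (locf u a y))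
  (fun y _ => @continuous_expR R (locf u a y))).
Qed.

Section Field.
Variables (a : chart M) (chi : M -> R).
Hypothesis Cchi : C1fun chi.

(** The density of chi e^u grad w. In its Euclidean divergence the derivative of [vol] supplies the
    trace term of [divg], that of e^u the drift, and that of chi the cross term. *)
Definition wfield i y := locf chi a y * (ewf a y * (vol a y * gw a i y)).

Lemma wfield_C1 i : Ck 1 (chart_im a) (wfield i).
Proof.
apply: (CkM (@oM a) (Cchi a)); apply: (CkM (@oM a) (@ewf_C1 a)).
exact (CkM (@oM a) (@vol_C1 a) (@gradv_C1 a i)).
Qed.

Let alg (X E v Y dX dU T dY : R) :
  dX * (E * (v * Y)) + X * (E * dU * (v * Y) + E * (v * T * Y + v * dY)) =
  E * v * (Y * dX) + E * v * X * (dY + (Y * T + Y * dU)).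
Proof. ring. Qed.

Lemma wfield_div y : chart_im a y -> \sum_i pd i (wfield i) y =
  vol a y * (expR (locf u a y) *
    (locf chi a y * wlap a y + gradip (metric a) (locf w a) (locf chi a) y)).
Proof.
move=> ay; have P i : pd i (wfield i) y = ewf a y * vol a y * (gw a i y * pd i (locf chi a) y) +
    ewf a y * vol a y * locf chi a y *
    (pd i (gw a i) y + (gw a i y * half_trace a i y + gw a i y * pd i (locf u a) y)).
  have d1 := Ck_der (i := i) (Cchi a) ay; have d2 := Ck_der (i := i) (@ewf_C1 a) ay.
  have d3 := Ck_der (i := i) (@vol_C1 a) ay; have d4 := Ck_der (i := i) (@gradv_C1 a i) ay.
  have d34 := derivableM d3 d4; have d234 := derivableM d2 d34.
  rewrite (pdM d1 d234) (pdM d2 d34) (pdM d3 d4) (pd_vol i ay).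
  have -> : pd i (ewf a) y = ewf a y * pd i (locf u a) y.
    exact: (pd_scomp i (Cu a) ay (is_derive_expR _)).
  exact: alg.
rewrite (eq_bigr _ (fun i _ => P i)) big_split/= -!mulr_sumr !big_split/=.
have -> : wlap a y = \sum_i pd i (gw a i) y +
    (\sum_i gw a i y * half_trace a i y + \sum_i gw a i y * pd i (locf u a) y).
  by rewrite /wlap (@gradipC a u w y ay) /divg -addrA.
rewrite -/(gradip (metric a) (locf w a) (locf chi a) y) -/(ewf a y).
move: (gradip _ _ _ _) (\sum_i _) (\sum_i _) (\sum_i _) => g0 s1 s2 s3; ring.
Qed.

Definition cut_div x : R := \1_(chart_dom a) x * (expR (u x) *
  (chi x * wlap a (coord a x) + gradip (metric a) (locf w a) (locf chi a) (coord a x))).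

Variable K : set 'rV[R]_m.
Hypotheses (cK : compact K) (KV : K `<=` chart_im a)
  (chiK : forall x, ~ (param a @` K) x -> chi x = 0).

(** Extension by zero: the values of [wfield] outside the image of the chart are junk. The support
    lies in the compact set K inside the image, so the result is C^1 on the whole space. *)
Let W i y := if `[< chart_im a y >] then wfield i y else 0.

Let W_in i y : chart_im a y -> W i y = wfield i y.
Proof. by move=> ay; rewrite /W asboolT. Qed.

Let W_K i y : ~ K y -> W i y = 0.
Proof.
move=> nK; rewrite /W; case: asboolP => // ay; rewrite /wfield /locf/= chiK ?mul0r//.
move=> [z Kz zy]; apply: nK; rewrite -(paramP MR ay).2 -zy.
by rewrite (paramP MR (KV Kz)).2.
Qed.

Let W_C1 i : Ck 1 setT (W i).
Proof.
apply: Ck_local => y _; have [ay|nay] := pselect (chart_im a y).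
  exists (chart_im a); split => //.
  by apply: Ck_ext (wfield_C1 i) => // z az; rewrite W_in.
exists (~` K); have oK : open (~` K).
  by apply: closed_openC; apply: compact_closed cK; exact: norm_hausdorff.
split => //; first by move=> /KV.
by apply: (@Ck_ext _ _ _ _ (fun=> 0)) => // [z nK|]; [rewrite W_K|exact: Ck_cst].
Qed.

Lemma integral_cut_div : dM.-integrable [set: borel M] (EFin \o cut_div) /\
  \int[dM]_x cut_div x = 0.
Proof.
have := integral_mdiv MR dM_vol cK KV W_C1 W_K.
have -> : mdiv a W = cut_div; last by [].
apply/funext => x; rewrite /mdiv /cut_div indicE.
have [/set_mem ax|ax] := boolP (x \in _); last by rewrite !mul0r.
have ay : chart_im a (coord a x) by exists x.
congr (_ * _); rewrite /cdiv.
have -> : \sum_i pd i (W i) (coord a x) = \sum_i pd i (wfield i) (coord a x).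
  apply: eq_bigr => i _; apply: pd_near.
  by apply: (near_open (@oM a) ay) => z; exact: W_in.
rewrite (wfield_div ay) /locf/= (mfd_coordK MM ax) mulrC mulKf//.
by rewrite gt_eqF// (vol_gt0 MR ay).
Qed.

End Field.
End WeightedDivergence.

Section SmoothStep.
Context {R : realType}.
Implicit Types t : R.

Lemma ramp_ge1 t : 1 <= t -> ramp t = t.
Proof.
move=> t1; rewrite /ramp.
have -> : Num.max (t + 1) 0 = t + 1 by apply/max_idPl; lra.
have -> : Num.max (t - 1) 0 = t - 1 by apply/max_idPl; lra.
by field.
Qed.

(** A C^1 step from 0 for t <= -1 to 1 for t >= 3: two ramps whose linear parts cancel. *)
Definition step t : R := (ramp t - ramp (t - 2)) / 2.

Lemma step_bounds t : 0 <= step t <= 1.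
Proof.
have maxP (s : R) : (Num.max s 0 = s /\ 0 <= s) \/ (Num.max s 0 = 0 /\ s <= 0).
  by have [s0|s0] := leP s 0; [right|left; split => //; exact: ltW].
rewrite /step /ramp.
have [[-> ?]|[-> ?]] := maxP (t + 1); have [[-> ?]|[-> ?]] := maxP (t - 1);
have [[-> ?]|[-> ?]] := maxP (t - 2 + 1); have [[-> ?]|[-> ?]] := maxP (t - 2 - 1);
by apply/andP; split; nra.
Qed.

Lemma step0 t : t <= -1 -> step t = 0.
Proof. by move=> t1; rewrite /step !ramp_le0//; lra. Qed.

Lemma step1 t : 3 <= t -> step t = 1.
Proof. by move=> t3; rewrite /step !ramp_ge1; [field|lra|lra]. Qed.

Lemma C1_ramp m (U : set 'rV[R]_m) (f : 'rV[R]_m -> R) : open U -> Ck 1 U f ->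
  Ck 1 U (fun y => ramp (f y)).
Proof.
move=> oU Cf; apply: (C1_scomp (u := ramp) (u' := @dramp R) oU Cf) => y _.
  exact: is_derive_ramp.
exact: dramp_continuous.
Qed.

Lemma C1_step m (U : set 'rV[R]_m) (f : 'rV[R]_m -> R) : open U -> Ck 1 U f ->
  Ck 1 U (fun y => step (f y)).
Proof.
move=> oU Cf; apply: (CkM oU); last exact: Ck_cst.
apply: (CkB oU); first exact: C1_ramp.
exact (C1_ramp oU (CkB oU Cf (Ck_cst 1 U 2))).
Qed.

End SmoothStep.

Section Bumps.
Context {R : realType} {m : nat} {M : riemData R m} (MR : is_riemannian M).
Let MM := riem_manifold MR.

Lemma bump_exists (x : M) : exists (K : set 'rV[R]_m) (B : M -> R),
  [/\ compact K, K `<=` chart_im (chart_at x),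
    C1fun B /\ forall z, 0 <= B z <= 1,
    forall z, ~ (param (chart_at x) @` K) z -> B z = 0 &
    \forall z \near x, B z = 1].
Proof.
set a := chart_at x; pose p0 := coord a x.
have ap0 : chart_im a p0 by exact: (coord_im MR).
have [r r0 [cB rP]] := chart_ball MR ap0.
have r2 : 0 < r ^+ 2 by exact: exprn_gt0.
(* The affine map sends q = r^2 / 4 to -1 and q = (3/4) r^2 to 3, the ends of the transition of
   [step]. So B is 1 on the inner ball and 0 outside K. *)
pose q := qball a p0; pose v p := 8 / r ^+ 2 * q p - 3.
pose A : set M := [set z | chart_dom a z /\ q (coord a z) < r ^+ 2].
pose B z := if `[< A z >] then 1 - step (v (coord a z)) else 0.
pose K := [set p | q p <= 3 / 4 * r ^+ 2].
have q_cont p : {for p, continuous q} by apply: (Ck_cont (U := setT) (qball_C1 a p0)).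
have Kr p : K p -> q p <= r ^+ 2.
  by move=> H; have H' : q p <= 3 / 4 * r ^+ 2 := H; lra.
have cK : compact K.
  apply: (@subclosed_compact _ _ [set p | q p <= r ^+ 2]) => //.
  apply: (@closed_comp _ _ q [set x : R | x <= 3 / 4 * r ^+ 2]); last exact: closed_le.
  by move=> p _; exact: q_cont.
have KV : K `<=` chart_im a by move=> p /Kr /rP[].
have oA : open A.
  by rewrite openE => z [az qz]; rewrite /interior; exact: (qball_coord_near MR ap0 az qz).
have cC : closed (param a @` K).
  apply: (compact_closed (mfd_hausdorff MM)); apply: continuous_compact cK.
  apply: continuous_in_subspaceT => p /set_mem Kp.
  by apply: (mfd_param_cont MM); exact: KV.
have B_off z : ~ (param a @` K) z -> B z = 0.
  move=> nK; rewrite /B; case: asboolP => // -[az qz].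
  rewrite step1 ?subrr// /v lerBrDr mulrAC ler_pdivlMr//.
  suff : 3 / 4 * r ^+ 2 < q (coord a z) by lra.
  by rewrite ltNge; apply/negP => H; apply: nK; exists (coord a z) => //; exact: (mfd_coordK MM).
exists K, B; split => //.
- split; last first.
    move=> z; rewrite /B; case: asboolP => _; last by rewrite lexx ler01.
    by have := step_bounds (v (coord a z)); lra.
  apply: (C1fun_local MR) => z; have [Az|nAz] := pselect (A z).
    exists a, A; split => //; first by move=> z' [].
    have oP := open_chart_pre MR (a := a) oA.
    have Cv : Ck 1 (chart_pre a A) (fun p => 1 - step (v p)).
      apply: (CkB oP); first exact: Ck_cst.
      apply: (C1_step oP); apply: (CkB oP); last exact: Ck_cst.
      apply: (CkM oP); first exact: Ck_cst.
      exact: Ck_sub (qball_C1 a p0).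
    apply: Ck_ext Cv => // p [ap Ap]; rewrite /locf /B /=; case: asboolP => // _.
    by rewrite (paramP MR ap).2.
  have nCz : ~ (param a @` K) z.
    move=> [p Kp pz]; apply: nAz; have [ax pK] := paramP MR (KV p Kp).
    rewrite pz in ax pK; split => //; rewrite pK.
    by have H' : q p <= 3 / 4 * r ^+ 2 := Kp; have := r2; lra.
  have oO : open (~` (param a @` K) `&` chart_dom (chart_at z)).
    by apply: openI; [exact: closed_openC|exact: (mfd_open_dom MM)].
  exists (chart_at z), (~` (param a @` K) `&` chart_dom (chart_at z)).
  split; [exact: oO|by split => //; exact: (mfd_cover MM)|by move=> z' []|].
  apply: (@Ck_ext _ _ _ _ (fun=> 0)); [exact: (open_chart_pre MR)| |exact: Ck_cst].
  by move=> p [_ [nC _]]; rewrite /locf/= B_off.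
- have q4 : q (coord a x) < r ^+ 2 / 4 by rewrite /q qball0 divr_gt0.
  apply: filterS (qball_coord_near MR ap0 (mfd_cover MM x) q4) => z [az qz].
  have qz' : q (coord a z) < r ^+ 2 / 4 := qz.
  rewrite /B asboolT; last by split => //; lra.
  rewrite step0 ?subr0// /v lerBlDr mulrAC ler_pdivrMr//.
  by lra.
Qed.

End Bumps.

Section GlobalGradient.
Context {R : realType} {m : nat} {M : riemData R m} (MR : is_riemannian M).
Implicit Types (a b : chart M) (x : M) (f : M -> R).
Let MM := riem_manifold MR.
Let oM a : open (chart_im a). Proof. exact: (mfd_open_im MM). Qed.

Definition gp f f' x : R :=
  gradip (metric (chart_at x)) (locf f (chart_at x)) (locf f' (chart_at x)) (coord (chart_at x) x).

Lemma gp_chart f f' a x : C1fun f -> C1fun f' -> chart_dom a x ->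
  gradip (metric a) (locf f a) (locf f' a) (coord a x) = gp f f' x.
Proof.
move=> Cf Cf' ax; pose b := chart_at x; have bx : chart_dom b x := mfd_cover MM x.
have E : transition a b (coord a x) = coord b x by rewrite /transition/= (mfd_coordK MM).
have H : ovl a b (coord a x) by split; [exists x|rewrite (mfd_coordK MM)].
have Ob : chart_im b (transition a b (coord a x)) by rewrite E; exists x.
by rewrite (gradip_transition MR H (@oM b) Ob (Cf b) (Cf' b)) E.
Qed.

Let inv_posdef x : posdef (invmx (metric (chart_at x) (coord (chart_at x) x))).
Proof. by apply: posdef_invmx; apply: (posdef_metric MR); exact: (coord_im MR). Qed.

Lemma gp_ge0 f x : 0 <= gp f f x.
Proof. by rewrite /gp gradipE posdef_ge0. Qed.

Lemma gp_cauchy f f' x : gp f f' x ^+ 2 <= gp f f x * gp f' f' x.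
Proof. by rewrite /gp !gradipE mulrC; exact: posdef_cauchy. Qed.

Lemma gpD f f1 f2 x : C1fun f1 -> C1fun f2 ->
  gp f (fun x => f1 x + f2 x) x = gp f f1 x + gp f f2 x.
Proof.
move=> C1 C2; have ax := coord_im MR x; rewrite /gp /gradip -big_split/=.
apply: eq_bigr => k _; rewrite -mulrDr; congr (_ * _).
exact (pdD (Ck_der (i := k) (C1 _) ax) (Ck_der (i := k) (C2 _) ax)).
Qed.

Lemma gp_near0 f f' x : (\forall z \near x, f' z = 0) -> gp f f' x = 0.
Proof.
move=> f0; rewrite /gp /gradip big1// => k _.
have -> : pd k (locf f' (chart_at x)) (coord (chart_at x) x) =
    pd k (fun=> 0 : R) (coord (chart_at x) x).
  apply: pd_near; have ax := coord_im MR x.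
  have f0' : \forall z \near param (chart_at x) (coord (chart_at x) x), f' z = 0.
    by rewrite (mfd_coordK MM (mfd_cover MM x)).
  exact: (mfd_param_cont MM ax f0').
by rewrite pd_cst mulr0.
Qed.

Lemma gp_sqr f f' x : C1fun f' -> gp f (fun x => f' x ^+ 2) x = 2 * f' x * gp f f' x.
Proof.
move=> C1; have ax := coord_im MR x; rewrite /gp /gradip mulr_sumr.
apply: eq_bigr => k _; have d := Ck_der (i := k) (C1 _) ax.
have -> : pd k (locf (fun x => f' x ^+ 2) (chart_at x)) (coord (chart_at x) x) =
   2 * f' x * pd k (locf f' (chart_at x)) (coord (chart_at x) x).
  apply: etrans (pdM d d) _.
  have -> : locf f' (chart_at x) (coord (chart_at x) x) = f' x.
    by rewrite /locf/= (mfd_coordK MM (mfd_cover MM x)).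
  move: (pd _ _ _) => p; ring.
by rewrite mulrCA.
Qed.

Lemma C1funM f f' : C1fun f -> C1fun f' -> C1fun (fun x => f x * f' x).
Proof. by move=> C1 C2 a; exact (CkM (@oM a) (C1 a) (C2 a)). Qed.

Lemma C1funD f f' : C1fun f -> C1fun f' -> C1fun (fun x => f x + f' x).
Proof. by move=> C1 C2 a; exact (CkD (@oM a) (C1 a) (C2 a)). Qed.

Lemma C1fun_cst (c : R) : C1fun (fun _ : M => c).
Proof. by move=> a; exact: Ck_cst. Qed.

End GlobalGradient.

Section Parabolicity.
Context {R : realType} {m : nat} {M : riemData R m} (MR : is_riemannian M).
Hypotheses (M_connected : connected [set: M]) (M_complete : complete_riemannian M).
Variables (dM : {measure set (borel M) -> \bar R}) (dM_vol : is_riemannian_volume dM).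
Variables (u w : M -> R).
Hypotheses (Cu : C1fun u) (Cw : forall a, Ck 2 (chart_im a) (locf w a)) (w_ge0 : forall x, 0 <= w x).
Hypothesis wlap_ge : forall a y, chart_im a y -> 0 <= wlap u w a y /\
  gradip (metric a) (locf w a) (locf w a) y <= 2 * locf w a y * wlap u w a y.
Implicit Types (a : chart M) (x : M) (f chi : M -> R).
Let MM := riem_manifold MR.
Let oM a : open (chart_im a). Proof. exact: (mfd_open_im MM). Qed.
Let Cw1 : C1fun w. Proof. by move=> a; exact: CkW (Cw a). Qed.

(* 0 where w vanishes, in which case the gradient of w vanishes too *)
Definition energy x : R := gp w w x / (2 * w x).

Let wlap_x a x : chart_dom a x ->
  0 <= wlap u w a (coord a x) /\ gp w w x <= 2 * w x * wlap u w a (coord a x).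
Proof.
move=> ax; have ay : chart_im a (coord a x) by exists x.
have [H0] := wlap_ge ay; rewrite (gp_chart MR Cw1 Cw1 ax).
by rewrite {1}/locf/= (mfd_coordK MM ax).
Qed.

Lemma energy_le a x : chart_dom a x -> energy x <= wlap u w a (coord a x).
Proof.
move=> /wlap_x[L0 H]; rewrite /energy.
have [->|w0] := eqVneq (w x) 0; first by rewrite mulr0 invr0 mulr0.
have wp : 0 < 2 * w x by rewrite mulr_gt0// lt_neqAle eq_sym w0 w_ge0.
by rewrite ler_pdivrMr// mulrC.
Qed.

Lemma energy_ge0 x : 0 <= energy x.
Proof. by rewrite /energy divr_ge0 ?(gp_ge0 MR)// mulr_ge0. Qed.

Lemma gp_w0 x : w x = 0 -> gp w w x = 0.
Proof.
move=> w0; apply: le_anti; rewrite (gp_ge0 MR) andbT.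
by have [_] := wlap_x (mfd_cover MM x); rewrite w0 mulr0 mul0r.
Qed.

(* The function k is a divergence, bounded below by that of e^u chi grad w with
   wlap replaced by [energy]. Unlike wlap, which is tied to a chart, this
   makes sense globally, and it is additive in chi. *)
Definition div_bound chi := exists2 k : M -> R,
  dM.-integrable [set: borel M] (EFin \o (k : borel M -> R)) /\ \int[dM]_x k x = 0 &
  forall x, expR (u x) * (chi x * energy x + gp w chi x) <= k x.

Lemma div_bound_cut a (K : set 'rV[R]_m) chi : compact K -> K `<=` chart_im a -> C1fun chi ->
  (forall x, 0 <= chi x) -> (forall x, ~ (param a @` K) x -> chi x = 0) -> div_bound chi.
Proof.
move=> cK KV Cc c0 cK0; exists (cut_div u w a chi).
  exact: (integral_cut_div MR dM_vol Cu Cw Cc cK KV cK0).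
move=> x; rewrite /cut_div indicE; have [/set_mem ax|ax] := boolP (x \in _).
  rewrite mul1r ler_wpM2l ?expR_ge0// (gp_chart MR Cw1 Cc ax) lerD2r ler_wpM2l//.
  exact: energy_le.
have nK z : chart_dom a z \/ ~ (param a @` K) z.
  have [az|az] := pselect (chart_dom a z); [by left|right => -[p Kp pz]; apply: az].
  by rewrite -pz; case: (paramP MR (KV p Kp)).
have nKx : ~ (param a @` K) x by case: (nK x) => // ax'; rewrite mem_set in ax.
have cC : closed (param a @` K).
  apply: (compact_closed (mfd_hausdorff MM)); apply: continuous_compact cK.
  apply: continuous_in_subspaceT => p /set_mem Kp.
  by apply: (mfd_param_cont MM); exact: KV.
rewrite (cK0 x nKx) mul0r add0r (gp_near0 MR) ?mulr0 ?mul0r//.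
by apply: (near_open (closed_openC cC) nKx) => z; exact: cK0.
Qed.

Lemma div_bound0 : div_bound (fun=> 0).
Proof.
exists (fun=> 0).
  by split; [exact: integrable0|rewrite Rintegral_cst//= mul0r].
by move=> x; rewrite mul0r add0r (gp_near0 MR) ?mulr0//; exact: filterE.
Qed.

Lemma div_boundD chi chi' : C1fun chi -> C1fun chi' -> div_bound chi -> div_bound chi' ->
  div_bound (fun x => chi x + chi' x).
Proof.
move=> C1 C2 [k [ik k0] kP] [k' [ik' k0'] kP']; exists (fun x => k x + k' x).
  split; first exact (integrableD measurableT ik ik').
  by have := RintegralD measurableT ik ik'; rewrite k0 k0' addr0.
move=> x; rewrite (gpD MR w x C1 C2); apply: le_trans (lerD (kP x) (kP' x)).
by rewrite -mulrDr mulrDl addrACA.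
Qed.

(** Peeling replaces a partition of unity. Q A says that from any chi a part satisfying [div_bound]
    can be split off so that the rest vanishes on A; for a union, the rest is split again. Locally
    the part is B chi with a bump B. The last clause of Q keeps the rest zero where chi is, so after
    K is exhausted nothing remains. *)
Lemma div_bound_compact (K : set M) chi : compact K -> C1fun chi -> (forall x, 0 <= chi x) ->
  (forall x, ~ K x -> chi x = 0) -> div_bound chi.
Proof.
move=> cK Cc c0 cK0.
pose Q (A : set M) := forall chi, C1fun chi -> (forall x, 0 <= chi x) ->
  exists chi1 chi2, [/\ chi = (fun x => chi1 x + chi2 x), C1fun chi1 /\ div_bound chi1,
    C1fun chi2 /\ (forall x, 0 <= chi2 x), forall x, A x -> chi2 x = 0 &
    forall x, chi x = 0 -> chi2 x = 0].
have QK : Q K.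
  apply: (compact_union_closed cK).
  - move=> A B AB QB f Cf f0; have [f1 [f2 [E H1 H2 H3 H4]]] := QB f Cf f0.
    by exists f1, f2; split => // x /AB; exact: H3.
  - move=> A B QA QB f Cf f0; have [f1 [f2 [E [C1 B1] [C2 f20] H3 H4]]] := QA f Cf f0.
    have [f3 [f4 [E' [C3 B3] [C4 f40] H5 H6]]] := QB f2 C2 f20.
    exists (fun x => f1 x + f3 x), f4; split.
    + by rewrite E E'; apply/funext => x; rewrite addrA.
    + by split; [exact: (C1funD MR)|exact: div_boundD].
    + by split.
    + by move=> x [/H3/H6|/H5].
    + by move=> x /H4/H6.
  - move=> f Cf f0; exists (fun=> 0), f; split; last by [].
    + by apply/funext => x; rewrite add0r.
    + by split; [exact: C1fun_cst|exact: div_bound0].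
    + by split.
    + by move=> x [].
  - move=> x _; have [S [B [cS SV [CB B01] BS B1]]] := bump_exists MR x.
    exists [set z | B z = 1] => // f Cf f0.
    have C1 : C1fun (fun x => B x * f x) by exact: (C1funM MR).
    have CN : C1fun (fun x => 1 - B x).
      by move=> b; exact (CkB (@oM b) (Ck_cst 1 _ 1) (CB b)).
    exists (fun x => B x * f x), (fun x => (1 - B x) * f x); split.
    + by apply/funext => z; rewrite mulrBl mul1r addrC subrK.
    + split=> //; apply: (div_bound_cut cS SV C1) => [z|z /BS ->]; last by rewrite mul0r.
      by rewrite mulr_ge0//; case/andP: (B01 z).
    + split; first exact: (C1funM MR).
      by move=> z; rewrite mulr_ge0// subr_ge0; case/andP: (B01 z).
    + by move=> z /= ->; rewrite subrr mul0r.
    + by move=> z ->; rewrite mulr0.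
have [chi1 [chi2 [E [C1 B1] _ H3 H4]]] := QK chi Cc c0.
suff -> : chi = chi1 by [].
rewrite E; apply/funext => x; have [Kx|nK] := pselect (K x); first by rewrite H3 ?addr0.
by rewrite H4 ?addr0// cK0.
Qed.

(* 2 p b >= - p^2 g / (4 w) - 4 w n by AM-GM, since b^2 <= g n. *)
Let amgm (p b g n v : R) : b ^+ 2 <= g * n -> 0 <= g -> 0 <= n -> 0 <= v -> (v = 0 -> g = 0) ->
  p ^+ 2 * (g / (2 * v)) / 2 - 4 * v * n <= p ^+ 2 * (g / (2 * v)) + 2 * p * b.
Proof.
move=> bgn g0 n0 v0 vg; have [ve|vn] := eqVneq v 0.
  have ge := vg ve; rewrite ge mul0r in bgn.
  have b0 : b = 0 by apply/eqP; rewrite -sqrf_eq0 eq_le bgn sqr_ge0.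
  by rewrite ge ve b0 mul0r !mulr0 !mul0r subr0 addr0.
pose q := g / (2 * v); have q0 : 0 <= q by rewrite divr_ge0// mulr_ge0.
have gq : g = 2 * v * q by rewrite /q mulrC divfK// mulf_neq0.
rewrite -/q; pose X := p ^+ 2 * q / 2; pose Y := 4 * v * n.
have X0 : 0 <= X by rewrite /X divr_ge0// mulr_ge0// sqr_ge0.
have Y0 : 0 <= Y by rewrite /Y !mulr_ge0.
have sq : (2 * p * b) ^+ 2 <= (X + Y) ^+ 2.
  have : (2 * p * b) ^+ 2 <= 4 * (X * Y).
    have -> : (2 * p * b) ^+ 2 = 4 * p ^+ 2 * b ^+ 2 by ring.
    have -> : 4 * (X * Y) = 4 * p ^+ 2 * (g * n) by rewrite gq /X /Y; field.
    by rewrite ler_wpM2l// mulr_ge0// sqr_ge0.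
  by have := sqr_ge0 (X - Y); rewrite sqrrB sqrrD; lra.
have : `|2 * p * b| <= X + Y.
  by rewrite -ler_sqr ?nnegrE ?addr_ge0// real_normK ?num_real.
by rewrite ler_norml => /andP[H _]; rewrite /X /Y in H *; lra.
Qed.

Section Cutoff.
Variables (r : R) (f : M -> R).
Hypotheses (r0 : 0 < r) (cf : cutfun f).

(** It vanishes where f <= 0, is at least 1 where f >= 2 r, and has slope at most 1 / r. It is not
    capped and may exceed 1. *)
Definition cutoff x : R := ramp (f x / r - 1).

Lemma cutoff_C1 : C1fun cutoff.
Proof.
move=> a; apply: (C1_ramp (@oM a)); apply: (CkB (@oM a)); last exact: Ck_cst.
by apply: (CkM (@oM a) (cut_C1 cf a)); exact: Ck_cst.
Qed.

Lemma cutoff_gp x : gp cutoff cutoff x <= r ^- 2.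
Proof.
have ax := coord_im MR x; set a := chart_at x in ax *; set y := coord a x in ax *.
pose s := dramp (f x / r - 1) / r.
have P i : pd i (locf cutoff a) y = s * pd i (locf f a) y.
  have df := Ck_der (i := i) (cut_C1 cf a) ax.
  have dc (k : R) : derivable (fun=> k) y (delta_mx 0 i : 'rV[R]_m) by exact: derivable_cst.
  have dM' : derivable (fun z => locf f a z * r^-1) y (delta_mx 0 i) by exact (derivableM df (dc _)).
  have Cq : Ck 1 (chart_im a) (fun z => locf f a z * r^-1 - 1).
    by apply: (CkB (@oM a)); [apply: (CkM (@oM a) (cut_C1 cf a))|]; exact: Ck_cst.
  apply: etrans (pd_scomp i Cq ax (is_derive_ramp _)) _.
  rewrite (pdB dM' (dc _)) pd_cst subr0 (pdM df (dc _)) pd_cst mulr0 addr0.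
  rewrite /s {1}/locf/= /y (mfd_coordK MM (mfd_cover MM x)); ring.
have -> : gp cutoff cutoff x = s ^+ 2 * gp f f x.
  rewrite /gp !gradipE -/a -/y.
  have -> : drow (locf cutoff a) y = s *: drow (locf f a) y.
    by apply/rowP => i; rewrite !mxE P.
  by rewrite gdotZl gdotZr mulrA -expr2.
have g1 : gp f f x <= 1 by exact: (cut_slope cf ax).
have s1 : s ^+ 2 <= r ^- 2.
  rewrite /s expr_div_n ler_piMl ?invr_ge0 ?sqr_ge0//.
  by rewrite expr_le1// ?dramp_ge0// dramp_le1.
by apply: le_trans s1; rewrite ler_piMr ?sqr_ge0.
Qed.

(** A Caccioppoli inequality in pointwise form: k has integral 0, so integration bounds the integral
    of cutoff^2 energy e^u by 8 / r^2 times that of w e^u. It is [amgm] with p the cutoff and n its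
    squared gradient. *)
Lemma cutoff_bound : exists2 k : M -> R,
  dM.-integrable [set: borel M] (EFin \o (k : borel M -> R)) /\ \int[dM]_x k x = 0 &
  forall x, expR (u x) * (cutoff x ^+ 2 * energy x / 2) <= k x + 4 / r ^+ 2 * (w x * expR (u x)).
Proof.
have [K cK fK] := cut_supp cf.
have [k [ik k0] kP] : div_bound (fun x => cutoff x ^+ 2).
  apply: (div_bound_compact cK).
  - by move=> a; exact: (CkX 2 (@oM a) (cutoff_C1 a)).
  - by move=> x; rewrite sqr_ge0.
  - move=> x /fK f0; rewrite /cutoff ramp_le0 ?expr0n//.
    by have : f x / r <= 0 by [rewrite pmulr_lle0 ?invr_gt0|]; lra.
exists k => // x; rewrite -lerBlDr; apply: le_trans (kP x).
rewrite (gp_sqr MR w x cutoff_C1).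
have -> : 4 / r ^+ 2 * (w x * expR (u x)) = expR (u x) * (4 / r ^+ 2 * w x) by ring.
rewrite -mulrBr ler_wpM2l ?expR_ge0//.
apply: le_trans (amgm (cutoff x) (gp_cauchy MR w cutoff x) (gp_ge0 MR w x) (gp_ge0 MR cutoff x)
  (w_ge0 x) (@gp_w0 x)).
rewrite -/(energy x) lerD2l lerN2 [4 / _ * _]mulrAC ler_wpM2l ?mulr_ge0//.
exact: cutoff_gp.
Qed.

End Cutoff.

Let W x := w x * expR (u x).

Let W_cont : continuous W.
Proof.
move=> x; apply: cvgM; first exact: (C1fun_continuous MR Cw1).
exact: (continuous_comp (C1fun_continuous MR Cu (x := x)) (@continuous_expR R _)).
Qed.

Hypothesis W_fin : (\int[dM]_x (w x * expR (u x))%:E < +oo)%E.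

Let W_int : dM.-integrable [set: borel M] (EFin \o (W : borel M -> R)).
Proof.
apply/integrableP; split; first by apply/measurable_EFinP; exact: continuous_borel.
have -> : (\int[dM]_x `|(EFin \o W) x| = \int[dM]_x (w x * expR (u x))%:E)%E; last by [].
by apply: eq_integral => x _ /=; rewrite ger0_norm// mulr_ge0// expR_ge0.
Qed.

Let gp_cont x : {for x, continuous (gp w w)}.
Proof.
pose a := chart_at x; have ax : chart_dom a x := mfd_cover MM x.
apply: (@continuous_near _ _ (gradip (metric a) (locf w a) (locf w a) \o coord a)).
  apply: (near_open (mfd_open_dom MM a) ax) => z az.
  by rewrite /= (gp_chart MR Cw1 Cw1 az).
apply: continuous_comp; first exact: (mfd_coord_cont MM ax).
have ay : chart_im a (coord a x) by exists x.
apply: (Ck_cont (U := chart_im a)) ay; apply: CkW; apply: Ck_sum => [|k _]; first exact: oM.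
apply: (CkM (@oM a)); first exact: (gradv_C1 MR Cw).
exact: Ck_pd (Cw a).
Qed.

Let H x := expR (u x) * energy x.

Let H_cont x : w x != 0 -> {for x, continuous H}.
Proof.
move=> wx; apply: cvgM.
  exact: (continuous_comp (C1fun_continuous MR Cu (x := x)) (@continuous_expR R _)).
apply: cvgM; first exact: gp_cont.
apply: cvgV; first by rewrite mulf_neq0.
by apply: cvgM; [exact: cvg_cst|exact: (C1fun_continuous MR Cw1)].
Qed.

(** A small coordinate cube, with the density controlled to within half of its value at the centre,
    so that the volume is finite and positive. *)
Let small_set x (N : set M) : nbhs x N -> exists A : set (borel M),
  [/\ measurable A, A `<=` N & exists2 v : R, 0 < v & dM A = v%:E].
Proof.
rewrite nbhsE => -[Q [oQ Qx] QN]; pose a := chart_at x; pose p := coord a x.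
have ap : chart_im a p by exact: (coord_im MR).
have ppre : chart_pre a Q p by split => //; rewrite /p (mfd_coordK MM (mfd_cover MM x)).
have [d1 d10 H1] := open_ball_sub (open_chart_pre MR (a := a) oQ) ppre.
have v0 : 0 < vol a p by exact: (vol_gt0 MR).
have v2 : 0 < vol a p / 2 by rewrite divr_gt0.
have [d2 d20 H2] := contP (vol_cont MR ap) v2.
pose e := Num.min d1 d2 / 2.
have dd0 : 0 < Num.min d1 d2 by rewrite lt_min d10.
have e0 : 0 < e by rewrite divr_gt0.
have cp y : cube p e y -> `|y - p| < Num.min d1 d2.
  move=> cy; apply: (@le_lt_trans _ _ e); last by rewrite /e; lra.
  apply: rV_norm_le => [|i]; first exact: ltW.
  by have /andP[h1 /ltW h2] := cy i; rewrite !mxE ger0_norm; lra.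
have c1 y : cube p e y -> chart_pre a Q y.
  by move=> /cp; rewrite lt_min => /andP[/H1].
have [] := volume_cube MR dM_vol e0 (ltW v0) (ltW v2) (a := a) (p := p).
- by move=> y /c1[].
- by move=> y /cp; rewrite lt_min => /andP[_ /H2 /ltW].
move=> v vE vB; exists (coord_pre a (cube p e)); split.
- exact: (measurable_coord_cube MR).
- by move=> z [az /c1[_ Qz]]; apply: QN; rewrite -(mfd_coordK MM az).
exists v => //; have em : 0 < e ^+ m by rewrite exprn_gt0.
move: vB; rewrite ler_norml => /andP[+ _]; rewrite mulrC [vol a p * _]mulrC => vB.
by have : 0 < e ^+ m * vol a p by [rewrite mulr_gt0|]; lra.
Qed.

(** If grad w were nonzero at x, e^u energy would exceed some d > 0 on a set A around x of measure v
    > 0, and cutoffs at scale r would give d v / 2 <= 4 J / r^2 for every r >= 1. The energy is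
    replaced by a multiple of the indicator of A, so that only functions known to be integrable are
    compared. *)
Lemma gp_zero x : gp w w x = 0.
Proof.
apply: contrapT => /eqP gx; have gpos : 0 < gp w w x by rewrite lt_neqAle eq_sym gx (gp_ge0 MR).
have wx : w x != 0 by apply/eqP => /gp_w0/eqP; exact/negP.
have Hx : 0 < H x.
  by rewrite /H mulr_gt0 ?expR_gt0// divr_gt0// mulr_gt0// lt_neqAle eq_sym wx w_ge0.
pose d := H x / 2; have d0 : 0 < d by rewrite divr_gt0.
have nN : nbhs x [set z | d <= H z /\ exists2 l, curve_length x z l & l <= 1].
  near=> z; split; last by near: z; exact: (near_curve MR x ltr01).
  by apply/ltW; near: z; apply: (cvgr_gt _ (H_cont wx)); rewrite /d; lra.
have [A [mA AN [v v0 vE]]] := small_set nN.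
pose J := \int[dM]_x W x.
have J0 : 0 <= J by apply: Rintegral_ge0 => z _; rewrite mulr_ge0 ?expR_ge0.
suff key r : 1 <= r -> d / 2 * v <= 4 / r ^+ 2 * J.
  have dv : 0 < d * v by rewrite mulr_gt0.
  (* For this r, r^2 d v >= r d v = d v + 8 J exceeds 8 J, against the bound. *)
  pose r := 1 + 8 * J / (d * v).
  have r1 : 1 <= r by rewrite lerDl divr_ge0 ?(ltW dv)// mulr_ge0.
  have rJ : r * (d * v) = d * v + 8 * J by rewrite /r mulrDl mul1r divfK ?gt_eqF.
  have r2 : 0 < r ^+ 2 by rewrite exprn_gt0//; lra.
  have := key r r1; rewrite [4 / _ * J]mulrAC ler_pdivlMr// expr2.
  have -> : d / 2 * v * (r * r) = r * (r * (d * v)) / 2 by field.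
  have : d * v + 8 * J <= r * (d * v + 8 * J) by rewrite ler_peMl// addr_ge0 ?(ltW dv)// mulr_ge0.
  rewrite rJ; lra.
move=> r1; have r0 : 0 < r by lra.
(* The extra 1 pays for moving along a curve of length at most 1: on A the function f is still at
   least 2 r, so the cutoff is at least 1. *)
have [f cf fx] := cutoff_exists MR M_connected M_complete x (2 * r + 1).
have [k [ik k0] kP] := cutoff_bound r0 cf.
have iA : dM.-integrable [set: borel M] (EFin \o (\1_A : borel M -> R)).
  apply/integrableP; split; first exact/measurable_EFinP.
  have -> : (\int[dM]_x `|(EFin \o (\1_A : borel M -> R)) x| = \int[dM]_x (\1_A x)%:E)%E.
    by apply: eq_integral => z _ /=; rewrite ger0_norm.
  by rewrite integral_indic// setIT [X in (X < _)%E]vE ltry.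
have IA : \int[dM]_x \1_A x = v.
  by rewrite /Rintegral integral_indic// setIT [X in fine X]vE.
have iZ := integrableZl measurableT (4 / r ^+ 2) W_int.
have iZA := integrableZl measurableT (d / 2) iA.
have -> : d / 2 * v = \int[dM]_x (d / 2 * \1_A x) by rewrite (RintegralZl _ measurableT iA) IA.
have -> : 4 / r ^+ 2 * J = \int[dM]_x (k x + 4 / r ^+ 2 * W x).
  by rewrite (RintegralD measurableT ik iZ) k0 add0r (RintegralZl _ measurableT W_int).
apply: (le_Rintegral measurableT iZA); first exact (integrableD measurableT ik iZ).
move=> z _; apply: le_trans (kP z); rewrite indicE.
have E0 := energy_ge0 z; have eu := expR_gt0 (u z).
have [/set_mem/AN[dH [l xz l1]]|_] := boolP (z \in _); last first.
  by rewrite mulr0 mulr_ge0 ?(ltW eu)// divr_ge0// mulr_ge0// sqr_ge0.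
have fz : 2 * r <= f z.
  have := curve_slope MR (cut_C1 cf) (cut_slope cf) (curve_sym MR xz); lra.
have c1 : 1 <= cutoff r f z.
  apply: le_trans (ramp_ge _); rewrite lerBrDr ler_pdivlMr//; lra.
have c2 : 1 <= cutoff r f z ^+ 2 by rewrite expr_ge1//; apply: le_trans c1.
rewrite mulr1 -mulrA mulrCA [energy z / 2]mulrC.
have : H z <= cutoff r f z ^+ 2 * H z by rewrite ler_peMl// mulr_ge0// ltW.
rewrite /H in dH *; move: (cutoff r f z ^+ 2) => c0.
by move: dH; move: (expR _) => e0; move: (energy z) => e1; lra.
Unshelve. all: by end_near. Qed.

Lemma wlap_zero a y : chart_im a y -> wlap u w a y = 0.
Proof.
have G0 a' y' i : chart_im a' y' -> pd i (locf w a') y' = 0.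
  move=> ay; have [ax yx] := paramP MR ay.
  have := gp_zero (param a' y'); rewrite -(gp_chart MR Cw1 Cw1 ax) yx gradipE => g0.
  have IP := posdef_invmx (posdef_metric MR ay).
  have [d0|dn] := eqVneq (drow (locf w a') y') 0.
    by have := congr1 (fun v : 'rV[R]_m => v 0 i) d0; rewrite !mxE.
  by have := IP.2 _ dn; rewrite g0 ltxx.
have V0 i y' : chart_im a y' -> gradv (metric a) (locf w a) i y' = 0.
  by move=> ay; rewrite /gradv big1// => q _; rewrite G0// mulr0.
move=> ay; rewrite /wlap /divg /gradip !big1 ?addr0// => i _.
- by rewrite G0// mulr0.
- by rewrite V0// mul0r.
- have -> : pd i (gradv (metric a) (locf w a) i) y = pd i (fun=> 0 : R) y.
    by apply: pd_near; apply: (near_open (@oM a) ay) => z; exact: V0.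
  by rewrite pd_cst.
Qed.

(* k w has slope at most 1 for every k. *)
Lemma w_constant x x' : w x' = w x.
Proof.
have le1 z z' l : curve_length z z' l -> w z' <= w z.
  move=> zz; rewrite leNgt; apply/negP => lt.
  pose k := (l + 1) / (w z' - w z); have wz : 0 < w z' - w z by rewrite subr_gt0.
  have CK : C1fun (fun x => k * w x) by exact: (C1funM MR (@C1fun_cst _ _ _ k) Cw1).
  have sK : slope1 (fun x => k * w x).
    move=> a y ay; have [ax yx] := paramP MR ay.
    rewrite -[X in gradip _ _ _ X]yx (gp_chart MR CK CK ax).
    have E : gp (fun x => k * w x) (fun x => k * w x) (param a y) = k ^+ 2 * gp w w (param a y).
      have az := coord_im MR (param a y).
      rewrite /gp !gradipE.
      have -> : drow (locf (fun x => k * w x) (chart_at (param a y))) (coord (chart_at (param a y)) (param a y)) =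
         k *: drow (locf w (chart_at (param a y))) (coord (chart_at (param a y)) (param a y)).
        apply/rowP => i; rewrite !mxE.
        have dw := Ck_der (i := i) (Cw1 (chart_at (param a y))) az.
        have dk : derivable (fun=> k) (coord (chart_at (param a y)) (param a y)) (delta_mx 0 i : 'rV[R]_m).
          exact: derivable_cst.
        apply: etrans (pdM dk dw) _; by rewrite pd_cst mul0r add0r.
      by rewrite gdotZl gdotZr mulrA -expr2.
    by rewrite E gp_zero mulr0 ler01.
  have := curve_slope MR CK sK zz; rewrite -lerBlDl -mulrBr /k divfK ?gt_eqF//; lra.
apply: (connected_all M_connected (Q := fun x' => w x' = w x) (x0 := x)) => // z Hz.
  apply: filterS (near_curve MR z ltr01) => z' [l zz _]; rewrite -Hz.
  by apply: le_anti; rewrite (le1 _ _ _ zz) (le1 _ _ _ (curve_sym MR zz)).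
apply: filterS (near_curve MR z ltr01) => z' [l zz _] E; apply: Hz; rewrite -E.
by apply: le_anti; rewrite (le1 _ _ _ zz) (le1 _ _ _ (curve_sym MR zz)).
Qed.

End Parabolicity.

(** * Mean curvature flow solitons *)

Section OrientedIntegral.
Context {R : realType} (I : set R) (hI : open_interval I) (h : R -> R).
Hypothesis h_cont : forall t, I t -> {for t, continuous h}.

(** A base point [lo] of I to the left of both t0 and t makes the oriented integral a difference of
    ordinary integrals from [lo], whatever the order of t0 and the upper limit; the fundamental
    theorem then applies. *)
Lemma is_derive_oriented_int (t0 t : R) : I t0 -> I t -> is_derive t 1 (oriented_int h t0) (h t).
Proof.
move=> It0 It; have [iI oI] := hI.
have inner s : I s -> exists2 e : R, 0 < e & I (s - e) /\ I (s + e).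
  move=> Is; have [e /= e0 He] := (nbhs_ballP _ _).1 (oI s Is).
  exists (e / 2); first by rewrite divr_gt0.
  by split; apply: He; rewrite /ball/=; [rewrite opprB addrC subrK|rewrite opprD addrA subrr sub0r normrN];
    rewrite ger0_norm ?divr_ge0 ?(ltW e0)//; lra.
have [lo [lo0 lot Ilo]] : exists lo, [/\ lo < t0, lo < t & I lo].
  have [le|lt] := leP t0 t.
    by have [e e0 [Ie _]] := inner _ It0; exists (t0 - e); split => //; lra.
  by have [e e0 [Ie _]] := inner _ It; exists (t - e); split => //; lra.
have [hi [hi0 hit Ihi]] : exists hi, [/\ t0 < hi, t < hi & I hi].
  have [le|lt] := leP t0 t.
    by have [e e0 [_ Ie]] := inner _ It; exists (t + e); split => //; lra.
  by have [e e0 [_ Ie]] := inner _ It0; exists (t0 + e); split => //; lra.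
have int_h x : x <= hi -> lebesgue_measure.-integrable `[lo, x] (EFin \o h).
  move=> xhi; apply: continuous_compact_integrable; first exact: segment_compact.
  apply: continuous_in_subspaceT => s /set_mem; rewrite /= in_itv/= => /andP[ls sx].
  by apply: h_cont; apply: iI Ilo Ihi _ _; rewrite ls (le_trans sx xhi).
pose G x := \int[lebesgue_measure]_(s in `[lo, x]) h s.
have GB x y : lo <= x -> x <= y -> y <= hi -> \int[lebesgue_measure]_(s in `[x, y]) h s = G y - G x.
  move=> lx xy yh; rewrite (Rintegral_itvB (int_h y yh)) ?bnd_simp//.
  rewrite Rintegral_itv_obnd_cbnd//; apply: integrableS (int_h y yh) => //.
  by move=> s; rewrite /= !in_itv/= => /andP[/ltW xs ->]; rewrite (le_trans lx xs).
have [dG EG] := continuous_FTC1_closed hit (int_h hi (lexx _)) lot (h_cont It).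
have DG : is_derive t 1 G (h t) by split; [exact: dG|rewrite -EG derive1E].
have D : is_derive t 1 (fun x => G x - G t0) (h t).
  by have := is_deriveB DG (is_derive_cst (G t0) t 1); rewrite subr0.
apply: near_eq_is_derive D; near=> x.
have xlo : lo <= x by apply/ltW; near: x; exact: lt_nbhsr.
have xhi : x <= hi by apply/ltW; near: x; exact: lt_nbhsl.
rewrite /oriented_int; case: ifP => [t0x|/negbT]; first by rewrite GB// ltW.
by rewrite -ltNge => /ltW xt; rewrite GB ?opprB// ltW.
Unshelve. all: by end_near. Qed.

End OrientedIntegral.

Section LocalOperators.
Context {R : realType} {m : nat} (U : set 'rV[R]_m) (g : 'rV[R]_m -> 'M[R]_m).
Hypothesis oU : open U.

Lemma gradv_ext (f f' : 'rV[R]_m -> R) k y : (forall y, U y -> f y = f' y) -> U y ->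
  gradv g f k y = gradv g f' k y.
Proof.
move=> E Uy; apply: eq_bigr => q _; congr (_ * _).
by apply: pd_near; exact: (near_open oU Uy).
Qed.

Lemma divg_ext (Y Y' : 'I_m -> 'rV[R]_m -> R) y : (forall i, pd i (Y i) y = pd i (Y' i) y) ->
  (forall i, Y i y = Y' i y) -> divg g Y y = divg g Y' y.
Proof.
move=> H1 H2; rewrite /divg; apply: (f_equal2 +%R); apply: eq_bigr => i _; first exact: H1.
by rewrite H2.
Qed.

Lemma gradip_ext (f f' : 'rV[R]_m -> R) y : (forall y, U y -> f y = f' y) -> U y ->
  gradip g f f y = gradip g f' f' y.
Proof.
move=> E Uy; apply: eq_bigr => k _; rewrite (gradv_ext k E Uy).
by rewrite (pd_near k (near_open oU Uy E)).
Qed.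

Lemma lop_local (f f' v t : 'rV[R]_m -> R) (b : R) y : (forall y, U y -> f y = f' y) -> U y ->
  (forall k, pd k v y = b * pd k t y) ->
  divg g (gradv g f) y + gradip g v f y = divg g (gradv g f') y + b * gradip g t f' y.
Proof.
move=> E Uy V; apply: (f_equal2 +%R).
  apply: divg_ext => i; last exact: gradv_ext.
  by apply: pd_near; apply: (near_open oU Uy) => z; exact: gradv_ext.
rewrite /gradip mulr_sumr; apply: eq_bigr => k _.
have -> : gradv g v k y = b * gradv g t k y.
  by rewrite /gradv mulr_sumr; apply: eq_bigr => q _; rewrite V mulrCA.
by rewrite -mulrA (pd_near k (near_open oU Uy E)).
Qed.

End LocalOperators.

Section SolitonRigidity.
Context {R : realType} {m n : nat} (I : set R) (hI : open_interval I) (t0 : R) (It0 : I t0).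
Context (h : R -> R) (sh : smooth_fun_on I h) (h_pos : forall t, I t -> 0 < h t).
Context (P : riemData R n) (PR : is_riemannian P) (M : riemData R m) (MR : is_riemannian M).
Context (M_connected : connected [set: M]) (M_complete : complete_riemannian M).
Context (dM : {measure set (borel M) -> \bar R}) (dM_vol : is_riemannian_volume dM).
Context (psi : M -> warped I h P) (c kappa : R)
  (psi_soliton : mcf_soliton psi (conformal_field (I:=I) (h:=h) (P:=P)) c)
  (P_curv : constant_sectional_curvature P kappa).
Hypothesis kappa_le : forall x, kappa <=
  derive1 h (height psi x) ^+ 2 - derive1 (derive1 h) (height psi x) * h (height psi x).
Hypothesis II_le : forall x, c * derive1 h (height psi x) + II2 psi x <= 0.
Let MM := riem_manifold MR.
Let oI : open I. Proof. by case: hI. Qed.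
Let oM (a : chart M) : open (chart_im a). Proof. exact: (mfd_open_im MM). Qed.

Definition log_weight (x : M) : R := c * oriented_int h t0 (height psi x).

Let h_cont t : I t -> {for t, continuous h}.
Proof.
by move=> It; apply: differentiable_continuous; apply/derivable1_diffP; exact (@sh 0%N t It).
Qed.

Let height_I (a : chart M) y : chart_im a y -> I (locf (height psi) a y).
Proof. by move=> _; case: (psi_chartP PR psi_soliton (param a y)). Qed.

Let dlog s : I s -> is_derive s 1 (fun s => c * oriented_int h t0 s) (c * h s).
Proof.
move=> Is; have D := is_derive_oriented_int hI h_cont It0 Is.
exact: is_deriveZ.
Qed.

Lemma log_weight_C1 : C1fun log_weight.
Proof.
move=> a; apply: (C1_scomp (u := fun s => c * oriented_int h t0 s) (u' := fun s => c * h s) (@oM a)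
  (@smooth_height _ _ _ _ oI _ _ PR _ MR _ _ psi_soliton a 1%N)) => y ay.
  by apply: dlog; exact: height_I.
by apply: cvgM; [exact: cvg_cst|apply: h_cont; exact: height_I].
Qed.

Let pd_log a i y : chart_im a y ->
  pd i (locf log_weight a) y = c * h (locf (height psi) a y) * pd i (locf (height psi) a) y.
Proof.
move=> ay; exact: (pd_scomp i (@smooth_height _ _ _ _ oI _ _ PR _ MR _ _ psi_soliton a 1%N) ay
  (dlog (height_I ay))).
Qed.

Let w : M -> R := wsol psi.

Let wE a y : chart_im a y -> locf w a y = wloc psi a y.
Proof. exact: (wsolE oI PR MR psi_soliton). Qed.

Lemma wsol_C2 a : Ck 2 (chart_im a) (locf w a).
Proof.
apply: Ck_ext (smooth_wloc oI sh h_pos PR MR psi_soliton a 2%N); first exact: oM.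
by move=> y /wE.
Qed.

(** The log-weight c eta has differential c h(t) dt, so its drift term is that of L. *)
Lemma wlap_Lsol a y : chart_im a y -> wlap log_weight w a y = Lsol psi c a y.
Proof.
move=> ay; exact (lop_local (metric a) (@oM a) (@wE a) ay (fun k => pd_log k ay)).
Qed.

Lemma wlap_lower a y : chart_im a y -> 0 <= wlap log_weight w a y /\
  gradip (metric a) (locf w a) (locf w a) y <= 2 * locf w a y * wlap log_weight w a y.
Proof.
move=> ay; rewrite wlap_Lsol// wE//.
rewrite (gradip_ext (metric a) (@oM a) (@wE a) ay).
exact: (Lsol_ge oI sh h_pos PR MR psi_soliton P_curv kappa_le II_le ay).
Qed.

Lemma wsol_ge0 x : 0 <= w x.
Proof.
have ay := coord_im MR x; rewrite -(mfd_coordK MM (mfd_cover MM x)).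
by rewrite -[w _]/(locf w _ _) wE//; exact: (wloc_ge0 oI h_pos PR MR psi_soliton ay).
Qed.

Hypothesis H_fin : (\int[dM]_x (norm_mean_curv psi x ^+ 2 * expR (c * oriented_int h t0 (height psi x)))%:E < +oo)%E.

Lemma wsol_fin : c != 0 -> (\int[dM]_x (w x * expR (log_weight x))%:E < +oo)%E.
Proof.
move=> c0; have c2 : 0 < c ^+ 2 by rewrite lt_neqAle eq_sym sqrf_eq0 c0 sqr_ge0.
have mW : measurable_fun [set: borel M] (fun x : borel M => (w x * expR (log_weight x))%:E).
  apply/measurable_EFinP; apply: continuous_borel => x.
  apply: cvgM; first exact: (C1fun_continuous MR (fun a => CkW (wsol_C2 a))).
  exact: (continuous_comp (C1fun_continuous MR log_weight_C1 (x := x)) (@continuous_expR R _)).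
have W0 (x : borel M) : (0 <= (w x * expR (log_weight x))%:E)%E.
  by rewrite lee_fin mulr_ge0 ?wsol_ge0 ?expR_ge0.
move: H_fin.
have -> : (\int[dM]_x (norm_mean_curv psi x ^+ 2 * expR (c * oriented_int h t0 (height psi x)))%:E =
    (c ^+ 2)%:E * \int[dM]_x (w x * expR (log_weight x))%:E)%E.
  rewrite -ge0_integralZl//; last by rewrite lee_fin ltW.
  apply: eq_integral => x _; rewrite -EFinM mulrA; congr (_ * _)%:E.
  exact: (norm_mean_curvE oI h_pos PR MR psi_soliton).
have := integral_ge0 (D := setT) dM (f := fun x => (w x * expR (log_weight x))%:E) (fun x _ => W0 x).
by case: (integral _ _ _) => [s| |] //= _; rewrite ?ltry// gt0_muley// lte_fin.
Qed.

Lemma soliton_rigidity :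
  parallel_mean_curv psi /\
  (mean_curv_zero psi \/ forall x, II2 psi x = - (c * derive1 h (height psi x))).
Proof.
(* For c = 0 the mean curvature vanishes by the soliton equation itself; otherwise |H|^2 = c^2 w
   carries the integrability over to w. *)
have [c0|c0] := eqVneq c 0.
  split; last left.
    by move=> a b i y Uy; exact: (c0_parallel oI sh PR MR psi_soliton i c0 Uy).
  by move=> a b y Uy; rewrite -(psi_soliton.2 a b y Uy) c0 scale0r.
have L0 a y : chart_im a y -> Lsol psi c a y = 0.
  move=> ay; rewrite -wlap_Lsol//.
  exact: (wlap_zero MR M_connected M_complete dM_vol log_weight_C1 wsol_C2 wsol_ge0 wlap_lower
    (wsol_fin c0) ay).
have wC x x' : w x' = w x.
  exact: (w_constant MR M_connected M_complete dM_vol log_weight_C1 wsol_C2 wsol_ge0 wlap_lower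
    (wsol_fin c0) x x').
split.
  move=> a b i y Uy.
  exact: (Lsol0_parallel oI sh h_pos PR MR psi_soliton P_curv kappa_le II_le i Uy
    (L0 a y (sol_dom_im MR Uy))).
(* As w is constant, its value at one point decides the alternative: H = 0 everywhere, or w > 0
   everywhere, so that it can be cancelled at each point. *)
have [w0|w0] := eqVneq (w point) 0.
  left=> a b y Uy; have ay := sol_dom_im MR Uy.
  apply: (wsol0_mean oI h_pos PR MR psi_soliton Uy).
  by rewrite -wE// -w0; exact: wC.
right=> x; have ax := mfd_cover MM x; have ay := coord_im MR x.
have wp : 0 < wloc psi (chart_at x) (coord (chart_at x) x).
  by rewrite -wE// [locf _ _ _](wC point) lt_neqAle eq_sym w0 wsol_ge0.
have := Lsol0_II oI sh h_pos PR MR psi_soliton P_curv kappa_le II_le ay (L0 _ _ ay) wp.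
by rewrite (mfd_coordK MM ax).
Qed.

End SolitonRigidity.

Theorem theorem8p4 (R : realType) (m n : nat)
  (I : set R) (hI : open_interval I) (t0 : R) (It0 : I t0)
  (h : R -> R) (h_smooth : smooth_fun_on I h)
  (h_pos : forall t, I t -> 0 < h t)
  (P : riemData R n) (P_riem : is_riemannian P)
  (M : riemData R m) (M_riem : is_riemannian M)
  (M_connected : connected [set: M]) (M_complete : complete_riemannian M)
  (dM : {measure set (borel M) -> \bar R}) (dM_vol : is_riemannian_volume dM)
  (psi : M -> warped I h P) (c kappa : R)
  (psi_soliton : mcf_soliton psi (conformal_field (I:=I) (h:=h) (P:=P)) c)
  (P_curv : constant_sectional_curvature P kappa) :
  let height := fun x : M => (psi x).1 in
  let h0 := fun x : M => h (height x) in
  let h1 := fun x : M => derive1 h (height x) in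
  let h2 := fun x : M => derive1n 2 h (height x) in
  let eta := fun x : M => oriented_int h t0 (height x) in
  (kappa%:E <= ereal_inf (range (fun x => (h1 x ^+ 2 - h2 x * h0 x)%:E)))%E ->
  (-oo < ereal_inf (range (fun x => ((kappa - h1 x ^+ 2) / h0 x ^+ 2)%:E)))%E ->
  (forall x, c * h1 x + II2 psi x <= 0) ->
  (\int[dM]_x (norm_mean_curv psi x ^+ 2 * expR (c * eta x))%:E < +oo)%E ->
  parallel_mean_curv psi /\
  (mean_curv_zero psi \/ forall x, II2 psi x = - (c * h1 x)).
Proof.
move=> height h0 h1 h2 eta kappa_le _ II_le H_fin.
have k_le x : kappa <= h1 x ^+ 2 - h2 x * h0 x.
  by have := le_trans kappa_le (ereal_inf_lbound (ex_intro2 _ _ x Logic.I erefl)); rewrite lee_fin.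
exact: (soliton_rigidity hI It0 h_smooth h_pos P_riem M_riem M_connected M_complete dM_vol
  psi_soliton P_curv k_le II_le H_fin).
Qed.
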